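(* Consider the $n\times n$ system $\frac{dY}{dz}=\big(\Lambda(t)+\frac{\widehat A_1(t)}{z}\big)Y$ with $\Lambda(t)=\mathrm{diag}(u_1(t),\dots,u_n(t))$, $u_a(t)=u_a(0)+t_a$, with $\widehat A_1(t)$ holomorphic on $\mathcal U_{\epsilon_0}(0)$, $0<\epsilon_0<\min_{j\ne k}\delta_{jk}$ (see context), isomonodromic in an admissible domain $\mathcal V$, and such that $(\widehat A_1(t))_{ab}=\mathcal O(u_a(t)-u_b(t))$, $a\ne b$, whenever $u_a(t)$ and $u_b(t)$ coalesce as $t$ tends to a point of the coalescence locus $\Delta\subset\mathcal U_{\epsilon_0}(0)$, where $0\in\Delta$. If the diagonal entries of $\widehat A_1(0)$ do not differ by non-zero integers, then there is a unique formal solution $$\mathring Y_F(z)=\Big(I+\sum_{k\ge1}\mathring F_kz^{-k}\Big)z^{B_1(0)}e^{\Lambda(0)z},\qquad B_1(0)=\mathrm{diag}(\widehat A_1(0)),$$ of the system at $t=0$, $\frac{dY}{dz}=\big(\Lambda(0)+\frac{\widehat A_1(0)}{z}\big)Y$, and its coefficients necessarily satisfy $\mathring F_k=F_k(0)$ for all $k\ge1$. Hence the system at $t=0$ has at $z=\infty$ only the canonical fundamental solutions $\mathring Y_1(z),\mathring Y_2(z),\mathring Y_3(z)$ (corresponding to this unique formal solution), and these coincide with the canonical solutions of the $t$-dependent system evaluated at $t=0$: $$Y_1(z,0)=\mathring Y_1(z),\quad Y_2(z,0)=\mathring Y_2(z),\quad Y_3(z,0)=\mathring Y_3(z).$$ Moreover,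 for any fundamental solution $\mathring Y^{(0)}(z)$ in Levelt form at $z=0$ of the system at $t=0$, there exists $Y^{(0)}(z,t)$ (a fundamental solution in Levelt form with $t$-independent data $R^{(0)}$, $C^{(0)}$) such that $Y^{(0)}(z,0)=\mathring Y^{(0)}(z)$. The following equalities hold: $$\mathbb S_1=\mathring{\mathbb S}_1,\qquad \mathbb S_2=\mathring{\mathbb S}_2,\qquad C^{(0)}=\mathring C^{(0)}.$$
   Context: Notation. $\mathcal R$ is the universal covering of $\mathbb C\setminus\{0\}$, so $\arg z\in\mathbb R$ for $z\in\mathcal R$. For $t\in\mathbb C^n$, $|t|=\max_i|t_i|$ and $\mathcal U_{\epsilon}(0)=\{t\in\mathbb C^n: |t|\le\epsilon\}$. The values $u_a(0)$ take $s<n$ distinct values $\lambda_1,\dots,\lambda_s$, with $\Lambda(0)=\lambda_1I_{p_1}\oplus\cdots\oplus\lambda_sI_{p_s}$. Coalescence locus: $\Delta=\{t\in\mathcal U_{\epsilon_0}(0): u_a(t)=u_b(t)\text{ for some }a\ne b\}$. Stokes rays of $\Lambda(t)$: rays $\{z\in\mathcal R:\Re[(u_a(t)-u_b(t))z]=0\}$ for pairs with $u_a(t)\neq u_b(t)$. Fix $\widetilde\tau\in\mathbb R$ admissible: $\Re[(u_a(0)-u_b(0))z]\ne0$ on $\arg z=\widetilde\tau$ whenever $u_a(0)\ne u_b(0)$. Radius: $\epsilon_0<\min_{1\le j\ne k\le s}\delta_{jk}$, where $\delta_{jk}=\frac12\min_{\rho\in\mathbb R}|\lambda_k-\lambda_j+i\rho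 e^{-i\widetilde\tau}|$ (no such condition if $s=1$). Cells: $X(\widetilde\tau)$ is the set of $t\in\mathcal U_{\epsilon_0}(0)$ for which some Stokes ray of $\Lambda(t)$ coincides with $\arg z=\widetilde\tau$; a $\widetilde\tau$-cell is a connected component of $\mathcal U_{\epsilon_0}(0)\setminus(\Delta\cup X(\widetilde\tau))$. The deformation is admissible in $\mathcal V$ if $\mathcal V\subset\mathcal U_{\epsilon_0}(0)$ is open, connected and $\overline{\mathcal V}$ is contained in a $\widetilde\tau$-cell. Formal solution: for $t\notin\Delta$ there is a unique formal solution $Y_F(z,t)=(I+\sum_{k\ge1}F_k(t)z^{-k})z^{B_1(t)}e^{\Lambda(t)z}$, $B_1(t)=\mathrm{diag}(\widehat A_1(t))$. Under the hypotheses of the claim the $F_k$ extend holomorphically to $\mathcal U_{\epsilon_0}(0)$, which gives meaning to $F_k(0)$. Asymptotics: $Y\sim Y_F$ in an open sector means that $Ye^{-\Lambda z}z^{-B_1}$ has asymptotic expansion $I+\sum_{k\ge1}F_kz^{-k}$ as $z\to\infty$ in every proper closed subsector. Sectors: $\Pi_r=\{z\in\mathcal R:\widetilde\tau+(r-2)\pi<\arg z<\widetilde\tau+(r-1)\pi\}$, $r=1,2,3$. $\mathcal S_r(t)$ is the open sector containing $\Pi_r$ and extending up to the closest Stokes rays of $\Lambda(t)$ outside $\Pi_r$; $\mathcal S_r(\overline{\mathcal V})=\bigcap_{t\in\overline{\mathcal V}}\mathcal S_r(t)$; $\mathcal S_r:=\mathcal S_r(0)$. Solutions and Stokes matrices: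 for $t\in\mathcal V$, $Y_r(z,t)$ is the unique fundamental solution with $Y_r\sim Y_F$ in $\mathcal S_r(\overline{\mathcal V})$, and $Y_{r+1}=Y_r\mathbb S_r$, $r=1,2$. Under the hypotheses of the claim, the $Y_r(z,t)$ extend as single-valued holomorphic functions of $t\in\mathcal U_{\epsilon_0}(0)$, which gives meaning to $Y_r(z,0)$. Given a formal solution $\mathring Y_F(z)$ of the system at $t=0$, $\mathring Y_r(z)$ is the unique fundamental solution of the system at $t=0$ with $\mathring Y_r\sim\mathring Y_F$ in $\mathcal S_r$, and $\mathring Y_{r+1}=\mathring Y_r\mathring{\mathbb S}_r$, $r=1,2$. Levelt form at $z=0$: $Y^{(0)}(z,t)=G^{(0)}(t)\big(I+\sum_{l\ge1}\Psi_l(t)z^l\big)z^{D^{(0)}}z^{S^{(0)}+R^{(0)}}$ (convergent series), where $J^{(0)}=(G^{(0)})^{-1}\widehat A_1G^{(0)}=D^{(0)}+S^{(0)}$ is a Jordan form of $\widehat A_1$, $D^{(0)}$ is a diagonal matrix of integers, $S^{(0)}$ is a Jordan matrix with eigenvalues of real part in $[0,1)$, and $R^{(0)}$ is nilpotent, its block relative to Jordan blocks $i,j$ (with eigenvalues $\widetilde\mu_i,\widetilde\mu_j$) being nonzero only if $\widetilde\mu_i-\widetilde\mu_j$ is a positive integer; analogously at fixed $t=0$. Central connection matrices: $Y_1(z,t)=Y^{(0)}(z,t)C^{(0)}$, $\mathring Y_1(z)=\mathring Y^{(0)}(z)\mathring C^{(0)}$. Isomonodromic in $\mathcal V$: the deformation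 is admissible in $\mathcal V$; $\widehat A_1(t)$ is holomorphically similar on $\mathcal V$ to its Jordan form $J^{(0)}$; $\mathbb S_1,\mathbb S_2,B_1$ and the eigenvalues of $\widehat A_1$ (hence $J^{(0)}$) are independent of $t\in\mathcal V$; and there is a fundamental solution $Y^{(0)}(z,t)$ in Levelt form, holomorphic in $t\in\mathcal V$, whose $R^{(0)}$ and $C^{(0)}$ are independent of $t\in\mathcal V$. *)

(* Defs.v *)
From HB Require Import structures.
From mathcomp Require Import all_boot all_order all_algebra.
From mathcomp Require Import complex.
From mathcomp Require Import all_classical all_reals all_analysis.

Set Implicit Arguments.
Unset Strict Implicit.
Unset Printing Implicit Defensive.

Import Order.TTheory GRing.Theory Num.Theory.
Import numFieldNormedType.Exports.

Local Open Scope classical_set_scope.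
Local Open Scope ring_scope.
Local Open Scope complex_scope.

(** The universal covering of C \ {0} is represented by C itself: a point z of
    the covering is given by its logarithm w = ln |z| + i arg z.  Hence [cexp w]
    is the projection of z to C \ {0}, [complex.Im w] is arg z (a real number,
    not taken modulo 2 pi), and a function of z is a function of w. *)
Section UniversalCovering.
Context {R : realType} {n : nat}.

Definition cexp (w : R[i]) : R[i] :=
  (expR (complex.Re w))%:C * (cos (complex.Im w) +i* sin (complex.Im w)).

Definition mexp (M : 'M[R[i]^o]_n) : 'M[R[i]^o]_n :=
  limn (series (fun k => (k`!%:R)^-1 *: M ^+ k)).

(* z ^ M = exp (M log z) *)
Definition zpow (w : R[i]) (M : 'M[R[i]^o]_n) : 'M[R[i]^o]_n := mexp (w *: M).

(* d/dz in the coordinate w = log z: d/dz = e^(-w) d/dw *)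
Definition ddz (Y : R[i]^o -> 'M[R[i]^o]_n) (w : R[i]^o) : 'M[R[i]^o]_n :=
  (cexp w)^-1 *: 'D_(1 : R[i]^o) Y w.

End UniversalCovering.

Section LinearSystem.
Context {R : realType} {n : nat}.
Implicit Types (u : 'rV[R[i]^o]_n) (A : 'M[R[i]^o]_n) (Y : R[i]^o -> 'M[R[i]^o]_n).

(* In this section the system is dY/dz = (diag u + A / z) Y. *)

Definition fundamental_solution u A Y : Prop :=
  forall w : R[i]^o,
    [/\ derivable Y w 1,
        ddz Y w = (diag_mx u + (cexp w)^-1 *: A) *m Y w
      & Y w \in unitmx].

Definition diag_part A : 'M[R[i]^o]_n := diag_mx (\row_a A a a).

(* Formal power series in z^-1 with matrix coefficients: F k is the coefficient
   of z^-k. *)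
Definition fser_mul (F G : nat -> 'M[R[i]^o]_n) (k : nat) : 'M[R[i]^o]_n :=
  \sum_(i < k.+1) F i *m G (k - i)%N.

Definition fser_ddz (F : nat -> 'M[R[i]^o]_n) (k : nat) : 'M[R[i]^o]_n :=
  - (k.-1%:R *: F k.-1).

Definition fser_system u A (k : nat) : 'M[R[i]^o]_n :=
  match k with 0%N => diag_mx u | 1%N => A | _ => 0 end.

(** (I + sum_(k >= 1) F_k z^-k) z^B e^(diag(u) z), with B the diagonal part of
    A, is a formal solution.  As B and diag u are diagonal, z^B e^(diag(u) z)
    has derivative (diag u + B / z) z^B e^(diag(u) z); cancelling the right
    factor leaves F' + F (diag u + B / z) = (diag u + A / z) F. *)
Definition formal_solution u A (F : nat -> 'M[R[i]^o]_n) : Prop :=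
  F 0%N = 1%:M /\
  forall k, fser_ddz F k + fser_mul F (fser_system u (diag_part A)) k
            = fser_mul (fser_system u A) F k.

(* Y e^(-diag(u) z) z^(-B) ~ I + sum_(k >= 1) F_k z^-k in every closed
   subsector a <= arg z <= b of S *)
Definition asymptotic_to u A (F : nat -> 'M[R[i]^o]_n) (S : set R[i]) Y : Prop :=
  forall a b : R, a <= b ->
  [set w : R[i] | a <= complex.Im w <= b] `<=` S ->
  forall N : nat, exists K rho : R, 0 < rho /\
    forall w : R[i], a <= complex.Im w <= b -> rho%:C <= `|cexp w| ->
      `| Y w *m mexp (- (cexp w *: diag_mx u)) *m zpow w (- diag_part A)
         - \sum_(k < N.+1) (cexp w) ^- k *: F k |
      <= K%:C * `|cexp w| ^- N.+1.

Definition canonical_solution u A F S Y : Prop :=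
  fundamental_solution u A Y /\ asymptotic_to u A F S Y.

(* arg z = theta is a Stokes ray of diag u *)
Definition stokes_arg u (theta : R) : Prop :=
  exists a b, u 0 a != u 0 b /\
    forall w : R[i], complex.Im w = theta ->
      complex.Re ((u 0 a - u 0 b) * cexp w) = 0.

Definition admissible_direction u (tau : R) : Prop :=
  forall a b, u 0 a != u 0 b ->
    forall w : R[i], complex.Im w = tau ->
      complex.Re ((u 0 a - u 0 b) * cexp w) != 0.

(** The sector S_r of diag u: it contains
    Pi_r = {tau + (r - 2) pi < arg z < tau + (r - 1) pi} and is bounded by the
    closest Stokes rays outside Pi_r.  It is the whole covering if diag u has no
    Stokes ray. *)
Definition sector u (tau : R) (r : nat) : set R[i] :=
  [set w | forall theta, stokes_arg u theta ->
     (tau + (r%:R - 1) * pi <= theta -> complex.Im w < theta) /\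
     (theta <= tau + (r%:R - 2) * pi -> theta < complex.Im w)].

(* Direct sum of (upper) Jordan blocks *)
Definition is_jordan (J : 'M[R[i]^o]_n) : Prop :=
  forall i j : 'I_n,
    (j != i -> j != i.+1 :> nat -> J i j = 0) /\
    (j = i.+1 :> nat -> J i j = 0 \/ (J i j = 1 /\ J i i = J j j)).

(** Y = G (I + sum_(l >= 1) Psi_l z^l) z^D z^(S + N) near z = 0.  The condition
    on the blocks of N relative to the Jordan blocks of J = D + S is written
    entrywise, J being constant along the diagonal of each of its blocks. *)
Definition levelt_form A Y (G D S N : 'M[R[i]^o]_n) : Prop :=
  [/\ G \in unitmx /\ invmx G *m A *m G = D + S,
      is_jordan (D + S),
      is_diag_mx D /\ (forall i, exists m : int, D i i = m%:~R),
      is_jordan S /\ (forall i, 0 <= complex.Re (S i i) < 1)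
    & [/\ exists k : nat, N ^+ k = 0,
          forall i j, N i j != 0 ->
            exists2 m : nat, (0 < m)%N & (D + S) i i - (D + S) j j = m%:R
        & exists Psi : nat -> 'M[R[i]^o]_n, Psi 0%N = 1%:M /\
            exists2 rho : R, 0 < rho &
              forall w : R[i], `|cexp w| < rho%:C ->
                cvgn (series (fun l => cexp w ^+ l *: Psi l)) /\
                Y w = G *m limn (series (fun l => cexp w ^+ l *: Psi l))
                        *m zpow w D *m zpow w (S + N)]].

Definition connected_by (Y Y' : R[i]^o -> 'M[R[i]^o]_n) (M : 'M[R[i]^o]_n) : Prop :=
  forall w, Y' w = Y w *m M.

Definition nonresonant_diagonal A : Prop :=
  forall (a b : 'I_n) (m : int), m != 0 -> A a a - A b b != m%:~R.

End LinearSystem.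

Section Deformation.
Context {R : realType} {n : nat}.
Implicit Types (t : 'rV[R[i]^o]_n) (V W : set 'rV[R[i]^o]_n).

(* lambda_1 I_{p_1} (+) ... (+) lambda_s I_{p_s}: the a-th diagonal entry lies in
   the block number blk a *)
Definition coalescent_spectrum (u0 : 'rV[R[i]^o]_n) (s : nat) (lam : 'I_s -> R[i])
    (blk : 'I_n -> 'I_s) : Prop :=
  [/\ (s < n)%N, injective lam, (forall j, exists a, blk a = j),
      (forall a b : 'I_n, (a <= b)%N -> (blk a <= blk b)%N)
    & forall a, u0 0 a = lam (blk a)].

(* |t| is the norm of the library on row vectors, max_i |t_i|. *)
Definition polydisc (eps : R) : set 'rV[R[i]^o]_n := [set t | `|t| <= eps%:C].

Definition gap (s : nat) (lam : 'I_s -> R[i]) (tau : R) (j k : 'I_s) : R :=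
  2^-1 * inf (range (fun rho : R =>
    complex.Re `|lam k - lam j + (0 +i* rho) * cexp (0 +i* (- tau))|)).

(* Holomorphy on a set that need not be open: restriction of a function which is
   holomorphic on an open neighbourhood. *)
Definition holomorphic_on (T : normedModType R[i]) (f : 'rV[R[i]^o]_n -> T) W :
    Prop :=
  exists (O : set 'rV[R[i]^o]_n) (g : 'rV[R[i]^o]_n -> T),
    [/\ open O, W `<=` O, forall t, O t -> differentiable g t
      & forall t, W t -> g t = f t].

Definition coalescence_locus (u0 : 'rV[R[i]^o]_n) (eps : R) : set 'rV[R[i]^o]_n :=
  [set t | polydisc eps t /\
     exists a b : 'I_n, a != b /\ (u0 + t) 0 a = (u0 + t) 0 b].

Definition crossing_locus (u0 : 'rV[R[i]^o]_n) (eps tau : R) : set 'rV[R[i]^o]_n :=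
  [set t | polydisc eps t /\ stokes_arg (u0 + t) tau].

Definition cell (u0 : 'rV[R[i]^o]_n) (eps tau : R) W : Prop :=
  let D := polydisc eps `\` (coalescence_locus u0 eps
                             `|` crossing_locus u0 eps tau) in
  exists2 t, D t & W = connected_component D t.

Definition admissible_domain (u0 : 'rV[R[i]^o]_n) (eps tau : R) V : Prop :=
  [/\ open V, connected V, V !=set0, V `<=` polydisc eps
    & exists2 W, cell u0 eps tau W & closure V `<=` W].

Definition sector_on (u0 : 'rV[R[i]^o]_n) (tau : R) (r : nat) V : set R[i] :=
  \bigcap_(t in closure V) sector (u0 + t) tau r.

Definition vanishing_condition (u0 : 'rV[R[i]^o]_n) (eps : R)
    (A1 : 'rV[R[i]^o]_n -> 'M[R[i]^o]_n) : Prop :=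
  forall a b : 'I_n, a != b ->
  forall t0, coalescence_locus u0 eps t0 -> (u0 + t0) 0 a = (u0 + t0) 0 b ->
    let nbhs_t0 := within (polydisc eps) (nbhs t0) in
    (fun t => A1 t a b : R[i]^o) =O_nbhs_t0
    (fun t => (u0 + t) 0 a - (u0 + t) 0 b : R[i]^o).

(* Y0 is a fundamental solution in Levelt form, holomorphic in t in W, with
   D, S, N (hence the Jordan form D + S) independent of t. *)
Definition levelt_family (u0 : 'rV[R[i]^o]_n) (A1 : 'rV[R[i]^o]_n -> 'M[R[i]^o]_n) W
    (Y0 : 'rV[R[i]^o]_n -> R[i]^o -> 'M[R[i]^o]_n) (D S N : 'M[R[i]^o]_n) : Prop :=
  exists G : 'rV[R[i]^o]_n -> 'M[R[i]^o]_n,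
    [/\ holomorphic_on G W, forall w, holomorphic_on (Y0 ^~ w) W
      & forall t, W t -> fundamental_solution (u0 + t) (A1 t) (Y0 t) /\
                         levelt_form (A1 t) (Y0 t) (G t) D S N].

(* Y r (r = 1, 2, 3) are the canonical solutions at infinity, and St r
   (r = 1, 2) the (constant) Stokes matrices. *)
Definition isomonodromic (u0 : 'rV[R[i]^o]_n) (eps tau : R) (A1 : 'rV[R[i]^o]_n -> 'M[R[i]^o]_n) V
    (Y : nat -> 'rV[R[i]^o]_n -> R[i]^o -> 'M[R[i]^o]_n)
    (St : nat -> 'M[R[i]^o]_n) : Prop :=
  [/\ admissible_domain u0 eps tau V,
      forall r t, (1 <= r <= 2)%N -> V t ->
        connected_by (Y r t) (Y r.+1 t) (St r),
      forall t t', V t -> V t' -> diag_part (A1 t) = diag_part (A1 t'),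
      forall t t', V t -> V t' -> char_poly (A1 t) = char_poly (A1 t')
    & exists Y0 D S N C0, levelt_family u0 A1 V Y0 D S N /\
        forall t, V t -> connected_by (Y0 t) (Y 1%N t) C0].

End Deformation.

(* Main.v *)
Require Import Defs.
From HB Require Import structures.
From mathcomp Require Import all_boot all_order all_algebra.
From mathcomp Require Import complex.
From mathcomp Require Import all_classical all_reals all_analysis.
From mathcomp Require Import perm ring lra.

Set Implicit Arguments.
Unset Strict Implicit.
Unset Printing Implicit Defensive.

Import Order.TTheory GRing.Theory Num.Theory.
Import numFieldNormedType.Exports.

Local Open Scope classical_set_scope.
Local Open Scope ring_scope.
Local Open Scope complex_scope.

(** The isomonodromic solutions satisfy [d_v Y = (z diag v + omega_v) Y], where
    [omega_ab = (v_a - v_b) A_ab / (u_a - u_b)]: the logarithmic derivative of Y is the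
    same for all sectors and for the Levelt solution, hence entire in z, and it grows
    linearly by the asymptotics (which hold locally uniformly in t by Baire's theorem), so
    Liouville's theorem applies.  The vanishing of [A_ab] on the coalescence locus makes
    omega holomorphic on the whole polydisc; its flow extends Y_r, the F_k and the
    Levelt solutions to t = 0, and preserves the Stokes and connection matrices.  The
    asymptotics at t = 0 are obtained by transporting the residual
    [Y e^(-Lambda z) z^(-B) - sum_(k <= N) F_k z^(-k)] from the cell to t = 0 along segments, on
    which the exponentials are harmless because epsilon0 is below the gap delta_jk, and
    by propagating it along lines in the z-plane with an exponential dichotomy.
    Nonresonance of the diagonal of A(0) gives uniqueness of the formal solution. *)

(* [w] is the logarithm of [z], so this is the modulus of [z] *)
Local Notation modz w := (expR (complex.Re w)).
Local Notation cRe := complex.Re.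
Local Notation cIm := complex.Im.

(** The obstacle is that the asymptotics in [V] are given for each t separately, and that the way to
    t = 0 leaves the cell and may cross Stokes rays and the coalescence locus. Identities are
    therefore proved on one small polydisc and continued by the holomorphic connection z diag v +
    omega; only the asymptotics need estimates. The path to 0 is broken at a point [tp] whose
    coordinates are real multiples of e^(-i al), where al is the lower boundary ray of the
    half-plane. The first leg costs at most exp(2 eps0 |Im(z e^(-i al))|), nothing on the ray al;
    the second costs at most exp(2 eps0 |Re(z e^(-i al))|), nothing on the middle ray al + pi/2.
    Each loss is removed by the dichotomy, started on the ray without loss. Near the boundary rays
    the second loss has rate close to 2 eps0, and it is beaten exactly because epsilon0 < delta_jk
    means 2 eps0 < |Re(e^(i tau) (lambda_j - lambda_k))|. This gains slightly more than the
    half-plane; from there small rotations reach every closed subsector of S_r, as they meet no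
    Stokes ray of Lambda(0). *)

Lemma powV_ge0 {R : realType} N (x : R) : 0 <= expR x ^- N.
Proof. by rewrite invr_ge0 exprn_ge0 ?expR_ge0. Qed.

Lemma le_of_eq {R : realType} (x y : R) : x = y -> x <= y.
Proof. by move=> ->. Qed.

Lemma half_lt {R : realType} (r : R) : 0 < r -> r / 2 < r.
Proof. by move=> r0; rewrite ltr_pdivrMr// ltr_pMr// ltr1n. Qed.

(** * Modulus, derivatives and integrals of complex-valued functions *)

Section ComplexCalculus.
Context {R : realType}.
Notation C := (R[i]^o)%type.

(** In [R[i]] the norm is itself a complex number; [nc] is the same number in [R], where the order
    is total and estimates can be left to [lra]. *)
Definition nc (x : C) : R := Normc.normc (x : R[i]).

Lemma normE (x : C) : `|x| = (nc x)%:C.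
Proof. by []. Qed.

Lemma nc_ge0 x : 0 <= nc x.
Proof. by rewrite -lecR -normE normr_ge0. Qed.

Lemma nc0 : nc 0 = 0. Proof. exact: Normc.normc0. Qed.
Lemma nc1 : nc 1 = 1. Proof. exact: Normc.normc1. Qed.
Lemma nc_eq0 x : (nc x == 0) = (x == 0).
Proof.
apply/eqP/eqP => [/(@Normc.eq0_normc R)//|->]; exact: nc0.
Qed.
Lemma nc_gt0 x : (0 < nc x) = (x != 0).
Proof. by rewrite lt_neqAle nc_ge0 eq_sym nc_eq0 andbT. Qed.
Lemma ncM x y : nc (x * y) = nc x * nc y. Proof. exact: Normc.normcM. Qed.
Lemma ncD x y : nc (x + y) <= nc x + nc y. Proof. exact: le_normcD. Qed.
Lemma ncN x : nc (- x) = nc x. Proof. exact: normcN. Qed.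
Lemma ncB x y : nc (x - y) <= nc x + nc y.
Proof. by rewrite -(ncN y) ncD. Qed.
Lemma ncC x y : nc (x - y) = nc (y - x).
Proof. by rewrite -ncN opprB. Qed.
Lemma ncV x : nc x^-1 = (nc x)^-1. Proof. exact: Normc.normcV. Qed.
Lemma ncX x k : nc (x ^+ k) = nc x ^+ k.
Proof. by elim: k => [|k IH]; rewrite ?expr0 ?nc1// !exprS ncM IH. Qed.
Lemma ncR (a : R) : nc a%:C = `|a|.
Proof. by rewrite /nc /= expr0n /= addr0 sqrtr_sqr. Qed.
Lemma ncE x : nc x ^+ 2 = cRe x ^+ 2 + cIm x ^+ 2.
Proof. by case: x => a b; rewrite /nc /= sqr_sqrtr ?addr_ge0 ?sqr_ge0. Qed.
Lemma Re_le_nc x : `|cRe x| <= nc x.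
Proof.
rewrite -(@ler_pXn2r _ 2%N)// ?nnegrE ?nc_ge0// ncE real_normK ?num_real//.
by rewrite lerDl sqr_ge0.
Qed.
Lemma Im_le_nc x : `|cIm x| <= nc x.
Proof.
rewrite -(@ler_pXn2r _ 2%N)// ?nnegrE ?nc_ge0// ncE real_normK ?num_real//.
by rewrite lerDr sqr_ge0.
Qed.
Lemma nc_le_ReIm x : nc x <= `|cRe x| + `|cIm x|.
Proof.
rewrite -(@ler_pXn2r _ 2%N)// ?nnegrE ?nc_ge0 ?addr_ge0// ncE sqrrD.
rewrite !real_normK ?num_real// lerD2r lerDl mulrn_wge0 ?mulr_ge0//.
Qed.
Lemma nc_triangle x y z : nc (x - z) <= nc (x - y) + nc (y - z).
Proof. by rewrite -(subrKA y) ncD. Qed.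
Lemma nc_sum (I : Type) (s : seq I) (P : pred I) (F : I -> C) :
  nc (\sum_(i <- s | P i) F i) <= \sum_(i <- s | P i) nc (F i).
Proof.
elim/big_rec2: _ => [|i y1 y2 _ h]; first by rewrite nc0.
by apply: le_trans (ncD _ _) _; rewrite lerD2l.
Qed.
Lemma nc_le0_eq x y : nc (x - y) <= 0 -> x = y.
Proof. by move=> h; apply/eqP; rewrite -subr_eq0 -nc_eq0 eq_le nc_ge0 h. Qed.
Lemma nc_eps_eq x y : (forall e : R, 0 < e -> nc (x - y) <= e) -> x = y.
Proof. by move=> h; apply: nc_le0_eq; apply/ler_addgt0Pr => e e0; rewrite add0r h. Qed.
Lemma nc_dist x y : nc x - nc y <= nc (x - y).
Proof. by rewrite lerBlDr; apply: le_trans (ncD _ _); rewrite subrK. Qed.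

Lemma cReD (x y : C) : cRe (x + y) = cRe x + cRe y.
Proof. by case: x y => [a b] [c d]. Qed.
Lemma cImD (x y : C) : cIm (x + y) = cIm x + cIm y.
Proof. by case: x y => [a b] [c d]. Qed.
Lemma cReN (x : C) : cRe (- x) = - cRe x.
Proof. by case: x. Qed.
Lemma cImN (x : C) : cIm (- x) = - cIm x.
Proof. by case: x. Qed.
Lemma cReM (x y : C) :
  cRe (x * y) = cRe x * cRe y - cIm x * cIm y.
Proof. by case: x y => [a b] [c d]. Qed.
Lemma cImM (x y : C) :
  cIm (x * y) = cRe x * cIm y + cIm x * cRe y.
Proof. by case: x y => [a b] [c d]. Qed.
Lemma ceqP (x y : C) :
  cRe x = cRe y -> cIm x = cIm y -> x = y.
Proof. by case: x y => [a b] [c d] /= -> ->. Qed.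
Lemma realCD (a b : R) : (a + b)%:C = a%:C + b%:C :> C.
Proof. exact: rmorphD. Qed.
Lemma realCM (a b : R) : (a * b)%:C = a%:C * b%:C :> C.
Proof. exact: rmorphM. Qed.
Lemma realCN (a : R) : (- a)%:C = - a%:C :> C.
Proof. exact: rmorphN. Qed.
Lemma realCB (a b : R) : (a - b)%:C = a%:C - b%:C :> C.
Proof. exact: rmorphB. Qed.
Lemma realCV (a : R) : (a^-1)%:C = (a%:C)^-1 :> C.
Proof. exact: fmorphV. Qed.
Lemma realC0 : 0%:C = 0 :> C. Proof. by []. Qed.
Lemma realC1 : 1%:C = 1 :> C. Proof. by []. Qed.

(** Increments in place of difference quotients: [h = 0] is allowed, no division occurs, and the
    value of the derivative is an argument that can be rewritten. *)
Definition cder (f : C -> C) (w d : C) : Prop :=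
  forall e : R, 0 < e -> exists2 r : R, 0 < r &
    forall h, nc h < r -> nc (f (w + h) - f w - d * h) <= e * nc h.

Definition rder (f : R -> C) (s : R) (d : C) : Prop :=
  forall e : R, 0 < e -> exists2 r : R, 0 < r &
    forall h, `|h| < r -> nc (f (s + h) - f s - d * h%:C) <= e * `|h|.

Definition ccont (f : C -> C) (w : C) : Prop :=
  forall e : R, 0 < e -> exists2 r : R, 0 < r &
    forall h, nc h < r -> nc (f (w + h) - f w) < e.

(* Derivatives with respect to a complex and to a real parameter are treated at once:
   increments are taken in [V], embedded in C by [io]. *)
Section Increments.
Variables (V : zmodType) (io : V -> C) (nm : V -> R).
Hypothesis nmE : forall h, nm h = nc (io h).

Definition incr_der (g : V -> C) s b := forall e : R, 0 < e -> exists2 r : R, 0 < r &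
  forall h, nm h < r -> nc (g (s + h) - g s - b * io h) <= e * nm h.

Lemma incr_der_cont g s b : incr_der g s b -> forall e : R, 0 < e -> exists2 r : R, 0 < r &
  forall h, nm h < r -> nc (g (s + h) - g s) < e.
Proof.
move=> fd e e0; have [r r0 fr] := fd 1 ltr01.
have p : 0 < 1 + nc b by rewrite ltr_pwDl// nc_ge0.
exists (Num.min r (e / (1 + nc b))) => [|h]; first by rewrite lt_min r0 divr_gt0.
rewrite lt_min ltr_pdivlMr// => /andP[hr he].
apply: le_lt_trans he; rewrite -[X in nc X](subrK (b * io h)); apply: le_trans (ncD _ _) _.
by rewrite mulrDr mulr1 ncM -nmE lerD// ?[_ * nc b]mulrC// -[leRHS]mul1r fr.
Qed.

Lemma incr_der_comp f g s a b : incr_der g s b -> cder f (g s) a ->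
  incr_der (fun x => f (g x)) s (a * b).
Proof.
move=> gb fa e e0; have n0 h : 0 <= nm h by rewrite nmE nc_ge0.
set K := 1 + nc b + nc a.
have K0 : 0 < K by rewrite /K -!addrA ltr_pwDl// !addr_ge0 ?nc_ge0.
have e2 : 0 < e / (2 * K) by rewrite divr_gt0// mulr_gt0.
have [r r0 fr] := fa _ e2; have [t t0 gs] := gb _ e2; have [s1 s10 gs1] := gb _ ltr01.
exists (Num.min t (Num.min s1 (r / K))) => [|h]; first by rewrite !lt_min t0 s10 divr_gt0.
rewrite !lt_min => /andP[/gs hs /andP[/gs1 hs1 hs2]].
have hg : nc (g (s + h) - g s) <= K * nm h.
  rewrite -[X in nc X](subrK (b * io h)); apply: le_trans (ncD _ _) _.
  rewrite ncM -nmE /K; apply: le_trans (_ : (1 + nc b) * nm h <= _); first by rewrite [leRHS]mulrDl lerD2r.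
  by rewrite ler_wpM2r// lerDl nc_ge0.
have := fr (g (s + h) - g s); rewrite [g s + _]addrC subrK => h1.
have {h1} := h1 (le_lt_trans hg _); rewrite mulrC -ltr_pdivlMr// => /(_ hs2) h1.
have -> : f (g (s + h)) - f (g s) - a * b * io h =
  (f (g (s + h)) - f (g s) - a * (g (s + h) - g s)) + a * (g (s + h) - g s - b * io h) by ring.
apply: le_trans (ncD _ _) _.
have -> : e * nm h = e / (2 * K) * (K * nm h) + e / (2 * K) * nm h * K by field; rewrite gt_eqF.
apply: lerD; first by apply: le_trans h1 _; rewrite ler_pM2l.
rewrite ncM mulrC ler_pM ?nc_ge0// /K; have := nc_ge0 b; lra.
Qed.
End Increments.

Lemma cder_cont f w d : cder f w d -> ccont f w.
Proof. exact: (@incr_der_cont _ (fun h : C => h) nc). Qed.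

Lemma cder_cst (c w : C) : cder (fun=> c) w 0.
Proof.
move=> e e0; exists 1 => // h _.
by rewrite subrr mul0r subrr nc0 mulr_ge0 ?nc_ge0 // ltW.
Qed.

Lemma cder_id w : cder (fun x => x) w 1.
Proof.
move=> e e0; exists 1 => // h _; rewrite mul1r.
by rewrite [w + h]addrC addrK subrr nc0 mulr_ge0 ?nc_ge0 // ltW.
Qed.

Lemma cderD f g w a b : cder f w a -> cder g w b ->
  cder (fun x => f x + g x) w (a + b).
Proof.
move=> fa gb e e0; have e2 : 0 < e / 2 by rewrite divr_gt0.
have [r r0 fr] := fa _ e2; have [s s0 gs] := gb _ e2.
exists (Num.min r s) => [|h]; first by rewrite lt_min r0.
rewrite lt_min => /andP[/fr hr /gs hs].
have -> : f (w + h) + g (w + h) - (f w + g w) - (a + b) * h =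
  (f (w + h) - f w - a * h) + (g (w + h) - g w - b * h) by ring.
apply: le_trans (ncD _ _) _; move: hr hs.
move: (nc _) (nc _) (nc h) => x y z; lra.
Qed.

Lemma cderM f g w a b : cder f w a -> cder g w b ->
  cder (fun x => f x * g x) w (a * g w + f w * b).
Proof.
move=> fa gb e e0.
set K := 1 + nc (f w) + nc (g w) + nc a.
have K0 : 0 < K by rewrite /K -!addrA ltr_pwDl// !addr_ge0 ?nc_ge0.
have e2 : 0 < e / (3 * K) by rewrite divr_gt0// mulr_gt0.
have [r r0 fr] := fa _ e2; have [s s0 gs] := gb _ e2.
have [s' s'0 gs'] := cder_cont gb e2.
have [s1 s10 gs1] := cder_cont gb ltr01.
exists (Num.min (Num.min r s) (Num.min s' s1)) => [|h]; first by rewrite !lt_min r0 s0 s'0.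
rewrite !lt_min => /andP[/andP[/fr hr /gs hs]] /andP[/gs' hs' /gs1 hs1].
have -> : f (w + h) * g (w + h) - f w * g w - (a * g w + f w * b) * h =
  (f (w + h) - f w - a * h) * (g w + (g (w + h) - g w)) +
  (f w * (g (w + h) - g w - b * h) + a * h * (g (w + h) - g w)) by ring.
have -> : e * nc h = K * (e / (3 * K) * nc h) +
    (K * (e / (3 * K) * nc h) + K * (e / (3 * K) * nc h)).
  by field; rewrite gt_eqF.
have hK1 : nc (g w) + 1 <= K by rewrite /K; have := nc_ge0 a; have := nc_ge0 (f w); lra.
have hK2 : nc (f w) <= K by rewrite /K; have := nc_ge0 a; have := nc_ge0 (g w); lra.
have hK3 : nc a <= K by rewrite /K; have := nc_ge0 (f w); have := nc_ge0 (g w); lra.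
apply: le_trans (ncD _ _) _; apply: lerD; last first.
  apply: le_trans (ncD _ _) _; apply: lerD; rewrite !ncM.
    by apply: ler_pM; rewrite ?nc_ge0.
  rewrite -mulrA; apply: ler_pM; rewrite ?mulr_ge0 ?nc_ge0//.
  by rewrite mulrC ler_wpM2r ?nc_ge0// ltW.
rewrite ncM [leLHS]mulrC; apply: ler_pM; rewrite ?nc_ge0//.
apply: le_trans (ncD _ _) _; apply: le_trans hK1; by rewrite lerD2l ltW.
Qed.

Lemma cder_eq f w a b : cder f w a -> a = b -> cder f w b.
Proof. by move=> h <-. Qed.

Lemma cder_ext f g w a : (forall x, f x = g x) -> cder f w a -> cder g w a.
Proof. by move=> /funext ->. Qed.

Lemma cder_near f g w a (r : R) : 0 < r -> (forall h, nc h < r -> f (w + h) = g (w + h)) ->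
  cder f w a -> cder g w a.
Proof.
move=> r0 fg fa e e0; have [s s0 fs] := fa e e0.
exists (Num.min r s) => [|h]; first by rewrite lt_min r0.
rewrite lt_min => /andP[hr hs].
by rewrite -fg// -[in g w](addr0 w) -fg ?nc0// addr0 fs.
Qed.

Lemma cder_unique f w a b : cder f w a -> cder f w b -> a = b.
Proof.
move=> fa fb; apply/eqP; rewrite -subr_eq0 -nc_eq0; apply/negP => /negP ab0.
have ab : 0 < nc (a - b) by rewrite lt_neqAle eq_sym ab0 nc_ge0.
have e4 : 0 < nc (a - b) / 4 by rewrite divr_gt0.
have [r r0 fr] := fa _ e4; have [s s0 fs] := fb _ e4.
pose t : R := Num.min r s / 2.
have t0 : 0 < t by rewrite divr_gt0// lt_min r0.
have trs : t < Num.min r s by rewrite ltr_pdivrMr// ltr_pMr ?lt_min ?r0// ltr1n.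
have nt : nc t%:C = t by rewrite ncR gtr0_norm.
have := fr t%:C; rewrite nt => /(_ (lt_le_trans trs _)).
rewrite ge_min lexx => /(_ isT) h1.
have := fs t%:C; rewrite nt => /(_ (lt_le_trans trs _)).
rewrite ge_min lexx orbT => /(_ isT) h2.
have : nc ((a - b) * t%:C) <= nc (a - b) / 4 * t + nc (a - b) / 4 * t.
  have -> : (a - b) * t%:C = (f (w + t%:C) - f w - b * t%:C) - (f (w + t%:C) - f w - a * t%:C) by ring.
  by apply: le_trans (ncB _ _) _; rewrite lerD.
by rewrite ncM nt -mulrDl ler_pM2r//; move: ab; set x := nc _; lra.
Qed.

Lemma cderN f w a : cder f w a -> cder (fun x => - f x) w (- a).
Proof.
move=> fa; apply: cder_ext (_ : cder (fun x => (-1) * f x) w _) => [x|].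
  by rewrite mulN1r.
apply: cder_eq (cderM (cder_cst (-1) w) fa) _; ring.
Qed.

Lemma cderB f g w a b : cder f w a -> cder g w b ->
  cder (fun x => f x - g x) w (a - b).
Proof. by move=> fa gb; apply: cderD fa (cderN gb). Qed.

Lemma cderZ (c : C) f w a : cder f w a -> cder (fun x => c * f x) w (c * a).
Proof.
by move=> fa; apply: cder_eq (cderM (cder_cst c w) fa) _; ring.
Qed.

Lemma cder_sum (I : Type) (s : seq I) (F : I -> C -> C) (d : I -> C) w :
  (forall i, cder (F i) w (d i)) ->
  cder (fun x => \sum_(i <- s) F i x) w (\sum_(i <- s) d i).
Proof.
move=> h; elim: s => [|i s IH].
  by apply: cder_ext (_ : cder (fun=> 0) w _) => [x|]; rewrite ?big_nil//; apply: cder_cst.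
apply: cder_ext (_ : cder (fun x => F i x + \sum_(j <- s) F j x) w _) => [x|].
  by rewrite big_cons.
by rewrite big_cons; apply: cderD.
Qed.

Lemma cderX w k : cder (fun x => x ^+ k) w (k%:R * w ^+ k.-1).
Proof.
elim: k => [|k IH]; first by rewrite mul0r; apply: cder_cst.
apply: cder_ext (_ : cder (fun x => x * x ^+ k) w _) => [x|]; first by rewrite exprS.
apply: cder_eq (cderM (cder_id w) IH) _.
case: k {IH} => [|k]/=; first by rewrite !expr0; ring.
by rewrite exprS -!natr1; ring.
Qed.

Lemma cder_comp f g w a b : cder g w b -> cder f (g w) a -> cder (fun x => f (g x)) w (a * b).
Proof. exact: (@incr_der_comp _ (fun h : C => h) nc). Qed.

Lemma rder_comp f (g : R -> C) s a b : rder g s b -> cder f (g s) a -> rder (fun x => f (g x)) s (a * b).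
Proof. by apply: (@incr_der_comp _ (fun h : R => h%:C) (fun h => `|h|)) => h; rewrite ncR. Qed.

Definition dr (f : R -> R) (s d : R) : Prop :=
  forall e : R, 0 < e -> exists2 r : R, 0 < r &
    forall h, `|h| < r -> `|f (s + h) - f s - d * h| <= e * `|h|.

Lemma drP f s d : dr f s d <-> is_derive s 1 f d.
Proof.
split => [fd|[fd <-]].
  have cv : (fun h : R => h^-1 *: (f (h *: (1:R) + s) - f s)) @ 0^' --> d.
    apply/cvgrPdist_le => /= e e0; have [r r0 fr] := fd e e0.
    near=> h; have h0 : h != 0 by near: h; exact: nbhs_dnbhs_neq.
    have hr : `|h| < r by near: h; exact: dnbhs0_lt.
    rewrite -(@ler_pM2r _ `|h|) ?normr_gt0// -normrM mulrBl.
    have -> : h^-1 *: (f (h *: 1 + s) - f s) * h = f (s + h) - f s by rewrite /GRing.scale/= mulr1 [h + s]addrC mulrAC mulVf// mul1r.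
    by rewrite distrC fr.
  have h : derivable f s 1 by apply/cvg_ex; exists d.
  by split => //; apply/cvg_lim.
move=> e e0.
have /cvgrPdist_le/(_ e e0)/= := fd.
rewrite near_withinE near_simpl /= => -[r/= r0 fr].
exists r => // h hr; have [->|h0] := eqVneq h 0.
  by rewrite addr0 subrr mulr0 subrr normr0 mulr0.
have := fr h; rewrite /ball/= sub0r normrN => /(_ hr h0).
rewrite -(@ler_pM2r _ `|h|) ?normr_gt0// -normrM mulrBl.
rewrite /GRing.scale/= mulr1 [h + s]addrC mulrAC mulVf// mul1r.
rewrite distrC; congr (`| _ - _ * _| <= _).
Unshelve. all: by end_near. Qed.

Lemma dr_ext f g s d : (forall x, f x = g x) -> dr f s d -> dr g s d.
Proof. by move=> /funext ->. Qed.

Lemma dr_eq f s a b : dr f s a -> a = b -> dr f s b.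
Proof. by move=> h <-. Qed.

Lemma dr_cst (c s : R) : dr (fun=> c) s 0.
Proof. by apply/drP; exact: is_derive_cst. Qed.
Lemma dr_id (s : R) : dr (fun x => x) s 1.
Proof. by apply/drP; exact: is_derive_id. Qed.
Lemma drD f g s a b : dr f s a -> dr g s b -> dr (fun x => f x + g x) s (a + b).
Proof. by move=> /drP fa /drP gb; apply/drP; exact: is_deriveD. Qed.
Lemma drN f s a : dr f s a -> dr (fun x => - f x) s (- a).
Proof. by move=> /drP fa; apply/drP; exact: is_deriveN. Qed.
Lemma drB f g s a b : dr f s a -> dr g s b -> dr (fun x => f x - g x) s (a - b).
Proof. by move=> /drP fa /drP gb; apply/drP; exact: is_deriveB. Qed.
Lemma drM f g s a b : dr f s a -> dr g s b ->
  dr (fun x => f x * g x) s (a * g s + f s * b).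
Proof.
move=> /drP fa /drP gb; apply/drP; apply: is_derive_eq.
by rewrite /GRing.scale/= [g s * a]mulrC addrC.
Qed.
Lemma drZ c f s a : dr f s a -> dr (fun x => c * f x) s (c * a).
Proof. by move=> fa; apply: dr_eq (drM (dr_cst c s) fa) _; ring. Qed.
Lemma dr_comp f g s a b : dr g s b -> dr f (g s) a -> dr (fun x => f (g x)) s (a * b).
Proof.
move=> /drP gb /drP fa; apply/drP; exact: is_derive1_comp.
Qed.
Lemma dr_sum (I : Type) (r : seq I) (F : I -> R -> R) (d : I -> R) w :
  (forall i, dr (F i) w (d i)) ->
  dr (fun x => \sum_(i <- r) F i x) w (\sum_(i <- r) d i).
Proof.
move=> h; elim: r => [|i r IH].
  by apply: dr_ext (_ : dr (fun=> 0) w _) => [x|]; rewrite ?big_nil//; apply: dr_cst.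
apply: dr_ext (_ : dr (fun x => F i x + \sum_(j <- r) F j x) w _) => [x|].
  by rewrite big_cons.
by rewrite big_cons; apply: drD.
Qed.

Lemma dr_cont f s d : dr f s d -> {for s, continuous f}.
Proof. by move=> /drP[fd _]; exact/differentiable_continuous/derivable1_diffP. Qed.

Lemma dr_ge0 f f' a b : (forall x, a <= x <= b -> dr f x (f' x)) ->
  (forall x, a <= x <= b -> 0 <= f' x) -> a <= b -> f a <= f b.
Proof.
move=> fd f0 ab.
have [||c cab E] := @MVT_segment R f f' a b ab.
- move=> x; by rewrite in_itv/= => /andP[x1 x2]; apply/drP/fd; rewrite !ltW.
- apply: continuous_in_subspaceT => x; rewrite inE/= in_itv/= => xab.
  exact: dr_cont (fd x xab).
- by rewrite -subr_ge0 E mulr_ge0 ?subr_ge0// f0// (itvP cab).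
Qed.

Lemma rder_Re (f : R -> C) s d : rder f s d -> dr (fun x => cRe (f x)) s (cRe d).
Proof.
move=> fd e e0; have [r r0 fr] := fd e e0; exists r => // h hr.
apply: le_trans (fr h hr); apply: le_trans (Re_le_nc _).
by rewrite !(cReD, cReN, cReM)/= mulr0 subr0.
Qed.
Lemma rder_Im (f : R -> C) s d : rder f s d -> dr (fun x => cIm (f x)) s (cIm d).
Proof.
move=> fd e e0; have [r r0 fr] := fd e e0; exists r => // h hr.
apply: le_trans (fr h hr); apply: le_trans (Im_le_nc _).
by rewrite !(cImD, cImN, cImM)/= mulr0 add0r.
Qed.
Lemma rderP (f : R -> C) s d : dr (fun x => cRe (f x)) s (cRe d) ->
  dr (fun x => cIm (f x)) s (cIm d) -> rder f s d.
Proof.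
move=> f1 f2 e e0; have e2 : 0 < e / 2 by rewrite divr_gt0.
have [r r0 fr] := f1 _ e2; have [t t0 ft] := f2 _ e2.
exists (Num.min r t) => [|h]; first by rewrite lt_min r0.
rewrite lt_min => /andP[/fr hr /ft ht].
apply: le_trans (nc_le_ReIm _) _.
rewrite !(cReD, cReN, cReM, cImD, cImN, cImM)/= !mulr0 subr0 add0r.
move: hr ht; move: `|_ - _ - _| `|_ - _ - _| => x y; lra.
Qed.

Lemma rder_eq (f : R -> C) s a b : rder f s a -> a = b -> rder f s b.
Proof. by move=> h <-. Qed.
Lemma rder_ext (f g : R -> C) s a : (forall x, f x = g x) -> rder f s a -> rder g s a.
Proof. by move=> /funext ->. Qed.
Lemma rder_cst (c : C) s : rder (fun=> c) s 0.
Proof. by apply: rderP; apply: dr_cst. Qed.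
Lemma rder_real f s d : dr f s d -> rder (fun x => (f x)%:C) s d%:C.
Proof. by move=> fd; apply: rderP => //=; apply: dr_cst. Qed.
Lemma rder_id s : rder (fun x : R => x%:C) s 1.
Proof. exact: rder_real (dr_id s). Qed.
Lemma rderD (f g : R -> C) s a b : rder f s a -> rder g s b ->
  rder (fun x => f x + g x) s (a + b).
Proof.
move=> fa gb; apply: rderP.
  rewrite cReD; apply: dr_ext (drD (rder_Re fa) (rder_Re gb)) => x.
  by rewrite cReD.
rewrite cImD; apply: dr_ext (drD (rder_Im fa) (rder_Im gb)) => x.
by rewrite cImD.
Qed.
Lemma rderM (f g : R -> C) s a b : rder f s a -> rder g s b ->
  rder (fun x => f x * g x) s (a * g s + f s * b).
Proof.
move=> fa gb; have f1 := rder_Re fa; have f2 := rder_Im fa.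
have g1 := rder_Re gb; have g2 := rder_Im gb; apply: rderP.
  apply: dr_ext (dr_eq (drB (drM f1 g1) (drM f2 g2)) _) => [x|].
    by rewrite cReM.
  rewrite cReD !cReM; ring.
apply: dr_ext (dr_eq (drD (drM f1 g2) (drM f2 g1)) _) => [x|].
  by rewrite cImM.
rewrite cImD !cImM; ring.
Qed.
Lemma rderZ (c : C) (f : R -> C) s a : rder f s a -> rder (fun x => c * f x) s (c * a).
Proof. by move=> fa; apply: rder_eq (rderM (rder_cst c s) fa) _; ring. Qed.
Lemma rderN (f : R -> C) s a : rder f s a -> rder (fun x => - f x) s (- a).
Proof.
move=> fa; apply: rder_ext (rder_eq (rderZ (-1) fa) _) => [x|]; ring.
Qed.
Lemma rderB (f g : R -> C) s a b : rder f s a -> rder g s b ->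
  rder (fun x => f x - g x) s (a - b).
Proof. by move=> fa gb; apply: rderD fa (rderN gb). Qed.
Lemma rder_sum (I : Type) (r : seq I) (F : I -> R -> C) (d : I -> C) w :
  (forall i, rder (F i) w (d i)) ->
  rder (fun x => \sum_(i <- r) F i x) w (\sum_(i <- r) d i).
Proof.
move=> h; elim: r => [|i r IH].
  by apply: rder_ext (_ : rder (fun=> 0) w _) => [x|]; rewrite ?big_nil//; apply: rder_cst.
apply: rder_ext (_ : rder (fun x => F i x + \sum_(j <- r) F j x) w _) => [x|].
  by rewrite big_cons.
by rewrite big_cons; apply: rderD.
Qed.

Lemma rder_compr (f : R -> C) (g : R -> R) s a b : dr g s b -> rder f (g s) a ->
  rder (fun x => f (g x)) s (a * b%:C).
Proof.
move=> gb fa; apply: rderP.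
  apply: dr_eq (dr_comp gb (rder_Re fa)) _; rewrite cReM/=; ring.
apply: dr_eq (dr_comp gb (rder_Im fa)) _; rewrite cImM/=; ring.
Qed.

(** Mean value inequality: the unit number [c] below turns the increment of [f] into a positive real
    number, after which g - Re(c f) is nondecreasing. *)
Lemma rder_bound_le (f d : R -> C) (g g' : R -> R) a b :
  (forall x, a <= x <= b -> rder f x (d x)) -> (forall x, a <= x <= b -> dr g x (g' x)) ->
  (forall x, a <= x <= b -> nc (d x) <= g' x) -> a <= b ->
  nc (f b - f a) <= g b - g a.
Proof.
move=> fd gd dM ab; set v := f b - f a.
have [E|v0] := eqVneq v 0.
  rewrite E nc0 subr_ge0; apply: (dr_ge0 gd) => // x xab.
  by apply: le_trans (dM x xab); exact: nc_ge0.
set c : C := (conjc v) / (nc v)%:C.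
have nv0 : nc v != 0 by rewrite nc_eq0.
have nvC : (nc v)%:C != 0 :> C by rewrite -nc_eq0 ncR normr_eq0.
have ncc : nc c = 1.
  have -> : nc c = nc (conjc v) / nc v by rewrite ncM ncV ncR ger0_norm ?nc_ge0.
  have -> : nc (conjc v) = nc v by rewrite /nc; case: (v) => x y /=; rewrite sqrrN.
  by rewrite divff.
have cv : c * v = (nc v)%:C.
  rewrite /c mulrAC; apply/(canLR (mulfK nvC)).
  apply: ceqP.
    by rewrite !cReM/= !mulr0 subr0 -expr2 ncE; case: (v) => x y /=; ring.
  by rewrite !cImM/=; case: (v) => x y /=; ring.
have -> : nc v = cRe (c * f b) - cRe (c * f a) by rewrite -cReN -cReD -mulrBr cv.
have : g a - cRe (c * f a) <= g b - cRe (c * f b).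
  apply: (@dr_ge0 (fun x => g x - cRe (c * f x))
    (fun x => g' x - cRe (c * d x))) => // x xab.
    by apply: drB (gd x xab) _; exact: (rder_Re (rderZ c (fd x xab))).
  rewrite subr_ge0; apply: le_trans (dM x xab).
  apply: le_trans (ler_norm _) _; apply: le_trans (Re_le_nc _) _.
  by rewrite ncM ncc mul1r.
lra.
Qed.

Lemma rder_bound (f d : R -> C) M a b : (forall x, a <= x <= b -> rder f x (d x)) ->
  (forall x, a <= x <= b -> nc (d x) <= M) -> a <= b -> nc (f b - f a) <= M * (b - a).
Proof.
move=> fd dM ab; rewrite mulrBr; apply: (rder_bound_le (g := fun x => M * x) (g' := fun=> M * 1) fd) => // x xab.
  exact: drZ (dr_id x).
by rewrite mulr1 dM.
Qed.

Lemma rder0_cst (f : R -> C) a b : (forall x, a <= x <= b -> rder f x 0) -> a <= b -> f b = f a.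
Proof.
move=> fd ab; apply: nc_le0_eq.
by apply: le_trans (rder_bound (d := fun=> 0) fd (M := 0) _ ab) _; rewrite ?mul0r// => x _; rewrite nc0.
Qed.

Definition cis (s : R) : C := cos s +i* sin s.
Lemma nc_cis s : nc (cis s) = 1.
Proof. by rewrite /nc/= cos2Dsin2 sqrtr1. Qed.
Lemma cis0 : cis 0 = 1. Proof. by rewrite /cis cos0 sin0. Qed.
Lemma cisD s t : cis (s + t) = cis s * cis t.
Proof. by apply: ceqP; rewrite ?cReM ?cImM/= ?cosD ?sinD; ring. Qed.
Lemma cis_neq0 s : cis s != 0.
Proof. by rewrite -nc_eq0 nc_cis oner_eq0. Qed.
Lemma cisN s : cis (- s) = (cis s)^-1.
Proof.
apply: (mulfI (cis_neq0 s)); rewrite -cisD subrr cis0 mulfV//; exact: cis_neq0.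
Qed.
Lemma cis2pi : cis (pi *+ 2) = 1. Proof. by rewrite /cis cos2pi sin2pi. Qed.
Lemma cispi : cis pi = -1 :> C.
Proof. by rewrite /cis cospi sinpi; apply: ceqP => //=; rewrite oppr0. Qed.
Lemma rder_cis s : rder cis s ('i * cis s).
Proof.
apply: rderP.
  apply: dr_eq (_ : dr cos s (- sin s)) _; first by apply/drP; exact: is_derive_cos.
  by rewrite cReM/=; ring.
apply: dr_eq (_ : dr sin s (cos s)) _; first by apply/drP; exact: is_derive_sin.
by rewrite cImM/=; ring.
Qed.

Lemma cexpE (w : C) : cexp w = (modz w)%:C * cis (cIm w).
Proof. by []. Qed.
Lemma cexpD (v w : C) : cexp (v + w) = cexp v * cexp w.
Proof. rewrite !cexpE cReD cImD expRD cisD realCM; ring. Qed.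
Lemma cexp0 : cexp (0 : C) = 1.
Proof. by rewrite cexpE/= expR0 cis0 mulr1. Qed.
Lemma nc_cexp (w : C) : nc (cexp w) = modz w.
Proof. by rewrite cexpE ncM ncR nc_cis mulr1 ger0_norm// expR_ge0. Qed.
Lemma cexp_neq0 (w : C) : cexp w != 0.
Proof. by rewrite -nc_eq0 nc_cexp gt_eqF// expR_gt0. Qed.
Lemma cexpN (w : C) : cexp (- w) = (cexp w)^-1.
Proof.
by apply: (mulfI (cexp_neq0 w)); rewrite -cexpD subrr cexp0 mulfV// cexp_neq0.
Qed.
(** Integration starts at [a - 1] and the fundamental theorem is used on [[a - 1, b + 1]], so that
    [a] and [b] are interior points and the derivative there is two-sided. *)
Lemma continuous_primitive (h : R -> R) (a b : R) : continuous h ->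
  exists P : R -> R, forall x, a <= x <= b -> dr P x (h x).
Proof.
move=> hc; exists (fun x => (\int[lebesgue_measure]_(t in `[(a - 1), x]) h t)%R).
move=> x /andP[ax xb].
have [||||d E] := @continuous_FTC1_closed R h (a - 1) x (b + 1).
- by rewrite (le_lt_trans xb)// ltrDl.
- apply: continuous_compact_integrable; first exact: segment_compact.
  exact: continuous_subspaceT.
- by rewrite (lt_le_trans _ ax)// ltrBlDr ltrDl.
- exact: hc.
- by apply/drP; apply: DeriveDef; [exact: d|rewrite -derive1E; exact: E].
Qed.

Definition rcont (f : R -> C) (s : R) : Prop :=
  forall e : R, 0 < e -> exists2 r : R, 0 < r &
    forall h, `|h| < r -> nc (f (s + h) - f s) < e.

(** Integrability means having a primitive. Linearity and additivity of the integral then reduce to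
    rules of differentiation and to the uniqueness of primitives up to constants. *)
Definition integ (h : R -> C) (a b : R) : Prop :=
  exists P : R -> C, forall x, a <= x <= b -> rder P x (h x).

Definition clamp (a b x : R) : R := Num.max a (Num.min x b).
Lemma clamp_in a b x : a <= b -> a <= clamp a b x <= b.
Proof. by move=> ab; rewrite /clamp le_max lexx/= ge_max ab ge_min lexx orbT. Qed.
Lemma clamp_id a b x : a <= x <= b -> clamp a b x = x.
Proof. by move=> /andP[ax xb]; rewrite /clamp min_l// max_r. Qed.
Lemma clamp_lip a b s h : `|clamp a b (s + h) - clamp a b s| <= `|h|.
Proof.
have := ler_norm h; have := ler_norm (- h); rewrite normrN; move: `|h| => u n1 n2.
have [m1 m2] : Num.min (s + h) b - Num.min s b <= u /\ Num.min s b - Num.min (s + h) b <= u.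
  by rewrite /Num.min; case: ifPn; case: ifPn; rewrite -?leNgt => *; split; lra.
rewrite ler_norml /clamp; apply/andP; move: m1 m2; move: (Num.min (s + h) b) (Num.min s b) => v w m1 m2.
by rewrite /Num.max; case: ifPn; case: ifPn; rewrite -?leNgt => *; split; lra.
Qed.

(** Composing [h] with the 1-Lipschitz retraction [clamp] of the line onto [[a, b]] gives a function
    continuous everywhere and unchanged on the interval. *)
Lemma integ_within (h : R -> C) a b :
  (forall x, a <= x <= b -> forall e : R, 0 < e -> exists2 r : R, 0 < r &
     forall y, a <= y <= b -> `|y - x| < r -> nc (h y - h x) < e) -> integ h a b.
Proof.
move=> hc; have [ab|ba] := leP a b; last first.
  by exists (fun=> 0) => x /andP[ax xb]; move: (le_trans ax xb); rewrite leNgt ba.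
pose cl := clamp a b; have clab x : a <= cl x <= b := clamp_in x ab.
have lip (g : C -> R) x : (forall u v : C, `|g u - g v| <= nc (u - v)) ->
    {for x, continuous (fun x => g (h (cl x)))}.
  move=> gl; apply/cvgrPdist_lt => /= e e0.
  have [r r0 hr] := hc _ (clab x) e e0; exists r => //= y /=; rewrite /ball_/= => xy; rewrite distrC.
  have yx : `|y - x| < r by rewrite distrC.
  apply: le_lt_trans (gl _ _) _.
  apply: hr (clab y) (le_lt_trans _ yx); have := clamp_lip a b x (y - x); by rewrite [x + _]addrC subrK.
have [P1 HP1] : exists P : R -> R, forall x, a <= x <= b -> dr P x (cRe (h (cl x))).
  apply: continuous_primitive => x; apply: (lip (@cRe R)) => u v.
  by rewrite -cReN -cReD Re_le_nc.
have [P2 HP2] : exists P : R -> R, forall x, a <= x <= b -> dr P x (cIm (h (cl x))).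
  apply: continuous_primitive => x; apply: (lip (@cIm R)) => u v.
  by rewrite -cImN -cImD Im_le_nc.
exists (fun x => P1 x +i* P2 x) => x xab.
by apply: rderP => /=; rewrite -{2}(clamp_id xab); [exact: HP1|exact: HP2].
Qed.

Lemma integ_cont (h : R -> C) a b : (forall x, a <= x <= b -> rcont h x) -> integ h a b.
Proof.
move=> hc; apply: integ_within => x xab e e0; have [r r0 hr] := hc x xab e e0.
by exists r => // y _ /hr; rewrite [x + _]addrC subrK.
Qed.

(** The increment of a chosen primitive, independent of the choice by [cintE]; it is 0 if there is
    no primitive, as the default is a constant function. *)
Definition cint (h : R -> C) (a b : R) : C :=
  let P := xget (fun=> 0) [set P : R -> C | forall x, a <= x <= b -> rder P x (h x)] in
  P b - P a.

Lemma cintE (h P : R -> C) a b : a <= b ->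
  (forall x, a <= x <= b -> rder P x (h x)) -> cint h a b = P b - P a.
Proof.
move=> ab HP; rewrite /cint.
case: xgetP => [Q _ HQ|/(_ P)//].
have : (fun x => Q x - P x) b = (fun x => Q x - P x) a.
  apply: (@rder0_cst (fun x => Q x - P x) a b _ ab) => x xab; apply: rder_eq (rderB (HQ x xab) (HP x xab)) _.
  by rewrite subrr.
move=> /= E; apply/eqP; rewrite -subr_eq0.
have -> : Q b - Q a - (P b - P a) = (Q b - P b) - (Q a - P a) by ring.
by rewrite E subrr.
Qed.

Lemma cint_split (h : R -> C) a b c : integ h a c -> a <= b -> b <= c ->
  cint h a c = cint h a b + cint h b c.
Proof.
move=> [P HP] ab bc; rewrite !(cintE (P := P))//; first ring.
- by move=> x /andP[bx xc]; apply: HP; rewrite (le_trans ab bx).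
- by move=> x /andP[bx xc]; apply: HP; rewrite bx (le_trans xc bc).
- exact: le_trans bc.
Qed.

Lemma integD (f g : R -> C) a b : integ f a b -> integ g a b -> integ (fun x => f x + g x) a b.
Proof.
move=> [P HP] [Q HQ]; exists (fun x => P x + Q x) => x xab.
by apply: rderD; [exact: HP|exact: HQ].
Qed.
Lemma integZ (c : C) (f : R -> C) a b : integ f a b -> integ (fun x => c * f x) a b.
Proof.
by move=> [P HP]; exists (fun x => c * P x) => x xab; apply: rderZ; exact: HP.
Qed.
Lemma cintD (f g : R -> C) a b : a <= b -> integ f a b -> integ g a b ->
  cint (fun x => f x + g x) a b = cint f a b + cint g a b.
Proof.
move=> ab [P HP] [Q HQ]; rewrite (cintE ab HP) (cintE ab HQ).
rewrite (cintE (P := fun x => P x + Q x))//; first ring.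
by move=> x xab; apply: rderD; [exact: HP|exact: HQ].
Qed.
Lemma cintZ (c : C) (f : R -> C) a b : a <= b -> integ f a b ->
  cint (fun x => c * f x) a b = c * cint f a b.
Proof.
move=> ab [P HP]; rewrite (cintE ab HP).
rewrite (cintE (P := fun x => c * P x))//; first ring.
by move=> x xab; apply: rderZ; exact: HP.
Qed.
Lemma cintB (f g : R -> C) a b : a <= b -> integ f a b -> integ g a b ->
  cint (fun x => f x - g x) a b = cint f a b - cint g a b.
Proof.
move=> ab [P HP] [Q HQ]; rewrite (cintE ab HP) (cintE ab HQ).
rewrite (cintE (P := fun x => P x - Q x))//; first ring.
by move=> x xab; apply: rderB; [exact: HP|exact: HQ].
Qed.
Lemma cint_bound (f : R -> C) M a b : a <= b -> integ f a b ->
  (forall x, a <= x <= b -> nc (f x) <= M) -> nc (cint f a b) <= M * (b - a).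
Proof. by move=> ab [P HP] fM; rewrite (cintE ab HP); exact: rder_bound HP fM ab. Qed.
Lemma integ_ext (f g : R -> C) a b : (forall x, a <= x <= b -> f x = g x) ->
  integ f a b -> integ g a b.
Proof. by move=> fg [P HP]; exists P => x xab; rewrite -fg//; exact: HP. Qed.
Lemma cint_ext (f g : R -> C) a b : (forall x, a <= x <= b -> f x = g x) ->
  cint f a b = cint g a b.
Proof.
move=> fg; rewrite /cint; set S := [set _ | _]; set T := [set _ | _].
suff -> : S = T by [].
by apply/seteqP; split => P /= HP x xab; [rewrite -fg|rewrite fg] => //; exact: HP.
Qed.
Lemma cint_sum (I : Type) (s : seq I) (F : I -> R -> C) a b : a <= b ->
  (forall i, integ (F i) a b) ->
  integ (fun x => \sum_(i <- s) F i x) a b /\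
  cint (fun x => \sum_(i <- s) F i x) a b = \sum_(i <- s) cint (F i) a b.
Proof.
move=> ab h; elim: s => [|i s [IH1 IH2]].
  have Z : forall x : R, a <= x <= b -> rder (fun=> 0 : C) x (\sum_(i <- [::]) F i x) by move=> x _; rewrite big_nil; exact: rder_cst.
  by split; [exists (fun=> 0)|rewrite (cintE ab Z) subrr big_nil].
rewrite big_cons -IH2 -cintD//; split.
  apply: integ_ext (integD (h i) IH1) => x _; by rewrite big_cons.
by apply: cint_ext => x _; rewrite big_cons.
Qed.

Lemma rder_cont (f : R -> C) s d : rder f s d -> rcont f s.
Proof.
have nE (h : R) : `|h| = nc (h%:C : C) by rewrite ncR.
exact: (@incr_der_cont _ (fun h : R => h%:C) (fun h => `|h|) nE f s d).
Qed.
Lemma rcont_comp (f : C -> C) (g : R -> C) s : rcont g s -> ccont f (g s) ->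
  rcont (fun x => f (g x)) s.
Proof.
move=> gs fg e e0; have [r r0 fr] := fg e e0; have [t t0 gt] := gs r r0.
by exists t => // h /gt/fr; rewrite [g s + _]addrC subrK.
Qed.
Lemma rcontM (f g : R -> C) s : rcont f s -> rcont g s -> rcont (fun x => f x * g x) s.
Proof.
move=> fs gs e e0; set K := 1 + nc (f s) + nc (g s).
have K0 : 0 < K by rewrite /K -!addrA ltr_pwDl// !addr_ge0 ?nc_ge0.
have e2 : 0 < e / (2 * K) by rewrite divr_gt0// mulr_gt0.
have [r r0 fr] := fs _ e2; have [t t0 gt] := gs _ e2; have [u u0 fu] := fs _ ltr01.
exists (Num.min r (Num.min t u)) => [|h]; first by rewrite !lt_min r0 t0.
rewrite !lt_min => /andP[/fr h1 /andP[/gt h2 /fu h3]].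
have -> : f (s + h) * g (s + h) - f s * g s =
  (f s + (f (s + h) - f s)) * (g (s + h) - g s) + (f (s + h) - f s) * g s by ring.
apply: le_lt_trans (ncD _ _) _; rewrite !ncM.
have -> : e = K * (e / (2 * K)) + e / (2 * K) * K by field; rewrite gt_eqF.
apply: ltr_leD.
  apply: le_lt_trans (_ : K * nc (g (s + h) - g s) < _); last by rewrite ltr_pM2l.
  rewrite ler_wpM2r ?nc_ge0//; apply: le_trans (ncD _ _) _.
  by rewrite /K; have := nc_ge0 (g s); lra.
by rewrite ler_pM ?nc_ge0// ?ltW// /K; have := nc_ge0 (f s); lra.
Qed.
Lemma rcontD (f g : R -> C) s : rcont f s -> rcont g s -> rcont (fun x => f x + g x) s.
Proof.
move=> fs gs e e0; have e2 : 0 < e / 2 by rewrite divr_gt0.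
have [r r0 fr] := fs _ e2; have [t t0 gt] := gs _ e2.
exists (Num.min r t) => [|h]; first by rewrite !lt_min r0 t0.
rewrite !lt_min => /andP[/fr h1 /gt h2].
have -> : f (s + h) + g (s + h) - (f s + g s) =
  (f (s + h) - f s) + (g (s + h) - g s) by ring.
by apply: le_lt_trans (ncD _ _) _; rewrite (splitr e) ltrD.
Qed.
Lemma rcont_cst (c : C) s : rcont (fun=> c) s.
Proof. exact: rder_cont (rder_cst c s). Qed.
Lemma rcont_sum (I : Type) (r : seq I) (F : I -> R -> C) s : (forall i, rcont (F i) s) ->
  rcont (fun x => \sum_(i <- r) F i x) s.
Proof.
move=> h; elim: r => [|i r IH].
  by under eq_fun => x do rewrite big_nil; exact: rcont_cst.
by under eq_fun => x do rewrite big_cons; exact: rcontD (h i) IH.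
Qed.
Lemma rcontB (f g : R -> C) s : rcont f s -> rcont g s -> rcont (fun x => f x - g x) s.
Proof.
move=> fs gs; have := rcontD fs (rcontM (rcont_cst (-1) s) gs).
by under eq_fun do rewrite mulN1r.
Qed.

(* For a nonnegative function of rectangles which is subadditive under
   subdivision, being o(side^2) around every point forces it to vanish. *)
Lemma bisection (E : R -> R -> R -> R -> R) (x0 y0 a b : R) : 0 <= a -> 0 <= b ->
  (forall x y c d : R, 0 <= c -> 0 <= d -> x0 <= x -> y0 <= y ->
     x + (c + c) <= x0 + a -> y + (d + d) <= y0 + b ->
     E x y (c + c) (d + d) <=
     E x y c d + E (x + c) y c d + E x (y + d) c d + E (x + c) (y + d) c d) ->
  (forall p q, x0 <= p <= x0 + a -> y0 <= q <= y0 + b -> forall e : R, 0 < e ->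
     exists2 r : R, 0 < r & forall x y c d, x0 <= x -> y0 <= y ->
       x + c <= x0 + a -> y + d <= y0 + b -> x <= p <= x + c -> y <= q <= y + d ->
       c < r -> d < r -> E x y c d <= e * (c + d) ^+ 2) ->
  E x0 y0 a b <= 0.
Proof.
move=> a0 b0 Esub Eloc; rewrite leNgt; apply/negP => E0.
pose A k : R := a / 2 ^+ k; pose B k : R := b / 2 ^+ k.
have pw k : (2 ^+ k.+1)^-1 + (2 ^+ k.+1)^-1 = (2 ^+ k)^-1 :> R by rewrite exprS invfM -mulrDl; have -> : 2^-1 + 2^-1 = 1 :> R; [field|rewrite mul1r].
have AE k : A k = A k.+1 + A k.+1 by rewrite /A -mulrDr pw.
have BE k : B k = B k.+1 + B k.+1 by rewrite /B -mulrDr pw.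
have A_ge0 k : 0 <= A k by rewrite divr_ge0// exprn_ge0.
have B_ge0 k : 0 <= B k by rewrite divr_ge0// exprn_ge0.
(* Of the four quarters of the current rectangle one carries at least a quarter of [E]; its lower
   left corner is the next point. *)
pose nx k (p : R * R) : R * R :=
  let t := E p.1 p.2 (A k) (B k) / 4 in
  if t <= E p.1 p.2 (A k.+1) (B k.+1) then p
  else if t <= E (p.1 + A k.+1) p.2 (A k.+1) (B k.+1) then (p.1 + A k.+1, p.2)
  else if t <= E p.1 (p.2 + B k.+1) (A k.+1) (B k.+1) then (p.1, p.2 + B k.+1)
  else (p.1 + A k.+1, p.2 + B k.+1).
pose s := fix s k := if k is k'.+1 then nx k' (s k') else (x0, y0).
have nxE k p : x0 <= p.1 -> y0 <= p.2 -> p.1 + A k <= x0 + a -> p.2 + B k <= y0 + b ->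
    E p.1 p.2 (A k) (B k) / 4 <= E (nx k p).1 (nx k p).2 (A k.+1) (B k.+1).
  move=> p1 p2 p3 p4; rewrite /nx; case: ifPn => // h1; case: ifPn => // h2; case: ifPn => // h3 /=.
  have := Esub p.1 p.2 _ _ (A_ge0 k.+1) (B_ge0 k.+1) p1 p2; rewrite -AE -BE => /(_ p3 p4).
  move: h1 h2 h3; rewrite -!ltNge; lra.
have nx1 k p : p.1 <= (nx k p).1 /\ (nx k p).1 + A k.+1 <= p.1 + A k.
  rewrite /nx (AE k); have := A_ge0 k.+1.
  by do ! case: ifPn => //= _; move=> h; split; lra.
have nx2 k p : p.2 <= (nx k p).2 /\ (nx k p).2 + B k.+1 <= p.2 + B k.
  rewrite /nx (BE k); have := B_ge0 k.+1.
  by do ! case: ifPn => //= _; move=> h; split; lra.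
have s1 k l : (k <= l)%N -> (s k).1 <= (s l).1 /\ (s l).1 + A l <= (s k).1 + A k.
  elim: l => [|l IH]; first by rewrite leqn0 => /eqP->.
  rewrite leq_eqVlt => /orP[/eqP->//|]; rewrite ltnS => /IH[h1 h2].
  by have [h3 h4] := nx1 l (s l); split; [exact: le_trans h3|exact: le_trans h2].
have s2 k l : (k <= l)%N -> (s k).2 <= (s l).2 /\ (s l).2 + B l <= (s k).2 + B k.
  elim: l => [|l IH]; first by rewrite leqn0 => /eqP->.
  rewrite leq_eqVlt => /orP[/eqP->//|]; rewrite ltnS => /IH[h1 h2].
  by have [h3 h4] := nx2 l (s l); split; [exact: le_trans h3|exact: le_trans h2].
have A00 : A 0%N = a by rewrite /A expr0 divr1.
have B00 : B 0%N = b by rewrite /B expr0 divr1.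
have sE k : E x0 y0 a b / 4 ^+ k <= E (s k).1 (s k).2 (A k) (B k).
  elim: k => [|k IH]; first by rewrite /= /A /B !expr0 !divr1.
  have [g1 g2] := s1 0%N k isT; have [g3 g4] := s2 0%N k isT.
  rewrite /= A00 in g2; rewrite /= B00 in g4.
  apply: le_trans (nxE k _ g1 g3 g2 g4); apply: le_trans (_ : E x0 y0 a b / 4 ^+ k / 4 <= _).
    by rewrite exprS invfM [_^-1 / _]mulrC mulrA.
  by rewrite ler_pM2r// invr_gt0.
have limit (u A' : nat -> R) : (forall k, 0 <= A' k) ->
   (forall k l, (k <= l)%N -> u k <= u l /\ u l + A' l <= u k + A' k) ->
   exists p, forall k, u k <= p <= u k + A' k.
  move=> A'0 h; exists (sup (range u)) => k.
  have ub j : u j <= u k + A' k.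
    have [jk|kj] := leqP j k.
      by apply: le_trans (proj1 (h _ _ jk)) _; rewrite lerDl.
    by apply: le_trans (proj2 (h _ _ (ltnW kj))); rewrite lerDl.
  apply/andP; split.
    apply: ub_le_sup; last by exists k.
    by exists (u k + A' k) => _ [j _ <-].
  apply: ge_sup; first by exists (u 0%N), 0%N.
  by move=> _ [j _ <-].
have [p Hp] := limit _ _ A_ge0 s1; have [q Hq] := limit _ _ B_ge0 s2.
have := Eloc p q; have := Hp 0%N; have := Hq 0%N; rewrite /= A00 B00 => -> -> /(_ isT isT).
(* At depth [k] the rectangle has side sum [(a + b) / 2 ^+ k] and still carries
   [E x0 y0 a b / 4 ^+ k]: with this [e] the local bound is too small for that. *)
set e := E x0 y0 a b / (2 * ((a + b) ^+ 2 + 1)).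
have den : 0 < (a + b) ^+ 2 + 1 by rewrite ltr_wpDl ?sqr_ge0.
have e0 : 0 < e by rewrite divr_gt0// mulr_gt0.
move=> /(_ e e0)[r r0 Hr].
have small (c : R) : 0 <= c -> exists k0, forall k, (k0 <= k)%N -> c / 2 ^+ k < r.
  move=> c0; exists (Num.truncn (c / r)).+1 => k kk.
  rewrite ltr_pdivrMr ?exprn_gt0// mulrC -ltr_pdivrMr//.
  apply: lt_le_trans (truncnS_gt _) _; rewrite -natrX ler_nat.
  by apply: leq_trans kk _; exact: ltnW (ltn_expl _ _).
have [k1 Hk1] := small a a0; have [k2 Hk2] := small b b0.
set k := maxn k1 k2.
have [h1 h2] := s1 0%N k isT; have [h3 h4] := s2 0%N k isT.
have := Hr (s k).1 (s k).2 (A k) (B k) h1 h3.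
rewrite -{1}A00 -{1}B00 => /(_ h2 h4 (Hp k) (Hq k) (Hk1 _ (leq_maxl _ _)) (Hk2 _ (leq_maxr _ _))).
move=> /(le_trans (sE k)).
have -> : A k + B k = (a + b) / 2 ^+ k by rewrite /A /B mulrDl.
rewrite exprMn exprVn -exprM mulnC exprM [2 ^+ 2](_ : _ = 4); last by rewrite -natrX.
rewrite mulrA ler_pM2r ?invr_gt0 ?exprn_gt0// /e => h.
have : E x0 y0 a b * (2 * ((a + b) ^+ 2 + 1)) <= E x0 y0 a b * (a + b) ^+ 2 by rewrite -ler_pdivlMr ?mulr_gt0//; move: h; rewrite mulrAC.
by rewrite ler_pM2l//; have := sqr_ge0 (a + b); lra.
Qed.
End ComplexCalculus.

(** * The Cauchy kernel and its geometric expansion *)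

Lemma geom_term (F : fieldType) (i a u z : F) m :
  i * a ^+ m * (u * z ^- m) = i * u * (a / z) ^+ m.
Proof. by rewrite exprMn exprVn; ring. Qed.

Lemma geom_split (F : fieldType) (i a u z : F) K : z != 0 -> z - a != 0 ->
  u * (i * z / (z - a)) =
  i * u * \sum_(m < K) (a / z) ^+ m + u * (i * z / (z - a) * (a / z) ^+ K).
Proof.
move=> z0 z1; have E : 1 - a / z = (z - a) / z by rewrite mulrBl divff.
have q0 : 1 - a / z != 0 by rewrite E mulf_neq0// invr_eq0.
have -> : \sum_(m < K) (a / z) ^+ m = (1 - (a / z) ^+ K) / (1 - a / z).
  apply: (mulIf q0); rewrite divfK// mulrC -[in RHS](expr1n _ K) subrXX.
  by congr (_ * _); apply: eq_bigr => m _; rewrite expr1n mul1r.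
by rewrite E; move: (_ ^+ K) => X; field; rewrite z0 z1.
Qed.

Lemma circle_prim (F : fieldType) (i M z : F) m : i != 0 -> M != 0 -> z != 0 ->
  (- (i * M))^-1 * (- (M * z ^+ m * (i * z)) / z ^+ m.+1 ^+ 2) = z ^- m.+1.
Proof.
move=> i0 M0 z0; rewrite expr2 exprS; have : z ^+ m != 0 by rewrite expf_neq0.
move: (z ^+ m) => Z Z0; by field; rewrite Z0 z0 oppr_eq0 mulf_neq0.
Qed.

Section CauchyKernel.
Context {R : realType}.
Notation C := (R[i]^o)%type.
Variables (r : R) (a : C).
Hypothesis (r0 : 0 < r) (ar : nc a < r).
Let zt (p : R) : C := r%:C * cis p.
Let k (p : R) : C := 'i * zt p / (zt p - a).

Lemma nc_i : nc ('i : C) = 1.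
Proof. by rewrite /nc/= expr0n/= add0r expr1n sqrtr1. Qed.

Lemma nc_circle p : nc (zt p) = r.
Proof. by rewrite ncM ncR nc_cis mulr1 gtr0_norm. Qed.

Lemma circle_neq0 p : zt p != 0.
Proof. by rewrite -nc_eq0 nc_circle gt_eqF. Qed.

Lemma nc_circleB p : r - nc a <= nc (zt p - a).
Proof. by rewrite -{1}(nc_circle p) nc_dist. Qed.

Lemma circleB_neq0 p : zt p - a != 0.
Proof. by rewrite -nc_gt0 (lt_le_trans _ (nc_circleB p))// subr_gt0. Qed.

Lemma rder_circle p : rder zt p ('i * zt p).
Proof. by apply: rder_eq (rderZ r%:C (rder_cis p)) _; rewrite /zt; ring. Qed.

Lemma kernel_bound p : nc (k p) <= r / (r - nc a).
Proof.
rewrite /k ncM ncV ncM nc_i nc_circle mul1r ler_pM2l// lef_pV2 ?posrE ?subr_gt0//.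
  exact: nc_circleB.
by rewrite nc_gt0 circleB_neq0.
Qed.

Lemma cder_invx (w : C) : w != 0 -> cder (fun x => x^-1) w (- (w ^+ 2)^-1).
Proof.
move=> w0 e e0; have m0 : 0 < nc w by rewrite nc_gt0.
have d0 : 0 < e * nc w ^+ 3 / 2 by rewrite divr_gt0// mulr_gt0// exprn_gt0.
exists (Num.min (nc w / 2) (e * nc w ^+ 3 / 2)) => [|h]; first by rewrite lt_min d0 divr_gt0.
rewrite lt_min => /andP[h1 h2].
have wh : nc w / 2 <= nc (w + h) by have := nc_dist w (- h); rewrite opprK ncN; lra.
have wh1 : 0 < nc (w + h) by apply: lt_le_trans wh; rewrite divr_gt0.
have wh0 : w + h != 0 by rewrite -nc_gt0.
have -> : (w + h)^-1 - w^-1 - - (w ^+ 2)^-1 * h = h * h / (w ^+ 2 * (w + h)) by field; apply/andP.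
rewrite !ncM ncV ncM ncX ler_pdivrMr ?mulr_gt0 ?exprn_gt0//.
have -> : e * nc h * (nc w ^+ 2 * nc (w + h)) = nc h * (e * nc w ^+ 2 * nc (w + h)) by ring.
apply: ler_wpM2l (nc_ge0 h) _ _ _; apply: le_trans (ltW h2) _.
have -> : e * nc w ^+ 3 / 2 = e * nc w ^+ 2 * (nc w / 2) by rewrite exprSr; ring.
by rewrite ler_wpM2l// mulr_ge0 ?exprn_ge0 ?ltW.
Qed.

Lemma rder_inv (f : R -> C) s d : f s != 0 -> rder f s d -> rder (fun x => (f x)^-1) s (- d / f s ^+ 2).
Proof. by move=> f0 fd; apply: rder_eq (rder_comp fd (cder_invx f0)) _; rewrite mulrC mulNr mulrN. Qed.

Lemma rcont_kernel p : rcont k p.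
Proof.
have h : rcont (fun x => (zt x - a)^-1) p.
  apply: rder_cont (rder_inv (circleB_neq0 p) _).
  by apply: rderB (rder_circle p) (rder_cst _ _).
exact: rcontM (rcontM (rcont_cst _ _) (rder_cont (rder_circle p))) h.
Qed.

Lemma rcont_ext (f g : R -> C) s : (forall x, f x = g x) -> rcont f s -> rcont g s.
Proof. by move=> /funext ->. Qed.

Lemma rcontX (f : R -> C) s m : rcont f s -> rcont (fun x => f x ^+ m) s.
Proof.
move=> fs; elim: m => [|m IH].
  by apply: rcont_ext (rcont_cst 1 s) => x; rewrite expr0.
by apply: rcont_ext (rcontM fs IH) => x; rewrite exprS.
Qed.

Lemma rcont_circleV p m : rcont (fun x => (zt x) ^- m) p.
Proof.
apply: (@rcont_ext (fun x => (zt x)^-1 ^+ m)) => [x|]; first by rewrite exprVn.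
apply: rcontX; exact: rder_cont (rder_inv (circle_neq0 p) (rder_circle p)).
Qed.

Lemma pi2_ge0 : 0 <= pi *+ 2 :> R.
Proof. by rewrite mulrn_wge0 ?pi_ge0. Qed.

(** The form k(p) dp is dz / (z - a) on the circle. Its geometric series in a / z is cut after [K]
    terms with exact remainder, so that only finite sums are integrated. With [u = 1] this gives the
    integral of the kernel, with the values of a function on the circle its Taylor formula. *)
Lemma kernel_expand (u : R -> C) M K : (forall p, rcont u p) -> (forall p, nc (u p) <= M) ->
  nc (cint (fun p => u p * k p) 0 (pi *+ 2) -
      'i * \sum_(m < K) cint (fun p => u p * zt p ^- m) 0 (pi *+ 2) * a ^+ m)
  <= M * (nc a / r) ^+ K * (r / (r - nc a)) * (pi *+ 2).
Proof.
move=> uc uM.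
have q1 p : rcont (fun x => a / zt x) p.
  apply: rcontM (rcont_cst _ _) _; apply: rcont_ext (rcont_circleV p 1) => x.
  by rewrite expr1.
have E1 p : u p * k p = \sum_(m < K) ('i * a ^+ m) * (u p * zt p ^- m) +
    u p * (k p * (a / zt p) ^+ K).
  have z0 := circle_neq0 p; have z1 := circleB_neq0 p.
  have -> : \sum_(m < K) ('i * a ^+ m) * (u p * zt p ^- m) =
     'i * u p * \sum_(m < K) (a / zt p) ^+ m.
    by rewrite mulr_sumr; apply: eq_bigr => m _; exact: geom_term.
  exact: geom_split.
have cs (m : 'I_K) : integ (fun p => ('i * a ^+ m) * (u p * zt p ^- m)) 0 (pi *+ 2).
  apply: integ_cont => p _; apply: rcontM (rcont_cst _ _) _.
  by apply: rcontM (uc p) (rcont_circleV p m).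
have [S1 S2] := cint_sum (index_enum 'I_K) pi2_ge0 cs.
have rest : integ (fun p => u p * (k p * (a / zt p) ^+ K)) 0 (pi *+ 2).
  apply: integ_cont => p _; apply: rcontM (uc p) (rcontM (rcont_kernel p) (rcontX K (q1 p))).
have -> : cint (fun p => u p * k p) 0 (pi *+ 2) =
   'i * \sum_(m < K) cint (fun p => u p * zt p ^- m) 0 (pi *+ 2) * a ^+ m +
   cint (fun p => u p * (k p * (a / zt p) ^+ K)) 0 (pi *+ 2).
  rewrite (cint_ext (g := fun p => \sum_(m < K) ('i * a ^+ m) * (u p * zt p ^- m) +
    u p * (k p * (a / zt p) ^+ K))); last by move=> p _; rewrite E1.
  rewrite cintD ?pi2_ge0// S2; congr (_ + _); rewrite mulr_sumr; apply: eq_bigr => m _.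
  rewrite cintZ ?pi2_ge0//; first ring.
  by apply: integ_cont => p _; apply: rcontM (uc p) (rcont_circleV p m).
rewrite [X in nc X]addrAC subrr add0r.
rewrite -[pi *+ 2 in leRHS]subr0.
apply: cint_bound => //; first exact: pi2_ge0.
move=> p _; rewrite ncM (ncM (k p)) ncX (ncM a) ncV nc_circle -mulrA.
have h0 : 0 <= (nc a / r) ^+ K by rewrite exprn_ge0// divr_ge0 ?nc_ge0// ltW.
apply: ler_pM => //; rewrite ?mulr_ge0 ?nc_ge0//.
by rewrite [leRHS]mulrC; apply: ler_pM; rewrite ?nc_ge0 ?kernel_bound.
Qed.

Lemma cint_circle0 m : cint (fun p => zt p ^- m.+1) 0 (pi *+ 2) = 0.
Proof.
have i0 : 'i != 0 :> C by rewrite -nc_eq0 nc_i oner_eq0.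
have HP x : 0 <= x <= pi *+ 2 ->
   rder (fun p => (- ('i * m.+1%:R))^-1 * (zt p ^+ m.+1)^-1) x (zt x ^- m.+1).
  move=> _; have z0 := circle_neq0 x.
  have zm : zt x ^+ m.+1 != 0 by rewrite expf_neq0.
  have hX : rder (fun p => zt p ^+ m.+1) x (m.+1%:R * zt x ^+ m * ('i * zt x)).
    exact: rder_comp (rder_circle x) (cderX _ m.+1).
  apply: rder_eq (rderZ _ (rder_inv zm hX)) _.
  have m0 : m.+1%:R != 0 :> C by rewrite pnatr_eq0.
  exact: circle_prim.
rewrite (cintE pi2_ge0 HP) /zt /=.
by rewrite cis2pi cis0 subrr.
Qed.

Lemma cint_cst (c : C) x y : x <= y -> cint (fun=> c) x y = c * (y - x)%:C.
Proof.
move=> xy; rewrite (cintE (P := fun p => c * p%:C))//; first by rewrite realCB mulrBr.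
by move=> p _; apply: rder_eq (rderZ c (rder_id p)) _; rewrite mulr1.
Qed.

Lemma small_pow (q A e : R) : 0 <= q < 1 -> 0 <= A -> 0 < e -> exists K, A * q ^+ K < e.
Proof.
move=> /andP[q0 q1] A0 e0.
have qn : `|q| < 1 by rewrite ger0_norm.
have eA : 0 < e / (A + 1) by rewrite divr_gt0// ltr_wpDl.
have [K _ HK] := (cvgrPdist_lt _ _).1 (cvg_expr qn) _ eA.
exists K; have := HK K (leqnn K); rewrite sub0r normrN ger0_norm ?exprn_ge0//.
rewrite ltr_pdivlMr ?ltr_wpDl// mulrC; apply: le_lt_trans.
by rewrite ler_wpM2r ?exprn_ge0// lerDl.
Qed.

(** All moments of the circle but the zeroth vanish by [cint_circle0], and the remainder of the
    expansion tends to 0; a positive distance to the claimed value would exceed it for large [K]. *)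
Lemma cint_kernel : cint k 0 (pi *+ 2) = 'i * (pi *+ 2)%:C.
Proof.
apply: nc_le0_eq; rewrite leNgt; apply/negP => h0.
have q1 : 0 <= nc a / r < 1 by rewrite divr_ge0 ?nc_ge0 ?ltW//= ltr_pdivrMr// mul1r.
have A0 : 0 <= r / (r - nc a) * (pi *+ 2) by rewrite mulr_ge0 ?pi2_ge0// divr_ge0// ?subr_ge0 ltW.
have [K] := small_pow q1 A0 h0.
have := @kernel_expand (fun=> 1) 1 K.+1 (fun p => rcont_cst _ _).
rewrite nc1 => /(_ (fun=> lexx _)).
rewrite (cint_ext (f := fun p => 1 * k p) (g := k)); last by move=> p _; rewrite mul1r.
rewrite big_ord_recl /= big1 ?addr0; last first.
  by move=> m _; under cint_ext do rewrite mul1r; rewrite cint_circle0 mul0r.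
rewrite expr0 mulr1 (cint_ext (f := fun p => 1 / zt p ^+ 0) (g := fun=> 1)); last first.
  by move=> p _; rewrite expr0 divr1.
rewrite cint_cst ?pi2_ge0// subr0 mul1r mul1r => h1 h2.
have : nc (cint k 0 (pi *+ 2) - 'i * (pi *+ 2)%:C) < nc (cint k 0 (pi *+ 2) - 'i * (pi *+ 2)%:C).
  apply: le_lt_trans h1 (le_lt_trans _ h2); rewrite -mulrA [leRHS]mulrC.
  rewrite ler_wpM2r//.
  by rewrite exprS ler_piMl ?exprn_ge0 ?(andP q1).1// ltW// (andP q1).2.
by rewrite ltxx.
Qed.
End CauchyKernel.

(** * Goursat's theorem and Cauchy's formula *)

Section Goursat.
Context {R : realType}.
Notation C := (R[i]^o)%type.
Variables (f : C -> C) (R0 r : R) (a : C).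
Hypothesis hf : forall z, nc z < R0 -> exists d, cder f z d.
Hypothesis (r0 : 0 < r) (rR : r < R0) (ar : nc a < r).
Let zt (p : R) : C := r%:C * cis p.
Let k (p : R) : C := 'i * zt p / (zt p - a).
Let G (x p : R) : C := a + x%:C * (zt p - a).
Let g x p := f (G x p).

Let G_lt (x p : R) : 0 <= x <= 1 -> nc (G x p) < R0.
Proof.
move=> /andP[x0 x1]; apply: le_lt_trans rR.
have -> : G x p = (1 - x)%:C * a + x%:C * zt p by rewrite /G realCB; ring.
apply: le_trans (ncD _ _) _; rewrite !ncM !ncR nc_cis mulr1 (ger0_norm x0).
rewrite (gtr0_norm r0) (ger0_norm (_ : 0 <= 1 - x)) ?subr_ge0//.
have : (1 - x) * nc a <= (1 - x) * r by rewrite ler_wpM2l ?subr_ge0// ltW.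
lra.
Qed.

Let rderGp x p : rder (G x) p (x%:C * ('i * zt p)).
Proof.
apply: rder_eq (rderD (rder_cst a p) (rderZ x%:C (rderB (rder_circle r p) (rder_cst a p)))) _.
by rewrite /zt; ring.
Qed.

Let rderGx x p : rder (fun x => G x p) x (zt p - a).
Proof.
apply: rder_eq (rderD (rder_cst a x) (rderM (rder_id x) (rder_cst (zt p - a) x))) _.
by ring.
Qed.

Let ccontf z : nc z < R0 -> ccont f z.
Proof. by move=> /hf[d]; exact: cder_cont. Qed.

Let rcgp (x p : R) : 0 <= x <= 1 -> rcont (g x) p.
Proof.
by move=> x01; apply: rcont_comp (rder_cont (rderGp x p)) (ccontf (G_lt p x01)).
Qed.

Let rcgx (x p : R) : 0 <= x <= 1 -> rcont (fun x => g x p) x.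
Proof.
by move=> x01; apply: rcont_comp (rder_cont (rderGx x p)) (ccontf (G_lt p x01)).
Qed.

(** [G] contracts the circle radially to [a], and dlog(G - a) = dx / x + k dp. Thus [I - J] is the
    integral of f(G) dlog(G - a) over the boundary of a rectangle in the (x, p) plane. *)
Let I x1 x2 y1 y2 := cint (fun p => (g x2 p - g x1 p) * k p) y1 y2.
Let J x1 x2 y1 y2 := cint (fun m => (g m y2 - g m y1) * (m^-1)%:C) x1 x2.

Let intI (x1 x2 y1 y2 : R) : 0 <= x1 <= 1 -> 0 <= x2 <= 1 ->
  integ (fun p => (g x2 p - g x1 p) * k p) y1 y2.
Proof.
move=> h1 h2; apply: integ_cont => p _; apply: rcontM; first by apply: rcontB; exact: rcgp.
exact: rcont_kernel.
Qed.

Let intJ (x1 x2 y1 y2 : R) : 0 < x1 -> x2 <= 1 ->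
  integ (fun m => (g m y2 - g m y1) * (m^-1)%:C) x1 x2.
Proof.
move=> x10 x21; apply: integ_cont => m /andP[m1 m2].
have m0 : 0 < m := lt_le_trans x10 m1.
have m01 : 0 <= m <= 1 by rewrite (ltW m0) (le_trans m2 x21).
apply: rcontM; first by apply: rcontB; exact: rcgx.
apply: rcont_ext (rder_cont (rder_inv (f := fun x => x%:C) _ (rder_id m))) => [x|].
  by rewrite realCV.
by rewrite -nc_eq0 ncR normr_eq0 gt_eqF.
Qed.

Let IX (x1 x2 x3 y1 y2 : R) : 0 <= x1 <= 1 -> 0 <= x2 <= 1 -> 0 <= x3 <= 1 -> y1 <= y2 ->
  I x1 x3 y1 y2 = I x1 x2 y1 y2 + I x2 x3 y1 y2.
Proof.
move=> h1 h2 h3 y12; rewrite -cintD//; try exact: intI.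
by apply: cint_ext => p _; ring.
Qed.
Let IY (x1 x2 y1 y2 y3 : R) : 0 <= x1 <= 1 -> 0 <= x2 <= 1 -> y1 <= y2 -> y2 <= y3 ->
  I x1 x2 y1 y3 = I x1 x2 y1 y2 + I x1 x2 y2 y3.
Proof. by move=> *; apply: cint_split => //; exact: intI. Qed.
Let JX (x1 x2 x3 y1 y2 : R) : 0 < x1 -> x1 <= x2 -> x2 <= x3 -> x3 <= 1 ->
  J x1 x3 y1 y2 = J x1 x2 y1 y2 + J x2 x3 y1 y2.
Proof. by move=> *; apply: cint_split => //; exact: intJ. Qed.
Let JY (x1 x2 y1 y2 y3 : R) : 0 < x1 -> x1 <= x2 -> x2 <= 1 ->
  J x1 x2 y1 y3 = J x1 x2 y1 y2 + J x1 x2 y2 y3.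
Proof.
move=> *; rewrite -cintD//; try exact: intJ.
by apply: cint_ext => p _; ring.
Qed.

Let E x y c d : R := nc (I x (x + c) y (y + d) - J x (x + c) y (y + d)).

Let G_lip (x p x' p' : R) : 0 <= x <= 1 -> p <= p' -> nc (G x' p' - G x p) <= 2 * r * (`|x' - x| + (p' - p)).
Proof.
move=> /andP[x0 x1] pp.
have -> : G x' p' - G x p = (x' - x)%:C * (zt p' - a) + x%:C * (zt p' - zt p) by rewrite /G realCB; ring.
apply: le_trans (ncD _ _) _; rewrite [leRHS]mulrDr; apply: lerD; rewrite ncM ncR.
  rewrite mulrC ler_wpM2r//; apply: le_trans (ncB _ _) _.
  by rewrite (nc_circle r0); move: ar; move: (nc a) => u; lra.
rewrite (ger0_norm x0).
have h : nc (zt p' - zt p) <= r * (p' - p).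
  apply: (rder_bound (d := fun q => 'i * zt q)) => // q _; first exact: rder_circle.
  by rewrite ncM nc_i (nc_circle r0) mul1r.
apply: (@le_trans _ _ (1 * nc (zt p' - zt p))); first by rewrite ler_wpM2r ?nc_ge0.
rewrite mul1r; apply: le_trans h _; rewrite -mulrA mulr_natl mulr2n lerDl.
by rewrite mulr_ge0 ?subr_ge0// ltW.
Qed.

(** Near G(p, q) the function is affine up to an error [e'] times the distance. Its constant part
    contributes nothing to [I] or [J], its linear part contributes the same [W] to both. *)
Let Eloc (x0 : R) : 0 < x0 -> x0 <= 1 -> forall p q : R, x0 <= p <= 1 -> forall e : R, 0 < e ->
  exists2 s : R, 0 < s & forall x y c d : R, x0 <= x -> x + c <= 1 ->
   x <= p <= x + c -> y <= q <= y + d -> c < s -> d < s -> E x y c d <= e * (c + d) ^+ 2.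
Proof.
move=> x00 x01 p q /andP[xp p1] e e0.
have p01 : 0 <= p <= 1 by rewrite p1 (le_trans (ltW x00) xp).
have [D HD] := hf (G_lt q p01).
pose K := r / (r - nc a) + x0^-1.
have K1 : 0 < r / (r - nc a) by rewrite divr_gt0// subr_gt0.
have K0 : 0 < K by rewrite addr_gt0// invr_gt0.
pose e' := e / (8 * r * K).
have e'0 : 0 < e' by rewrite divr_gt0// !mulr_gt0.
have [s s0 Hs] := HD e' e'0.
exists (s / (8 * r)) => [|x y c d x0x xc1 /andP[xp' pxc] /andP[yq qyd] cs ds].
  by rewrite divr_gt0// mulr_gt0.
have c0 : 0 <= c by move: (le_trans xp' pxc); rewrite lerDl.
have d0 : 0 <= d by move: (le_trans yq qyd); rewrite lerDl.
have x0' : 0 < x := lt_le_trans x00 x0x.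
have B2 (X : R) : X <= c + d -> 2 * r * X <= 4 * r * (c + d).
  move=> Xcd; apply: (@le_trans _ _ (2 * r * (c + d))).
    by rewrite ler_pM2l ?mulr_gt0.
  by rewrite ler_wpM2r ?addr_ge0// ler_pM2r// ler_nat.
pose err m t := g m t - g p q - D * (G m t - G p q).
have Herr m t : x <= m <= x + c -> y <= t <= y + d -> nc (err m t) <= e' * (4 * r * (c + d)).
  move=> /andP[m1 m2] /andP[t1 t2].
  have m01 : 0 <= m <= 1 by rewrite (le_trans (ltW x0') m1) (le_trans m2 xc1).
  have hG : nc (G m t - G p q) <= 4 * r * (c + d).
    have mp : `|m - p| <= c by rewrite ler_norml; apply/andP; split; lra.
    have [qt|tq] := leP q t.
      apply: le_trans (G_lip m p01 qt) _; apply: B2; lra.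
    rewrite ncC; apply: le_trans (G_lip p m01 (ltW tq)) _; rewrite distrC.
    apply: B2; lra.
  have := Hs (G m t - G p q); rewrite [G p q + _]addrC subrK => h.
  apply: le_trans (h _) _; last by rewrite ler_pM2l.
  apply: le_lt_trans hG _; move: cs ds; rewrite !ltr_pdivlMr ?mulr_gt0// => cs ds.
  lra.
pose W := D * c%:C * (zt (y + d) - zt y).
pose B := e' * (4 * r * (c + d)).
have B0 : 0 <= B.
  rewrite /B; apply: mulr_ge0; first exact: ltW.
  by apply: mulr_ge0; [rewrite mulr_ge0// ltW|exact: addr_ge0].
have hx : x <= x <= x + c by rewrite lexx lerDl.
have hxc : x <= x + c <= x + c by rewrite lexx lerDl c0.
have hy : y <= y <= y + d by rewrite lexx lerDl.
have hyd : y <= y + d <= y + d by rewrite lexx lerDl d0.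
have bI : nc (I x (x + c) y (y + d) - W) <= (2 * B * (r / (r - nc a))) * d.
  have [P HP] : integ (fun p => (g (x + c) p - g x p) * k p) y (y + d) by apply: intI; rewrite ?(ltW x0')/= ?addr_ge0 ?(ltW x0')//= (le_trans _ xc1)// lerDl.
  have yd : y <= y + d by rewrite lerDl.
  rewrite /I (cintE yd HP).
  have -> : P (y + d) - P y - W = (P (y + d) - D * c%:C * zt (y + d)) - (P y - D * c%:C * zt y) by rewrite /W; ring.
  have Ed : d = y + d - y by ring.
  rewrite [X in _ <= _ * X]Ed.
  apply: (rder_bound (f := fun t => P t - D * c%:C * zt t)
     (d := fun t => (err (x + c) t - err x t) * k t)) => // t tyd.
    apply: rder_eq (rderB (HP t tyd) (rderZ (D * c%:C) (rder_circle r t))) _.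
    have z1 : zt t - a != 0 := circleB_neq0 r0 ar t.
    rewrite -[r%:C * cis t]/(zt t).
    have -> : 'i * zt t = k t * (zt t - a) by rewrite /k divfK.
    by rewrite /err /G realCD; ring.
  rewrite ncM; apply: ler_pM; rewrite ?nc_ge0//; last exact: kernel_bound.
  by apply: le_trans (ncB _ _) _; rewrite mulr_natl mulr2n lerD// Herr.
have bJ : nc (J x (x + c) y (y + d) - W) <= (2 * B * x0^-1) * c.
  have [P HP] := intJ y (y + d) x0' xc1.
  have xc : x <= x + c by rewrite lerDl.
  rewrite /J (cintE xc HP).
  have -> : P (x + c) - P x - W = (P (x + c) - D * (zt (y + d) - zt y) * (x + c)%:C) -
      (P x - D * (zt (y + d) - zt y) * x%:C).
    by rewrite /W realCD; ring.
  have Ec : c = x + c - x by ring.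
  rewrite [X in _ <= _ * X]Ec.
  apply: (rder_bound (f := fun t => P t - D * (zt (y + d) - zt y) * t%:C)
     (d := fun t => (err t (y + d) - err t y) * (t^-1)%:C)) => // t txc.
    apply: rder_eq (rderB (HP t txc) (rderZ _ (rder_id t))) _.
    have t0 : 0 < t by rewrite (lt_le_trans x0')// (andP txc).1.
    have E0 : (t%:C * (t^-1)%:C) = 1 :> C by rewrite -realCM mulfV ?gt_eqF.
    rewrite /err /G.
    have -> : D * (zt (y + d) - zt y) * 1 = D * (zt (y + d) - zt y) * (t%:C * (t^-1)%:C) by rewrite E0.
    by ring.
  rewrite ncM; apply: ler_pM; rewrite ?nc_ge0//.
    by apply: le_trans (ncB _ _) _; rewrite mulr_natl mulr2n lerD// Herr.
  have t0 : x0 <= t by rewrite (le_trans x0x)// (andP txc).1.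
  rewrite ncR ger0_norm ?invr_ge0 ?(le_trans (ltW x00) t0)//.
  by rewrite lef_pV2// posrE// (lt_le_trans x00 t0).
rewrite /E.
have -> : I x (x + c) y (y + d) - J x (x + c) y (y + d) =
  (I x (x + c) y (y + d) - W) - (J x (x + c) y (y + d) - W) by ring.
apply: le_trans (ncB _ _) _; apply: le_trans (lerD bI bJ) _.
apply: le_trans (_ : 2 * B * K * (c + d) <= _).
  have gen (T u v : R) : 0 <= T -> 0 <= u -> 0 <= v ->
      T * u * d + T * v * c <= T * (u + v) * (c + d).
    move=> T0 u0 v0; rewrite -subr_ge0.
    have -> : T * (u + v) * (c + d) - (T * u * d + T * v * c) = T * (u * c) + T * (v * d) by ring.
    by rewrite addr_ge0 ?mulr_ge0.
  by apply: gen; [rewrite mulr_ge0|exact: ltW|rewrite invr_ge0 ltW].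
rewrite /B /e'; apply: le_of_eq; field.
by rewrite ?gt_eqF.
Qed.

(** The sides p = 0 and p = 2 pi of the rectangle have the same image under [G], so [J] vanishes and
    only the two circles remain. *)
Lemma goursat (x0 : R) : 0 < x0 -> x0 <= 1 ->
  cint (fun p => g 1 p * k p) 0 (pi *+ 2) = cint (fun p => g x0 p * k p) 0 (pi *+ 2).
Proof.
move=> x00 x01.
have x01' : 0 <= x0 <= 1 by rewrite x01 ltW.
have h01 : 0 <= (1:R) <= 1 by rewrite ler01 lexx.
have : E x0 0 (1 - x0) (pi *+ 2) <= 0.
  apply: bisection; rewrite ?subr_ge0 ?pi2_ge0//.
    move=> x y c d c0 d0 xx yy.
    rewrite [x0 + _]addrC subrK add0r => xc yd.
    have xp : 0 < x := lt_le_trans x00 xx.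
    have h1 : 0 <= x <= 1 by rewrite (ltW xp)/= (le_trans _ xc)// lerDl addr_ge0.
    have h2 : 0 <= x + c <= 1 by rewrite addr_ge0 ?(ltW xp)//= (le_trans _ xc)// lerD2l lerDl.
    have h3 : 0 <= x + (c + c) <= 1 by rewrite xc !addr_ge0 ?(ltW xp).
    rewrite /E (IX h1 h2 h3) ?lerDl ?addr_ge0// (IY (y2 := y + d) h1 h2) ?lerD2l ?lerDl//.
    rewrite (IY (y2 := y + d) h2 h3) ?lerD2l ?lerDl//.
    rewrite (JX (x2 := x + c)) ?lerD2l ?lerDl//.
    rewrite (@JY x (x + c) _ (y + d)) ?lerDl ?(andP h2).2//.
    rewrite (@JY (x + c) _ _ (y + d)) ?lerD2l ?lerDl ?ltr_wpDr//.
    rewrite !(addrA x) !(addrA y).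
    set i1 := I _ _ _ _; set i2 := I _ _ _ _; set i3 := I _ _ _ _; set i4 := I _ _ _ _.
    set j1 := J _ _ _ _; set j2 := J _ _ _ _; set j3 := J _ _ _ _; set j4 := J _ _ _ _.
    have -> : i1 + i2 + (i3 + i4) - (j1 + j2 + (j3 + j4)) =
      (i1 - j1) + ((i3 - j3) + ((i2 - j2) + (i4 - j4))) by ring.
    have nc4 (u v w t : C) : nc (u + (v + (w + t))) <= nc u + nc v + nc w + nc t.
      rewrite -!addrA; do 2! (apply: le_trans (ncD _ _) _; rewrite lerD2l).
      exact: ncD.
    exact: nc4.
  rewrite [x0 + _]addrC subrK add0r => p q px _ e e0.
  have [s s0 Hs] := Eloc x00 x01 q px e0; exists s => // x y c d xx _ xc _.
  exact: Hs.
rewrite /E [x0 + _]addrC subrK add0r => h.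
have {h} : I x0 1 0 (pi *+ 2) = J x0 1 0 (pi *+ 2) by apply/eqP; rewrite -subr_eq0 -nc_eq0 eq_le h nc_ge0.
have -> : J x0 1 0 (pi *+ 2) = 0.
  rewrite /J (cint_ext (g := fun=> 0)) ?cint_cst// ?mul0r// => m _.
  by rewrite /g /G /zt cis2pi cis0 subrr mul0r.
move=> h; apply/eqP; rewrite -subr_eq0 -cintB ?pi2_ge0//; last first.
- by apply: integ_cont => p _; apply: rcontM (rcgp _ x01') (rcont_kernel r0 ar p).
- by apply: integ_cont => p _; apply: rcontM (rcgp _ h01) (rcont_kernel r0 ar p).
rewrite -h /I; apply/eqP; apply: cint_ext => p _; ring.
Qed.

(** By [goursat] the circle may be shrunk towards [a], where [f] is within any tolerance of [f a];
    the integral of the kernel gives the factor 2 pi i. *)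
Lemma cauchy_formula : cint (fun p => f (zt p) * k p) 0 (pi *+ 2) = f a * ('i * (pi *+ 2)%:C).
Proof.
rewrite -(cint_kernel r0 ar) -cintZ ?pi2_ge0//; last first.
  by apply: integ_cont => p _; exact: rcont_kernel.
apply: nc_eps_eq => e e0.
pose K := r / (r - nc a) * (pi *+ 2).
have K1 : 0 < r / (r - nc a) by rewrite divr_gt0// subr_gt0.
have K0 : 0 <= K by rewrite mulr_ge0 ?pi2_ge0// ltW.
have e1 : 0 < e / (K + 1) by rewrite divr_gt0// ltr_wpDl.
have [s s0 Hs] := ccontf (lt_trans ar rR) e1.
pose x0 := Num.min 1 (s / (4 * r)).
have x00 : 0 < x0 by rewrite lt_min ltr01 divr_gt0// mulr_gt0.
have x01 : x0 <= 1 by rewrite ge_min lexx.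
have x01' : 0 <= x0 <= 1 by rewrite x01 ltW.
have -> : cint (fun p => f (zt p) * k p) 0 (pi *+ 2) = cint (fun p => g x0 p * k p) 0 (pi *+ 2).
  rewrite -(goursat x00 x01); apply: cint_ext => p _; congr (f _ * _).
  by rewrite /G mul1r addrC subrK.
rewrite -cintB ?pi2_ge0//; last first.
- by apply: integ_cont => p _; apply: rcontM (rcont_cst _ _) (rcont_kernel r0 ar p).
- by apply: integ_cont => p _; apply: rcontM (rcgp _ x01') (rcont_kernel r0 ar p).
apply: le_trans (_ : e / (K + 1) * (r / (r - nc a)) * (pi *+ 2 - 0) <= _); last first.
  rewrite subr0 -mulrA -/K mulrAC ler_pdivrMr ?ltr_wpDl// ler_pM2l//; lra.
apply: cint_bound; first exact: pi2_ge0.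
  apply: integ_cont => p _; apply: rcontB.
  - by apply: rcontM (rcgp _ x01') (rcont_kernel r0 ar p).
  - by apply: rcontM (rcont_cst _ _) (rcont_kernel r0 ar p).
move=> p _; rewrite -mulrBl ncM; apply: ler_pM; rewrite ?nc_ge0//; last exact: kernel_bound.
apply/ltW/Hs; rewrite ncM ncR gtr0_norm//.
apply: le_lt_trans (_ : x0 * (2 * r) < _).
  rewrite ler_pM2l//; apply: le_trans (ncB _ _) _; rewrite (nc_circle r0).
  by move: ar; move: (nc a) => u; lra.
apply: le_lt_trans (_ : s / (4 * r) * (2 * r) < _).
  by rewrite ler_wpM2r ?mulr_ge0 ?(ltW r0)// ge_min lexx orbT.
have -> : s / (4 * r) * (2 * r) = s / 2 by field; rewrite gt_eqF.
exact: half_lt.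
Qed.
End Goursat.

(** * Holomorphic functions of one variable *)

Section Holomorphy.
Context {R : realType}.
Notation C := (R[i]^o)%type.

Definition holo (f : C -> C) (c : C) (r : R) : Prop :=
  forall z, nc (z - c) < r -> exists d, cder f z d.

Lemma holo_sub f c r c' r' : holo f c r -> nc (c' - c) + r' <= r -> holo f c' r'.
Proof.
move=> hf cc z zc; apply: hf; apply: lt_le_trans cc.
by apply: le_lt_trans (nc_triangle z c' c) _; rewrite addrC ltrD2l.
Qed.

Lemma cder_shift (f : C -> C) c z d : cder f (c + z) d -> cder (fun x => f (c + x)) z d.
Proof.
move=> fd; apply: cder_eq (cder_comp (g := fun x => c + x) (cderD (cder_cst c z) (cder_id z)) fd) _.
by rewrite add0r mulr1.
Qed.

Definition circle (c : C) (r p : R) : C := c + r%:C * cis p.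

Lemma circle_dist c r p : 0 < r -> nc (circle c r p - c) = r.
Proof. by move=> r0; rewrite /circle addrAC subrr add0r (nc_circle r0). Qed.

Lemma rcont_circle c r p : rcont (circle c r) p.
Proof.
apply: rder_cont (rderD (rder_cst c p) (rder_circle r p)).
Qed.

Lemma rcont_bounded (h : R -> C) a b : (forall x, rcont h x) ->
  exists M, forall x, a <= x <= b -> nc (h x) <= M.
Proof.
move=> hc; have [ab|ba] := leP a b; last first.
  by exists 0 => x /andP[ax xb]; move: (le_trans ax xb); rewrite leNgt ba.
have cont : continuous (fun x => nc (h x)).
  move=> x; apply/cvgrPdist_lt => /= e e0; have [r r0 hr] := hc x e e0.
  exists r => //= y /=; rewrite /ball_/= => xy.
  have yx : `|y - x| < r by rewrite distrC.
  have := hr (y - x) yx; rewrite [x + _]addrC subrK; apply: le_lt_trans.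
  rewrite ler_norml lerBrDr lerBlDr; apply/andP; split.
    have := nc_dist (h y) (h x); lra.
  by rewrite -lerBlDr ncC nc_dist.
have [c _ Hc] := @EVT_max R (fun x => nc (h x)) a b ab (continuous_subspaceT cont).
by exists (nc (h c)) => x xab; apply: Hc; rewrite in_itv/=.
Qed.

(** Cauchy's integral for the m-th Taylor coefficient of [f] at [c], taken over the circle of radius
    [r]. *)
Definition tc (f : C -> C) (c : C) (r : R) (m : nat) : C :=
  ((pi *+ 2)^-1)%:C * cint (fun p => f (circle c r p) * (r%:C * cis p) ^- m) 0 (pi *+ 2).

Lemma integ_tc f c r m : 0 < r -> (forall p, ccont f (circle c r p)) ->
  integ (fun p => f (circle c r p) * (r%:C * cis p) ^- m) 0 (pi *+ 2).
Proof.
move=> r0 fc; apply: integ_cont => p _; apply: rcontM (rcont_circleV r0 p m).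
exact: rcont_comp (rcont_circle _ _ _) (fc _).
Qed.

Lemma pi2_gt0 : 0 < pi *+ 2 :> R.
Proof. by rewrite mulrn_wgt0 ?pi_gt0. Qed.

Lemma tc_bound f c r m M : 0 < r -> (forall p, ccont f (circle c r p)) ->
  (forall p, nc (f (circle c r p)) <= M) -> nc (tc f c r m) <= M / r ^+ m.
Proof.
move=> r0 fc fM; rewrite /tc ncM ncR ger0_norm ?invr_ge0 ?pi2_ge0// mulrC.
rewrite ler_pdivrMr ?pi2_gt0// -[X in _ <= _ * X]subr0.
apply: cint_bound; [exact: pi2_ge0|exact: integ_tc|move=> p _].
rewrite ncM ncV ncX (nc_circle r0) ler_pM2r ?invr_gt0 ?exprn_gt0// fM.
Qed.

Lemma tcB f g c r m : 0 < r -> (forall p, ccont f (circle c r p)) ->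
  (forall p, ccont g (circle c r p)) ->
  tc (fun z => f z - g z) c r m = tc f c r m - tc g c r m.
Proof.
move=> r0 fc gc; rewrite /tc -mulrBr -cintB ?pi2_ge0//; try exact: integ_tc.
by congr (_ * _); apply: cint_ext => p _; rewrite mulrBl.
Qed.

(** Taylor's formula with geometric remainder, as a property of its own: it passes to uniform limits
    before these are known to be differentiable, and it implies differentiability. *)
Definition taylor_at (f : C -> C) (c : C) (r M : R) : Prop :=
  forall h, nc h < r -> forall K,
    nc (f (c + h) - \sum_(m < K) tc f c r m * h ^+ m) <= M * (nc h / r) ^+ K * (r / (r - nc h)).

Lemma holo_ccont f c r z : holo f c r -> nc (z - c) < r -> ccont f z.
Proof. by move=> hf /hf[d]; exact: cder_cont. Qed.

Lemma taylor f c R0 r M : holo f c R0 -> 0 < r -> r < R0 ->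
  (forall p, nc (f (circle c r p)) <= M) -> taylor_at f c r M.
Proof.
move=> hf r0 rR fM h hr K.
have hf' z : nc z < R0 -> exists d, cder (fun x => f (c + x)) z d.
  move=> zR; have [|d fd] := hf (c + z); first by rewrite addrAC subrr add0r.
  by exists d; exact: cder_shift.
have := cauchy_formula hf' r0 rR hr.
have uc p : rcont (fun p => f (c + r%:C * cis p)) p.
  apply: rcont_comp (rcont_circle _ _ _) _.
  by apply: holo_ccont hf _; rewrite (circle_dist c p r0).
have uM p : nc (f (c + r%:C * cis p)) <= M by exact: fM.
have := kernel_expand r0 hr K uc uM; move=> + E; rewrite {}E.
set S := \sum_(m < K) _; set T := \sum_(m < K) tc f c r m * h ^+ m.
have -> : S = (pi *+ 2)%:C * T.
  rewrite /T mulr_sumr; apply: eq_bigr => m _; rewrite /tc !mulrA -realCM.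
  by rewrite mulfV ?gt_eqF ?pi2_gt0// mul1r.
have -> : f (c + h) * ('i * (pi *+ 2)%:C) - 'i * ((pi *+ 2)%:C * T) =
   (f (c + h) - T) * ('i * (pi *+ 2)%:C) by ring.
rewrite !ncM nc_i mul1r ncR ger0_norm ?pi2_ge0// => H.
by rewrite -(ler_pM2r pi2_gt0).
Qed.

Lemma holo_circle_bound f c R0 r : holo f c R0 -> 0 < r -> r < R0 ->
  exists M, forall p, nc (f (circle c r p)) <= M.
Proof.
move=> hf r0 rR.
have fc p : rcont (fun p => f (circle c r p)) p.
  apply: rcont_comp (rcont_circle _ _ _) _.
  by apply: holo_ccont hf _; rewrite (circle_dist c p r0).
have [M HM] := rcont_bounded (- pi) (pi *+ 2) fc.
(* The bound holds for angles in [[- pi, pi *+ 2]]; removing [m] full turns brings any [p] there. *)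
exists M => p.
pose m := Num.floor (p / (pi *+ 2)).
have pp := @pi2_gt0.
pose q := p - (m%:~R) * (pi *+ 2).
have q0 : 0 <= q by rewrite subr_ge0 -ler_pdivlMr// floor_le_tmp.
have q1 : q <= pi *+ 2.
  rewrite lerBlDl -[X in _ <= _ + X]mul1r -mulrDl -ler_pdivrMr//.
  by have := floorD1_gt (p / (pi *+ 2)); rewrite intrD => /ltW.
have cisM (k : int) x : cis (x + k%:~R * (pi *+ 2)) = cis x :> C.
  have cisn (j : nat) y : cis (y + j%:R * (pi *+ 2)) = cis y :> C.
    elim: j y => [|j IH] y; first by rewrite mul0r addr0.
    by rewrite -natr1 mulrDl mul1r addrA cisD cis2pi mulr1 IH.
  case: k => j; first by rewrite -pmulrn cisn.
  rewrite NegzE mulrNz -(cisn j.+1 (x + _)); congr cis.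
  by rewrite -pmulrn mulNr subrK.
have -> : circle c r p = circle c r q by rewrite /circle -[in cis p](subrK (m%:~R * (pi *+ 2)) p) cisM.
by apply: HM; rewrite q1 andbT (le_trans _ q0)// oppr_le0 pi_ge0.
Qed.

Lemma holo_ccont_circle f c R0 r p : holo f c R0 -> 0 < r -> r < R0 -> ccont f (circle c r p).
Proof. by move=> hf r0 rR; apply: holo_ccont hf _; rewrite circle_dist. Qed.

Lemma taylor_ge0 f c r M : 0 < r -> taylor_at f c r M -> 0 <= M.
Proof.
move=> r0 T; have := T 0; rewrite nc0 => /(_ r0 0%N).
by rewrite mul0r expr0 mulr1 subr0 divff ?gt_eqF// mulr1; apply: le_trans; exact: nc_ge0.
Qed.

Lemma taylor_tc0 f c r M : 0 < r -> taylor_at f c r M -> tc f c r 0 = f c.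
Proof.
move=> r0 T; have := T 0; rewrite nc0 => /(_ r0 1%N).
rewrite mul0r expr1 mulr0 mul0r big_ord_recl big_ord0 expr0 mulr1 !addr0 => h.
by apply/esym/eqP; rewrite -subr_eq0 -nc_eq0 eq_le h nc_ge0.
Qed.

Lemma half_ratio (r x : R) : 0 < r -> 0 <= x -> x <= r / 2 -> r / (r - x) <= 2.
Proof. by move=> r0 x0 xr; rewrite ler_pdivrMr; lra. Qed.

Lemma taylor_quad f c r M h : 0 < r -> taylor_at f c r M -> nc h <= r / 2 ->
  nc (f (c + h) - f c - tc f c r 1 * h) <= M * (nc h / r) ^+ 2 * 2.
Proof.
move=> r0 T hr; have hr' : nc h < r by apply: le_lt_trans hr _; exact: half_lt.
have := T h hr' 2%N; rewrite !big_ord_recl big_ord0 /= expr0 mulr1 addr0 expr1.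
rewrite (taylor_tc0 r0 T) opprD addrA => /le_trans; apply.
rewrite ler_wpM2l ?half_ratio ?nc_ge0// mulr_ge0 ?(taylor_ge0 r0 T)//.
by rewrite exprn_ge0// divr_ge0 ?nc_ge0 ?ltW.
Qed.

Lemma taylor_cder f c r M : 0 < r -> taylor_at f c r M -> cder f c (tc f c r 1).
Proof.
move=> r0 T e e0; have M0 := taylor_ge0 r0 T.
have d0 : 0 < e * r ^+ 2 / (2 * (M + 1)) by rewrite divr_gt0 ?mulr_gt0 ?exprn_gt0// ltr_wpDl.
exists (Num.min (r / 2) (e * r ^+ 2 / (2 * (M + 1)))) => [|h].
  by rewrite lt_min d0 divr_gt0.
rewrite lt_min => /andP[h1 h2]; apply: le_trans (taylor_quad r0 T (ltW h1)) _.
have -> : M * (nc h / r) ^+ 2 * 2 = M * 2 / r ^+ 2 * nc h * nc h by field; rewrite gt_eqF.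
rewrite ler_wpM2r ?nc_ge0//; apply: le_trans (_ : (M + 1) * 2 / r ^+ 2 * nc h <= _).
  rewrite ler_wpM2r ?nc_ge0// ler_pM2r ?invr_gt0 ?exprn_gt0// ler_pM2r//; lra.
apply: le_trans (_ : (M + 1) * 2 / r ^+ 2 * (e * r ^+ 2 / (2 * (M + 1))) <= _).
  by rewrite ler_pM2l ?ltW// !mulr_gt0 ?invr_gt0 ?exprn_gt0 ?ltr_wpDl.
by apply: le_of_eq; field; rewrite !gt_eqF// ltr_wpDl.
Qed.

Lemma holo_cder f c R0 r : holo f c R0 -> 0 < r -> r < R0 -> cder f c (tc f c r 1).
Proof.
move=> hf r0 rR; have [M HM] := holo_circle_bound hf r0 rR.
exact: taylor_cder r0 (taylor hf r0 rR HM).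
Qed.

Definition unif_lim (F : nat -> C -> C) f c r := forall e : R, 0 < e ->
  exists N, forall n, (N <= n)%N -> forall z, nc (z - c) < r -> nc (F n z - f z) <= e.

Lemma unif_ccont F f c r z : (forall n, holo (F n) c r) -> unif_lim F f c r ->
  nc (z - c) < r -> ccont f z.
Proof.
move=> hF uF zr e e0; have e3 : 0 < e / 4 by rewrite divr_gt0.
have [N HN] := uF _ e3; have {}HN := HN N (leqnn N).
have [s s0 Hs] := holo_ccont (hF N) zr e3.
exists (Num.min s (r - nc (z - c))) => [|h]; first by rewrite lt_min s0 subr_gt0.
rewrite lt_min => /andP[/Hs h1 h2].
have zh : nc (z + h - c) < r by rewrite addrAC; apply: le_lt_trans (ncD _ _) _; rewrite -ltrBrDl.
have := HN _ zh; have := HN _ zr; rewrite ncC => a1 a2.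
have -> : f (z + h) - f z = - (F N (z + h) - f (z + h)) + (F N (z + h) - F N z) - (f z - F N z) by ring.
apply: le_lt_trans (ncB _ _) _.
have := ncD (- (F N (z + h) - f (z + h))) (F N (z + h) - F N z); rewrite ncN.
lra.
Qed.

Lemma unif_tc F f c R0 r m : (forall n, holo (F n) c R0) -> unif_lim F f c R0 ->
  0 < r -> r < R0 -> forall e : R, 0 < e -> exists N, forall n, (N <= n)%N ->
  nc (tc (F n) c r m - tc f c r m) <= e.
Proof.
move=> hF uF r0 rR e e0.
have e1 : 0 < e * r ^+ m by rewrite mulr_gt0// exprn_gt0.
have [N HN] := uF _ e1; exists N => n Nn.
have cF k p := holo_ccont_circle p (hF k) r0 rR.
have cf p : ccont f (circle c r p) by apply: unif_ccont hF uF _; rewrite circle_dist.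
rewrite -tcB//; apply: le_trans (@tc_bound _ c r m (e * r ^+ m) r0 _ _) _.
- move=> p; have h := cF n p; have h' := cf p => e' e'0.
  have e2 : 0 < e' / 2 by rewrite divr_gt0.
  have [s s0 Hs] := h _ e2; have [t t0 Ht] := h' _ e2.
  exists (Num.min s t) => [|v]; first by rewrite lt_min s0.
  rewrite lt_min => /andP[/Hs a1 /Ht a2].
  set x := circle c r p in a1 a2 *.
  have -> : F n (x + v) - f (x + v) - (F n x - f x) = (F n (x + v) - F n x) - (f (x + v) - f x) by ring.
  by apply: le_lt_trans (ncB _ _) _; lra.
- by move=> p; apply: HN => //; rewrite circle_dist.
- by rewrite mulfK// expf_neq0// gt_eqF.
Qed.

Lemma nc_pow_le (h : C) (r : R) m : nc h <= r -> nc (h ^+ m) <= r ^+ m.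
Proof. by move=> hr; rewrite ncX lerXn2r ?nnegrE ?nc_ge0// (le_trans (nc_ge0 h)). Qed.

(** Both sides of Taylor's formula for [F n] converge, the coefficients by [unif_tc]. Weierstrass's
    theorem follows, as [taylor_cder] reads the derivative of the limit off the formula. *)
Lemma unif_taylor F f c R0 r M : (forall n, holo (F n) c R0) -> unif_lim F f c R0 ->
  0 < r -> r < R0 -> (forall p, nc (f (circle c r p)) <= M) -> taylor_at f c r M.
Proof.
move=> hF uF r0 rR fM h hr K; apply/ler_addgt0Pr => e e0.
set B := _ * _ * _.
pose Q := (nc h / r) ^+ K * (r / (r - nc h)).
have Q0 : 0 <= Q by rewrite mulr_ge0 ?exprn_ge0 ?divr_ge0 ?nc_ge0 ?subr_ge0 ?ltW.
pose P := 1 + Q + \sum_(m < K) r ^+ m.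
have S0 : 0 <= \sum_(m < K) r ^+ m by rewrite sumr_ge0// => m _; rewrite exprn_ge0// ltW.
have P0 : 0 < P by rewrite /P -addrA ltr_pwDl// addr_ge0.
have e1 : 0 < e / P by rewrite divr_gt0.
have [N0 HN0] := uF _ e1.
have [N1 HN1] : exists N, forall n, (N <= n)%N -> forall m : 'I_K,
    nc (tc (F n) c r m - tc f c r m) <= e / P.
  elim: (K) => [|k [N' IH]]; first by exists 0%N => n _ [].
  have [N2 HN2] := unif_tc k hF uF r0 rR e1; exists (maxn N' N2) => n.
  rewrite geq_max => /andP[n1 n2] m; have := ltn_ord m; rewrite ltnS leq_eqVlt.
  by move=> /orP[/eqP->|mk]; [exact: HN2|exact: (IH n n1 (Ordinal mk))].
pose n := maxn N0 N1.
have {}HN0 := HN0 n (leq_maxl _ _); have {}HN1 := HN1 n (leq_maxr _ _).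
have FM p : nc (F n (circle c r p)) <= M + e / P.
  have := HN0 (circle c r p); rewrite circle_dist// => /(_ rR) h1.
  rewrite -[F n _](subrK (f (circle c r p))); apply: le_trans (ncD _ _) _.
  by rewrite addrC lerD.
have := taylor (hF n) r0 rR FM hr K; rewrite -mulrA -/Q mulrDl => h1.
have hc : nc (c + h - c) < R0 by rewrite addrAC subrr add0r (lt_trans hr).
have h2 := HN0 _ hc; rewrite ncC in h2.
have -> : f (c + h) - \sum_(m < K) tc f c r m * h ^+ m =
  (f (c + h) - F n (c + h)) + (F n (c + h) - \sum_(m < K) tc (F n) c r m * h ^+ m) +
  \sum_(m < K) (tc (F n) c r m - tc f c r m) * h ^+ m.
  rewrite [X in _ = _ + X](_ : _ = \sum_(m < K) tc (F n) c r m * h ^+ m -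
     \sum_(m < K) tc f c r m * h ^+ m); first by ring.
  by rewrite -sumrB; apply: eq_bigr => m _; rewrite mulrBl.
apply: le_trans (ncD _ _) _.
apply: (@le_trans _ _ (e / P + (M * Q + e / P * Q) + e / P * \sum_(m < K) r ^+ m)).
  apply: lerD; first by apply: le_trans (ncD _ _) _; apply: lerD.
  apply: le_trans (nc_sum _ _ _) _; rewrite mulr_sumr; apply: ler_sum => m _.
  by rewrite ncM ler_pM ?nc_ge0// nc_pow_le// ltW.
have -> : e / P + (M * Q + e / P * Q) + e / P * \sum_(m < K) r ^+ m = M * Q + e / P * P by rewrite /P; ring.
have -> : e / P * P = e by rewrite divfK ?gt_eqF.
have -> : B = M * Q by rewrite /B /Q [RHS]mulrA.
exact: lexx.
Qed.

Lemma unif_bound F f c R0 r : (forall n, holo (F n) c R0) -> unif_lim F f c R0 ->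
  0 < r -> r < R0 -> exists M, forall p, nc (f (circle c r p)) <= M.
Proof.
move=> hF uF r0 rR; have [N HN] := uF _ ltr01; have {}HN := HN N (leqnn N).
have [M HM] := holo_circle_bound (hF N) r0 rR; exists (M + 1) => p.
rewrite -[f _](subrK (F N (circle c r p))) addrC; apply: le_trans (ncD _ _) _.
by rewrite lerD// ncC HN// circle_dist.
Qed.

Lemma unif_sub F f c r c' r' : unif_lim F f c r -> nc (c' - c) + r' <= r -> unif_lim F f c' r'.
Proof.
move=> uF cc e e0; have [N HN] := uF e e0; exists N => n Nn z zc; apply: HN => //.
apply: lt_le_trans cc.
by apply: le_lt_trans (nc_triangle z c' c) _; rewrite addrC ltrD2l.
Qed.

Lemma unif_holo F f c R0 : (forall n, holo (F n) c R0) -> unif_lim F f c R0 -> holo f c R0.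
Proof.
move=> hF uF z zR; set r' := R0 - nc (z - c).
have r'0 : 0 < r' by rewrite subr_gt0.
have cc : nc (z - c) + r' <= R0 by rewrite /r' addrC subrK.
have hF' n := holo_sub (hF n) cc; have uF' := unif_sub uF cc.
have r2 : 0 < r' / 2 by rewrite divr_gt0.
have r2' : r' / 2 < r' by exact: half_lt.
have [M HM] := unif_bound hF' uF' r2 r2'.
exists (tc f z (r' / 2) 1); exact: taylor_cder r2 (unif_taylor hF' uF' r2 r2' HM).
Qed.

Lemma unif_cder F f c R0 (d : nat -> C) D : 0 < R0 ->
  (forall n, holo (F n) c R0) -> unif_lim F f c R0 ->
  (forall n, cder (F n) c (d n)) ->
  (forall e : R, 0 < e -> exists N, forall n, (N <= n)%N -> nc (d n - D) <= e) ->
  cder f c D.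
Proof.
move=> R00 hF uF Fd dD.
have r2 : 0 < R0 / 2 by rewrite divr_gt0.
have r2' : R0 / 2 < R0 by exact: half_lt.
have fd := holo_cder (unif_holo hF uF) r2 r2'.
apply: cder_eq fd _; apply: nc_eps_eq => e e0; have e1 : 0 < e / 2 by rewrite divr_gt0.
have [N1 H1] := dD _ e1; have [N2 H2] := unif_tc 1 hF uF r2 r2' e1.
have {}H1 := H1 _ (leq_maxl N1 N2); have {}H2 := H2 _ (leq_maxr N1 N2).
rewrite (cder_unique (Fd _) (holo_cder (hF (maxn N1 N2)) r2 r2')) in H1.
rewrite ncC in H2.
by apply: le_trans (nc_triangle _ (tc (F (maxn N1 N2)) c (R0 / 2) 1) _) _; rewrite (splitr e); apply: lerD.
Qed.

(** If the coefficients below [m] vanish, the zero value at a small real [x] bounds the m-th term by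
    a remainder of order [x ^+ m.+1]; this excludes a nonzero coefficient. *)
Lemma taylor_zero_near f c r M s : 0 < r -> taylor_at f c r M -> 0 < s ->
  (forall h, nc h < s -> f (c + h) = 0) -> forall m, tc f c r m = 0.
Proof.
move=> r0 T s0 f0 m; have M0 := taylor_ge0 r0 T.
elim/ltn_ind: m => m IH; apply/eqP; rewrite -nc_eq0 eq_le nc_ge0 andbT.
rewrite leNgt; apply/negP => tm.
pose K := M * 2 / r ^+ m.+1.
have K0 : 0 <= K by rewrite divr_ge0 ?mulr_ge0// exprn_ge0// ltW.
pose x := Num.min (Num.min (s / 2) (r / 2)) (nc (tc f c r m) / (2 * (K + 1))).
have x0 : 0 < x by rewrite !lt_min !divr_gt0// mulr_gt0// ltr_wpDl.
have xs : x < s.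
  apply: le_lt_trans (_ : s / 2 < s); last exact: half_lt.
  by rewrite !ge_min lexx.
have xr : x <= r / 2 by rewrite !ge_min lexx orbT.
have xr' : x < r by apply: le_lt_trans xr _; exact: half_lt.
have xt : x <= nc (tc f c r m) / (2 * (K + 1)) by rewrite !ge_min lexx !orbT.
have nx : nc x%:C = x by rewrite ncR gtr0_norm.
have := T x%:C; rewrite nx => /(_ xr' m.+1).
rewrite f0 ?nx// big_ord_recr /= big1 ?add0r => [|k _]; last by rewrite IH// mul0r.
rewrite ncN ncM ncX nx => h.
have : nc (tc f c r m) * x ^+ m <= K * x * x ^+ m.
  apply: le_trans h _; apply: (@le_trans _ _ (M * (x / r) ^+ m.+1 * 2)).
    apply: ler_wpM2l; last exact: half_ratio (ltW x0) xr.
    by rewrite mulr_ge0// exprn_ge0// divr_ge0//; exact: ltW.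
  rewrite /K; apply: le_of_eq.
  rewrite expr_div_n [x ^+ m.+1]exprS; field.
  by rewrite expf_neq0// gt_eqF.
rewrite ler_pM2r ?exprn_gt0// => h2.
have : K * x < nc (tc f c r m).
  apply: le_lt_trans (_ : (K + 1) * (nc (tc f c r m) / (2 * (K + 1))) < _).
    by apply: ler_pM => //; [exact: ltW|rewrite lerDl].
  have -> : (K + 1) * (nc (tc f c r m) / (2 * (K + 1))) = nc (tc f c r m) / 2 by field; rewrite gt_eqF// ltr_wpDl.
  exact: half_lt.
by rewrite ltNge h2.
Qed.

Lemma holo_zero_ball f c R0 s : holo f c R0 -> 0 < s ->
  (forall h, nc h < s -> f (c + h) = 0) -> forall h, nc h < R0 -> f (c + h) = 0.
Proof.
move=> hf s0 f0 h hR; pose r := (nc h + R0) / 2.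
have h0 := nc_ge0 h.
have hr : nc h < r by rewrite /r ltr_pdivlMr//; lra.
have r0 : 0 < r by apply: le_lt_trans hr.
have rR : r < R0 by rewrite /r ltr_pdivrMr//; lra.
have [M HM] := holo_circle_bound hf r0 rR; have T := taylor hf r0 rR HM.
have M0 := taylor_ge0 r0 T.
have tz := taylor_zero_near r0 T s0 f0.
apply/eqP; rewrite -nc_eq0 eq_le nc_ge0 andbT; apply/ler_addgt0Pr => e e0; rewrite add0r.
have q1 : 0 <= nc h / r < 1 by rewrite divr_ge0 ?(ltW r0)//= ltr_pdivrMr// mul1r.
have A0 : 0 <= M * (r / (r - nc h)) by rewrite mulr_ge0// divr_ge0// ?subr_ge0 ltW.
have [K HK] := small_pow q1 A0 e0.
have := T h hr K; rewrite big1 ?subr0 => [|m _]; last by rewrite tz mul0r.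
by move=> /le_trans; apply; rewrite mulrAC ltW.
Qed.

(** Continuation by discs: vanishing near one of the [N] division points spreads to its disc of
    radius [d], which contains the disc of radius [d / 2] around the next one, as consecutive points
    are closer than [d / 2]. *)
Lemma holo_zero_segment f (d : R) (a v : C) : 0 < d ->
  (forall x : R, 0 <= x <= 1 -> holo f (a + x%:C * v) d) ->
  (exists2 s : R, 0 < s & forall h, nc h < s -> f (a + h) = 0) -> f (a + v) = 0.
Proof.
move=> d0 hf [s s0 f0].
pose N := (Num.truncn (2 * nc v / d)).+1.
have N0 : (0 : R) < N%:R by rewrite ltr0n.
have NH : nc v / N%:R < d / 2.
  rewrite ltr_pdivrMr// mulrAC ltr_pdivlMr// [d * _]mulrC -ltr_pdivrMr// [nc v * 2]mulrC.
  exact: truncnS_gt.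
have step k : (k <= N)%N -> exists2 s : R, 0 < s & forall h, nc h < s ->
    f (a + (k%:R / N%:R)%:C * v + h) = 0.
  elim: k => [|k IH] kN.
    by exists s => // h hs; rewrite mul0r realC0 mul0r addr0 f0.
  have [t t0 Ht] := IH (ltnW kN).
  have k01 : 0 <= (k%:R / N%:R : R) <= 1 by rewrite divr_ge0 ?ler0n ?(ltW N0)//= ler_pdivrMr// mul1r ler_nat ltnW.
  have H := holo_zero_ball (hf _ k01) t0 Ht.
  exists (d / 2) => [|h hd]; first by rewrite divr_gt0.
  have -> : a + (k.+1%:R / N%:R)%:C * v + h =
      a + (k%:R / N%:R)%:C * v + ((N%:R^-1)%:C * v + h).
    by rewrite -natr1 mulrDl mul1r realCD; ring.
  apply: H; apply: le_lt_trans (ncD _ _) _; rewrite ncM ncR ger0_norm ?invr_ge0 ?ltW//.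
  by rewrite mulrC (splitr d) ltrD.
have [t t0 Ht] := step N (leqnn N); have := Ht 0; rewrite nc0 => /(_ t0).
by rewrite divff ?gt_eqF// realC1 mul1r addr0.
Qed.

Lemma cder0_cst (f : C -> C) : (forall w, cder f w 0) -> forall w, f w = f 0.
Proof.
move=> h w; have := @rder0_cst R (fun s => f (s%:C * w)) 0 1 _ ler01.
rewrite mul1r mul0r; apply => s _.
have r := rderM (rder_id s) (rder_cst w s).
by apply: rder_eq (rder_comp r (h _)) _; rewrite mul0r.
Qed.

Lemma liouville (f : C -> C) M : (forall z, exists d, cder f z d) -> (forall z, nc (f z) <= M) ->
  forall z, f z = f 0.
Proof.
move=> hf fM z.
have M0 : 0 <= M by apply: le_trans (fM 0); exact: nc_ge0.
have d0 w : cder f w 0.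
  have [d fd] := hf w; apply: cder_eq (fd) _; apply/eqP; rewrite -nc_eq0 eq_le nc_ge0 andbT.
  apply/ler_addgt0Pr => e e0; rewrite add0r.
  pose r := (M + 1) / e; have r0 : 0 < r by rewrite divr_gt0// ltr_wpDl.
  have h2 : holo f w (r + 1) by move=> u _; exact: hf.
  have r1 : r < r + 1 by rewrite ltrDl.
  rewrite (cder_unique fd (holo_cder h2 r0 r1)).
  apply: le_trans (@tc_bound f w r 1 M r0 _ _) _ => [p|p|].
  - exact: holo_ccont_circle h2 r0 r1.
  - exact: fM.
  rewrite expr1 /r ler_pdivrMr// mulrCA mulfV ?gt_eqF// mulr1; lra.
exact: cder0_cst d0 z.
Qed.
Lemma integB (f g : R -> C) a b : integ f a b -> integ g a b ->
  integ (fun x => f x - g x) a b.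
Proof.
move=> [P HP] [Q HQ]; exists (fun x => P x - Q x) => x xab.
by apply: rderB; [exact: HP|exact: HQ].
Qed.

Lemma cint_bound_le (f : R -> C) (g g' : R -> R) a b : a <= b -> integ f a b ->
  (forall x, a <= x <= b -> dr g x (g' x)) ->
  (forall x, a <= x <= b -> nc (f x) <= g' x) -> nc (cint f a b) <= g b - g a.
Proof. by move=> ab [P HP] gd fM; rewrite (cintE ab HP); exact: rder_bound_le HP gd fM ab. Qed.

Lemma dr_expR s : dr expR s (expR s : R).
Proof. by apply/drP; exact: is_derive_expR. Qed.

Lemma rder_cexp_line (h : C) s : rder (fun s : R => cexp (s%:C * h)) s (h * cexp (s%:C * h)).
Proof.
have E x : cexp (x%:C * h) = (expR (x * cRe h))%:C * cis (x * cIm h).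
  rewrite cexpE; congr ((expR _)%:C * cis _); first by rewrite cReM/=; ring.
  by rewrite cImM/=; ring.
have dl (c : R) : dr (fun x => x * c) s c by apply: dr_eq (drM (dr_id s) (dr_cst c s)) _; ring.
apply: rder_ext (rder_eq (rderM (rder_real (dr_comp (dl (cRe h)) (dr_expR _)))
   (rder_compr (dl (cIm h)) (rder_cis _))) _) => [x|]; first by rewrite E.
have Eh : h = (cRe h)%:C + 'i * (cIm h)%:C by case: (h) => a b; apply: ceqP; rewrite ?cReD ?cReM ?cImD ?cImM/=; ring.
rewrite E realCM [X in _ = X * _]Eh.
by move: (expR _)%:C (cis _) (cRe h)%:C (cIm h)%:C => u v x y; ring.
Qed.

(** By [cexpD] only the point 0 matters; there the mean value inequality, used twice on the segment
    from 0 to [h], gives |e^h - 1 - h| <= e |h|^2 for |h| <= 1. *)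
Lemma cder_cexp (w : C) : cder cexp w (cexp w).
Proof.
have small (h : C) : nc h <= 1 -> nc (cexp h - 1 - h) <= expR 1 * nc h * nc h.
  move=> h1.
  have b0 s : 0 <= s <= 1 -> nc (cexp (s%:C * h)) <= expR 1.
    move=> /andP[s0 s1]; rewrite nc_cexp ler_expR.
    apply: le_trans (ler_norm _) _; apply: le_trans (Re_le_nc _) _.
    by rewrite ncM ncR ger0_norm// -[leRHS]mulr1 ler_pM ?nc_ge0.
  have b1 s : 0 <= s <= 1 -> nc (cexp (s%:C * h) - 1) <= expR 1 * nc h.
    move=> /andP[s0 s1]; have := @rder_bound R _ _ (expR 1 * nc h) 0 s
      (fun x _ => rder_cexp_line h x) _ s0.
    rewrite realC0 mul0r cexp0 subr0 => H; apply: le_trans (H _) _.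
      move=> x /andP[x0 xs]; rewrite ncM mulrC ler_wpM2r ?nc_ge0// b0// x0.
      exact: le_trans s1.
    by rewrite -[leRHS]mulr1 ler_wpM2l// mulr_ge0 ?nc_ge0 ?expR_ge0.
  have := @rder_bound R (fun s : R => cexp (s%:C * h) - s%:C * h)
    (fun s => h * cexp (s%:C * h) - h) (expR 1 * nc h * nc h) 0 1 _ _ ler01.
  rewrite realC1 realC0 !mul1r !mul0r cexp0 !subr0 mulr1.
  have -> : cexp h - h - 1 = cexp h - 1 - h by ring.
  apply => x x01.
    apply: rder_eq (rderB (rder_cexp_line h x) (rderM (rder_id x) (rder_cst h x))) _.
    by ring.
  have -> : h * cexp (x%:C * h) - h = (cexp (x%:C * h) - 1) * h by ring.
  by rewrite ncM ler_wpM2r ?nc_ge0// b1.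
move=> e e0.
have K0 : 0 < nc (cexp w) * expR 1 + 1 by rewrite ltr_wpDl// mulr_ge0 ?nc_ge0 ?expR_ge0.
exists (Num.min 1 (e / (nc (cexp w) * expR 1 + 1))) => [|h].
  by rewrite lt_min ltr01 divr_gt0.
rewrite lt_min => /andP[h1 h2].
have -> : cexp (w + h) - cexp w - cexp w * h = cexp w * (cexp h - 1 - h) by rewrite cexpD; ring.
rewrite ncM; apply: le_trans (_ : nc (cexp w) * (expR 1 * nc h * nc h) <= _).
  by rewrite ler_wpM2l ?nc_ge0// small// ltW.
rewrite !mulrA ler_wpM2r ?nc_ge0//; move: h2; rewrite ltr_pdivlMr// => h2.
apply: le_trans (ltW h2); rewrite mulrDr mulr1 mulrC lerDl nc_ge0//.
Qed.

(** Differentiation under the integral: Cauchy's estimates from the common bound [M] make the second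
    order remainder of [g p] uniform in [p]. *)
Lemma dui (g : R -> C -> C) (g' : R -> C) (c : C) (R0 M a b : R) : a <= b -> 0 < R0 ->
  (forall p, a <= p <= b -> holo (g p) c R0) ->
  (forall p z, a <= p <= b -> nc (z - c) < R0 -> nc (g p z) <= M) ->
  (forall z p, a <= p <= b -> nc (z - c) < R0 -> rcont (g^~ z) p) ->
  (forall p, a <= p <= b -> cder (g p) c (g' p)) ->
  integ g' a b /\ cder (fun z => cint (g^~ z) a b) c (cint g' a b).
Proof.
move=> ab R00 hg gM gc g'd.
pose r := R0 / 2; have r0 : 0 < r by rewrite divr_gt0.
have rR : r < R0 by exact: half_lt.
have M0 : 0 <= M by apply: le_trans (gM a c _ _); rewrite ?nc_ge0 ?lexx ?subrr ?nc0.
pose K := M / r ^+ 2 * 2.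
have K0 : 0 <= K by rewrite mulr_ge0// divr_ge0// exprn_ge0// ltW.
have quad p h : a <= p <= b -> nc h <= r / 2 ->
    nc (g p (c + h) - g p c - g' p * h) <= K * nc h ^+ 2.
  move=> pab hr.
  have T : taylor_at (g p) c r M.
    apply: (taylor (hg p pab) r0 rR) => q; apply: gM => //.
    by rewrite circle_dist.
  rewrite (cder_unique (g'd p pab) (taylor_cder r0 T)).
  apply: le_trans (taylor_quad r0 T hr) _.
  by rewrite /K; apply: le_of_eq; field; rewrite gt_eqF.
have hball (h : C) : nc h <= r / 2 -> nc (c + h - c) < R0.
  move=> hr; rewrite addrAC subrr add0r; apply: le_lt_trans hr _.
  by apply: lt_trans rR; exact: half_lt.
have cball : nc (c - c) < R0 by rewrite subrr nc0.
have int' : integ g' a b.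
  (* continuity of g' as a uniform limit of difference quotients *)
  have cont p : a <= p <= b -> forall e : R, 0 < e -> exists2 s : R, 0 < s &
      forall q, a <= q <= b -> `|q - p| < s -> nc (g' q - g' p) < e.
    move=> pab e e0.
    (* The difference quotient with increment [t] is within [e / 4] of the derivative, uniformly in
       the integration variable. *)
    pose t : R := Num.min (r / 2) (e / (4 * (K + 1))).
    have t0 : 0 < t by rewrite lt_min !divr_gt0// mulr_gt0// ltr_wpDl.
    have tr : nc t%:C <= r / 2 by rewrite ncR gtr0_norm// ge_min lexx.
    have Kt : K * t <= e / 4.
      apply: (@le_trans _ _ ((K + 1) * (e / (4 * (K + 1))))).
        by apply: ler_pM => //; [exact: ltW|rewrite lerDl|rewrite ge_min lexx orbT].
      by apply: le_of_eq; field; rewrite gt_eqF// ltr_wpDl.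
    have et : 0 < e * t / 8 by rewrite divr_gt0// mulr_gt0.
    have [s1 s10 H1] := gc _ p pab (hball _ tr) _ et.
    have [s2 s20 H2] := gc _ p pab cball _ et.
    exists (Num.min s1 s2) => [|q qab]; first by rewrite lt_min s10.
    rewrite lt_min => /andP[/H1 + /H2]; rewrite [p + _]addrC subrK => a1 a2.
    rewrite -(@ltr_pM2r _ t)//; have <- : nc t%:C = t by rewrite ncR gtr0_norm.
    rewrite -ncM.
    have -> : (g' q - g' p) * t%:C = (g q (c + t%:C) - g p (c + t%:C)) - (g q c - g p c)
       - ((g q (c + t%:C) - g q c - g' q * t%:C) - (g p (c + t%:C) - g p c - g' p * t%:C)).
      by ring.
    have b1 := quad q _ qab tr; have b2 := quad p _ pab tr.
    apply: le_lt_trans (ncB _ _) _; have := ncB (g q (c + t%:C) - g p (c + t%:C)) (g q c - g p c).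
    have := ncB (g q (c + t%:C) - g q c - g' q * t%:C) (g p (c + t%:C) - g p c - g' p * t%:C).
    have nt : nc t%:C = t by rewrite ncR gtr0_norm.
    rewrite nt in b1 b2 *; have : K * t ^+ 2 <= e / 4 * t.
      by rewrite expr2 mulrA ler_wpM2r// ltW.
    have : 0 < e * t by rewrite mulr_gt0.
    lra.
  exact: integ_within cont.
split => // e e0.
have Kb : 0 < K * (b - a) + 1 by rewrite ltr_wpDl// mulr_ge0// subr_ge0.
exists (Num.min (r / 2) (e / (K * (b - a) + 1))) => [|h].
  by rewrite lt_min !divr_gt0.
rewrite lt_min => /andP[/ltW h1 h2].
have ig z : nc (z - c) < R0 -> integ (g^~ z) a b by move=> zR; apply: integ_cont => p pab; exact: gc.
have i1 := ig _ (hball h h1); have i2 := ig _ cball; have i3 := integZ h int'.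
rewrite [_ * h]mulrC -(cintB ab i1 i2) -(cintZ _ ab int') -cintB//; last exact: integB.
apply: le_trans (_ : K * nc h ^+ 2 * (b - a) <= _).
  apply: cint_bound => //.
    exact: integB (integB i1 i2) i3.
  by move=> x xab; rewrite [h * _]mulrC; exact: quad.
rewrite expr2 mulrA mulrAC ler_wpM2r ?nc_ge0//; move: h2; rewrite ltr_pdivlMr// => h2.
apply: le_trans (ltW h2).
have -> : K * nc h * (b - a) = nc h * (K * (b - a)) by ring.
by rewrite ler_wpM2l ?nc_ge0// lerDl.
Qed.
Lemma holo_near f g c (r : R) : (forall z, nc (z - c) < r -> f z = g z) -> holo f c r -> holo g c r.
Proof.
move=> fg hf z zr; have [d fd] := hf z zr; exists d.
apply: (cder_near (r := r - nc (z - c))) fd => [|h hr]; first by rewrite subr_gt0.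
apply: fg; rewrite addrAC; apply: le_lt_trans (ncD _ _) _.
by rewrite -ltrBrDl.
Qed.

Lemma holo_tc_param (f : C -> C -> C) (D1 D2 : C -> C) x0 y0 (R0 M : R) : 0 < R0 ->
  (forall y, nc (y - y0) < R0 -> holo (f^~ y) x0 R0) ->
  (forall x, nc (x - x0) < R0 -> holo (f x) y0 R0) ->
  (forall x y, nc (x - x0) < R0 -> nc (y - y0) < R0 -> nc (f x y) <= M) ->
  (forall y, nc (y - y0) < R0 -> cder (f^~ y) x0 (D1 y)) ->
  (forall x, nc (x - x0) < R0 -> cder (f x) y0 (D2 x)) ->
  cder D1 y0 (tc D2 x0 (R0 / 2) 1).
Proof.
move=> R00 h1 h2 fM d1 d2; set r := R0 / 2.
have r0 : 0 < r by rewrite divr_gt0.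
have rR : r < R0 by exact: half_lt.
have M0 : 0 <= M by apply: le_trans (fM x0 y0 _ _); rewrite ?nc_ge0 ?subrr ?nc0.
have cR p : nc (circle x0 r p - x0) < R0 by rewrite circle_dist.
pose g p y := f (circle x0 r p) y * (r%:C * cis p) ^- 1.
have gn p : nc ((r%:C * cis p) ^- 1 : C) = r^-1 by rewrite expr1 ncV (nc_circle r0).
have [||||_ H] := @dui g (fun p => D2 (circle x0 r p) * (r%:C * cis p) ^- 1) y0 R0 (M / r)
    0 (pi *+ 2) pi2_ge0 R00.
- move=> p _ y yR; have [d fd] := h2 _ (cR p) y yR.
  by eexists; apply: cderM fd (cder_cst _ _).
- move=> p z _ zR; rewrite /g ncM gn ler_wpM2r ?invr_ge0 ?(ltW r0)//; exact: fM.
- move=> z p _ zR; apply: rcontM; last exact: rcont_circleV.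
  by apply: rcont_comp (rcont_circle _ _ _) (holo_ccont (h1 z zR) (cR p)).
- move=> p _; apply: cder_eq (cderM (d2 _ (cR p)) (cder_cst _ _)) _.
  by rewrite mulr0 addr0.
apply: (cder_near (f := fun y => ((pi *+ 2)^-1)%:C * cint (g^~ y) 0 (pi *+ 2)) (r := R0)) => //.
  move=> h hR; have yR : nc (y0 + h - y0) < R0 by rewrite addrAC subrr add0r.
  by rewrite (cder_unique (d1 _ yR) (holo_cder (h1 _ yR) r0 rR)).
exact: cderZ.
Qed.

(** [D1] is a Cauchy integral of [f] over a circle in x; differentiated in y under the integral, it
    becomes the same integral of [D2]. With the variables exchanged this shows that [D2] is
    holomorphic in x, so that the integral obtained is its derivative. *)
Lemma mixed_partials (f : C -> C -> C) (D1 D2 : C -> C) x0 y0 (R0 M : R) : 0 < R0 ->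
  (forall y, nc (y - y0) < R0 -> holo (f^~ y) x0 R0) ->
  (forall x, nc (x - x0) < R0 -> holo (f x) y0 R0) ->
  (forall x y, nc (x - x0) < R0 -> nc (y - y0) < R0 -> nc (f x y) <= M) ->
  (forall y, nc (y - y0) < R0 -> cder (f^~ y) x0 (D1 y)) ->
  (forall x, nc (x - x0) < R0 -> cder (f x) y0 (D2 x)) ->
  exists E, cder D1 y0 E /\ cder D2 x0 E.
Proof.
move=> R00 h1 h2 fM d1 d2.
exists (tc D2 x0 (R0 / 2) 1); split; first exact: holo_tc_param R00 h1 h2 fM d1 d2.
have r0 : 0 < R0 / 2 by rewrite divr_gt0.
apply: (holo_cder (R0 := R0)) => //; last exact: half_lt.
move=> x1 x1R; set r1 := R0 - nc (x1 - x0).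
have r10 : 0 < r1 by rewrite subr_gt0.
have r1R : r1 <= R0 by rewrite gerBl nc_ge0.
have sub x : nc (x - x1) < r1 -> nc (x - x0) < R0.
  move=> xr; apply: le_lt_trans (nc_triangle x x1 x0) _; rewrite -ltrBrDr; exact: xr.
pose E y := xget 0 [set d | cder (f^~ y) x1 d].
have HE y : nc (y - y0) < r1 -> cder (f^~ y) x1 (E y).
  move=> yr; rewrite /E; case: xgetP => [d _ //|N].
  by have [d fd] := h1 y (lt_le_trans yr r1R) x1 x1R; case: (N d).
exists (tc E y0 (r1 / 2) 1).
apply: (@holo_tc_param (fun y x => f x y) D2 E y0 x1 r1 M) => //.
- move=> x xr; apply: holo_sub (h2 x (sub x xr)) _.
  by rewrite subrr nc0 add0r.
- move=> y yr; apply: holo_sub (h1 y (lt_le_trans yr r1R)) _.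
  by rewrite addrC subrK.
- move=> y x yr xr; apply: fM; [exact: sub|exact: lt_le_trans r1R].
- by move=> x xr; apply: d2; exact: sub.
Qed.
End Holomorphy.

(** * Holomorphy on polydiscs *)

Section PolydiscHolomorphy.
Context {R : realType} {n : nat}.
Notation C := (R[i]^o)%type.
Notation T := 'rV[R[i]^o]_n.
Implicit Types (t v c : T) (f g : T -> C).

Definition pd (c : T) (r : R) (t : T) : Prop := forall i, nc (t 0 i - c 0 i) < r.

Definition locbd f t : Prop := exists d M : R, 0 < d /\ forall s, pd t d s -> nc (f s) <= M.

(** Holomorphy along complex lines together with local boundedness. On open polydiscs it amounts to
    differentiability ([ghol_differentiable], [differentiable_mghol]), but it can be handled by
    one-variable arguments. *)
Definition ghol f c (r : R) : Prop :=
  (forall t v, pd c r t -> exists d, cder (fun x => f (t + x *: v)) 0 d) /\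
  (forall t, pd c r t -> locbd f t).

Definition vn v : R := \sum_i nc (v 0 i).
Lemma vn_ge0 v : 0 <= vn v. Proof. by apply: sumr_ge0 => i _; exact: nc_ge0. Qed.
Lemma nc_le_vn v i : nc (v 0 i) <= vn v.
Proof. by rewrite /vn (bigD1 i)//= lerDl sumr_ge0// => j _; exact: nc_ge0. Qed.

Lemma line_add t v (x y : C) : t + x *: v + y *: v = t + (x + y) *: v.
Proof. by rewrite -addrA -scalerDl. Qed.

Lemma pd_line t v (x : C) (d : R) : pd t d (t + x *: v) <-> forall i, nc (x * v 0 i) < d.
Proof.
by split => h i; have := h i; rewrite !mxE [t 0 i + _]addrC addrK.
Qed.

Lemma pd_center c r : 0 < r -> pd c r c.
Proof. by move=> r0 i; rewrite subrr nc0. Qed.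

Lemma pd_trans c r t d s : pd t d s -> (forall i, nc (t 0 i - c 0 i) + d <= r) -> pd c r s.
Proof.
move=> ts h i; apply: le_lt_trans (nc_triangle _ (t 0 i) _) _.
by apply: lt_le_trans (h i); rewrite addrC ltrD2l.
Qed.

Lemma pd_open c r t : pd c r t -> exists2 d : R, 0 < d & forall i, nc (t 0 i - c 0 i) + d <= r.
Proof.
move=> ct; pose m := \big[Num.min/1]_i (r - nc (t 0 i - c 0 i)).
exists m => [|i].
  by rewrite /m; elim/big_ind: _ => // [x y x0 y0|i _]; rewrite ?lt_min ?x0// subr_gt0.
rewrite -lerBrDl /m; exact: bigmin_le_cond.
Qed.

Lemma pd_le c r r' t : r <= r' -> pd c r t -> pd c r' t.
Proof. by move=> rr h i; exact: lt_le_trans (h i) rr. Qed.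

Lemma ghol_sub f c r t d : ghol f c r -> (forall i, nc (t 0 i - c 0 i) + d <= r) -> ghol f t d.
Proof.
move=> [h1 h2] td; split => [s v st|s st].
  by apply: h1; exact: pd_trans st td.
by apply: h2; exact: pd_trans st td.
Qed.

Lemma ghol_holo f c r t v (x0 : C) d : ghol f c r ->
  (forall x, nc (x - x0) < d -> pd c r (t + x *: v)) -> holo (fun x => f (t + x *: v)) x0 d.
Proof.
move=> [h1 _] H x xd; have [e He] := h1 _ v (H x xd); exists e => k k0.
have [s s0 Hs] := He k k0; exists s => // h hs; have := Hs h hs.
by rewrite add0r scale0r addr0 line_add.
Qed.

Definition pder f v t : C := xget 0 [set d | cder (fun x => f (t + x *: v)) 0 d].

Lemma pderP f v t d : cder (fun x => f (t + x *: v)) 0 d -> pder f v t = d.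
Proof.
move=> h; rewrite /pder; case: xgetP => [e _ He|/(_ d)//]; exact: cder_unique He h.
Qed.

Lemma ghol_pder f c r t v : ghol f c r -> pd c r t -> cder (fun x => f (t + x *: v)) 0 (pder f v t).
Proof. by move=> [h _] ct; have [d Hd] := h t v ct; rewrite (pderP Hd). Qed.

Lemma ghol_pder_line f c r t v (x : C) : ghol f c r -> pd c r (t + x *: v) ->
  cder (fun x => f (t + x *: v)) x (pder f v (t + x *: v)).
Proof.
move=> hf ct; have h := ghol_pder v hf ct.
move=> k k0; have [s s0 Hs] := h k k0; exists s => // y hs; have := Hs y hs.
by rewrite add0r scale0r addr0 line_add.
Qed.

Lemma bidisc f c r t v w : ghol f c r -> pd c r t -> exists2 d : R, 0 < d & exists M : R,
  forall x y : C, nc x < d -> nc y < d -> pd c r (t + x *: v + y *: w) /\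
     nc (f (t + x *: v + y *: w)) <= M.
Proof.
move=> [_ hb] ct; have [e [M [e0 HM]]] := hb t ct; have [d d0 Hd] := pd_open ct.
pose K := vn v + vn w + 1.
have K0 : 0 < K by rewrite ltr_wpDl// addr_ge0 ?vn_ge0.
pose m := Num.min e d; have m0 : 0 < m by rewrite lt_min e0.
exists (m / K); first by rewrite divr_gt0.
exists M => x y xd yd.
have H : pd t m (t + x *: v + y *: w).
  move=> i; rewrite !mxE -addrA [t 0 i + _]addrC addrK; apply: le_lt_trans (ncD _ _) _.
  rewrite !ncM; apply: (@le_lt_trans _ _ (m / K * (vn v + vn w))).
    by rewrite mulrDr; apply: lerD; apply: ler_pM; rewrite ?nc_ge0 ?nc_le_vn// ltW.
  by rewrite mulrAC ltr_pdivrMr// ltr_pM2l// ltrDl.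
split; last by apply: HM; apply: pd_le H; rewrite ge_min lexx.
apply: pd_trans (pd_le _ H) Hd; by rewrite ge_min lexx orbT//.
Qed.

Lemma ghol_mixed f c r t v w : ghol f c r -> pd c r t ->
  exists E, cder (fun y => pder f v (t + y *: w)) 0 E /\
            cder (fun x => pder f w (t + x *: v)) 0 E.
Proof.
move=> hf ct; have [d d0 [M HM]] := bidisc v w hf ct.
have n0 : nc (0 : C) < d by rewrite nc0.
have [|||||E [E1 E2]] := @mixed_partials R (fun x y => f (t + x *: v + y *: w))
   (fun y => pder f v (t + y *: w)) (fun x => pder f w (t + x *: v)) 0 0 d M d0.
- move=> y; rewrite subr0 => yd.
  apply: (holo_near (f := fun x => f (t + y *: w + x *: v))).
    by move=> x _; rewrite addrAC.
  by apply: ghol_holo hf _ => x; rewrite subr0 => xd; rewrite addrAC; exact: (HM x y xd yd).1.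
- move=> x; rewrite subr0 => xd.
  by apply: ghol_holo hf _ => y; rewrite subr0 => yd; exact: (HM x y xd yd).1.
- by move=> x y; rewrite !subr0 => xd yd; exact: (HM x y xd yd).2.
- move=> y; rewrite subr0 => yd.
  have ty : pd c r (t + y *: w) by have := (HM 0 y n0 yd).1; rewrite scale0r addr0.
  apply: cder_ext (ghol_pder v hf ty) => x; by rewrite addrAC.
- move=> x; rewrite subr0 => xd.
  have ty : pd c r (t + x *: v) by have := (HM x 0 xd n0).1; rewrite scale0r addr0.
  exact: ghol_pder w hf ty.
by exists E.
Qed.

Lemma ghol_cauchy f c r t v (d M : R) : ghol f c r -> 0 < d ->
  (forall x, nc x < d -> pd c r (t + x *: v)) ->
  (forall x, nc x < d -> nc (f (t + x *: v)) <= M) ->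
  nc (pder f v t) <= 2 * M / d /\
  forall x, nc x <= d / 4 -> nc (f (t + x *: v) - f t - x * pder f v t) <= 8 * M / d ^+ 2 * nc x ^+ 2.
Proof.
move=> hf d0 tP fM.
have hl : holo (fun x => f (t + x *: v)) 0 d by apply: ghol_holo hf _ => x; rewrite subr0; exact: tP.
have d2 : 0 < d / 2 by rewrite divr_gt0.
have dd := half_lt d0.
have ct : pd c r t by have := tP 0; rewrite nc0 => /(_ d0); rewrite scale0r addr0.
have FM p : nc (f (t + circle 0 (d / 2) p *: v)) <= M by apply: fM; rewrite -[circle _ _ _]subr0 circle_dist.
have E : pder f v t = tc (fun x => f (t + x *: v)) 0 (d / 2) 1.
  exact: cder_unique (ghol_pder v hf ct) (holo_cder hl d2 dd).
split.
  rewrite E; apply: le_trans (@tc_bound _ _ 0 (d / 2) 1 M d2 _ FM) _.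
    by move=> p; exact: holo_ccont_circle hl d2 dd.
  by rewrite expr1; apply: le_of_eq; field; rewrite gt_eqF.
move=> x xd; have T := taylor hl d2 dd FM.
have xd' : nc x <= d / 2 / 2 by apply: le_trans xd _; lra.
have := taylor_quad d2 T xd'; rewrite add0r scale0r addr0 -E [_ * x]mulrC => /le_trans; apply.
by apply: le_of_eq; field; rewrite gt_eqF.
Qed.

Lemma line_pd t v (d : R) (x : C) : nc x < d / (vn v + 1) -> pd t d (t + x *: v).
Proof.
move=> xd; have K0 : 0 < vn v + 1 by rewrite ltr_wpDl ?vn_ge0.
move: xd; rewrite ltr_pdivlMr// => xd i.
rewrite !mxE [t 0 i + _]addrC addrK ncM; apply: le_lt_trans xd.
rewrite ler_wpM2l ?nc_ge0//; apply: le_trans (nc_le_vn v i) _; by rewrite lerDl.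
Qed.

(** Along lines the derivative is differentiable by the symmetry of mixed derivatives; its local
    bound is Cauchy's estimate. *)
Lemma ghol_pder_ghol f c r v : ghol f c r -> ghol (pder f v) c r.
Proof.
move=> hf; split => [t w ct|t ct].
  by have [E [E1 _]] := ghol_mixed v w hf ct; exists E.
have [e [M [e0 HM]]] := hf.2 t ct; have [d d0 Hd] := pd_open ct.
pose m := Num.min e d / 2; have m0 : 0 < m by rewrite divr_gt0// lt_min e0.
exists m, (2 * M / (m / (vn v + 1))); split => // s ts.
have K0 : 0 < vn v + 1 by rewrite ltr_wpDl ?vn_ge0.
have H x : nc x < m / (vn v + 1) -> pd t (Num.min e d) (s + x *: v).
  move=> xm; apply: pd_trans (line_pd s xm) _ => i.
  have := ts i; have : m + m = Num.min e d by rewrite /m -splitr.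
  lra.
have [] // := @ghol_cauchy f c r s v (m / (vn v + 1)) M hf.
- by rewrite divr_gt0.
- move=> x /H h; apply: pd_trans (pd_le _ h) Hd; by rewrite ge_min lexx orbT.
- by move=> x /H h; apply: HM; apply: pd_le h; rewrite ge_min lexx.
Qed.

Lemma ghol_cst (a : C) c r : ghol (fun=> a) c r.
Proof.
split => [t v _|t _]; first by exists 0; exact: cder_cst.
by exists 1, (nc a).
Qed.

Lemma ghol_coord i c r : ghol (fun t => t 0 i) c r.
Proof.
split => [t v _|t _].
  exists (v 0 i); apply: cder_ext (cder_eq (cderD (cder_cst (t 0 i) 0)
    (cderM (cder_id 0) (cder_cst (v 0 i) 0))) _) => [x|]; first by rewrite !mxE.
  by ring.
exists 1, (1 + nc (t 0 i)); split => // s ts.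
by rewrite -[s 0 i](subrK (t 0 i)); apply: le_trans (ncD _ _) _; rewrite lerD2r ltW.
Qed.

Lemma locbd2 f g (op : C -> C -> C) (k : R -> R -> R) t : locbd f t -> locbd g t ->
  (forall a b (x y : R), nc a <= x -> nc b <= y -> nc (op a b) <= k x y) ->
  locbd (fun s => op (f s) (g s)) t.
Proof.
move=> [d [M [d0 HM]]] [e [N [e0 HN]]] H; exists (Num.min d e), (k M N).
split=> [|s ts]; first by rewrite lt_min d0.
by apply: H; [apply: HM|apply: HN]; apply: pd_le ts; rewrite ge_min lexx ?orbT.
Qed.

Lemma gholD f g c r : ghol f c r -> ghol g c r -> ghol (fun t => f t + g t) c r.
Proof.
move=> [f1 f2] [g1 g2]; split => [t v ct|t ct].
  by have [a Ha] := f1 t v ct; have [b Hb] := g1 t v ct; exists (a + b); exact: cderD.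
apply: (locbd2 (k := fun x y => x + y)) (f2 t ct) (g2 t ct) _ => a b x y ax by_.
by apply: le_trans (ncD _ _) _; exact: lerD.
Qed.

Lemma gholM f g c r : ghol f c r -> ghol g c r -> ghol (fun t => f t * g t) c r.
Proof.
move=> [f1 f2] [g1 g2]; split => [t v ct|t ct].
  by have [a Ha] := f1 t v ct; have [b Hb] := g1 t v ct; eexists; exact: cderM Ha Hb.
apply: (locbd2 (k := fun x y => x * y)) (f2 t ct) (g2 t ct) _ => a b x y ax by_.
by rewrite ncM; apply: ler_pM; rewrite ?nc_ge0.
Qed.

Lemma ghol_ext f g c r : (forall t, f t = g t) -> ghol f c r -> ghol g c r.
Proof. by move=> /funext ->. Qed.

Lemma gholN f c r : ghol f c r -> ghol (fun t => - f t) c r.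
Proof.
move=> hf; apply: ghol_ext (gholM (ghol_cst (-1) c r) hf) => t; by rewrite mulN1r.
Qed.
Lemma gholB f g c r : ghol f c r -> ghol g c r -> ghol (fun t => f t - g t) c r.
Proof. by move=> hf hg; apply: gholD hf (gholN hg). Qed.
Lemma ghol_sum (I : Type) (s : seq I) (F : I -> T -> C) c r :
  (forall i, ghol (F i) c r) -> ghol (fun t => \sum_(i <- s) F i t) c r.
Proof.
move=> h; elim: s => [|i s IH].
  by apply: ghol_ext (ghol_cst 0 c r) => t; rewrite big_nil.
by apply: ghol_ext (gholD (h i) IH) => t; rewrite big_cons.
Qed.

Lemma ghol_near f g c r : (forall t, pd c r t -> f t = g t) -> ghol f c r -> ghol g c r.
Proof.
move=> fg [h1 h2]; split => [t v ct|t ct].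
  have [d Hd] := h1 t v ct; exists d; have [e e0 He] := pd_open ct.
  apply: (cder_near (r := e / (vn v + 1))) Hd.
    by rewrite divr_gt0// ltr_wpDl ?vn_ge0.
  by move=> h hr; rewrite add0r; apply: fg; exact: pd_trans (line_pd t hr) He.
have [d [M [d0 HM]]] := h2 t ct; have [e e0 He] := pd_open ct.
exists (Num.min d e), M; split => [|s ts]; first by rewrite lt_min d0.
rewrite -fg; first by apply: HM; apply: pd_le ts; rewrite ge_min lexx.
apply: pd_trans (pd_le _ ts) He; by rewrite ge_min lexx orbT.
Qed.

(** On the complex line through [t0] and [t], the points of the segment have discs of a common
    radius inside the polydisc, by convexity, and the one-variable identity theorem applies. *)
Lemma ghol_zero f c r t0 s : ghol f c r -> pd c r t0 -> 0 < s ->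
  (forall t, pd t0 s t -> f t = 0) -> forall t, pd c r t -> f t = 0.
Proof.
move=> hf c0 s0 f0 t ct.
have [d1 d10 H1] := pd_open c0; have [d2 d20 H2] := pd_open ct.
pose v := t - t0; pose m := Num.min d1 d2; have m0 : 0 < m by rewrite lt_min d10.
have K0 : 0 < vn v + 1 by rewrite ltr_wpDl ?vn_ge0.
have -> : t = t0 + 1 *: v by rewrite scale1r /v addrC subrK.
rewrite -[1]add0r; apply: (holo_zero_segment (f := fun x => f (t0 + x *: v)) (d := m / (vn v + 1))).
- by rewrite divr_gt0.
- move=> x /andP[x0 x1]; rewrite mulr1 add0r; apply: ghol_holo hf _ => y yx.
  have -> : t0 + y *: v = (t0 + x%:C *: v) + (y - x%:C) *: v by rewrite -addrA -scalerDl [x%:C + _]addrC subrK.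
  apply: pd_trans (line_pd _ yx) _ => i; rewrite !mxE.
  have -> : t0 0 i + x%:C * (t 0 i - t0 0 i) - c 0 i =
     (1 - x)%:C * (t0 0 i - c 0 i) + x%:C * (t 0 i - c 0 i) by rewrite realCB; ring.
  apply: le_trans (lerD (ncD _ _) (lexx _)) _; rewrite !ncM !ncR (ger0_norm x0).
  rewrite ger0_norm ?subr_ge0//.
  have a1 : nc (t0 0 i - c 0 i) <= r - m by have := H1 i; rewrite lerBrDr; apply: le_trans; rewrite lerD2l ge_min lexx.
  have a2 : nc (t 0 i - c 0 i) <= r - m by have := H2 i; rewrite lerBrDr; apply: le_trans; rewrite lerD2l ge_min lexx orbT.
  have : (1 - x) * nc (t0 0 i - c 0 i) <= (1 - x) * (r - m) by rewrite ler_wpM2l ?subr_ge0.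
  have : x * nc (t 0 i - c 0 i) <= x * (r - m) by rewrite ler_wpM2l.
  lra.
- exists (s / (vn v + 1)) => [|h hs]; first by rewrite divr_gt0.
  by rewrite add0r; apply: f0; exact: line_pd.
Qed.
End PolydiscHolomorphy.

(** * Links with the topology and the derivatives of normed spaces *)

Lemma derivable_dist (K : numFieldType) (V W : normedModType K) (f : V -> W) (a v : V) (D : W) :
  (derivable f a v /\ 'D_v f a = D) <->
  forall e : K, 0 < e -> \forall h \near (0 : K)^', `|D - h^-1 *: (f (h *: v + a) - f a)| <= e.
Proof.
split => [[h1 <-]|h]; first by move/cvgrPdist_le: h1.
have H : (fun h => h^-1 *: ((f \o shift a) (h *: v) - f a)) @ 0^' --> D by apply/cvgrPdist_le.
by split; [apply/cvg_ex; exists D|exact: cvg_lim].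
Qed.

Lemma differentiable_quad (K : numFieldType) (V W : normedModType K) (f : V -> W)
    (df : {linear V -> W}) (x : V) : continuous df ->
  (forall e : K, 0 < e -> \forall v \near (0 : V), `|f (v + x) - (f x + df v)| <= e * `|v|) ->
  differentiable f x.
Proof.
move=> dfc H; have E : f \o shift x = cst (f x) + df +o_ 0 id by apply/eqaddoP.
by apply/diff_locallyP; rewrite (diff_unique dfc E); split.
Qed.

Section Bridges.
Context {R : realType}.
Notation C := (R[i]^o)%type.

Lemma posC (e : R[i]) : 0 < e -> e = (cRe e)%:C /\ 0 < cRe e.
Proof.
by case: e => a b; rewrite ltcE /= => /andP[/eqP -> a0].
Qed.

Lemma nnegC (e : R[i]) : 0 <= e -> e = (cRe e)%:C /\ 0 <= cRe e.
Proof. by case: e => a b; rewrite lecE /= => /andP[/eqP -> a0]. Qed.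

Lemma lec_R (a b : R) : (a%:C <= b%:C :> R[i]) = (a <= b).
Proof. by rewrite lecE /= eqxx. Qed.
Lemma ltc_R (a b : R) : (a%:C < b%:C :> R[i]) = (a < b).
Proof. by rewrite ltcE /= eqxx. Qed.

Lemma mxnormP m n (X : 'M[C]_(m, n)) (x : R) : 0 <= x ->
  `|X| <= x%:C <-> forall i j, nc (X i j) <= x.
Proof.
move=> x0; split => [h i j|h].
  rewrite -lec_R; apply: le_trans h; rewrite -normE [leRHS]/Num.Def.normr /= mx_normE.
  rewrite -[leLHS]nngE num_le; exact: (le_bigmax _ (fun k : 'I_m * 'I_n => `|X k.1 k.2|%:nng) (i, j)).
have [E|/mx_norm_neq0[ij E]] := eqVneq (mx_norm X) 0.
  by rewrite [leLHS]/Num.Def.normr/= E lec_R.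
by rewrite [leLHS]/Num.Def.normr /= E normE lec_R.
Qed.

Lemma mxnorm_ltP m n (X : 'M[C]_(m, n)) (x : R) : 0 < x ->
  `|X| < x%:C <-> forall i j, nc (X i j) < x.
Proof.
move=> x0; split => [h i j|h].
  rewrite -ltc_R; apply: le_lt_trans h; rewrite -normE [leRHS]/Num.Def.normr /= mx_normE.
  rewrite -[leLHS]nngE num_le; exact: (le_bigmax _ (fun k : 'I_m * 'I_n => `|X k.1 k.2|%:nng) (i, j)).
have [E|/mx_norm_neq0[ij E]] := eqVneq (mx_norm X) 0.
  by rewrite [ltLHS]/Num.Def.normr/= E ltc_R.
by rewrite [ltLHS]/Num.Def.normr /= E normE ltc_R.
Qed.

Lemma nbhs_nc (a : C) (P : set C) :
  nbhs a P <-> exists2 d : R, 0 < d & forall h, nc (h - a) < d -> P h.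
Proof.
split => [/nbhs_ballP[e /posC[-> e0] H]|[d d0 H]].
  exists (cRe e) => // h hd; apply: H; rewrite -ball_normE /= normE ltc_R ncC//.
apply/nbhs_ballP; exists d%:C => [|h]; first by rewrite /= ltc_R.
by rewrite -ball_normE /= normE ltc_R ncC; exact: H.
Qed.

Lemma nbhs_mx m n (a : 'M[C]_(m, n)) (P : set 'M[C]_(m, n)) :
  nbhs a P <-> exists2 d : R, 0 < d & forall h : 'M[C]_(m, n), (forall i j, nc (h i j - a i j) < d) -> P h.
Proof.
split => [/nbhs_ballP[e /posC[-> e0] H]|[d d0 H]].
  exists (cRe e) => // h hd; apply: H; rewrite -ball_normE /=.
  by apply/mxnorm_ltP => // i j; rewrite !mxE ncC.
apply/nbhs_ballP; exists d%:C => [|h]; first by rewrite /= ltc_R.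
by rewrite -ball_normE /= => /mxnorm_ltP h1; apply: H => i j; have := h1 d0 i j; rewrite !mxE ncC.
Qed.

Lemma dnbhs0_nc (P : set C) :
  nbhs (0^' : set_system C) P <-> exists2 d : R, 0 < d & forall h, h != 0 -> nc h < d -> P h.
Proof.
rewrite /dnbhs /=; split => [/nbhs_nc[d d0 H]|[d d0 H]].
  by exists d => // h h0 hd; apply: H; rewrite ?subr0//.
by apply/nbhs_nc; exists d => // h; rewrite subr0 => hd h0; exact: H.
Qed.

Lemma derivable_cder (V : normedModType R[i]) m n (f : V -> 'M[C]_(m, n)) (a v : V) D :
  (derivable f a v /\ 'D_v f a = D) <->
  forall i j, cder (fun x => f (a + x *: v) i j) 0 (D i j).
Proof.
split.
  move=> /derivable_dist H i j e e0.
  have /dnbhs0_nc[d d0 Hd] := H e%:C (ltac:(by rewrite ltc_R)).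
  exists d => // h hd; have [->|h0] := eqVneq h 0.
    by rewrite addr0 subrr mulr0 subrr nc0 mulr0.
  have := Hd h h0 hd; move=> /(mxnormP _ (ltW e0))/(_ i j).
  rewrite /= !mxE add0r scale0r addr0 [a + _]addrC -{1}ncN => Q.
  have -> : f (h *: v + a) i j - f a i j - D i j * h =
      h * - (D i j - h^-1 * (f (h *: v + a) i j - f a i j)).
    by field.
  by rewrite ncM mulrC ler_wpM2r ?nc_ge0.
move=> H; apply/derivable_dist => e /posC[-> e0].
have [d Hd] : exists d : 'I_m -> 'I_n -> R, forall i j, 0 < d i j /\ forall h, nc h < d i j ->
    nc (f (a + (0 + h) *: v) i j - f (a + 0 *: v) i j - D i j * h) <= cRe e * nc h.
  have [d Hd] := choice (fun ij => let: ex_intro2 d d0 Hd := H ij.1 ij.2 _ e0 in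
     ex_intro (fun d => 0 < d /\ forall h, nc h < d -> nc (f (a + (0 + h) *: v) ij.1 ij.2 -
      f (a + 0 *: v) ij.1 ij.2 - D ij.1 ij.2 * h) <= cRe e * nc h) d (conj d0 Hd)).
  by exists (fun i j => d (i, j)) => i j; exact: (Hd (i, j)).
pose d0 := \big[Num.min/1]_(ij : 'I_m * 'I_n) d ij.1 ij.2.
apply/dnbhs0_nc; exists d0.
  rewrite /d0; elim/big_ind: _ => // [x y x0 y0|ij _]; first by rewrite lt_min x0.
  exact: (Hd ij.1 ij.2).1.
move=> h h0 hd; apply/mxnormP; first exact: ltW.
move=> i j; rewrite /= !mxE.
have hij : nc h < d i j.
  apply: lt_le_trans hd _; rewrite /d0.
  exact: (@bigmin_le_cond _ _ _ _ (i, j) xpredT (fun ij => d ij.1 ij.2)).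
have := (Hd i j).2 h hij; rewrite add0r scale0r addr0 [a + _]addrC => Q.
have -> : D i j - h^-1 * (f (h *: v + a) i j - f a i j) =
   - (h^-1 * (f (h *: v + a) i j - f a i j - D i j * h)) by field.
rewrite ncN ncM ncV mulrC ler_pdivrMr ?nc_gt0//.
Qed.

Definition mcv m n (u : nat -> 'M[C]_(m, n)) (L : 'M[C]_(m, n)) := forall e : R, 0 < e ->
  exists N, forall k, (N <= k)%N -> forall i j, nc (u k i j - L i j) <= e.

Lemma mcvP m n (u : nat -> 'M[C]_(m, n)) L : mcv u L <-> (u @ \oo --> L).
Proof.
split => [H|/cvgrPdist_le H e e0].
  apply/cvgrPdist_le => e /posC[-> e0]; have [N HN] := H _ e0.
  exists N => // k /= Nk; apply/mxnormP; first exact: ltW.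
  by move=> i j; rewrite !mxE ncC; exact: HN.
have [N _ HN] := H e%:C (ltac:(by rewrite ltc_R)).
exists N => k Nk i j; have := HN k Nk; move=> /(mxnormP _ (ltW e0))/(_ i j).
by rewrite !mxE ncC.
Qed.

Lemma mcv_lim m n (u : nat -> 'M[C]_(m, n)) L : mcv u L -> cvgn u /\ limn u = L.
Proof. by move=> /mcvP h; split; [apply/cvg_ex; exists L|exact: cvg_lim]. Qed.

Lemma cvgn_mcv m n (u : nat -> 'M[C]_(m, n)) : cvgn u -> mcv u (limn u).
Proof. by move=> h; apply/mcvP. Qed.

(** Turns local bounds into a uniform one: [Q m x] weakens as [m] grows, so compactness selects a
    single index. *)
Lemma compact_uniform (X : topologicalType) (K : set X) (Q : nat -> X -> Prop) : compact K ->
  (forall m m' x, (m <= m')%N -> Q m x -> Q m' x) ->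
  (forall x, K x -> exists m, nbhs x (Q m)) -> exists m, forall x, K x -> Q m x.
Proof.
move=> /compact_near_coveringP H mono loc.
have [x Kx|N _ HN] := H nat \oo (fun m x => Q m x) _.
  have [m Hm] := loc x Kx; exists (Q m, [set k | (m <= k)%N]).
    by split => //=; exists m.
  by move=> [y k] /= [Qy mk]; exact: mono mk Qy.
by exists N => x Kx; apply: HN => /=.
Qed.

Lemma rect_compact (a b c d : R) :
  compact [set z : C | a <= cRe z <= b /\ c <= cIm z <= d].
Proof.
pose f (p : R * R) : C := (p.1 +i* p.2).
have cf : continuous f.
  move=> [x y]; apply/cvgrPdist_lt => e /posC[-> e0].
  have e2 : 0 < cRe e / 2 by rewrite divr_gt0.
  exists (ball x (cRe e / 2), ball y (cRe e / 2)).
    by split; apply: nbhsx_ballx.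
  move=> [x' y'] /=; rewrite -!ball_normE /= => -[h1 h2].
  rewrite normE ltc_R; apply: le_lt_trans (nc_le_ReIm _) _.
  by rewrite [ltRHS]splitr; apply: ltrD.
have := continuous_compact (f := f) (A := `[a, b] `*` `[c, d]) _ _.
move=> /(_ (@continuous_subspaceT _ _ _ _ cf)).
move=> /(_ (compact_setX (@segment_compact _ a b) (@segment_compact _ c d))).
congr compact; apply/seteqP; split => [z [[x y] /= [h1 h2] <-] /=|[x y] /= [h1 h2]].
  by rewrite !in_itv /= in h1 h2.
by exists (x, y) => //=; rewrite !in_itv.
Qed.

Lemma rect_bounded (f : C -> C) (a b c d : R) : (forall z, ccont f z) ->
  exists M : R, 0 < M /\ forall z, a <= cRe z <= b -> c <= cIm z <= d -> nc (f z) <= M.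
Proof.
move=> fc.
have [m m1 m2|x _|m Hm] := @compact_uniform C _ (fun m z => nc (f z) <= m.+1%:R) (@rect_compact a b c d).
- by move=> mm /le_trans; apply; rewrite ler_nat ltnS.
- have [e e0 He] := fc x 1 ltr01.
  exists (Num.truncn (nc (f x) + 1)); apply/nbhs_nc; exists e => // h hx.
  have := He (h - x) hx; rewrite [x + _]addrC subrK => Q.
  have := nc_dist (f h) (f x); have := truncnS_gt (nc (f x) + 1); lra.
by exists m.+1%:R; split => [|z h1 h2]; [rewrite ltr0n|apply: Hm].
Qed.
End Bridges.

Section PolydiscBridges.
Context {R : realType} {n : nat}.
Notation C := (R[i]^o)%type.
Notation T := 'rV[R[i]^o]_n.
Implicit Types (t v c : T) (f g : T -> C).

Lemma polydiscP (eps : R) t : 0 <= eps -> polydisc eps t <-> forall i, nc (t 0 i) <= eps.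
Proof.
move=> e0; rewrite /polydisc /=; split; first by move=> /mxnormP H i; exact: H.
by move=> H; apply/mxnormP => // i j; rewrite ord1.
Qed.

Lemma nbhs_pd t (P : set T) : nbhs t P <-> exists2 d : R, 0 < d & forall s, pd t d s -> P s.
Proof.
split => [/nbhs_mx[d d0 H]|[d d0 H]].
  by exists d => // s ts; apply: H => i j; rewrite ord1.
by apply/nbhs_mx; exists d => // s ts; apply: H => i.
Qed.

Lemma open_pd (O : set T) t : open O -> O t -> exists2 d : R, 0 < d & forall s, pd t d s -> O s.
Proof. by move=> oO Ot; apply/nbhs_pd; exact: open_nbhs_nbhs. Qed.

Lemma pd_is_open c r : open (pd c r : set T).
Proof.
rewrite openE => t ct; have [d d0 Hd] := pd_open ct.
by apply/nbhs_pd; exists d => // s ts; exact: pd_trans ts Hd.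
Qed.

Lemma polydisc_compact (eps : R) : 0 <= eps -> compact (polydisc eps : set T).
Proof.
move=> e0; have K : compact [set z : C | nc z <= eps].
  apply: (subclosed_compact _ (@rect_compact R (- eps) eps (- eps) eps)).
    rewrite closedE => z /= nz; rewrite leNgt; apply/negP => ze; apply: nz.
    apply/nbhs_nc; exists (nc z - eps); first by rewrite subr_gt0.
    move=> h hz /= he; have := nc_dist z h; rewrite ncC; lra.
  move=> z /= ze; rewrite -!ler_norml; split.
    exact: le_trans (Re_le_nc z) ze.
  exact: le_trans (Im_le_nc z) ze.
have := @rV_compact C n (fun=> [set z : C | nc z <= eps]) (fun=> K).
congr compact; apply/seteqP; split => t /=.
  by move=> H; apply/polydiscP.
by move=> /(polydiscP _ e0).
Qed.

(** The closed polydisc has a Lebesgue number [d] in the open set; the contraction by [k] moves a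
    point of the larger polydisc into the closed one by less than [d]. *)
Lemma polydisc_nbhs (eps : R) (O : set T) : 0 <= eps -> open O -> polydisc eps `<=` O ->
  exists2 d : R, 0 < d & forall t, pd 0 (eps + d) t -> O t.
Proof.
move=> e0 oO sub.
have [m m' x mm|x|m Hm] := @compact_uniform T (polydisc eps)
    (fun m x => forall s, pd x (m.+1%:R^-1) s -> O s) (polydisc_compact e0).
- move=> H s xs; apply: H; apply: pd_le xs.
  by rewrite lef_pV2 ?posrE ?ltr0n// ler_nat ltnS.
- move=> /sub Ox; have [d d0 Hd] := open_pd oO Ox.
  have d2 : 0 < d / 2 by rewrite divr_gt0.
  exists (Num.truncn (d / 2)^-1); apply/nbhs_pd; exists (d / 2) => // y xy s ys.
  apply: Hd => i; apply: le_lt_trans (nc_triangle _ (y 0 i) _) _.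
  rewrite [ltRHS]splitr; apply: ltrD (xy i); apply: lt_le_trans (ys i) _.
  rewrite invf_ple ?posrE ?ltr0n//; exact: ltW (truncnS_gt _).
pose d : R := m.+1%:R^-1.
have d0 : 0 < d by rewrite invr_gt0 ltr0n.
exists d => // t td.
pose k : R := eps / (eps + d).
have k0 : 0 <= k by rewrite divr_ge0// addr_ge0// ltW.
have ed : 0 < eps + d by rewrite ltr_wpDl.
have H i : nc (t 0 i) < eps + d by have := td i; rewrite mxE subr0.
apply: (Hm (k%:C *: t)).
  apply/polydiscP => // i; rewrite mxE ncM ncR ger0_norm//.
  rewrite /k mulrAC ler_pdivrMr// ler_wpM2l//; exact: ltW.
move=> i; rewrite mxE -{1}[t 0 i]mul1r -mulrBl ncM -realC1 -realCB ncR.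
rewrite ger0_norm ?subr_ge0; last by rewrite /k ler_pdivrMr// mul1r lerDl ltW.
have -> : 1 - k = d / (eps + d) by rewrite /k; field; rewrite gt_eqF.
by rewrite mulrAC ltr_pdivrMr// ltr_pM2l.
Qed.

(** The step along [w] starts at the moved point [t + h *: v]: Cauchy's quadratic bound controls it
    uniformly in [h], and the continuity of [pder f w] brings its derivative back to [t]. *)
Lemma pderD f c r t v w : ghol f c r -> pd c r t ->
  pder f (v + w) t = pder f v t + pder f w t.
Proof.
move=> hf ct; apply: pderP => e e0.
have [d d0 [M HM]] := bidisc v w hf ct.
have n0 : nc (0 : C) < d by rewrite nc0.
have M0 : 0 <= M by apply: le_trans (HM 0 0 n0 n0).2; exact: nc_ge0.
have e3 : 0 < e / 3 by rewrite divr_gt0.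
have [d1 d10 H1] := ghol_pder v hf ct e3.
have [d2 d20 H2] := cder_cont (ghol_pder v (ghol_pder_ghol w hf) ct) e3.
pose K := 8 * M / d ^+ 2.
have K0 : 0 <= K by rewrite divr_ge0 ?mulr_ge0 ?exprn_ge0// ltW.
pose d3 := e / 3 / (K + 1).
have d30 : 0 < d3 by rewrite divr_gt0// ltr_wpDl.
exists (Num.min (d / 4) (Num.min d1 (Num.min d2 d3))); first by rewrite !lt_min d10 d20 d30 divr_gt0.
move=> h; rewrite !lt_min => /and4P[h0 h1 h2 h3].
have hd : nc h < d by apply: lt_le_trans h0 _; rewrite ler_pdivrMr// ler_peMr ?ltW// ltr1n.
have := H1 h h1; have := H2 h h2.
have := (@ghol_cauchy R n f c r (t + h *: v) w d M hf d0 (fun x xd => (HM h x hd xd).1)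
  (fun x xd => (HM h x hd xd).2)).2 h (ltW h0).
rewrite !add0r !scale0r !addr0 => Q1 Q2 Q3.
have -> : t + h *: (v + w) = t + h *: v + h *: w by rewrite scalerDr addrA.
set a := f (t + h *: v + h *: w) in Q1 *; set b := f (t + h *: v) in Q1 Q3 *.
set p := pder f w (t + h *: v) in Q1 Q2.
have -> : a - f t - (pder f v t + pder f w t) * h = (a - b - h * p) +
   (h * (p - pder f w t) + (b - f t - pder f v t * h)) by ring.
apply: le_trans (ncD _ _) _; apply: le_trans (lerD (lexx _) (ncD _ _)) _.
have Q4 : K * nc h ^+ 2 <= e / 3 * nc h.
  rewrite expr2 mulrA ler_wpM2r ?nc_ge0//; apply: le_trans (ler_wpM2l K0 (ltW h3)) _.
  by rewrite /d3 mulrCA ler_piMr ?(ltW e3)// ler_pdivrMr ?ltr_wpDl// mul1r lerDl.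
have Q5 : nc (h * (p - pder f w t)) <= e / 3 * nc h by rewrite ncM mulrC; apply: ler_wpM2r; [exact: nc_ge0|exact: ltW].
have := le_trans Q1 Q4; lra.
Qed.

Lemma pderZ f c r t v (x : C) : ghol f c r -> pd c r t -> pder f (x *: v) t = x * pder f v t.
Proof.
move=> hf ct; apply: pderP.
apply: cder_ext (cder_eq (@cder_comp R (fun y => f (t + y *: v)) (fun y => y * x) 0 _ _ _ _) _).
- by move=> y /=; rewrite scalerA.
- exact: cderM (cder_id 0) (cder_cst x 0).
- by rewrite mul0r; exact: ghol_pder hf ct.
by rewrite mul1r mulr0 addr0 mulrC.
Qed.

Lemma ghol_quad f c r t : ghol f c r -> pd c r t -> exists K d : R, [/\ 0 < d, 0 <= K &
  forall v, (forall i, nc (v 0 i) < d) -> nc (f (t + v) - f t - pder f v t) <= K * vn v ^+ 2].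
Proof.
move=> hf ct; have [e [M [e0 HM]]] := hf.2 t ct; have [d d0 Hd] := pd_open ct.
have M0 : 0 <= M by apply: le_trans (HM t (pd_center t e0)); exact: nc_ge0.
pose m := Num.min e d; have m0 : 0 < m by rewrite lt_min e0.
have n1 : (0 : R) < n%:R + 1 by rewrite ltr_wpDl ?ler0n.
pose del : R := m / 8 / (n%:R + 1).
have del0 : 0 < del by rewrite !divr_gt0.
exists (8 * M / m ^+ 2 * 4), del; split => //.
  by rewrite mulr_ge0// divr_ge0 ?mulr_ge0 ?exprn_ge0// ltW.
move=> v vd.
have [V0|V0] := eqVneq (vn v) 0.
  have -> : v = 0.
    apply/rowP => i; rewrite mxE; apply/eqP; rewrite -nc_eq0 eq_le nc_ge0 andbT -V0; exact: nc_le_vn.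
  have -> : pder f 0 t = 0 by apply: pderP; apply: cder_ext (cder_cst (f t) 0) => x; rewrite scaler0 addr0.
  by rewrite addr0 !subrr nc0 mulr_ge0 ?exprn_ge0 ?vn_ge0// mulr_ge0// divr_ge0 ?mulr_ge0 ?exprn_ge0// ltW.
have Vp : 0 < vn v by rewrite lt_def V0 vn_ge0.
have Vm : vn v <= m / 8.
  apply: (@le_trans _ _ (\sum_(i < n) del)); first by apply: ler_sum => i _; exact: ltW.
  have E : del * (n%:R + 1) = m / 8 by rewrite /del divfK// gt_eqF.
  by rewrite -E (sumr_const _ del) card_ord -[X in X <= _]mulr_natr ler_wpM2l// ?lerDl// ltW.
(* Discs of radius [q] in the direction [v] stay inside the polydisc of radius [m]; [q >= 4] puts
   the increment 1 into the quarter disc where [ghol_cauchy] gives its quadratic bound. *)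
pose q : R := m / 2 / vn v.
have q0 : 0 < q by rewrite !divr_gt0.
have q4 : 4 <= q by rewrite /q ler_pdivlMr//; lra.
have L (x : C) : nc x < q -> pd t m (t + x *: v).
  move=> xq; apply/pd_line => i; rewrite ncM.
  apply: (@le_lt_trans _ _ (q * vn v)); first by apply: ler_pM; rewrite ?nc_ge0 ?nc_le_vn// ltW.
  by rewrite /q divfK//; lra.
have := (@ghol_cauchy R n f c r t v q M hf q0 _ _).2 1; rewrite nc1 mul1r scale1r.
have -> : 8 * M / q ^+ 2 * 1 ^+ 2 = 8 * M / m ^+ 2 * 4 * vn v ^+ 2 by rewrite /q; field; rewrite V0 gt_eqF.
apply.
- move=> x /L h; apply: pd_trans (pd_le _ h) Hd; by rewrite ge_min lexx orbT.
- by move=> x /L h; apply: HM; apply: pd_le h; rewrite ge_min lexx.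
- by rewrite ler_pdivlMr// mul1r.
Qed.

Lemma ghol_differentiable p q (g : T -> 'M[C]_(p, q)) c r t :
  (forall i j, ghol (fun s => g s i j) c r) -> pd c r t -> differentiable g t.
Proof.
move=> hg ct.
pose L (v : T) : 'M[C]_(p, q) := \matrix_(i, j) pder (fun s => g s i j) v t.
have lin : linear L.
  move=> a v w; apply/matrixP => i j; rewrite !mxE.
  by rewrite (pderD _ _ (hg i j) ct) (pderZ _ _ (hg i j) ct).
pose Ll : {linear T -> 'M[C]_(p, q)} := HB.pack L (GRing.isLinear.Build _ _ _ _ L lin).
have [K HK] := choice (fun ij : 'I_p * 'I_q => ghol_quad (hg ij.1 ij.2) ct).
have [d Hd] := choice HK.
pose d0 := \big[Num.min/1]_ij d ij.
have d00 : 0 < d0.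
  rewrite /d0; elim/big_ind: _ => // [x y x0 y0|ij _]; first by rewrite lt_min x0.
  by have [] := Hd ij.
have dd ij : d0 <= d ij by exact: bigmin_le_cond.
pose K0 := \sum_ij K ij.
have KK ij : K ij <= K0 by rewrite /K0 (bigD1 ij)//= lerDl sumr_ge0// => k _; have [] := Hd k.
have K00 : 0 <= K0 by apply: sumr_ge0 => k _; have [] := Hd k.
pose B : R := \sum_k \sum_i \sum_j nc (L (delta_mx 0 k) i j).
have LB v (x : R) i j : 0 <= x -> (forall k, nc (v 0 k) <= x) -> nc (L v i j) <= x * B.
  move=> x0 vx; have -> : L v = \sum_k v 0 k *: L (delta_mx 0 k).
    rewrite {1}[v]row_sum_delta -[L]/(Ll : _ -> _) linear_sum; apply: eq_bigr => k _; by rewrite linearZ.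
  rewrite summxE; apply: le_trans (nc_sum _ _ _) _; rewrite /B mulr_sumr.
  apply: ler_sum => k _; rewrite mxE ncM; apply: ler_pM; rewrite ?nc_ge0//.
  rewrite (bigD1 i)//= (bigD1 j)//= -addrA lerDl addr_ge0// ?sumr_ge0// => i' _; rewrite ?nc_ge0//.
  by rewrite sumr_ge0// => j' _; rewrite nc_ge0.
have B0 : 0 <= B by rewrite /B; do 3!apply: sumr_ge0 => ? _; exact: nc_ge0.
have B1 : 0 < B + 1 by rewrite ltr_wpDl.
have Lc : continuous Ll.
  move=> v A /nbhs_mx[e e0 He]; apply/nbhs_pd; exists (e / (B + 1)); first by rewrite divr_gt0.
  move=> w vw; apply: He => i j.
  have -> : Ll w i j - Ll v i j = L (w - v) i j by rewrite -[L]/(Ll : _ -> _) linearB !mxE.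
  apply: le_lt_trans (LB _ (e / (B + 1)) i j _ _) _.
  - by rewrite divr_ge0// ltW.
  - by move=> k; rewrite !mxE; exact: ltW (vw k).
  - by rewrite -mulrA gtr_pMr// mulrC ltr_pdivrMr// mul1r ltrDl.
apply: (differentiable_quad Lc) => e /posC[-> e0].
  pose k := cRe e.
  have n1 : (0 : R) < n%:R + 1 by rewrite ltr_wpDl ?ler0n.
  pose KN := K0 * n%:R ^+ 2 + 1.
  have KN0 : 0 < KN by rewrite ltr_wpDl// mulr_ge0// exprn_ge0.
  have kk : 0 < k / KN by rewrite divr_gt0.
  apply/nbhs_pd; exists (Num.min d0 (k / KN)); first by rewrite lt_min d00.
  move=> v vd.
  have vd' i : nc (v 0 i) < Num.min d0 (k / KN) by have := vd i; rewrite mxE subr0.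
  have [nv nv0] : exists2 x : R, 0 <= x & `|v| = x%:C by have [E1 E2] := nnegC (normr_ge0 v); exists (cRe `|v|).
  move=> Ev; have vx i : nc (v 0 i) <= nv.
    by apply: (mxnormP v nv0).1; rewrite Ev.
  have nvk : nv <= k / KN.
    rewrite -lec_R -Ev; apply/mxnormP; first exact: ltW.
    by move=> i j; rewrite ord1; have := vd' j; rewrite lt_min => /andP[_ /ltW].
  rewrite Ev -realCM; apply/mxnormP; first by rewrite mulr_ge0// ltW.
  move=> i j; have [h1 h2 h3] := Hd (i, j).
  have := h3 v _; rewrite /= => /(_ _)/le_trans.
  have -> : (g (v + t) - (g t + Ll v)) i j =
     g (t + v) i j - g t i j - pder (fun s => g s i j) v t.
    by rewrite !mxE [v + t]addrC opprD addrA.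
  apply.
    by move=> l; have := vd' l; rewrite lt_min => /andP[/lt_le_trans + _]; apply.
  have vn1 : vn v <= n%:R * nv.
    rewrite /vn; apply: le_trans (ler_sum (G := fun=> nv) _ _) _ => //.
    by rewrite (sumr_const _ nv) card_ord -[X in X <= _]mulr_natl.
  apply: (@le_trans _ _ (K0 * (n%:R * nv) ^+ 2)).
    by apply: ler_pM => //; [rewrite exprn_ge0 ?vn_ge0|rewrite lerXn2r ?nnegrE ?vn_ge0 ?mulr_ge0].
  rewrite (_ : K0 * _ = K0 * n%:R ^+ 2 * nv * nv); last by ring.
  rewrite ler_wpM2r//.
  apply: (@le_trans _ _ (KN * nv)); first by rewrite ler_wpM2r// /KN lerDl.
  by rewrite mulrC -ler_pdivlMr.
Qed.
End PolydiscBridges.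

(** * Linear differential equations on the real line *)

Section LinearODE.
Context {R : realType}.
Notation C := (R[i]^o)%type.

Definition tail (b : R^nat) (k : nat) : R := limn (series b) - series b k.

Lemma tail_small (b : R^nat) (e : R) : cvgn (series b) -> 0 < e ->
  exists N, forall k, (N <= k)%N -> `|tail b k| < e.
Proof.
by move=> /cvgrPdist_lt H e0; have [N _ HN] := H e e0; exists N => k Nk; exact: HN.
Qed.

(** Real and imaginary parts converge by comparison; the tail of the majorant is kept as an explicit
    error, from which the uniform limits below are obtained. *)
Lemma csum (u : nat -> C) (b : R^nat) : cvgn (series b) -> (forall k, nc (u k) <= b k) ->
  exists L : C, forall k, nc (\sum_(j < k) u j - L) <= tail b k.
Proof.
move=> cb ub.
have cg (g : C -> R) : (forall z, `|g z| <= nc z) -> cvgn (series (fun k => g (u k))).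
  move=> gn; apply: normed_cvg; apply: series_le_cvg cb.
  - by move=> k /=; exact: normr_ge0.
  - by move=> k; apply: le_trans (ub k); exact: nc_ge0.
  - by move=> k /=; apply: le_trans (gn _) (ub k).
have /cvgrPdist_lt cr := cg (@cRe R) (@Re_le_nc R).
have /cvgrPdist_lt ci := cg (@cIm R) (@Im_le_nc R).
set L : C := limn (series (fun k => cRe (u k))) +i*
             limn (series (fun k => cIm (u k))).
have S k : \sum_(j < k) u j = (series (fun k => cRe (u k)) k +i*
    series (fun k => cIm (u k)) k).
  rewrite /series /= !big_mkord; elim: k => [|k IH]; first by rewrite !big_ord0.
  by rewrite !big_ord_recr /= IH; case: (u k).
exists L => k; apply/ler_addgt0Pr => e e0.
have e2 : 0 < e / 2 by rewrite divr_gt0.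
have [N1 _ H1] := cr _ e2; have [N2 _ H2] := ci _ e2.
pose m := (k + N1 + N2)%N.
have Lm : nc (\sum_(j < m) u j - L) <= e.
  rewrite S; apply: le_trans (nc_le_ReIm _) _; rewrite [leRHS]splitr.
  apply: lerD; rewrite /= distrC; apply: ltW; [apply: H1|apply: H2]; rewrite /= /m.
    by rewrite addnAC leq_addl.
  by rewrite leq_addl.
have nd : nondecreasing_seq (series b) by apply/nondecreasing_seqP => j; rewrite /series /= big_nat_recr//= lerDl; apply: le_trans (ub j); exact: nc_ge0.
have km : nc (\sum_(j < k) u j - \sum_(j < m) u j) <= series b m - series b k.
  rewrite ncC /m -addnA; elim: (N1 + N2)%N => [|j IH]; first by rewrite addn0 !subrr nc0.
  rewrite addnS big_ord_recr /= addrAC; apply: le_trans (ncD _ _) _.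
  have -> : series b (k + j).+1 = series b (k + j)%N + b (k + j)%N by rewrite /series /= big_nat_recr.
  by rewrite addrAC; exact: lerD.
have := nondecreasing_cvgn_le nd cb m.
have := nc_triangle (\sum_(j < k) u j) (\sum_(j < m) u j) L.
rewrite /tail; lra.
Qed.

(** The integral of [f] from 0 to [x], rescaled to the unit interval so that one formula serves both
    signs of [x]. *)
Definition prim (f : R -> C) (x : R) : C := cint (fun s => x%:C * f (s * x)) 0 1.

Lemma rcont_scale (f : R -> C) (x s : R) : rcont f (s * x) -> rcont (fun s => f (s * x)) s.
Proof.
move=> fc e e0; have [d d0 Hd] := fc e e0.
exists (d / (`|x| + 1)); first by rewrite divr_gt0// ltr_wpDl.
move=> h hd; rewrite mulrDl; apply: Hd; rewrite normrM.
move: hd; rewrite ltr_pdivlMr ?ltr_wpDl//; apply: le_lt_trans.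
by rewrite ler_wpM2l// lerDl.
Qed.

Lemma primE (f P : R -> C) (x a b : R) : a <= 0 <= b -> a <= x <= b ->
  (forall y, a <= y <= b -> rder P y (f y)) -> prim f x = P x - P 0.
Proof.
move=> /andP[a0 b0] /andP[ax xb] HP; rewrite /prim.
rewrite (cintE (P := fun s => P (s * x)) ler01); first by rewrite mul1r mul0r.
move=> s /andP[s0 s1]; apply: rder_eq (rder_compr (g := fun s => s * x) (dr_eq (drM (dr_id s) (dr_cst x s)) _) (HP _ _)) _.
- by rewrite mul1r mulr0 addr0.
- have [x0|x0] := leP 0 x.
    by rewrite (le_trans a0) ?mulr_ge0//= (le_trans _ xb)// ler_piMl.
  rewrite (le_trans ax)/=; last by rewrite ler_niMl// ltW.
  by rewrite (le_trans _ b0)// mulr_ge0_le0// ltW.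
- by rewrite mulrC.
Qed.

Lemma prim0 (f : R -> C) : prim f 0 = 0.
Proof.
rewrite /prim (cintE (P := fun=> 0) ler01) ?subrr// => s _.
by apply: rder_eq (rder_cst 0 s) _; rewrite realC0 mul0r.
Qed.

Lemma rder_near (f g : R -> C) s d (r : R) : 0 < r -> (forall h, `|h| < r -> f (s + h) = g (s + h)) ->
  rder f s d -> rder g s d.
Proof.
move=> r0 fg fd e e0; have [t t0 Ht] := fd e e0.
exists (Num.min r t); first by rewrite lt_min r0.
move=> h; rewrite lt_min => /andP[h1 h2]; rewrite -fg// -[s]addr0 -fg ?normr0// addr0.
exact: Ht.
Qed.

Lemma prim_rder (f : R -> C) x : (forall y, rcont f y) -> rder (prim f) x (f x).
Proof.
move=> fc; pose a := - (`|x| + 1); pose b := `|x| + 1.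
have [P HP] := @integ_cont R f a b (fun y _ => fc y).
have ab : a <= 0 <= b by rewrite /a /b oppr_le0 addr_ge0.
have xx := ler_norm x; have xx' := ler_norm (- x); rewrite normrN in xx'.
apply: (rder_near (f := fun y => P y - P 0) (r := 1)) => //.
  move=> h; rewrite ltr_norml => /andP[h1 h2].
  by rewrite (primE (P := P) ab)// /a /b; apply/andP; split; lra.
apply: rder_eq (rderB (HP x _) (rder_cst (P 0) x)) _; last by rewrite subr0.
by rewrite /a /b; apply/andP; split; lra.
Qed.

Lemma prim_bound (f : R -> C) (K x : R) k : (forall y, rcont f y) -> 0 <= K ->
  (forall y, nc (f y) <= K * `|y| ^+ k) -> nc (prim f x) <= K * `|x| ^+ k.+1 / k.+1%:R.
Proof.
move=> fc K0 fK; rewrite /prim.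
have k0 : k.+1%:R != 0 :> R by rewrite pnatr_eq0.
have drX (s : R) m : dr (fun s => s ^+ m.+1) s (m.+1%:R * s ^+ m).
  elim: m => [|m IH]; first by apply: dr_eq (dr_id s) _; rewrite expr0 mulr1.
  apply: dr_ext (dr_eq (drM (dr_id s) IH) _) => [y|]; first exact/esym/exprS.
  rewrite -[m.+2]addn1 natrD exprS; ring.
have := @cint_bound_le R (fun s => x%:C * f (s * x)) (fun s => K * `|x| ^+ k.+1 / k.+1%:R * s ^+ k.+1)
  (fun s => K * `|x| ^+ k.+1 * s ^+ k) 0 1 ler01.
rewrite expr1n mulr1 expr0n /= mulr0 subr0; apply.
- apply: integZ; apply: integ_cont => s _; apply: rcont_scale; exact: fc.
- move=> s _; apply: dr_eq (drZ _ (drX s k)) _; by rewrite mulrA divfK.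
- move=> s /andP[s0 s1]; rewrite ncM ncR; apply: le_trans (ler_wpM2l (normr_ge0 x) (fK _)) _.
  rewrite normrM (ger0_norm s0) exprMn; apply: le_of_eq; rewrite exprS; ring.
Qed.

Variables (n : nat).
Notation M_n := 'M[R[i]^o]_n.

Definition mrd (X : R -> M_n) (s : R) (D : M_n) := forall i j, rder (fun s => X s i j) s (D i j).
Definition mder (X : C -> M_n) (w : C) (D : M_n) := forall i j, cder (fun s => X s i j) w (D i j).

(** The k-th term of the Peano-Baker series, that is, the difference of consecutive Picard
    approximations. *)
Fixpoint pic (M : R -> M_n) k (x : R) : M_n := match k with
 | 0%N => 1%:M
 | k'.+1 => \matrix_(i, j) prim (fun s => (M s *m pic M k' s) i j) x
 end.

Lemma nc_mx1 (i j : 'I_n) : nc ((1%:M : M_n) i j) <= 1.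
Proof. by rewrite mxE; case: (i == j); rewrite ?nc1 ?nc0. Qed.

Lemma nc_mulmx (A B : M_n) (a b : R) i j : (forall i j, nc (A i j) <= a) ->
  (forall i j, nc (B i j) <= b) -> nc ((A *m B) i j) <= n%:R * a * b.
Proof.
move=> Aa Bb; rewrite mxE; apply: le_trans (nc_sum _ _ _) _.
apply: (@le_trans _ _ (\sum_(l < n) a * b)).
  by apply: ler_sum => l _; rewrite ncM; apply: ler_pM; rewrite ?nc_ge0.
by rewrite (sumr_const _ (a * b)) card_ord -[X in X <= _]mulr_natl mulrA.
Qed.

Lemma rcont_mulmx (A B : R -> M_n) s i j : (forall i j, rcont (fun s => A s i j) s) ->
  (forall i j, rcont (fun s => B s i j) s) -> rcont (fun s => (A s *m B s) i j) s.
Proof.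
move=> Ac Bc; apply: (rcont_ext (f := fun s => \sum_l A s i l * B s l j)) => [x|]; first by rewrite mxE.
by apply: rcont_sum => l; apply: rcontM.
Qed.

Section Picard.
Variables (M : R -> M_n) (B : R).
Hypothesis Mc : forall s i j, rcont (fun s => M s i j) s.
Hypothesis MB : forall s i j, nc (M s i j) <= B.

Lemma pic_cont k s i j : rcont (fun s => pic M k s i j) s.
Proof.
elim: k s i j => [|k IH] s i j /=; first exact: rcont_cst.
apply: (rcont_ext (f := prim (fun s => (M s *m pic M k s) i j))) => [x|]; first by rewrite mxE.
apply: rder_cont (prim_rder _ _) => y; exact: rcont_mulmx.
Qed.

Lemma picS_rd k s : mrd (pic M k.+1) s (M s *m pic M k s).
Proof.
move=> i j /=; apply: (rder_ext (f := prim (fun s => (M s *m pic M k s) i j))) => [x|]; first by rewrite mxE.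
by apply: prim_rder => y; apply: rcont_mulmx => // *; exact: pic_cont.
Qed.

Lemma pic_bound k x i j : nc (pic M k x i j) <= (n%:R * B * `|x|) ^+ k / k`!%:R.
Proof.
have B0 : 0 <= B by apply: le_trans (MB 0 i j); exact: nc_ge0.
elim: k x i j => [|k IH] x i j /=.
  by rewrite expr0 fact0 divr1 nc_mx1.
rewrite mxE; apply: le_trans (prim_bound (K := (n%:R * B) ^+ k.+1 / k`!%:R) (k := k) _ _ _ _) _.
- by move=> y; apply: rcont_mulmx => // *; exact: pic_cont.
- by rewrite divr_ge0// exprn_ge0// mulr_ge0.
- move=> y; apply: le_trans (nc_mulmx (a := B) _ _ (MB y) (IH y)) _.
  by rewrite exprMn exprS -!mulrA [_ ^+ _ / _]mulrC lexx.
- rewrite factS natrM !exprMn invfM.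
  move: (k.+1%:R^-1) (k`!%:R^-1) => a b; apply: le_of_eq; ring.
Qed.

(** The sum of the Peano-Baker series. It is selected by its tail bound, so that later estimates
    quote this bound and never the selection. *)
Definition ode (x : R) : M_n := \matrix_(i, j)
  xget 0 [set L : C | forall k, nc (\sum_(l < k) pic M l x i j - L) <= tail (exp_coeff (n%:R * B * `|x|)) k].

Lemma odeP x i j k : nc (\sum_(l < k) pic M l x i j - ode x i j) <= tail (exp_coeff (n%:R * B * `|x|)) k.
Proof.
rewrite /ode mxE; case: xgetP => [L _ //|].
have [L HL] := @csum (fun l => pic M l x i j) (exp_coeff (n%:R * B * `|x|)) (is_cvg_series_exp_coeff _)
   (fun l => pic_bound l x i j).
by move=> /(_ L) [].
Qed.

Lemma tail_exp_le (x y : R) k : 0 <= x -> x <= y -> tail (exp_coeff x) k <= tail (exp_coeff y) k.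
Proof.
move=> x0 xy; rewrite /tail.
have cx := is_cvg_series_exp_coeff x; have cy := is_cvg_series_exp_coeff y.
have nd : nondecreasing_seq (series (exp_coeff y) - series (exp_coeff x)).
  apply/nondecreasing_seqP => j; rewrite !fctE /series /= !big_nat_recr//= opprD addrACA lerDl subr_ge0.
  by rewrite /exp_coeff ler_wpM2r ?invr_ge0// lerXn2r// nnegrE (le_trans x0).
have := nondecreasing_cvgn_le nd (is_cvgB cy cx) k; rewrite (limB cy cx).
move=> /(_ _); rewrite -[(_ - _) k]/(series (exp_coeff y) k - series (exp_coeff x) k) => h.
lra.
Qed.

Lemma ode_bound x i j : nc (ode x i j) <= expR (n%:R * B * `|x|).
Proof.
have := odeP x i j 0; rewrite big_ord0 sub0r ncN /tail /series /= big_geq// subr0; apply.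
Qed.

Lemma ode0 : ode 0 = 1%:M.
Proof.
apply/matrixP => i j; apply: nc_le0_eq.
have := odeP 0 i j 1; rewrite big_ord1 /= ncC => /le_trans; apply.
rewrite normr0 mulr0 /tail series_exp_coeff0; have := expR0 R; rewrite /expR => ->.
by rewrite subrr.
Qed.

Lemma ode_rcont x i j : rcont (fun x => ode x i j) x.
Proof.
have B0 : 0 <= B by apply: le_trans (MB 0 i j); exact: nc_ge0.
move=> e e0; have e4 : 0 < e / 4 by rewrite divr_gt0.
pose X := `|x| + 1.
have [N HN] := tail_small (is_cvg_series_exp_coeff (n%:R * B * X)) e4.
have {}HN y : `|y| <= X -> nc (\sum_(l < N) pic M l y i j - ode y i j) < e / 4.
  move=> yX; apply: le_lt_trans (odeP y i j N) _; apply: le_lt_trans (HN N (leqnn N)).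
  apply: le_trans (tail_exp_le _ _ _) (ler_norm _); first by rewrite !mulr_ge0.
  by rewrite ler_wpM2l// mulr_ge0.
have cS : rcont (fun y => \sum_(l < N) pic M l y i j) x by apply: rcont_sum => l; exact: pic_cont.
have [d d0 Hd] := cS _ e4; exists (Num.min d 1); first by rewrite lt_min d0 ltr01.
move=> h; rewrite lt_min => /andP[h1 h2].
have X1 : `|x| <= X by rewrite /X lerDl.
have X2 : `|x + h| <= X by apply: le_trans (ler_normD _ _) _; rewrite /X lerD2l ltW.
have := HN _ X1; have := HN _ X2; have := Hd h h1; rewrite [nc (_ - ode (x + h) i j)]ncC => a1 a2 a3.
have := nc_triangle (ode (x + h) i j) (\sum_(l < N) pic M l (x + h) i j) (ode x i j).
have := nc_triangle (\sum_(l < N) pic M l (x + h) i j) (\sum_(l < N) pic M l x i j) (ode x i j).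
lra.
Qed.

(** The partial sums satisfy the integral equation up to a shift of the index, [S N.+1] against
    [S N]; the tails bound the error on both sides. *)
Lemma ode_integral x i j : ode x i j = (1%:M : M_n) i j + prim (fun s => (M s *m ode s) i j) x.
Proof.
have B0 : 0 <= B by apply: le_trans (MB 0 i j); exact: nc_ge0.
have Oc y : rcont (fun s => (M s *m ode s) i j) y by apply: rcont_mulmx => // *; exact: ode_rcont.
apply: nc_eps_eq => e e0.
pose K := n%:R * B * `|x| + 1.
have K0 : 0 < K by rewrite ltr_wpDl// !mulr_ge0.
have e2 : 0 < e / K / 2 by rewrite !divr_gt0.
have e3 : 0 < e / 2 by rewrite divr_gt0.
pose X := `|x|.
have [N1 HN1] := tail_small (is_cvg_series_exp_coeff (n%:R * B * X)) e2.
have [N2 HN2] := tail_small (is_cvg_series_exp_coeff (n%:R * B * X)) e3.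
pose N := maxn N1 N2.
pose S k (y : R) : M_n := \matrix_(i, j) \sum_(l < k) pic M l y i j.
have Sc k i' j' y : rcont (fun y => S k y i' j') y.
  apply: (rcont_ext (f := fun s => \sum_(l < k) pic M l s i' j')) => [z|]; first by rewrite mxE.
  by apply: rcont_sum => l; exact: pic_cont.
have SE : S N.+1 x i j = (1%:M : M_n) i j + prim (fun s => (M s *m S N s) i j) x.
  rewrite mxE big_ord_recl /=; congr (_ + _).
  rewrite (primE (P := fun y => \sum_(l < N) pic M l.+1 y i j) (a := - `|x|) (b := `|x|)).
  - by rewrite [X in _ - X]big1 ?subr0 // => l _; rewrite /= mxE prim0.
  - by rewrite oppr_le0 normr_ge0.
  - by rewrite -ler_norml.
  - move=> y _; apply: rder_eq (@rder_sum R _ (index_enum 'I_N) (fun l y => pic M l.+1 y i j) (fun l => (M y *m pic M l y) i j) y _) _.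
      by move=> l; exact: picS_rd.
    rewrite mxE; under [RHS]eq_bigr do rewrite mxE mulr_sumr.
    by rewrite exchange_big; apply: eq_bigr => l _; rewrite mxE.
have XX : `|x| <= X by [].
have a1 : nc (S N.+1 x i j - ode x i j) <= e / 2.
  rewrite mxE; apply: le_trans (odeP x i j N.+1) _; apply: le_trans (ler_norm _) (ltW (HN2 _ _)).
  by rewrite (leq_trans (leq_maxr N1 N2)).
have a2 : nc (prim (fun s => (M s *m S N s) i j) x - prim (fun s => (M s *m ode s) i j) x) <= e / 2.
  rewrite /prim -cintB//; last 2 first.
  - by apply: integZ; apply: integ_cont => s _; apply: (rcont_scale (f := fun s => (M s *m S N s) i j)); exact: rcont_mulmx.
  - by apply: integZ; apply: integ_cont => s _; apply: (rcont_scale (f := fun s => (M s *m ode s) i j)); exact: Oc.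
  have -> : e / 2 = (e / 2) * (1 - 0) by rewrite subr0 mulr1.
  apply: cint_bound => //.
    apply: integB.
    - by apply: integZ; apply: integ_cont => s _; apply: (rcont_scale (f := fun s => (M s *m S N s) i j)); exact: rcont_mulmx.
    - by apply: integZ; apply: integ_cont => s _; apply: (rcont_scale (f := fun s => (M s *m ode s) i j)); exact: Oc.
  move=> s /andP[s0 s1]; rewrite -mulrBr ncM ncR.
  have sx : `|s * x| <= X by rewrite normrM (ger0_norm s0) ler_piMl.
  have -> : (M (s * x) *m S N (s * x)) i j - (M (s * x) *m ode (s * x)) i j =
      (M (s * x) *m (S N (s * x) - ode (s * x))) i j by rewrite mulmxBr !mxE.
  have := @nc_mulmx (M (s * x)) (S N (s * x) - ode (s * x)) B (e / K / 2) i j (MB _).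
  move=> /(_ _)/(ler_wpM2l (normr_ge0 x))/le_trans; apply.
    move=> i' j'; rewrite mxE [X in _ + X]mxE [X in X - _]mxE; apply: le_trans (odeP _ i' j' N) _.
    apply: le_trans (tail_exp_le (y := n%:R * B * X) _ _ _) _; first by rewrite !mulr_ge0.
      by rewrite ler_wpM2l// mulr_ge0.
    by apply: le_trans (ler_norm _) (ltW (HN1 _ _)); exact: leq_maxl.
  have -> : `|x| * (n%:R * B * (e / K / 2)) = (n%:R * B * `|x|) / K * (e / 2) by ring.
  rewrite ler_piMl ?(ltW e3)// ler_pdivrMr// mul1r /K lerDl//.
have -> : ode x i j - ((1%:M : M_n) i j + prim (fun s => (M s *m ode s) i j) x) =
  - (S N.+1 x i j - ode x i j) + (prim (fun s => (M s *m S N s) i j) x - prim (fun s => (M s *m ode s) i j) x).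
  have G (a b c d : C) : a - (b + d) = - (b + c - a) + (c - d) by ring.
  by rewrite SE; exact: G.
apply: le_trans (ncD _ _) _; rewrite ncN; lra.
Qed.

Lemma ode_rd x : mrd ode x (M x *m ode x).
Proof.
move=> i j; apply: (rder_ext (f := fun x => (1%:M : M_n) i j + prim (fun s => (M s *m ode s) i j) x)).
  by move=> y; rewrite -ode_integral.
apply: rder_eq (rderD (rder_cst _ x) (prim_rder (f := fun s => (M s *m ode s) i j) x _)) _ => [y|].
  by apply: rcont_mulmx => // *; exact: ode_rcont.
by rewrite add0r.
Qed.
End Picard.

Lemma holo_mulmx (A B : C -> M_n) c r i j : (forall i j, holo (fun y => A y i j) c r) ->
  (forall i j, holo (fun y => B y i j) c r) -> holo (fun y => (A y *m B y) i j) c r.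
Proof.
move=> Ah Bh z zr.
have [d Hd] := choice (fun l => Ah i l z zr); have [e He] := choice (fun l => Bh l j z zr).
exists (\sum_l (d l * B z l j + A z i l * e l)).
apply: (cder_ext (f := fun y => \sum_l A y i l * B y l j)) => [x|]; first by rewrite mxE.
by apply: cder_sum => l; exact: cderM.
Qed.

Lemma ode_holo (M : R -> C -> M_n) (B : R) c r x i j : 0 < r ->
  (forall y, nc (y - c) < r -> forall s i j, rcont (fun s => M s y i j) s) ->
  (forall y, nc (y - c) < r -> forall s i j, nc (M s y i j) <= B) ->
  (forall s i j, holo (fun y => M s y i j) c r) ->
  holo (fun y => ode (M^~ y) B x i j) c r.
Proof.
move=> r0 Mc MB Mh.
have cr : nc (c - c) < r by rewrite subrr nc0.
have B0 : 0 <= B by apply: le_trans (MB c cr 0 i j); exact: nc_ge0.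
have H k : forall x i j, holo (fun y => pic (M^~ y) k x i j) c r.
  elim: k => [|k IH] x' i' j' /=; first by move=> z _; exists 0; exact: cder_cst.
  move=> z zr; pose r' := r - nc (z - c); have r'0 : 0 < r' by rewrite subr_gt0.
  have sub y : nc (y - z) < r' -> nc (y - c) < r by move=> yr; apply: le_lt_trans (nc_triangle y z c) _; rewrite -ltrBrDr.
  have hh s : holo (fun y => x'%:C * (M (s * x') y *m pic (M^~ y) k (s * x')) i' j') z r'.
    move=> y yr; have [d Hd] := @holo_mulmx (M (s * x')) (fun y => pic (M^~ y) k (s * x')) c r i' j'
       (Mh _) (IH _) y (sub y yr).
    by exists (x'%:C * d); exact: cderZ.
  have [g' Hg'] := choice (fun s => hh s z (ltac:(by rewrite subrr nc0))).
  pose K := `|x'| * (n%:R * B * ((n%:R * B * `|x'|) ^+ k / k`!%:R)).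
  have [||||_ D] := @dui R (fun s y => x'%:C * (M (s * x') y *m pic (M^~ y) k (s * x')) i' j') g' z r' K 0 1 ler01 r'0.
  - by move=> p _; exact: hh.
  - move=> p y /andP[p0 p1] yr; rewrite ncM ncR ler_wpM2l//.
    apply: nc_mulmx => [|i1 j1]; first exact: MB (sub y yr) _.
    apply: le_trans (pic_bound (Mc y (sub y yr)) (MB y (sub y yr)) _ _ _ _) _.
    rewrite ler_wpM2r ?invr_ge0// lerXn2r ?nnegrE ?mulr_ge0// ler_wpM2l ?mulr_ge0//.
    by rewrite normrM (ger0_norm p0) ler_piMl.
  - move=> y p _ yr; apply: rcontM; first exact: rcont_cst.
    apply: (rcont_scale (f := fun s => (M s y *m pic (M^~ y) k s) i' j')).
    by apply: rcont_mulmx => *; [exact: Mc (sub y yr) _ _ _|exact: pic_cont (Mc y (sub y yr)) _ _ _ _].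
  - by move=> p _; exact: Hg'.
  exists (cint g' 0 1); apply: cder_ext D => y; by rewrite mxE.
apply: (unif_holo (F := fun k y => \sum_(l < k) pic (M^~ y) l x i j)).
  move=> k z zr; have [d Hd] := choice (fun l => H l x i j z zr).
  by exists (\sum_(l < k) d l); apply: cder_sum => l; exact: Hd.
move=> e e0; have [N HN] := tail_small (is_cvg_series_exp_coeff (n%:R * B * `|x|)) e0.
exists N => k Nk z zr; apply: le_trans (odeP (Mc z zr) (MB z zr) _ _ _ _) _.
by apply: le_trans (ler_norm _) (ltW (HN _ Nk)).
Qed.

End LinearODE.

(** * Matrix exponentials *)

Section MatrixCalculus.
Context {R : realType} {n : nat}.
Notation C := (R[i]^o)%type.
Notation M_n := 'M[R[i]^o]_n.
Implicit Types (X Y : C -> M_n) (A B D E : M_n).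

Lemma mder_ext X Y w D : (forall x, X x = Y x) -> mder X w D -> mder Y w D.
Proof. by move=> /funext ->. Qed.
Lemma mder_eq X w D E : mder X w D -> D = E -> mder X w E.
Proof. by move=> h <-. Qed.
Lemma mder_cst A w : mder (fun=> A) w 0.
Proof. by move=> i j; rewrite mxE; exact: cder_cst. Qed.
Lemma mderD X Y w D E : mder X w D -> mder Y w E -> mder (fun x => X x + Y x) w (D + E).
Proof.
move=> hX hY i j; rewrite mxE; apply: cder_ext (cderD (hX i j) (hY i j)) => x; by rewrite mxE.
Qed.
Lemma mderN X w D : mder X w D -> mder (fun x => - X x) w (- D).
Proof. move=> hX i j; rewrite mxE; apply: cder_ext (cderN (hX i j)) => x; by rewrite mxE. Qed.
Lemma mderM X Y w D E : mder X w D -> mder Y w E ->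
  mder (fun x => X x *m Y x) w (D *m Y w + X w *m E).
Proof.
move=> hX hY i j; rewrite !mxE -big_split /=.
apply: cder_ext (cder_sum (d := fun l => D i l * Y w l j + X w i l * E l j) _ _) => [x|l].
  by rewrite mxE.
exact: cderM.
Qed.
Lemma mderZ (f : C -> C) X w d D : cder f w d -> mder X w D ->
  mder (fun x => f x *: X x) w (d *: X w + f w *: D).
Proof.
move=> hf hX i j; rewrite !mxE; apply: cder_ext (cderM hf (hX i j)) => x; by rewrite mxE.
Qed.
Lemma mder_unique X w D E : mder X w D -> mder X w E -> D = E.
Proof. by move=> h1 h2; apply/matrixP => i j; exact: cder_unique (h1 i j) (h2 i j). Qed.
Lemma mder_comp (g : C -> C) X w d D : cder g w d -> mder X (g w) D -> mder (fun x => X (g x)) w (d *: D).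
Proof.
move=> hg hX i j; rewrite mxE mulrC; exact: (cder_comp (f := fun y => X y i j) hg (hX i j)).
Qed.

Lemma mder0_cst X : (forall w, mder X w 0) -> forall w, X w = X 0.
Proof.
move=> h w; apply/matrixP => i j; apply: (cder0_cst (f := fun w => X w i j)) => v.
by have := h v i j; rewrite mxE.
Qed.

Lemma mxpow_bound A (b : R) k i j : (forall i j, nc (A i j) <= b) ->
  nc ((A ^+ k) i j) <= (n%:R * b) ^+ k.
Proof.
move=> Ab; elim: k i j => [|k IH] i j; first by rewrite expr0; exact: nc_mx1.
have -> : A ^+ k.+1 = A *m A ^+ k by rewrite exprS.
by rewrite exprS; exact: nc_mulmx.
Qed.

Lemma mxexpZ A (x : C) k : (x *: A) ^+ k = x ^+ k *: A ^+ k.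
Proof.
elim: k => [|k IH]; first by rewrite !expr0 scale1r.
by rewrite !exprS IH -[LHS]/((x *: A) *m (x ^+ k *: A ^+ k)) -scalemxAl -scalemxAr scalerA.
Qed.

Lemma mxsubE (A B : M_n) i j : (A - B) i j = A i j - B i j.
Proof. by rewrite !mxE. Qed.

Definition mterm A (k : nat) : M_n := (k`!%:R)^-1 *: A ^+ k.

Lemma mterm_bound A (b : R) k i j : (forall i j, nc (A i j) <= b) ->
  nc (mterm A k i j) <= exp_coeff (n%:R * b) k.
Proof.
move=> Ab; rewrite /mterm mxE ncM ncV /exp_coeff /= mulrC.
have -> : (k`!%:R : C) = (k`!%:R : R)%:C by rewrite rmorph_nat.
by rewrite ncR ger0_norm// ler_wpM2r ?invr_ge0//; exact: mxpow_bound.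
Qed.

Lemma mx_bound A : exists b : R, 0 <= b /\ forall i j, nc (A i j) <= b.
Proof.
exists (\sum_i \sum_j nc (A i j)); split => [|i j].
  by do 2!apply: sumr_ge0 => ? _; exact: nc_ge0.
rewrite (bigD1 i)//= (bigD1 j)//= -addrA lerDl addr_ge0// ?sumr_ge0// => k _; first exact: nc_ge0.
by rewrite sumr_ge0// => l _; exact: nc_ge0.
Qed.

Lemma series_mxE (u : nat -> M_n) k i j : series u k i j = \sum_(l < k) u l i j.
Proof. by rewrite /series /= big_mkord summxE. Qed.

Lemma mexp_tail A (b : R) k i j : (forall i j, nc (A i j) <= b) ->
  nc (\sum_(l < k) mterm A l i j - mexp A i j) <= tail (exp_coeff (n%:R * b)) k.
Proof.
move=> Ab.
have [L HL] := choice (fun ij : 'I_n * 'I_n => @csum R (fun l => mterm A l ij.1 ij.2) (exp_coeff (n%:R * b))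
  (is_cvg_series_exp_coeff _) (fun l => mterm_bound l ij.1 ij.2 Ab)).
have -> : mexp A = \matrix_(i, j) L (i, j).
  apply: (mcv_lim (u := series (fun k => (k`!%:R)^-1 *: A ^+ k)) _).2 => e e0.
  have [N HN] := tail_small (is_cvg_series_exp_coeff (n%:R * b)) e0.
  exists N => l Nl i' j'; rewrite series_mxE mxE.
  by apply: le_trans (HL (i', j') l) _; apply: le_trans (ler_norm _) (ltW (HN _ Nl)).
by rewrite mxE; exact: (HL (i, j)).
Qed.

Lemma mterm0 A : mterm A 0 = 1%:M.
Proof. by rewrite /mterm fact0 invr1 scale1r expr0. Qed.

Lemma mexp0 : mexp 0 = 1%:M :> M_n.
Proof.
apply/matrixP => i j; apply: nc_le0_eq; rewrite ncC.
have H0 : forall i j : 'I_n, nc ((0 : M_n) i j) <= 0 by move=> ? ?; rewrite mxE nc0.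
have := mexp_tail 1 i j H0; rewrite big_ord1 mterm0 mulr0 => /le_trans; apply.
by rewrite /tail series_exp_coeff0; have := expR0 R; rewrite /expR => ->; rewrite subrr.
Qed.

Lemma zpow0 A : zpow 0 A = 1%:M.
Proof. by rewrite /zpow scale0r mexp0. Qed.

Lemma mtermS_der A k w i j :
  cder (fun w => mterm (w *: A) k.+1 i j) w ((A *m mterm (w *: A) k) i j).
Proof.
have E l (x : C) : mterm (x *: A) l i j = (l`!%:R)^-1 * (x ^+ l * (A ^+ l) i j) by rewrite /mterm mxexpZ !mxE.
apply: cder_ext (cder_eq (cderZ ((k.+1)`!%:R)^-1 (cderM (cderX w k.+1) (cder_cst ((A ^+ k.+1) i j) w))) _).
  by move=> x; rewrite E.
have -> : (A *m mterm (w *: A) k) i j = (k`!%:R)^-1 * (w ^+ k * (A ^+ k.+1) i j) by rewrite /mterm mxexpZ -!scalemxAr [LHS]mxE [X in _ * X]mxE exprS.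
rewrite /= mulr0 addr0 factS natrM.
have a0 : (k.+1%:R : C) != 0 by rewrite pnatr_eq0.
have b0 : (k`!%:R : C) != 0 by rewrite pnatr_eq0 -lt0n fact_gt0.
move: (w ^+ k) ((A ^+ k.+1) i j) => x y; field; exact/andP.
Qed.

Lemma mexp_comm A w : A *m mexp (w *: A) = mexp (w *: A) *m A.
Proof.
have [b [b0 Hb]] := mx_bound (w *: A); have [c [c0 Hc]] := mx_bound A.
apply/matrixP => i j; apply: nc_eps_eq => e e0.
pose K := n%:R * c + n%:R * c + 1; have K0 : 0 < K by rewrite ltr_wpDl// addr_ge0// mulr_ge0.
have [N HN] := tail_small (is_cvg_series_exp_coeff (n%:R * b)) (divr_gt0 e0 K0).
pose S : M_n := \sum_(l < N) mterm (w *: A) l.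
have SA : A *m S = S *m A.
  rewrite /S mulmx_sumr mulmx_suml; apply: eq_bigr => l _.
  rewrite /mterm -scalemxAr -scalemxAl; congr (_ *: _).
  by rewrite mxexpZ -scalemxAr -scalemxAl -[A *m _]/(A * _) -exprS exprSr.
have H i' j' : nc ((S - mexp (w *: A)) i' j') <= e / K.
  rewrite mxE summxE [X in _ + X]mxE; apply: le_trans (mexp_tail N i' j' Hb) _.
  by apply: le_trans (ler_norm _) (ltW (HN _ (leqnn N))).
have -> : (A *m mexp (w *: A)) i j - (mexp (w *: A) *m A) i j =
   ((S - mexp (w *: A)) *m A) i j - (A *m (S - mexp (w *: A))) i j.
  rewrite mulmxBl mulmxBr SA !mxsubE.
  move: ((S *m A) i j) ((mexp _ *m A) i j) ((A *m mexp _) i j) => x y z; ring.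
apply: le_trans (ncB _ _) _.
apply: le_trans (lerD (nc_mulmx i j H Hc) (nc_mulmx i j Hc H)) _.
have -> : n%:R * (e / K) * c + n%:R * c * (e / K) = (n%:R * c + n%:R * c) / K * e by ring.
by rewrite ler_piMl ?(ltW e0)// ler_pdivrMr// mul1r /K lerDl.
Qed.

Lemma mexp_der A w : mder (fun w => mexp (w *: A)) w (A *m mexp (w *: A)).
Proof.
move=> i j; have [c [c0 Hc]] := mx_bound A.
pose W := (nc w + 1) * c.
have HW x : nc (x - w) < 1 -> forall i j, nc ((x *: A) i j) <= W.
  move=> xw i' j'; rewrite mxE ncM; apply: ler_pM; rewrite ?nc_ge0//.
  by have := nc_dist x w; lra.
pose d k : C := if k is k'.+1 then \sum_(l < k') (A *m mterm (w *: A) l) i j else 0.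
apply: (unif_cder (F := fun k x => \sum_(l < k) mterm (x *: A) l i j) (R0 := 1) (d := d)) => //.
- move=> k x xr.
  have D l : exists d, cder (fun x => mterm (x *: A) l i j) x d.
    case: l => [|l]; last by eexists; exact: mtermS_der.
    by exists 0; apply: cder_ext (cder_cst ((1%:M : M_n) i j) x) => y; rewrite mterm0.
  have [dd Hd] := choice D; exists (\sum_(l < k) dd l); apply: cder_sum => l; exact: Hd.
- move=> e e0; have [N HN] := tail_small (is_cvg_series_exp_coeff (n%:R * W)) e0.
  exists N => k Nk x xr; apply: le_trans (mexp_tail k i j (HW x xr)) _.
  by apply: le_trans (ler_norm _) (ltW (HN _ Nk)).
- case=> [|k] /=; first by apply: cder_ext (cder_cst 0 w) => x; rewrite big_ord0.
  apply: (cder_ext (f := fun x => (1%:M : M_n) i j + \sum_(l < k) mterm (x *: A) l.+1 i j)).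
    by move=> x; rewrite big_ord_recl mterm0.
  apply: cder_eq (cderD (cder_cst _ w) (@cder_sum R _ (index_enum 'I_k) (fun l x => mterm (x *: A) l.+1 i j) (fun l => (A *m mterm (w *: A) l) i j) w
    (fun l => mtermS_der A l w i j))) _.
  by rewrite add0r.
- move=> e e0; pose K := n%:R * c + 1; have K0 : 0 < K by rewrite ltr_wpDl// mulr_ge0.
  have [N HN] := tail_small (is_cvg_series_exp_coeff (n%:R * W)) (divr_gt0 e0 K0).
  exists N.+1 => -[//|k] Nk /=.
  have -> : \sum_(l < k) (A *m mterm (w *: A) l) i j - (A *m mexp (w *: A)) i j =
     (A *m ((\sum_(l < k) mterm (w *: A) l) - mexp (w *: A))) i j.
    by rewrite mulmxBr mulmx_sumr [RHS]mxE summxE [in RHS]mxE.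
  have H i' j' : nc ((\sum_(l < k) mterm (w *: A) l - mexp (w *: A)) i' j') <= e / K.
    rewrite mxE summxE [X in _ + X]mxE; apply: le_trans (mexp_tail k i' j' (HW w _)) _.
      by rewrite subrr nc0.
    by apply: le_trans (ler_norm _) (ltW (HN _ _)).
  apply: le_trans (nc_mulmx i j Hc H) _.
  have -> : n%:R * c * (e / K) = (n%:R * c) / K * e by ring.
  by rewrite ler_piMl ?(ltW e0)// ler_pdivrMr// mul1r /K lerDl.
Qed.

Lemma zpow_der A w : mder (zpow^~ A) w (A *m zpow w A).
Proof. exact: mexp_der. Qed.

Lemma zpow_comm A w : A *m zpow w A = zpow w A *m A.
Proof. exact: mexp_comm. Qed.

(** [zpow (x + y) A *m zpow (- x) A] has derivative 0 in x, because [A] commutes with its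
    exponentials; its value is read off at x = 0. *)
Lemma zpowD A v w : zpow (v + w) A = zpow v A *m zpow w A.
Proof.
have inv (x y : C) : zpow (x + y) A *m zpow (- x) A = zpow y A.
  pose f (x : C) : M_n := zpow (x + y) A *m zpow (- x) A.
  suff E : forall z, mder f z 0.
    have e1 : zpow (- 0) A = 1%:M by rewrite oppr0; exact: zpow0.
    have e2 : zpow (0 + y) A = zpow y A by rewrite add0r.
    exact: (etrans (mder0_cst E x) (etrans (congr2 mulmx e2 e1) (mulmx1 _))).
  move=> z.
  have c1 : cder (fun x => x + y) z 1 by apply: cder_eq (cderD (cder_id z) (cder_cst y z)) _; rewrite addr0.
  have c2 : cder (fun x => - x) z (-1) by apply: cderN; exact: cder_id.
  apply: mder_eq (mderM (mder_comp c1 (zpow_der A (z + y))) (mder_comp c2 (zpow_der A (- z)))) _.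
  have G (X Y : M_n) : A *m X = X *m A -> 1 *: (A *m X) *m Y + X *m (-1 *: (A *m Y)) = 0 by move=> XA; rewrite scale1r scaleN1r mulmxN XA -mulmxA subrr.
  exact: G (zpow_comm A (z + y)).
have I := inv (- w) 0; rewrite addr0 opprK (zpow0 A) in I.
have J := inv w v; rewrite [w + v]addrC in J.
have G (X Y Z W : M_n) : Y *m Z = 1%:M -> X *m Y = W -> X = W *m Z by move=> YZ <-; rewrite -mulmxA YZ mulmx1.
exact: G I J.
Qed.

Lemma zpow_unit A w : zpow w A \in unitmx /\ invmx (zpow w A) = zpow (- w) A.
Proof.
have I : zpow w A *m zpow (- w) A = 1%:M by rewrite -zpowD subrr zpow0.
have [u _] := mulmx1_unit I; split => //.
by rewrite -[LHS]mulmx1 -I mulKmx.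
Qed.

(** The (i, j) entry of exp(w diag d) times exp(- w d_i) is constant in w; compare w = 0 and w =
    1. *)
Lemma mexp_diag (d : 'rV[R[i]^o]_n) i j : mexp (diag_mx d) i j = (cexp (d 0 i)) *+ (i == j).
Proof.
pose f (w : C) := zpow w (diag_mx d) i j * cexp (- w * d 0 i).
have E w : f w = (i == j)%:R.
  have -> : ((i == j)%:R : C) = f 0 by rewrite /f zpow0 oppr0 mul0r cexp0 mulr1 mxE.
  apply: cder0_cst => v.
  have c : cder (fun x : C => - x * d 0 i) v (- d 0 i) by apply: cder_eq (cderM (cderN (cder_id v)) (cder_cst (d 0 i) v)) _; ring.
  apply: cder_eq (cderM (zpow_der (diag_mx d) v i j) (cder_comp c (cder_cexp _))) _.
  rewrite mul_diag_mx mxE; ring.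
have := E 1; rewrite /f /zpow scale1r mulN1r cexpN => h.
by rewrite -[LHS]mulr1 -(mulVf (cexp_neq0 (d 0 i))) mulrA h mulr_natl.
Qed.
End MatrixCalculus.

(** * Baire's theorem in a polydisc *)

Section Baire.
Context {R : realType}.

Lemma nested_real (x d : nat -> R) : (forall k, 0 <= d k) ->
  (forall j k, (k <= j)%N -> `|x j - x k| + d j <= d k) -> exists L, forall k, `|L - x k| <= d k.
Proof.
move=> d0 H; pose E := range (fun k => x k - d k).
have ub j k : x j - d j <= x k + d k.
  have := d0 k; have := d0 j; have [jk|/ltnW kj] := leqP j k.
    have := H k j jk; have := ler_norm (x j - x k); rewrite distrC; lra.
  have := H j k kj; have := ler_norm (x j - x k); lra.
have E0 : E !=set0 by exists (x 0%N - d 0%N); exists 0%N.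
exists (sup E) => k; rewrite ler_norml; apply/andP; split.
  have : x k - d k <= sup E; last by lra.
  apply: ub_le_sup; last by exists k.
  by exists (x 0%N + d 0%N) => _ [j _ <-]; exact: ub.
have : sup E <= x k + d k; last by lra.
by apply: ge_sup => // _ [j _ <-]; exact: ub.
Qed.

Context {n : nat}.
Notation T := 'rV[R[i]^o]_n.

(** If no [P m] contained a polydisc, nested polydiscs could be chosen that avoid one [P m] after
    the other, since the complements are open; their common point would lie in no [P m]. *)
Lemma baire (c : T) (r : R) (P : nat -> T -> Prop) : 0 < r ->
  (forall t, pd c r t -> exists m, P m t) ->
  (forall m t, pd c r t -> ~ P m t -> exists2 d : R, 0 < d & forall s, pd t d s -> ~ P m s) ->
  exists m t (d : R), [/\ 0 < d, forall s, pd t d s -> pd c r s & forall s, pd t d s -> P m s].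
Proof.
move=> r0 cov op; apply: contrapT => N.
pose ok (x : T * R) := 0 < x.2 /\ forall s, pd x.1 x.2 s -> pd c r s.
have step (mx : nat * (T * R)) : exists y : T * R, ok mx.2 ->
    [/\ ok y, forall i, nc (y.1 0 i - mx.2.1 0 i) + y.2 <= mx.2.2 / 8 & forall s, pd y.1 y.2 s -> ~ P mx.1 s].
  case: mx => m [t d] /=; have [[/= d0 sub]|no] := pselect (ok (t, d)); last by exists (t, d) => /no.
  have [s [ts nP]] : exists s, pd t (d / 16) s /\ ~ P m s.
    apply: contrapT => N'; apply: N; exists m, t, (d / 16); split; first by rewrite divr_gt0.
      move=> s ts; apply: sub; apply: pd_le ts; rewrite ler_pdivrMr// ler_peMr// ?ltW//; lra.
    by move=> s ts; apply: contrapT => nP; apply: N'; exists s.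
  have cs : pd c r s by apply: sub; apply: pd_le ts; rewrite ler_pdivrMr// ler_peMr// ?ltW//; lra.
  have [e e0 He] := op m s cs nP.
  exists (s, Num.min e (d / 16)) => _ /=.
  have q i : nc (s 0 i - t 0 i) + Num.min e (d / 16) <= d / 8.
    have := ts i; have : Num.min e (d / 16) <= d / 16 by rewrite ge_min lexx orbT.
    lra.
  split => //=; last by move=> s' ss; apply: He; apply: pd_le ss; rewrite ge_min lexx.
  split => /=; first by rewrite lt_min e0 divr_gt0.
  move=> s' ss; apply: sub; apply: pd_trans ss _ => i; have := q i; move: d0; clear; lra.
have [f Hf] := choice step.
pose sq := fix sq k := if k is k'.+1 then f (k', sq k') else (c, r).
have okk k : ok (sq k) by elim: k => [|k IH] //=; have [] := Hf (k, sq k) IH.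
have H1 k i : nc ((sq k.+1).1 0 i - (sq k).1 0 i) + (sq k.+1).2 <= (sq k).2 / 8 by have [_ + _] := Hf (k, sq k) (okk k); apply.
(* Shrinking by 8 at each step keeps all later centers within a quarter of the radius; a quarter for
   the real and one for the imaginary part leave the limit strictly inside every polydisc. *)
have H2 i j k : (k <= j)%N -> nc ((sq j).1 0 i - (sq k).1 0 i) + (sq j).2 / 4 <= (sq k).2 / 4.
  elim: j => [|j IH]; first by rewrite leqn0 => /eqP ->; rewrite subrr nc0 add0r.
  rewrite leq_eqVlt => /orP[/eqP -> |]; first by rewrite subrr nc0 add0r.
  rewrite ltnS => /IH h; have := H1 j i.
  have := nc_triangle ((sq j.+1).1 0 i) ((sq j).1 0 i) ((sq k).1 0 i).
  have := (okk j).1; have := (okk j.+1).1; move: h; clear; move: (sq j.+1) (sq j) => y x; lra.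
have /choice[X HX] : forall i : 'I_n, exists X : R, forall k, `|X - cRe ((sq k).1 0 i)| <= (sq k).2 / 4.
  move=> i; apply: nested_real => [k|j k jk]; first by rewrite divr_ge0// ltW// (okk k).1.
  apply: le_trans (H2 i j k jk); rewrite lerD2r; apply: le_trans (Re_le_nc _).
  by rewrite cReD cReN.
have /choice[Y HY] : forall i : 'I_n, exists X : R, forall k, `|X - cIm ((sq k).1 0 i)| <= (sq k).2 / 4.
  move=> i; apply: nested_real => [k|j k jk]; first by rewrite divr_ge0// ltW// (okk k).1.
  apply: le_trans (H2 i j k jk); rewrite lerD2r; apply: le_trans (Im_le_nc _).
  by rewrite cImD cImN.
pose L : T := \row_i (X i +i* Y i).
have HL k : pd (sq k).1 (sq k).2 L.
  move=> i; rewrite mxE; apply: le_lt_trans (nc_le_ReIm _) _.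
  rewrite cReD cReN cImD cImN /=; have := HX i k; have := HY i k; have := (okk k).1; lra.
have [m Pm] := cov L (HL 0%N).
have [_ _ nP] := Hf (m, sq m) (okk m).
exact: nP (HL m.+1) Pm.
Qed.
End Baire.

(** * Matrix-valued holomorphic functions and formal solutions *)

Section MatrixHolomorphy.
Context {R : realType} {n : nat}.
Notation C := (R[i]^o)%type.
Notation T := 'rV[R[i]^o]_n.
Notation M_n := 'M[R[i]^o]_n.
Implicit Types (t v c p : T) (f : T -> C) (X Y : T -> M_n).

Definition mghol X c r := forall i j, ghol (fun t => X t i j) c r.

Lemma mghol_sub X c r t d : mghol X c r -> (forall i, nc (t 0 i - c 0 i) + d <= r) -> mghol X t d.
Proof. by move=> h cd i j; exact: ghol_sub (h i j) cd. Qed.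

Lemma mghol_cst (A : M_n) c r : mghol (fun=> A) c r.
Proof. by move=> i j; exact: ghol_cst. Qed.

Lemma mghol_ext X Y c r : (forall t, X t = Y t) -> mghol X c r -> mghol Y c r.
Proof. by move=> /funext ->. Qed.

Lemma mghol_near X Y c r : (forall t, pd c r t -> X t = Y t) -> mghol X c r -> mghol Y c r.
Proof. by move=> XY h i j; apply: ghol_near (h i j) => t ct; rewrite XY. Qed.

Lemma mgholM X Y c r : mghol X c r -> mghol Y c r -> mghol (fun t => X t *m Y t) c r.
Proof.
move=> hX hY i j; apply: (ghol_ext (f := fun t => \sum_l X t i l * Y t l j)) => [t|]; first by rewrite mxE.
by apply: ghol_sum => l; exact: gholM.
Qed.

Lemma mgholD X Y c r : mghol X c r -> mghol Y c r -> mghol (fun t => X t + Y t) c r.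
Proof.
by move=> hX hY i j; apply: ghol_ext (gholD (hX i j) (hY i j)) => t; rewrite mxE.
Qed.

Lemma mgholB X Y c r : mghol X c r -> mghol Y c r -> mghol (fun t => X t - Y t) c r.
Proof.
by move=> hX hY i j; apply: ghol_ext (gholB (hX i j) (hY i j)) => t; rewrite !mxE.
Qed.

Lemma mgholZ f X c r : ghol f c r -> mghol X c r -> mghol (fun t => f t *: X t) c r.
Proof. by move=> hf hX i j; apply: ghol_ext (gholM hf (hX i j)) => t; rewrite !mxE. Qed.

Lemma mghol_zero X c r t0 s : mghol X c r -> pd c r t0 -> 0 < s ->
  (forall t, pd t0 s t -> X t = 0) -> forall t, pd c r t -> X t = 0.
Proof.
move=> hX ct s0 X0 t tr; apply/matrixP => i j; rewrite mxE.
by apply: (ghol_zero (hX i j) ct s0) => // t' /X0 ->; rewrite mxE.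
Qed.

Lemma mghol_eq X Y c r t0 s : mghol X c r -> mghol Y c r -> pd c r t0 -> 0 < s ->
  (forall t, pd t0 s t -> X t = Y t) -> forall t, pd c r t -> X t = Y t.
Proof.
move=> hX hY ct s0 XY t tr; apply/eqP; rewrite -subr_eq0; apply/eqP.
apply: (mghol_zero (mgholB hX hY) ct s0 _ tr) => t' h; by rewrite XY// subrr.
Qed.

Lemma ghol_inv f c r (m : R) : ghol f c r -> 0 < m -> (forall t, pd c r t -> m <= nc (f t)) ->
  ghol (fun t => (f t)^-1) c r.
Proof.
move=> [h1 h2] m0 fm; have f0 t : pd c r t -> f t != 0.
  by move=> /fm h; rewrite -nc_gt0; exact: lt_le_trans h.
split => [t v ct|t ct]; last first.
  have [d d0 Hd] := pd_open ct; exists d, m^-1; split => // s ts.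
  have cs := pd_trans ts Hd; rewrite ncV lef_pV2 ?posrE ?fm// nc_gt0 f0//.
have [d Hd] := h1 t v ct; have fn0 : f (t + 0 *: v) != 0 by rewrite scale0r addr0 f0.
by eexists; exact: cder_comp Hd (cder_invx fn0).
Qed.

Lemma ghol_cont f c r t (e : R) : ghol f c r -> pd c r t -> 0 < e ->
  exists2 d : R, 0 < d & forall s, pd t d s -> nc (f s - f t) < e.
Proof.
move=> hf ct e0.
have D := @ghol_differentiable R n 1 1 (fun s => (f s)%:M) c r t (fun i j => _) ct.
have /D/differentiable_continuous H : forall i j : 'I_1, ghol (fun s => (f s)%:M i j) c r by move=> i j; apply: ghol_ext hf => s; rewrite !ord1 mxE eqxx.
have Q : nbhs ((f t)%:M : 'M[R[i]^o]_1) [set A : 'M[R[i]^o]_1 | nc (A ord0 ord0 - f t) < e] by apply/nbhs_mx; exists e => // h /(_ ord0 ord0); rewrite mxE eqxx.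
have /nbhs_pd[d d0 Hd] := H _ Q.
by exists d => // s /Hd /=; rewrite mxE eqxx.
Qed.

Lemma convex_lt (s x y r : R) : 0 <= s -> s <= 1 -> x < r -> y < r -> (1 - s) * x + s * y < r.
Proof.
move=> s0 s1 xr yr; apply: (@le_lt_trans _ _ (Num.max x y)); last by rewrite gt_max xr.
have -> : Num.max x y = (1 - s) * Num.max x y + s * Num.max x y by ring.
by apply: lerD; apply: ler_wpM2l; rewrite ?subr_ge0 ?le_max ?lexx ?orbT.
Qed.

Lemma pd_convex c r p q (s : R) : pd c r p -> pd c r q -> 0 <= s <= 1 -> pd c r (p + s%:C *: (q - p)).
Proof.
move=> cp cq /andP[s0 s1] i; rewrite !mxE.
have -> : p 0 i + s%:C * (q 0 i - p 0 i) - c 0 i =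
   (1 - s)%:C * (p 0 i - c 0 i) + s%:C * (q 0 i - c 0 i) by rewrite realCB; ring.
apply: le_lt_trans (ncD _ _) _; rewrite !ncM !ncR (ger0_norm s0) ger0_norm ?subr_ge0//.
by apply: convex_lt; [| |exact: cp|exact: cq].
Qed.

Lemma segment_locbd f c r p v : ghol f c r ->
  (forall s : R, 0 <= s <= 1 -> pd c r (p + s%:C *: v)) ->
  exists d M : R, 0 < d /\ forall (s : R) t, 0 <= s <= 1 -> pd (p + s%:C *: v) d t ->
    pd c r t /\ nc (f t) <= M.
Proof.
move=> hf hs.
have [m m' x mm H|x /=|m Hm] := @compact_uniform R `[0, 1]
    (fun m s => forall t, pd (p + s%:C *: v) (m.+1%:R^-1) t -> pd c r t /\ nc (f t) <= m.+1%:R)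
    (@segment_compact _ 0 1).
- move=> t ht; have [] := H t; first by apply: pd_le ht; rewrite lef_pV2 ?posrE ?ltr0n// ler_nat ltnS.
  by move=> h1 h2; split => //; apply: le_trans h2 _; rewrite ler_nat ltnS.
- rewrite in_itv /= => /hs cx.
  have [d d0 Hd] := pd_open cx; have [e [M [e0 HM]]] := hf.2 _ cx.
  pose q := Num.min d e / 2; have q0 : 0 < q by rewrite divr_gt0// lt_min d0.
  pose N := (Num.truncn q^-1 + Num.truncn `|M|)%N; exists N.
  have K0 : 0 < vn v + 1 by rewrite ltr_wpDl ?vn_ge0.
  apply/nbhs_ballP; exists (q / (vn v + 1)); first by rewrite /= divr_gt0.
  move=> y; rewrite -ball_normE /= => xy t yt.
  have xt : pd (p + x%:C *: v) (Num.min d e) t.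
    move=> i; apply: le_lt_trans (nc_triangle _ ((p + y%:C *: v) 0 i) _) _.
    have -> : Num.min d e = q + q by rewrite /q -splitr.
    apply: ltrD.
      apply: lt_le_trans (yt i) _; rewrite invf_ple ?posrE ?ltr0n//.
      apply: ltW; apply: lt_le_trans (truncnS_gt _) _; by rewrite ler_nat ltnS leq_addr.
    rewrite !mxE opprD addrACA subrr add0r -mulrBl ncM -realCB ncR distrC.
    move: xy; rewrite ltr_pdivlMr//; apply: le_lt_trans; rewrite ler_wpM2l//.
    by apply: le_trans (nc_le_vn v i) _; rewrite lerDl.
  split; first by apply: pd_trans (pd_le _ xt) Hd; rewrite ge_min lexx.
  apply: le_trans (HM t _) _; first by apply: pd_le xt; rewrite ge_min lexx orbT.
  apply: le_trans (ler_norm _) _; apply: ltW; apply: lt_le_trans (truncnS_gt _) _.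
  by rewrite ler_nat ltnS leq_addl.
exists m.+1%:R^-1, m.+1%:R; split; first by rewrite invr_gt0 ltr0n.
by move=> s t s01; apply: Hm; rewrite /= in_itv.
Qed.

Lemma fin_uniform (I : finType) (P : I -> R -> R -> Prop) :
  (forall i d M d' M', d' <= d -> M <= M' -> P i d M -> P i d' M') ->
  (forall i, exists d M, 0 < d /\ P i d M) -> exists d M, 0 < d /\ forall i, P i d M.
Proof.
move=> mono H; have [d Hd] := choice H; have [M HM] := choice Hd.
exists (\big[Num.min/1]_i d i), (\sum_i `|M i|); split.
  by elim/big_ind: _ => // [x y x0 y0|i _]; [rewrite lt_min x0|have [] := HM i].
move=> i; apply: mono (HM i).2; first exact: bigmin_le_cond.
rewrite (bigD1 i)//=; apply: le_trans (ler_norm _) _.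
by rewrite lerDl sumr_ge0.
Qed.

(** Hadamard's lemma: [pt t] replaces the coordinate [a] of [t] by the coordinate [b], where [f]
    vanishes, and the quotient averages the derivative along the segment from [pt t] to [t]. The
    segment stays in the polydisc because [c 0 a = c 0 b]. *)
Lemma hadamard f c r (a b : 'I_n) : ghol f c r -> a != b -> c 0 a = c 0 b ->
  (forall t, pd c r t -> t 0 a = t 0 b -> f t = 0) ->
  exists q, ghol q c r /\ forall t, pd c r t -> f t = (t 0 a - t 0 b) * q t.
Proof.
move=> hf ab cab f0.
pose e : T := delta_mx 0 a.
pose pt t : T := t - (t 0 a - t 0 b) *: e.
pose dir t : T := (t 0 a - t 0 b) *: e.
pose l (s : R) t : T := pt t + s%:C *: dir t.
have ea : e 0 a = 1 by rewrite mxE !eqxx.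
have eb : e 0 b = 0 by rewrite mxE eqxx /= eq_sym (negbTE ab).
have lin s t v (x : C) : l s (t + x *: v) = l s t + x *: l s v by apply/rowP => i; rewrite !mxE; ring.
have l1 t : l 1 t = t by rewrite /l /pt /dir scale1r subrK.
have inside t s : pd c r t -> 0 <= s <= 1 -> pd c r (l s t).
  move=> ct /andP[s0 s1] i; have [->|ia] := eqVneq i a; last first.
    have -> : l s t 0 i = t 0 i by rewrite !mxE (negbTE ia) andbF !(mulr0, oppr0, addr0).
    exact: ct.
  have -> : l s t 0 a - c 0 a = (1 - s)%:C * (t 0 b - c 0 b) + s%:C * (t 0 a - c 0 a) by rewrite -cab !mxE !eqxx realCB /=; ring.
  apply: le_lt_trans (ncD _ _) _; rewrite !ncM !ncR (ger0_norm s0) ger0_norm ?subr_ge0//.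
  by apply: convex_lt; [| |exact: ct|exact: ct].
pose g s t := pder f e (l s t).
exists (fun t => cint (g^~ t) 0 1); split.
  have hp := ghol_pder_ghol e hf.
  have bd t : pd c r t -> exists d M : R, 0 < d /\ forall t', pd t d t' ->
      pd c r t' /\ forall s, 0 <= s <= 1 -> nc (g s t') <= M.
    move=> ct.
    have [d [M [d0 HdM]]] := @segment_locbd (pder f e) c r (pt t) (dir t) hp (fun s s01 => inside t s ct s01).
    have [d' d'0 Hd'] := pd_open ct.
    exists (Num.min (d / 4) d'), M; split; first by rewrite lt_min d'0 divr_gt0.
    move=> t' tt; split.
      by apply: pd_trans (pd_le _ tt) Hd'; rewrite ge_min lexx orbT.
    move=> s s01; apply: (HdM s _ s01 _).2 => i.
    have q j : nc (t' 0 j - t 0 j) < d / 4 by apply: lt_le_trans (tt j) _; rewrite ge_min lexx.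
    have -> : l s t' 0 i - (pt t + s%:C *: dir t) 0 i =
      (t' 0 i - t 0 i) - (1 - s)%:C * ((t' 0 a - t 0 a) - (t' 0 b - t 0 b)) * e 0 i.
      by rewrite !mxE realCB; ring.
    apply: le_lt_trans (ncB _ _) _.
    have e1 : nc (e 0 i) <= 1 by rewrite mxE; case: (_ && _); rewrite ?nc1 ?nc0.
    have : nc ((1 - s)%:C * ((t' 0 a - t 0 a) - (t' 0 b - t 0 b)) * e 0 i) <= d / 2.
      rewrite !ncM ncR; case/andP: s01 => s0 s1; rewrite ger0_norm ?subr_ge0//.
      apply: (@le_trans _ _ (1 * (d / 2) * 1)); last by rewrite mulr1 mul1r.
      apply: ler_pM => //; rewrite ?mulr_ge0 ?nc_ge0 ?subr_ge0//.
      apply: ler_pM => //; rewrite ?nc_ge0 ?subr_ge0//; first lra.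
      by apply: le_trans (ncB _ _) _; have := q a; have := q b; lra.
    have := q i; lra.
  have gc t s : pd c r t -> 0 <= s <= 1 -> rcont (g^~ t) s.
    move=> ct s01; apply: (rcont_comp (f := fun x => pder f e (pt t + x *: dir t)) (g := fun s => s%:C)).
      exact: rder_cont (rder_id s).
    exact: cder_cont (ghol_pder_line hp (inside t s ct s01)).
  split => [t v ct|t ct]; last first.
    have [d [M [d0 H]]] := bd t ct; exists d, M; split => // s ts.
    have [cs gM] := H s ts.
    rewrite -[M]mulr1 -[X in M * X](subr0 1); apply: cint_bound => //.
    by apply: integ_cont => x x01; exact: gc.
  have [d [M [d0 H]]] := bd t ct.
  have K0 : 0 < vn v + 1 by rewrite ltr_wpDl ?vn_ge0.
  have q0 : 0 < d / (vn v + 1) by rewrite divr_gt0.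
  have Hx (x : C) : nc (x - 0) < d / (vn v + 1) -> pd t d (t + x *: v) by rewrite subr0; exact: line_pd.
  have hh s : 0 <= s <= 1 -> holo (fun x => g s (t + x *: v)) 0 (d / (vn v + 1)).
    move=> s01; apply: (holo_near (f := fun x => pder f e (l s t + x *: l s v))).
      by move=> x _; rewrite -lin.
    by apply: (ghol_holo hp) => x xd; rewrite -lin; apply: inside => //; exact: (H _ (Hx x xd)).1.
  have /choice[g' Hg'] : forall s : R, exists d : C, 0 <= s <= 1 -> cder (fun x => g s (t + x *: v)) 0 d.
    move=> s; have [s01|no] := boolP (0 <= s <= 1); last by exists 0.
    by have [|d' Hd'] := hh s s01 0; [rewrite subrr nc0|exists d'].
  have [||||_ D] := @dui R (fun s x => g s (t + x *: v)) g' 0 (d / (vn v + 1)) M 0 1 ler01 q0.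
  - exact: hh.
  - by move=> s x s01 /Hx/H[_]; apply.
  - by move=> x s s01 /Hx/H[cx _]; exact: gc.
  - exact: Hg'.
  by exists (cint g' 0 1).
move=> t ct.
have dE : dir t = (t 0 a - t 0 b) *: e by [].
have l0 : f (l 0 t) = 0.
  apply: f0; first by apply: inside; rewrite ?lexx ?ler01.
  have ptE i : pt t 0 i = t 0 i - (t 0 a - t 0 b) * e 0 i by rewrite !mxE.
  by rewrite /l realC0 scale0r addr0 !ptE ea eb; ring.
have D s : 0 <= s <= 1 -> rder (fun s => f (l s t)) s ((t 0 a - t 0 b) * g s t).
  move=> s01; have := rder_comp (rder_id s) (ghol_pder_line (v := dir t) (x := s%:C) hf (inside t s ct s01)).
  by rewrite mulr1 dE (pderZ _ _ hf (inside t s ct s01)).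
have ig : integ (g^~ t) 0 1.
  have hp := ghol_pder_ghol e hf.
  apply: integ_cont => s s01; apply: (rcont_comp (f := fun x => pder f e (pt t + x *: dir t)) (g := fun s => s%:C)).
    exact: rder_cont (rder_id s).
  exact: cder_cont (ghol_pder_line hp (inside t s ct s01)).
by rewrite -(cintZ _ ler01 ig) (cintE ler01 D) l0 subr0 l1.
Qed.

Lemma differentiable_mghol X c r : (forall t, pd c r t -> differentiable X t) -> mghol X c r.
Proof.
move=> H i j; split => [t v ct|t ct].
  have D : derivable X t v := diff_derivable (H t ct).
  by exists ('D_v X t i j); exact: (derivable_cder X t v ('D_v X t)).1 (conj D erefl) i j.
have /differentiable_continuous hc := H t ct.
have Q : nbhs (X t) [set A : M_n | nc (A i j) <= nc (X t i j) + 1].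
  apply/nbhs_mx; exists 1 => // A /(_ i j) hA /=.
  have := nc_dist (A i j) (X t i j); lra.
have /nbhs_pd[d d0 Hd] := hc _ Q.
by exists d, (nc (X t i j) + 1).
Qed.

Lemma holomorphic_on_polydisc X (eps : R) : 0 <= eps -> holomorphic_on X (polydisc eps) ->
  exists X' d, [/\ 0 < d, mghol X' 0 (eps + d) & forall t, polydisc eps t -> X' t = X t].
Proof.
move=> e0 [U [g [oO sub dg E]]]; have [d d0 Hd] := polydisc_nbhs e0 oO sub.
by exists g, d; split => //; apply: differentiable_mghol => t /Hd/dg.
Qed.

Lemma holomorphic_on_open X (V : set T) c r : open V -> holomorphic_on X V ->
  (forall t, pd c r t -> V t) -> mghol X c r.
Proof.
move=> oV [U [g [oO sub dg E]]] cV.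
by apply: (mghol_near (X := g)) => [t /cV/E//|]; apply: differentiable_mghol => t /cV/sub/dg.
Qed.

Lemma mghol_holomorphic_on X (eps e1 : R) : 0 <= eps -> eps < e1 -> mghol X 0 e1 ->
  holomorphic_on X (polydisc eps).
Proof.
move=> e0 ee h; exists (pd 0 e1 : set T), X; split => //.
- exact: pd_is_open.
- move=> t /(polydiscP _ e0) H i; rewrite mxE subr0; exact: le_lt_trans (H i) ee.
- by move=> t ct; exact: ghol_differentiable h ct.
Qed.

Definition mpder X v t : M_n := \matrix_(i, j) pder (fun s => X s i j) v t.

Lemma mpder_mghol X c r v : mghol X c r -> mghol (mpder X v) c r.
Proof.
move=> h i j; apply: ghol_ext (ghol_pder_ghol v (h i j)) => t; by rewrite mxE.
Qed.

Lemma mpder_line X c r t v (x : C) : mghol X c r -> pd c r (t + x *: v) ->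
  mder (fun x => X (t + x *: v)) x (mpder X v (t + x *: v)).
Proof. by move=> h ct i j; rewrite mxE; exact: ghol_pder_line (h i j) ct. Qed.

Lemma mpder_der X c r t v : mghol X c r -> pd c r t ->
  mder (fun x => X (t + x *: v)) 0 (mpder X v t).
Proof. by move=> h ct i j; rewrite mxE; exact: ghol_pder (h i j) ct. Qed.

Lemma mpderP X v t D : mder (fun x => X (t + x *: v)) 0 D -> mpder X v t = D.
Proof. by move=> h; apply/matrixP => i j; rewrite mxE; exact: pderP (h i j). Qed.

Lemma at0 X t v : X (t + 0 *: v) = X t.
Proof. by rewrite scale0r addr0. Qed.

Lemma mpderM X Y c r t v : mghol X c r -> mghol Y c r -> pd c r t ->
  mpder (fun t => X t *m Y t) v t = mpder X v t *m Y t + X t *m mpder Y v t.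
Proof.
move=> hX hY ct; apply: mpderP.
apply: mder_eq (mderM (mpder_der v hX ct) (mpder_der v hY ct)) _; by rewrite !at0.
Qed.

Lemma mpderD X Y c r t v : mghol X c r -> mghol Y c r -> pd c r t ->
  mpder (fun t => X t + Y t) v t = mpder X v t + mpder Y v t.
Proof. by move=> hX hY ct; apply: mpderP; exact: mderD (mpder_der v hX ct) (mpder_der v hY ct). Qed.

Lemma mpder_cst (A : M_n) v t : mpder (fun=> A) v t = 0.
Proof. by apply: mpderP; exact: mder_cst. Qed.

Lemma mpderMr X (A : M_n) c r t v : mghol X c r -> pd c r t ->
  mpder (fun t => X t *m A) v t = mpder X v t *m A.
Proof. by move=> hX ct; rewrite (mpderM v hX (mghol_cst A c r) ct) mpder_cst mulmx0 addr0. Qed.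

Lemma mpder_near X Y c r t v : (forall t, pd c r t -> X t = Y t) -> mghol X c r -> pd c r t ->
  mpder Y v t = mpder X v t.
Proof.
move=> XY hX ct; apply: mpderP => i j; have [d d0 Hd] := pd_open ct.
apply: (cder_near (r := d / (vn v + 1))) (mpder_der v hX ct i j).
  by rewrite divr_gt0// ltr_wpDl ?vn_ge0.
by move=> h hr; rewrite add0r XY//; exact: pd_trans (line_pd t hr) Hd.
Qed.

Implicit Types (u : T) (A : M_n) (F H : nat -> M_n).

(** The equation of formal solutions at the power -k-1 of z; at the power 0 it only says that [F 0]
    commutes with diag u. *)
Definition formal_rec u A (B : M_n) F : Prop := forall k,
  diag_mx u *m F k.+1 - F k.+1 *m diag_mx u = F k *m B - A *m F k - F k *+ k.

Lemma fser_mul_sysr u A F k :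
  fser_mul F (fser_system u A) k.+1 = F k.+1 *m diag_mx u + F k *m A.
Proof.
rewrite /fser_mul big_ord_recr big_ord_recr /= subnn subSn// subnn /=.
by rewrite big1 ?add0r 1?addrC// => i _; rewrite subSn ?(ltnW (ltn_ord i))// -(subnSK (ltn_ord i)) /= mulmx0.
Qed.

Lemma fser_mul_sysl u A F k :
  fser_mul (fser_system u A) F k.+1 = diag_mx u *m F k.+1 + A *m F k.
Proof.
rewrite /fser_mul big_ord_recl big_ord_recl /= subn0 subSS subn0.
by rewrite big1 ?addr0// => i _; rewrite mul0mx.
Qed.

Lemma mxaddE (A B : M_n) i j : (A + B) i j = A i j + B i j.
Proof. by rewrite mxE. Qed.
Lemma mxoppE (A : M_n) i j : (- A) i j = - A i j.
Proof. by rewrite mxE. Qed.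
Lemma mxmulnE (A : M_n) k i j : (A *+ k) i j = k%:R * A i j.
Proof. by rewrite mulmxnE mulr_natl. Qed.

Lemma formal_solutionP u A F :
  formal_solution u A F <-> F 0%N = 1%:M /\ formal_rec u A (diag_part A) F.
Proof.
have E (W X Y Z K : M_n) : - K + (X + Y) = Z + W <-> Z - X = Y - W - K.
  split => h; apply/matrixP => i j; have /matrixP/(_ i j) := h; rewrite !(mxaddE, mxoppE) => e.
    have -> : Z i j - X i j = (Z i j + W i j) - W i j - X i j by ring.
    by rewrite -e; ring.
  have -> : Z i j + W i j = (Z i j - X i j) + X i j + W i j by ring.
  by rewrite e; ring.
split => [[F0 h]|[F0 h]]; split => // k.
  have := h k.+1; rewrite /fser_ddz /= fser_mul_sysr fser_mul_sysl scaler_nat.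
  by move/E.
case: k => [|k].
  rewrite /fser_ddz /fser_mul !big_ord1 /= F0 scale0r oppr0 add0r mul1mx mulmx1 //.
by rewrite /fser_ddz /= fser_mul_sysr fser_mul_sysl scaler_nat; apply/E.
Qed.

Lemma diag_commE u A i j : (diag_mx u *m A - A *m diag_mx u) i j = (u 0 i - u 0 j) * A i j.
Proof. by rewrite mxsubE mul_diag_mx mul_mx_diag !mxE; ring. Qed.

Lemma diag_part_mulr A (X : M_n) i j : (X *m diag_part A) i j = X i j * A j j.
Proof. by rewrite mul_mx_diag !mxE. Qed.

(** For u_a != u_b, step [k] of the recursion annihilates the entry (a, b) of [H k.+1]. For u_a =
    u_b the commutator vanishes in step [k.+1], which leaves (A_bb - A_aa - (k + 1)) H_ab = 0, as
    [A] is diagonal inside the blocks of equal u. *)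
Lemma formal_zero u A H :
  (forall a b, a != b -> u 0 a = u 0 b -> A a b = 0) ->
  (forall a b k, u 0 a = u 0 b -> A b b - A a a != k.+1%:R) ->
  H 0%N = 0 -> formal_rec u A (diag_part A) H -> forall k, H k = 0.
Proof.
move=> A0 res H0 rec; elim=> [//|k IH].
have off a b : u 0 a != u 0 b -> H k.+1 a b = 0.
  move=> uab; have /matrixP/(_ a b) := rec k.
  rewrite diag_commE IH mul0mx mulmx0 mul0rn subrr subr0 mxE => /eqP.
  by rewrite mulf_eq0 subr_eq0 (negbTE uab) => /eqP.
apply/matrixP => a b; rewrite mxE.
have [uab|] := eqVneq (u 0 a) (u 0 b); last exact: off.
have /matrixP/(_ a b) := rec k.+1.
rewrite diag_commE uab subrr mul0r mxsubE mxsubE diag_part_mulr mxmulnE mxE (bigD1 a)//=.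
rewrite big1 => [|c ca]; last first.
  have [uca|uca] := eqVneq (u 0 a) (u 0 c).
    by rewrite A0 ?mul0r// eq_sym.
  by rewrite off ?mulr0// eq_sym -uab.
rewrite addr0 => E; have /eqP : H k.+1 a b * (A b b - A a a - k.+1%:R) = 0 by rewrite [RHS]E; ring.
by rewrite mulf_eq0 subr_eq0 (negbTE (res _ _ k uab)) orbF => /eqP.
Qed.

Lemma formal_unique u A F G :
  (forall a b, a != b -> u 0 a = u 0 b -> A a b = 0) ->
  (forall a b k, u 0 a = u 0 b -> A b b - A a a != k.+1%:R) ->
  formal_solution u A F -> formal_solution u A G -> forall k, F k = G k.
Proof.
move=> A0 res /formal_solutionP[F0 hF] /formal_solutionP[G0 hG] k.
apply/eqP; rewrite -subr_eq0; apply/eqP.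
apply: (formal_zero (H := fun k => F k - G k) A0 res) => [|l].
  by rewrite F0 G0 subrr.
have := hF l; have := hG l; move: (F l) (G l) (F l.+1) (G l.+1) => f g f' g' e1 e2.
have -> : diag_mx u *m (f' - g') - (f' - g') *m diag_mx u =
  (diag_mx u *m f' - f' *m diag_mx u) - (diag_mx u *m g' - g' *m diag_mx u).
  by rewrite mulmxBl mulmxBr; apply/matrixP => i j; rewrite !(mxaddE, mxoppE); ring.
rewrite e1 e2 mulmxBl mulmxBr mulrnBl; apply/matrixP => i j.
rewrite !(mxaddE, mxoppE, mxmulnE); ring.
Qed.

(* The derivative of the recursion along the isomonodromic flow.  The identity is
   tested on the images of additive maps [p], as noncommutative monomials then
   become atoms of a commutative ring. *)
Lemma ring_flow (V : pzRingType) (K : comPzRingType) (p : V -> K) (L E om A B F F1 F2 D D1 : V) k :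
  (forall x y, p (x + y) = p x + p y) -> (forall x, p (- x) = - p x) ->
  (forall x m, p (x *+ m) = m%:R * p x) ->
  L * F1 - F1 * L = F * B - A * F - F *+ k ->
  L * F2 - F2 * L = F1 * B - A * F1 - F1 *+ k.+1 ->
  E * F1 - F1 * E + (L * D1 - D1 * L) = D * B - (om * A - A * om) * F - A * D - D *+ k ->
  L * om - om * L = E * A - A * E ->
  L * E = E * L -> B * E = E * B ->
  let H := D - om * F - (E * F1 - F1 * E) in
  let H1 := D1 - om * F1 - (E * F2 - F2 * E) in
  p (L * H1 - H1 * L) = p (H * B - A * H - H *+ k).
Proof.
move=> pD pN pn e1 e2 e3 e4 e5 e6 H H1.
have h1 : om * (L * F1 - F1 * L) = om * (F * B - A * F - F *+ k) by rewrite e1.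
have h2 : (L * om - om * L) * F1 = (E * A - A * E) * F1 by rewrite e4.
have h3 : E * (L * F2 - F2 * L) = E * (F1 * B - A * F1 - F1 *+ k.+1) by rewrite e2.
have h4 : (L * F2 - F2 * L) * E = (F1 * B - A * F1 - F1 *+ k.+1) * E by rewrite e2.
have h5 : L * E * F2 = E * L * F2 by rewrite e5.
have h6 : F2 * (L * E) = F2 * (E * L) by rewrite e5.
have h7 : F1 * (B * E) = F1 * (E * B) by rewrite e6.
rewrite /H /H1.
have ex (x y : V) : x = y -> p x - p y = 0 by move=> ->; rewrite subrr.
move: (ex _ _ e3) (ex _ _ h1) (ex _ _ h2) (ex _ _ h3) (ex _ _ h4) (ex _ _ h5) (ex _ _ h6) (ex _ _ h7).
rewrite !(mulrDl, mulrDr, mulNr, mulrN, mulrnAr, mulrnAl) !mulrA !(pD, pN, pn) -natr1.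
have S (g x1 x2 x3 x4 x5 x6 x7 x8 : K) : x1 = 0 -> x2 = 0 -> x3 = 0 -> x4 = 0 -> x5 = 0 -> x6 = 0 ->
    x7 = 0 -> x8 = 0 -> g = x1 - x2 - x3 - x4 + x5 - x6 + x7 + x8 -> g = 0.
  by move=> -> -> -> -> -> -> -> -> ->; rewrite !(subr0, addr0).
move=> a1 a2 a3 a4 a5 a6 a7 a8.
apply/eqP; rewrite -subr_eq0; apply/eqP.
apply: (S _ _ _ _ _ _ _ _ _ a1 a2 a3 a4 a5 a6 a7 a8); ring.
Qed.

(** [H] measures how far F_k is from the flow of the connection, [D] being its derivative and [E]
    the matrix diag v. This defect satisfies the recursion of formal solutions again, so that
    [formal_zero] can annihilate it. *)
Lemma formal_flow (L E om A B : M_n) (F F1 F2 D D1 : M_n) k :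
  L *m F1 - F1 *m L = F *m B - A *m F - F *+ k ->
  L *m F2 - F2 *m L = F1 *m B - A *m F1 - F1 *+ k.+1 ->
  E *m F1 - F1 *m E + (L *m D1 - D1 *m L) =
    D *m B - (om *m A - A *m om) *m F - A *m D - D *+ k ->
  L *m om - om *m L = E *m A - A *m E ->
  L *m E = E *m L -> B *m E = E *m B ->
  let H := D - om *m F - (E *m F1 - F1 *m E) in
  let H1 := D1 - om *m F1 - (E *m F2 - F2 *m E) in
  L *m H1 - H1 *m L = H *m B - A *m H - H *+ k.
Proof.
move=> e1 e2 e3 e4 e5 e6 H H1; apply/matrixP => i j.
exact: (@ring_flow M_n C (fun P => P i j) L E om A B F F1 F2 D D1 k
  (fun P Q => mxaddE P Q i j) (fun P => mxoppE P i j) (fun P m => mxmulnE P m i j) e1 e2 e3 e4 e5 e6).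
Qed.
End MatrixHolomorphy.

(** * Energy estimates for linear equations with diagonal leading part *)

Section Growth.
Context {R : realType}.
Notation C := (R[i]^o)%type.

Definition cdot (x y : C) : R := cRe x * cRe y + cIm x * cIm y.

Lemma cdot_le x y : `|cdot x y| <= nc x * nc y.
Proof.
have -> : cdot x y = cRe ((cRe x +i* - cIm x : C) * y) by rewrite cReM /= mulNr opprK.
apply: le_trans (Re_le_nc _) _; rewrite ncM ler_wpM2r ?nc_ge0//.
rewrite -(@ler_sqr R) ?nnegrE ?nc_ge0// !ncE /= sqrrN//.
Qed.

Lemma cdotD x y z : cdot x (y + z) = cdot x y + cdot x z.
Proof. by rewrite /cdot cReD cImD; ring. Qed.

Lemma cdot_mul x d : cdot x (d * x) = cRe d * nc x ^+ 2.
Proof. by rewrite /cdot ncE cReM cImM; ring. Qed.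

Lemma dr_nc2 (x : R -> C) s d : rder x s d -> dr (fun s => nc (x s) ^+ 2) s (2 * cdot (x s) d).
Proof.
move=> h; apply: (dr_ext (f := fun s => cRe (x s) * cRe (x s) + cIm (x s) * cIm (x s))).
  by move=> y; rewrite ncE !expr2.
apply: dr_eq (drD (drM (rder_Re h) (rder_Re h)) (drM (rder_Im h) (rder_Im h))) _.
by rewrite /cdot; ring.
Qed.

Lemma dr_expZ (c s : R) : dr (fun s => expR (c * s)) s (c * expR (c * s)).
Proof.
apply: dr_eq (dr_comp (drZ c (dr_id s)) (dr_expR _)) _; by rewrite mulr1 mulrC.
Qed.

Lemma gronwall (V V' : R -> R) (c S : R) : 0 <= S -> (forall s, 0 <= s <= S -> dr V s (V' s)) ->
  (forall s, 0 <= s <= S -> V' s <= c * V s) -> V S <= expR (c * S) * V 0.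
Proof.
move=> S0 dV le.
have : (fun s => - (expR (- c * s) * V s)) 0 <= (fun s => - (expR (- c * s) * V s)) S.
  apply: (@dr_ge0 R (fun s => - (expR (- c * s) * V s)) (fun s => expR (- c * s) * (c * V s - V' s)) 0 S) => //.
    move=> s s0; apply: dr_eq (drN (drM (dr_expZ (- c) s) (dV s s0))) _; ring.
  by move=> s s0; rewrite mulr_ge0 ?expR_ge0// subr_ge0 le.
rewrite /= mulr0 expR0 mul1r lerN2 => h.
have -> : V S = expR (c * S) * (expR (- c * S) * V S) by rewrite mulrA -expRD mulNr subrr expR0 mul1r.
by rewrite ler_wpM2l ?expR_ge0.
Qed.

Lemma gronwall_ge (V V' : R -> R) (c S : R) : 0 <= S -> (forall s, 0 <= s <= S -> dr V s (V' s)) ->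
  (forall s, 0 <= s <= S -> c * V s <= V' s) -> expR (c * S) * V 0 <= V S.
Proof.
move=> S0 dV le; rewrite -lerN2 -mulrN.
apply: (@gronwall (fun s => - V s) (fun s => - V' s) c S) => // s s0; first exact: drN (dV s s0).
by rewrite mulrN lerN2 le.
Qed.

Context {n : nat}.
Implicit Types (x r d : 'I_n -> R -> C).

Definition en (p : pred 'I_n) x (s : R) : R := \sum_(a | p a) nc (x a s) ^+ 2.

Lemma en_ge0 p x s : 0 <= en p x s.
Proof. by apply: sumr_ge0 => a _; exact: exprn_ge0 (nc_ge0 _). Qed.

Lemma en_split p x s : en xpredT x s = en p x s + en (predC p) x s.
Proof. by rewrite /en (bigID p). Qed.

Lemma sum_cst (c : R) : \sum_(a < n) c = n%:R * c.
Proof. by rewrite (sumr_const _ c) card_ord -[LHS]mulr_natl. Qed.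

Lemma nc2_le_en x s a : nc (x a s) ^+ 2 <= en xpredT x s.
Proof. by rewrite /en (bigD1 a)//= lerDl sumr_ge0// => b _; exact: exprn_ge0 (nc_ge0 _). Qed.

Lemma sum_sqr x s : (\sum_a nc (x a s)) ^+ 2 <= n%:R * en xpredT x s.
Proof.
rewrite expr2 mulr_suml.
apply: (@le_trans _ _ (\sum_a \sum_b (nc (x a s) ^+ 2 / 2 + nc (x b s) ^+ 2 / 2))).
  apply: ler_sum => a _; rewrite mulr_sumr; apply: ler_sum => b _.
  have := sqr_ge0 (nc (x a s) - nc (x b s)); nra.
under eq_bigr do rewrite big_split /= sum_cst -mulr_suml -/(en xpredT x s).
rewrite big_split /= sum_cst -mulr_sumr -mulr_suml -/(en xpredT x s).
by apply: le_of_eq; field.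
Qed.

Lemma sum_err x r s (eta delta : R) : 0 <= eta -> 0 <= delta ->
  (forall a, nc (r a s) <= eta * \sum_b nc (x b s) + delta) ->
  \sum_a nc (x a s) * nc (r a s) <= n%:R * eta * en xpredT x s + delta * \sum_a nc (x a s).
Proof.
move=> e0 d0 h.
apply: (@le_trans _ _ (\sum_a nc (x a s) * (eta * \sum_b nc (x b s) + delta))).
  by apply: ler_sum => a _; rewrite ler_wpM2l ?nc_ge0.
rewrite -mulr_suml mulrDr [_ * delta]mulrC lerD2r mulrCA [n%:R * eta]mulrC -mulrA ler_wpM2l//.
by rewrite -expr2 sum_sqr.
Qed.

Lemma sum_lin x s (delta : R) : delta * (\sum_a nc (x a s)) <= (en xpredT x s + n%:R * delta ^+ 2) / 2.
Proof.
rewrite mulr_sumr -sum_cst /en -big_split /= mulr_suml; apply: ler_sum => a _.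
have := sqr_ge0 (nc (x a s) - delta); nra.
Qed.

Lemma dr_en p x (x' : 'I_n -> C) s : (forall a, rder (x a) s (x' a)) ->
  dr (en p x) s (2 * \sum_(a | p a) cdot (x a s) (x' a)).
Proof.
move=> h; rewrite /en mulr_sumr big_mkcond /=.
apply: (dr_ext (f := fun s => \sum_a (if p a then nc (x a s) ^+ 2 else 0))).
  by move=> y; rewrite -big_mkcond.
apply: dr_sum => a; case: (p a); [exact: dr_nc2|exact: dr_cst].
Qed.

(** Only the real parts of the diagonal rates enter the derivative of the energy. Adding
    [n%:R * delta ^+ 2] to it absorbs the forcing: componentwise 2 delta |x| <= |x|^2 + delta^2,
    which costs the summand 1 in the exponent. *)
Lemma growth x d r (kappa eta delta S : R) : 0 <= S -> 0 <= kappa -> 0 <= eta -> 0 <= delta ->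
  (forall a s, 0 <= s <= S -> rder (x a) s (d a s * x a s + r a s)) ->
  (forall a s, 0 <= s <= S -> cRe (d a s) <= kappa) ->
  (forall a s, 0 <= s <= S -> nc (r a s) <= eta * \sum_b nc (x b s) + delta) ->
  en xpredT x S + n%:R * delta ^+ 2 <=
    expR ((2 * kappa + 2 * n%:R * eta + 1) * S) * (en xpredT x 0 + n%:R * delta ^+ 2).
Proof.
move=> S0 k0 e0 d0 hx hd hr.
apply: (@gronwall (fun s => en xpredT x s + n%:R * delta ^+ 2)
  (fun s => 2 * \sum_a cdot (x a s) (d a s * x a s + r a s) + 0)) => // s s0.
  by apply: drD (dr_cst _ s); apply: dr_en => a; exact: hx.
have b1 : \sum_a cdot (x a s) (d a s * x a s + r a s) <=
    kappa * en xpredT x s + \sum_a nc (x a s) * nc (r a s).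
  rewrite /en mulr_sumr -big_split /=; apply: ler_sum => a _.
  rewrite cdotD cdot_mul; apply: lerD; first by rewrite ler_wpM2r ?exprn_ge0 ?nc_ge0 ?hd.
  exact: le_trans (ler_norm _) (cdot_le _ _).
have b2 := sum_err e0 d0 (fun a => hr a s s0).
have b3 := sum_lin x s delta.
have b4 := en_ge0 xpredT x s.
have b5 : 0 <= n%:R * delta ^+ 2 by rewrite mulr_ge0 ?exprn_ge0.
have b6 : 0 <= kappa * (n%:R * delta ^+ 2) by rewrite mulr_ge0.
have b7 : 0 <= n%:R * eta * (n%:R * delta ^+ 2) by rewrite !mulr_ge0.
rewrite addr0; move: b1 b2 b3 b4 b5 b6 b7.
move: (\sum_a cdot _ _) (\sum_a nc (x a s) * _) (delta * _) (en _ _ _) (n%:R * delta ^+ 2).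
move=> S1 S2 S3 E D; rewrite -[n%:R * eta * D]mulrA; nra.
Qed.

(* [V = E_P - E_Q - k0^2] satisfies [V' >= c V]; were it positive somewhere, it
   would outgrow the a priori bound. *)
Lemma dichotomy x r (d : 'I_n -> C) (P : pred 'I_n) (mu1 mu2 eta k0 K : R) :
  0 <= eta -> 0 <= k0 ->
  (forall a s, 0 <= s -> rder (x a) s (d a * x a s + r a s)) ->
  (forall a, if P a then mu2 <= cRe (d a) else cRe (d a) <= 0) ->
  (forall a s, 0 <= s -> nc (r a s) <= eta * (\sum_b nc (x b s) + k0)) ->
  (forall s, 0 <= s -> en xpredT x s <= K * expR (2 * mu1 * s)) ->
  (2 * n + 1)%:R * eta <= mu2 -> 2 * mu1 < 2 * mu2 - (2 * n + 1)%:R * eta ->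
  forall s, 0 <= s ->
    en xpredT x s <= 2 * expR (2 * (2 * n + 1)%:R * eta * s) * (en xpredT x 0 + k0 ^+ 2).
Proof.
move=> e0 k00 hx hd hr hK; set N : R := (2 * n + 1)%:R => hN hmu.
pose EP := en P x; pose EQ := en (predC P) x.
pose SP s := \sum_(a | P a) cdot (x a s) (d a * x a s + r a s).
pose SQ s := \sum_(a | predC P a) cdot (x a s) (d a * x a s + r a s).
have dEP s : 0 <= s -> dr EP s (2 * SP s) by move=> s0; apply: dr_en => a; exact: hx.
have dEQ s : 0 <= s -> dr EQ s (2 * SQ s) by move=> s0; apply: dr_en => a; exact: hx.
have k2 : 0 <= k0 ^+ 2 by rewrite exprn_ge0.
have EP0 s : 0 <= EP s := en_ge0 P x s.
have EQ0 s : 0 <= EQ s := en_ge0 (predC P) x s.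
pose err s := \sum_a nc (x a s) * nc (r a s).
have errB s : 0 <= s -> 2 * err s <= eta * N * (EP s + EQ s + k0 ^+ 2).
  move=> s0; have h1 : forall a, nc (r a s) <= eta * \sum_b nc (x b s) + eta * k0.
    by move=> a; rewrite -mulrDr; exact: hr.
  have := sum_err e0 (mulr_ge0 e0 k00) h1; have := ler_wpM2l e0 (sum_lin x s k0).
  rewrite mulrA (en_split P) -/(EP s) -/(EQ s) -/(err s).
  have : N = 2 * n%:R + 1 by rewrite /N natrD natrM.
  have : 0 <= eta * ((n%:R + 1) * k0 ^+ 2) by rewrite !mulr_ge0// addr_ge0.
  move: (eta * k0 * _) => Z a1 ->; nra.
have pq s : err s = \sum_(a | P a) nc (x a s) * nc (r a s) + \sum_(a | predC P a) nc (x a s) * nc (r a s) by rewrite /err (bigID P).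
have SPb s : mu2 * EP s - \sum_(a | P a) nc (x a s) * nc (r a s) <= SP s.
  rewrite /EP /en mulr_sumr -sumrB; apply: ler_sum => a Pa.
  rewrite cdotD cdot_mul; have := cdot_le (x a s) (r a s); rewrite ler_norml => /andP[h _].
  have := hd a; rewrite Pa => ha; have : mu2 * nc (x a s) ^+ 2 <= cRe (d a) * nc (x a s) ^+ 2.
    by rewrite ler_wpM2r ?exprn_ge0 ?nc_ge0.
  lra.
have SQb s : SQ s <= \sum_(a | predC P a) nc (x a s) * nc (r a s).
  apply: ler_sum => a Pa.
  rewrite cdotD cdot_mul; have := cdot_le (x a s) (r a s); rewrite ler_norml => /andP[_ h].
  have := hd a; rewrite (negbTE Pa) => ha; have : cRe (d a) * nc (x a s) ^+ 2 <= 0.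
    by rewrite mulr_le0_ge0 ?exprn_ge0 ?nc_ge0.
  lra.
have nn s : 0 <= \sum_(a | P a) nc (x a s) * nc (r a s) by apply: sumr_ge0 => a _; rewrite mulr_ge0 ?nc_ge0.
pose V s := EP s - EQ s - k0 ^+ 2.
have dV s : 0 <= s -> dr V s (2 * SP s - 2 * SQ s - 0) by move=> s0; apply: drB (dr_cst _ s); apply: drB; [exact: dEP|exact: dEQ].
(* The energy of the fast part grows at least at the rate [2 * mu2], and the coupling costs at most
   [N * eta]. *)
pose c := 2 * mu2 - N * eta.
have N0 : 0 <= N by rewrite /N ler0n.
have Ne : 0 <= N * eta by rewrite mulr_ge0.
have cV s : 0 <= s -> c * V s <= 2 * SP s - 2 * SQ s - 0.
  move=> s0; have := SPb s; have := SQb s; have := errB s s0; rewrite pq.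
  have : 0 <= (mu2 - N * eta) * (EQ s + k0 ^+ 2) by rewrite mulr_ge0 ?subr_ge0// addr_ge0.
  rewrite /c /V; nra.
have V0 s : 0 <= s -> V s <= 0.
  move=> s0; rewrite leNgt; apply/negP => Vs.
  have Kb S : 0 <= S -> expR ((c - 2 * mu1) * S) * V s <= K * expR (2 * mu1 * s).
    move=> S0; have := @gronwall_ge (fun y => V (s + y)) (fun y => 2 * SP (s + y) - 2 * SQ (s + y) - 0) c S S0.
    have H1 y : 0 <= y <= S -> dr (fun y => V (s + y)) y (2 * SP (s + y) - 2 * SQ (s + y) - 0).
      move=> /andP[y0 _]; apply: dr_eq (dr_comp (drD (dr_cst s y) (dr_id y)) (dV _ _)) _; first by rewrite addr_ge0.
      by rewrite add0r mulr1.
    move=> /(_ H1 (fun y y0 => cV _ (addr_ge0 s0 (proj1 (andP y0))))); rewrite addr0 => H2.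
    have H3 : V (s + S) <= K * expR (2 * mu1 * (s + S)).
      apply: le_trans (hK _ (addr_ge0 s0 S0)); rewrite (en_split P) /V -/(EP _) -/(EQ _).
      have := EQ0 (s + S); lra.
    rewrite -(ler_pM2l (expR_gt0 (2 * mu1 * S))) mulrA -expRD mulrCA -expRD.
    apply: le_trans (_ : _ <= V (s + S)) _; last apply: le_trans H3 _.
      by apply: le_trans H2; apply: le_of_eq; congr (expR _ * _); ring.
    by apply: le_of_eq; congr (_ * expR _); ring.
  have cm : 0 < c - 2 * mu1 by rewrite subr_gt0.
  pose L := K * expR (2 * mu1 * s) / V s.
  have [S [S0 SL]] : exists S, 0 <= S /\ L < expR ((c - 2 * mu1) * S).
    exists (`|L| / (c - 2 * mu1)); split; first by rewrite divr_ge0// ltW.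
    rewrite mulrCA divff ?gt_eqF// mulr1; apply: lt_le_trans (expR_ge1Dx _).
    by have := ler_norm L; lra.
  have := Kb S S0; rewrite -ler_pdivlMr// leNgt; by rewrite SL.
(* Since [V <= 0], the fast part is dominated by the rest, [EP s <= EQ s + k0 ^+ 2], and the
   inequality for [EQ] closes by itself. *)
have dW s : 0 <= s -> 2 * SQ s <= 2 * N * eta * (EQ s + k0 ^+ 2).
  move=> s0; have := SQb s; have := errB s s0; have := nn s; rewrite pq.
  have : N * eta * V s <= 0 by rewrite mulr_ge0_le0 ?V0.
  rewrite /V; nra.
move=> s s0.
have := @gronwall (fun s => EQ s + k0 ^+ 2) (fun s => 2 * SQ s + 0) (2 * N * eta) s s0.
move=> /(_ (fun y y0 => drD (dEQ y (proj1 (andP y0))) (dr_cst _ y))) W.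
have {}W : EQ s + k0 ^+ 2 <= expR (2 * N * eta * s) * (EQ 0 + k0 ^+ 2) by apply: W => y /andP[y0 _]; rewrite addr0; exact: dW.
have := V0 s s0; rewrite /V (en_split P) -/(EP s) -/(EQ s) (en_split P x 0) -/(EP 0) -/(EQ 0) => h.
have h2 : expR (2 * N * eta * s) * (EQ 0 + k0 ^+ 2) <= expR (2 * N * eta * s) * (EP 0 + EQ 0 + k0 ^+ 2) by rewrite ler_wpM2l ?expR_ge0// lerD2r lerDr.
lra.
Qed.
End Growth.

(** * Inverse matrices *)

Section Inverse.
Context {R : realType}.
Notation C := (R[i]^o)%type.

Lemma cder_prod (I : Type) (s : seq I) (F : I -> C -> C) w :
  (forall i, exists d, cder (F i) w d) -> exists d, cder (fun x => \prod_(i <- s) F i x) w d.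
Proof.
move=> h; elim: s => [|i s [d Hd]].
  by exists 0; apply: cder_ext (cder_cst 1 w) => x; rewrite big_nil.
have [e He] := h i; eexists; apply: cder_ext (cderM He Hd) => x; by rewrite big_cons.
Qed.

Lemma cder_det m (X : C -> 'M[R[i]^o]_m) w :
  (forall i j, exists d, cder (fun x => X x i j) w d) -> exists d, cder (fun x => \det (X x)) w d.
Proof.
move=> h; rewrite /determinant.
have H (s : {perm 'I_m}) : exists d, cder (fun x => (-1) ^+ s * \prod_i X x i (s i)) w d.
  have [d Hd] := @cder_prod _ (index_enum 'I_m) (fun i x => X x i (s i)) w (fun i => h i (s i)).
  by exists ((-1) ^+ s * d); exact: cderZ.
have [d Hd] := choice H; exists (\sum_s d s); by apply: cder_sum.
Qed.

Lemma invmxE m (A : 'M[R[i]^o]_m) i j : A \in unitmx -> invmx A i j = (\det A)^-1 * cofactor A j i.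
Proof. by move=> uA; rewrite /invmx uA !mxE. Qed.

Lemma mder_invmx m (X : C -> 'M[R[i]^o]_m) w : (forall x, X x \in unitmx) ->
  (forall i j, exists d, cder (fun x => X x i j) w d) ->
  forall i j, exists d, cder (fun x => invmx (X x) i j) w d.
Proof.
move=> uX h i j.
have [d Hd] := cder_det h.
have [e He] : exists e, cder (fun x => cofactor (X x) j i) w e.
  have [k l|e He] := @cder_det _ (fun x => row' j (col' i (X x))) w.
    by have [q Hq] := h (lift j k) (lift i l); exists q; apply: cder_ext Hq => x; rewrite !mxE.
  by exists ((-1) ^+ (j + i) * e); apply: cderZ He.
have u0 : \det (X w) != 0 by have := uX w; rewrite unitmxE unitfE.
have Hq := cder_comp Hd (cder_invx u0); eexists.
have E x : invmx (X x) i j = (\det (X x))^-1 * cofactor (X x) j i by exact: invmxE (uX x).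
by rewrite (funext E); exact: cderM Hq He.
Qed.

Lemma invmx_mul m (A B : 'M[R[i]^o]_m) : A \in unitmx -> B \in unitmx -> invmx (A *m B) = invmx B *m invmx A.
Proof.
move=> uA uB; have u : A *m B \in unitmx by rewrite unitmx_mul uA.
have I : A *m B *m (invmx B *m invmx A) = 1%:M by rewrite mulmxA mulmxK// mulmxV.
by rewrite -[RHS](mulKmx u) I mulmx1.
Qed.

(** For the largest modulus [c] of an entry of the inverse, X^-1 = I - (X - I) X^-1 gives
    [c <= 1 + c / 2]. *)
Lemma inv_near1 n (X : 'M[R[i]^o]_n) : X \in unitmx ->
  (forall i j, nc ((X - 1%:M) i j) <= (2 * n%:R)^-1) -> forall i j, nc (invmx X i j) <= 2.
Proof.
move=> uX H; have n0 (i : 'I_n) : 0 < n%:R :> R by rewrite ltr0n; case: n i {X uX H} => // -[].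
have [b [b0 Hb]] := mx_bound (invmx X).
move=> i j; have [k Hk] : exists kl : 'I_n * 'I_n, forall kl', nc (invmx X kl'.1 kl'.2) <= nc (invmx X kl.1 kl.2).
  have := @arg_maxP _ _ _ (i, j) xpredT (fun kl : 'I_n * 'I_n => nc (invmx X kl.1 kl.2)) isT.
  by case=> kl _ h; exists kl => kl'; exact: h.
apply: le_trans (Hk (i, j)) _; set c := nc _.
have c1 : c <= 1 + c / 2.
  have E : invmx X = 1%:M - (X - 1%:M) *m invmx X by rewrite mulmxBl mulmxV// mul1mx opprB addrCA subrr addr0.
  rewrite {1}/c {1}E mxsubE; apply: le_trans (ncB _ _) _; apply: lerD; first exact: nc_mx1.
  apply: le_trans (nc_mulmx (b := c) _ _ H _) _; first by move=> a b'; exact: (Hk (a, b')).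
  apply: le_of_eq; field; by rewrite gt_eqF// n0.
by move: c c1; clear => c c1; lra.
Qed.
End Inverse.

(** * Systems in the logarithmic coordinate and Levelt solutions *)

Section Systems.
Context {R : realType} {n : nat}.
Notation C := (R[i]^o)%type.
Notation M_n := 'M[R[i]^o]_n.
Implicit Types (u : 'rV[R[i]^o]_n) (A B : M_n) (Y : C -> M_n).

Lemma mxscaleE (x : C) A i j : (x *: A) i j = x * A i j.
Proof. by rewrite mxE. Qed.

Lemma cder_line1 (f : C -> C) w d : cder (fun x => f (w + x *: (1 : C))) 0 d <-> cder f w d.
Proof.
have E x : x *: (1 : C) = x by rewrite /GRing.scale /= mulr1.
split => h e e0; have [r r0 H] := h e e0; exists r => // k kr; have := H k kr.
  by rewrite !E add0r addr0.
by rewrite !E add0r addr0.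
Qed.

Lemma scale_system (z : C) u A (X Y : M_n) : z != 0 ->
  z^-1 *: X = (diag_mx u + z^-1 *: A) *m Y <-> X = (z *: diag_mx u + A) *m Y.
Proof.
move=> z0; have E : (z *: diag_mx u + A) *m Y = z *: ((diag_mx u + z^-1 *: A) *m Y).
  by rewrite scalemxAl scalerDr scalerA mulfV// scale1r.
split => [h|->]; first by rewrite E -h scalerA mulfV// scale1r.
by rewrite E scalerA mulVf// scale1r.
Qed.

(** In the coordinate w = log z the system is dY/dw = (z Lambda + A) Y, with coefficients entire in
    w. *)
Lemma fundP u A Y : fundamental_solution u A Y <->
  forall w, mder Y w ((cexp w *: diag_mx u + A) *m Y w) /\ Y w \in unitmx.
Proof.
split => H w; have := H w.
  move=> [d1 d2 d3]; split => //.
  have E : 'D_(1 : C) Y w = (cexp w *: diag_mx u + A) *m Y w by apply/(scale_system _ _ _ _ (cexp_neq0 w)); exact: d2.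
  move=> i j; apply/cder_line1.
  exact: (derivable_cder Y w (1 : C) ((cexp w *: diag_mx u + A) *m Y w)).1 (conj d1 E) i j.
move=> [d1 d2].
have [] := (derivable_cder Y w (1 : C) ((cexp w *: diag_mx u + A) *m Y w)).2.
  by move=> i j; apply: (cder_line1 (fun w => Y w i j) w _).2; exact: d1.
move=> h1 h2; split => //.
by apply/(scale_system _ _ _ _ (cexp_neq0 w)).
Qed.

Lemma fund_const u A Y Y' : fundamental_solution u A Y -> fundamental_solution u A Y' ->
  forall w, Y' w = Y w *m (invmx (Y 0) *m Y' 0).
Proof.
move=> /fundP hY /fundP hY'.
pose X w := invmx (Y w) *m Y' w.
have dX w : mder X w 0.
  have uY x := (hY x).2.
  have /choice[D HD] : forall ij : 'I_n * 'I_n, exists d, cder (fun x => invmx (Y x) ij.1 ij.2) w d by move=> ij; apply: mder_invmx => // i j; eexists; exact: (hY w).1.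
  have dI : mder (fun x => invmx (Y x)) w (\matrix_(i, j) D (i, j)) by move=> i j; rewrite mxE; exact: HD (i, j).
  have E : (\matrix_(i, j) D (i, j)) *m Y w + invmx (Y w) *m ((cexp w *: diag_mx u + A) *m Y w) = 0.
    apply: mder_unique (mderM dI (hY w).1) _.
    by apply: mder_ext (mder_cst 1%:M w) => x; rewrite mulVmx// (hY x).2.
  have DE : (\matrix_(i, j) D (i, j)) = - (invmx (Y w) *m (cexp w *: diag_mx u + A)).
    have G (X1 X2 X3 X4 : M_n) : X2 \in unitmx -> X1 *m X2 + X3 *m (X4 *m X2) = 0 -> X1 = - (X3 *m X4).
      move=> u2; rewrite mulmxA -mulmxDl => /(congr1 (mulmx^~ (invmx X2))).
      by rewrite mulmxK// mul0mx => /eqP; rewrite addr_eq0 => /eqP.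
    exact: G (uY w) E.
  apply: mder_eq (mderM dI (hY' w).1) _.
  have G (X1 X2 X3 : M_n) : - (X1 *m X2) *m X3 + X1 *m (X2 *m X3) = 0 by rewrite mulNmx !mulmxA addNr.
  by rewrite DE; exact: G.
move=> w; rewrite -/(X 0) -(mder0_cst dX w) /X mulKVmx//; exact: (hY w).2.
Qed.

(** The matrix Y e^(-Lambda z) z^(-B) whose expansion is prescribed, written entrywise because both
    factors are diagonal; only the diagonal of [B] enters. *)
Definition gau u B Y (w : C) : M_n :=
  \matrix_(i, j) (Y w i j * cexp (- (cexp w * u 0 j + w * B j j))).

Lemma gauE u A Y w :
  Y w *m mexp (- (cexp w *: diag_mx u)) *m zpow w (- diag_part A) = gau u A Y w.
Proof.
have -> : - (cexp w *: diag_mx u) = diag_mx (- (cexp w *: u)) by apply/matrixP => i j; rewrite !mxE; case: eqVneq; rewrite ?mulr1n ?mulr0n ?mulr0 ?oppr0.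
have -> : zpow w (- diag_part A) = mexp (diag_mx (\row_a (- (w * A a a)))).
  rewrite /zpow; congr mexp; apply/matrixP => i j; rewrite !mxE.
  by case: eqVneq; rewrite ?mulr1n ?mulr0n ?mulrN ?mulr0 ?oppr0.
have D (d : 'rV[R[i]^o]_n) : mexp (diag_mx d) = diag_mx (\row_j cexp (d 0 j)) by apply/matrixP => i j; rewrite mexp_diag !mxE; case: eqVneq => [->|].
rewrite !D !mul_mx_diag; apply/matrixP => i j; rewrite !mxE -mulrA -cexpD; congr (_ * cexp _).
by rewrite opprD.
Qed.

Definition psum (F : nat -> M_n) N (w : C) : M_n := \sum_(k < N.+1) (cexp w) ^- k *: F k.

(* K is uniform on the sector alpha <= Im w <= beta *)
Definition asym (B : M_n) u (F : nat -> M_n) Y (al be : R) : Prop :=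
  forall N, exists K rho : R, [/\ 0 <= K, 0 < rho & forall w : C, al <= cIm w <= be ->
    rho <= modz w -> forall i j,
      nc (gau u B Y w i j - psum F N w i j) <= K * modz w ^- N.+1].

Lemma asymptotic_toP u A F (S : set R[i]) Y : asymptotic_to u A F S Y <->
  forall a b : R, a <= b -> [set w : R[i] | a <= cIm w <= b] `<=` S -> asym A u F Y a b.
Proof.
split => H a b ab sub N.
  have [K [rho [r0 h]]] := H a b ab sub N.
  exists `|K|, rho; split => // w wab rw i j; have := h w wab.
  rewrite normE nc_cexp lec_R gauE => /(_ rw).
  have -> : K%:C * (modz w)%:C ^- N.+1 = (K * modz w ^- N.+1)%:C :> R[i] by rewrite realCM realCV; congr (_ * _^-1); rewrite -rmorphXn.
  move=> h1; have : 0 <= K * modz w ^- N.+1.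
    by rewrite -lec_R; apply: le_trans h1; exact: normr_ge0.
  move=> K0; have := (mxnormP _ K0).1 h1 i j; rewrite mxsubE => h2; apply: le_trans h2 _.
  by rewrite ler_wpM2r ?ler_norm// invr_ge0 exprn_ge0// expR_ge0.
have [K [rho [K0 r0 h]]] := H a b ab sub N.
exists K, rho; split => // w wab; rewrite normE nc_cexp lec_R gauE => rw.
have -> : K%:C * (modz w)%:C ^- N.+1 = (K * modz w ^- N.+1)%:C :> R[i] by rewrite realCM realCV; congr (_ * _^-1); rewrite -rmorphXn.
apply/mxnormP; first by rewrite mulr_ge0// invr_ge0 exprn_ge0// expR_ge0.
by move=> i j; rewrite mxsubE; exact: h.
Qed.

Lemma gau_der u A B Y w : mder Y w ((cexp w *: diag_mx u + A) *m Y w) ->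
  mder (gau u B Y) w (cexp w *: (diag_mx u *m gau u B Y w - gau u B Y w *m diag_mx u)
    + A *m gau u B Y w - gau u B Y w *m diag_part B).
Proof.
move=> hY i j.
have c : cder (fun x : C => - (cexp x * u 0 j + x * B j j)) w (- (cexp w * u 0 j + B j j)).
  apply: cder_eq (cderN (cderD (cderM (cder_cexp w) (cder_cst (u 0 j) w)) (cderM (cder_id w) (cder_cst (B j j) w)))) _.
  by ring.
apply: (cder_ext (f := fun w => Y w i j * cexp (- (cexp w * u 0 j + w * B j j)))).
  by move=> x; rewrite mxE.
apply: cder_eq (cderM (hY i j) (cder_comp c (cder_cexp _))) _.
rewrite !(mxaddE, mxoppE) mxscaleE diag_commE diag_part_mulr.
have -> : (A *m gau u B Y w) i j = (A *m Y w) i j * cexp (- (cexp w * u 0 j + w * B j j)) by rewrite !mxE mulr_suml; apply: eq_bigr => k _; rewrite !mxE mulrA.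
have -> : ((cexp w *: diag_mx u + A) *m Y w) i j = cexp w * u 0 i * Y w i j + (A *m Y w) i j by rewrite mulmxDl mxaddE -scalemxAl mxscaleE mul_diag_mx [(\matrix_(_, _) _) i j]mxE mulrA.
have -> : gau u B Y w i j = Y w i j * cexp (- (cexp w * u 0 j + w * B j j)) by rewrite mxE.
have G (z ui uj y a q b : C) : (z * ui * y + a) * q + y * (q * - (z * uj + b)) =
  z * ((ui - uj) * (y * q)) + a * q - y * q * b by ring.
exact: G.
Qed.
Notation T := 'rV[R[i]^o]_n.

Implicit Types (t v c : T) (f g : C -> T -> C).

Lemma ghol_cexp (f : T -> C) c r : ghol f c r -> ghol (fun t => cexp (f t)) c r.
Proof.
move=> [h1 h2]; split => [t v ct|t ct].
  by have [d Hd] := h1 t v ct; eexists; exact: cder_comp Hd (cder_cexp _).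
have [d [M [d0 HM]]] := h2 t ct; exists d, (expR M); split => // s ts.
rewrite nc_cexp ler_expR; apply: le_trans (HM s ts).
by apply: le_trans (ler_norm _) (Re_le_nc _).
Qed.

(** Separate holomorphy in w and t with a joint local bound, as the exchange of the two derivatives
    requires. *)
Definition jhol f c (r : R) : Prop :=
  [/\ forall w, ghol (f w) c r, forall t w, pd c r t -> exists d, cder (f^~ t) w d &
   forall w t, pd c r t -> exists d M : R, 0 < d /\ forall w' t', nc (w' - w) < d -> pd t d t' ->
     nc (f w' t') <= M].

(** [mixed_partials] in the variables w and x, where t moves along t + x v; the local bound of [g]
    is Cauchy's estimate in w. *)
Lemma jhol_dw f g c r : jhol f c r -> (forall w t, pd c r t -> cder (f^~ t) w (g w t)) ->
  forall w, ghol (g w) c r /\ forall t v, pd c r t -> cder (fun w => pder (f w) v t) w (pder (g w) v t).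
Proof.
move=> [h1 h2 h3] hg w.
have mix t v : pd c r t -> exists E, cder (fun x => g w (t + x *: v)) 0 E /\
    cder (fun y => pder (f (w + y)) v t) 0 E.
  move=> ct; have [d [M [d0 HM]]] := h3 w t ct; have [e e0 He] := pd_open ct.
  have K0 : 0 < vn v + 1 by rewrite ltr_wpDl ?vn_ge0.
  pose m := Num.min d e; have m0 : 0 < m by rewrite lt_min d0.
  pose q := Num.min d (m / (vn v + 1)); have q0 : 0 < q by rewrite lt_min d0 divr_gt0.
  have L (x : C) : nc (x - 0) < q -> pd t m (t + x *: v) by rewrite subr0 lt_min => /andP[_ xq]; exact: line_pd.
  have Lc (x : C) : nc (x - 0) < q -> pd c r (t + x *: v).
    move=> /L h; apply: pd_trans (pd_le _ h) He; by rewrite ge_min lexx orbT.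
  have [|||||E [E1 E2]] := @mixed_partials R (fun x y => f (w + y) (t + x *: v))
     (fun y => pder (f (w + y)) v t) (fun x => g w (t + x *: v)) 0 0 q M q0.
  - by move=> y _; apply: ghol_holo (h1 _) _ => x xq; exact: Lc.
  - move=> x xq y _; have [e' He'] := h2 _ (w + y) (Lc x xq).
    by exists e'; exact: (cder_shift (f := fun w => f w (t + x *: v))).
  - move=> x y xq; rewrite subr0 => yq; apply: HM.
      by rewrite addrAC subrr add0r; apply: lt_le_trans yq _; rewrite ge_min lexx.
    by apply: pd_le (L x xq); rewrite ge_min lexx.
  - by move=> y _; exact: ghol_pder (h1 _) ct.
  - move=> x xq; apply: (cder_shift (f := fun w => f w (t + x *: v))).
    by rewrite addr0; apply: hg; exact: Lc.
  by exists E.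
split; last first.
  move=> t v ct; have [E [E1 E2]] := mix t v ct; rewrite (pderP E1).
  apply: (cder_ext (f := fun x => pder (f (w + (x - w))) v t)) => [x|].
    by rewrite addrC subrK.
  apply: cder_eq (cder_comp (f := fun y => pder (f (w + y)) v t) (cderB (cder_id w) (cder_cst w w)) _) _.
    by rewrite subrr; exact: E2.
  by rewrite subr0 mulr1.
split => [t v ct|t ct]; first by have [E [E1 _]] := mix t v ct; exists E.
have [d [M [d0 HM]]] := h3 w t ct; have [e e0 He] := pd_open ct.
pose m := Num.min d e.
exists m, (M / (d / 2) ^+ 1); split; first by rewrite lt_min d0.
move=> s ts; have cs : pd c r s.
  by apply: pd_trans (pd_le _ ts) He; rewrite ge_min lexx orbT.
have d2 : 0 < d / 2 by rewrite divr_gt0.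
have hl : holo (f^~ s) w d by move=> z _; exact: h2.
rewrite (cder_unique (hg w s cs) (holo_cder hl d2 (half_lt d0))).
apply: tc_bound => // [p|p]; first exact: holo_ccont_circle hl d2 (half_lt d0).
apply: HM; first by rewrite circle_dist// half_lt.
by apply: pd_le ts; rewrite ge_min lexx.
Qed.

Definition mjhol (X : C -> T -> M_n) c r := forall i j, jhol (fun w t => X w t i j) c r.

Lemma mjhol_dw (X D : C -> T -> M_n) c r : mjhol X c r ->
  (forall w t, pd c r t -> mder (X^~ t) w (D w t)) ->
  forall w, mghol (D w) c r /\ forall t v, pd c r t -> mder (fun w => mpder (X w) v t) w (mpder (D w) v t).
Proof.
move=> hX hD w; split => [i j|t v ct i j].
  exact: (jhol_dw (g := fun w t => D w t i j) (hX i j) (fun w t ct => hD w t ct i j) w).1.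
rewrite mxE; apply: (cder_ext (f := fun w => pder (fun t => X w t i j) v t)) => [x|]; first by rewrite mxE.
exact: (jhol_dw (g := fun w t => D w t i j) (hX i j) (fun w t ct => hD w t ct i j) w).2.
Qed.

Lemma mghol_locbd (X : T -> M_n) c r t : mghol X c r -> pd c r t ->
  exists d M : R, [/\ 0 < d, 0 <= M & forall s, pd t d s -> forall i j, nc (X s i j) <= M].
Proof.
move=> hX ct.
have [||d [M [d0 H]]] := @fin_uniform R ('I_n * 'I_n)%type (fun ij d M => forall s, pd t d s -> nc (X s ij.1 ij.2) <= M).
- by move=> ij d M d' M' dd MM h s ts; apply: le_trans MM; apply: h; exact: pd_le ts.
- by move=> ij; have [d [M [d0 H]]] := (hX ij.1 ij.2).2 t ct; exists d, M.
exists d, `|M|; split => // s ts i j; exact: le_trans (H (i, j) s ts) (ler_norm _).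
Qed.

(** The joint bound comes from the equation: a bound near [t] at one [w] spreads to nearby [w'] by
    the energy estimate along the segment. *)
Lemma system_mjhol (u0 : T) (A : T -> M_n) (Y : C -> T -> M_n) c r :
  mghol A c r -> (forall w, mghol (Y w) c r) ->
  (forall t w, pd c r t -> mder (Y^~ t) w ((cexp w *: diag_mx (u0 + t) + A t) *m Y w t)) ->
  mjhol Y c r.
Proof.
move=> hA hY hd a b; split => [w|t w ct|w t ct]; first exact: hY.
  by eexists; exact: hd.
have [d1 [MA [d10 MA0 HA]]] := mghol_locbd hA ct.
have [d2 [MY [d20 MY0 HY]]] := mghol_locbd (hY w) ct.
have [d3 d30 H3] := pd_open ct.
pose d := Num.min 1 (Num.min d1 (Num.min d2 d3)).
have d0 : 0 < d by rewrite !lt_min ltr01 d10 d20.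
pose U := \sum_j nc ((u0 + t) 0 j) + 1.
have U0 : 0 <= U by rewrite addr_ge0// sumr_ge0// => j _; exact: nc_ge0.
pose eta := expR (cRe w + 1) * U + MA.
have eta0 : 0 <= eta by rewrite addr_ge0// mulr_ge0// expR_ge0.
pose K := expR ((2 * 0 + 2 * n%:R * eta + 1) * 1) * (n%:R * MY ^+ 2).
exists d, (K + 1); split => // w' t' ww tt.
have ct' : pd c r t' by apply: pd_trans (pd_le _ tt) H3; rewrite !ge_min lexx !orbT.
pose h := w' - w.
have hh : nc h <= 1 by apply: ltW; apply: lt_le_trans ww _; rewrite ge_min lexx.
pose x (k : 'I_n) (s : R) := Y (w + s%:C * h) t' k b.
pose rr (k : 'I_n) (s : R) := h * ((cexp (w + s%:C * h) *: diag_mx (u0 + t') + A t') *m Y (w + s%:C * h) t') k b.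
have G := @growth R n x (fun _ _ => 0) rr 0 eta 0 1 ler01 (lexx 0) eta0 (lexx 0).
have E1 : x a 1 = Y w' t' a b by rewrite /x realC1 mul1r /h addrC subrK.
suff : nc (Y w' t' a b) ^+ 2 <= K.
  move=> h1; have K0 : 0 <= K by apply: le_trans h1; exact: exprn_ge0 (nc_ge0 _).
  have := sqr_ge0 (nc (Y w' t' a b) - 1); have := nc_ge0 (Y w' t' a b); move: h1 K0; nra.
rewrite -E1; apply: le_trans (nc2_le_en x 1 a) _.
rewrite expr0n /= mulr0 !addr0 in G; apply: le_trans (G _ _ _) _.
- move=> k s s01; rewrite mul0r add0r /x /rr.
  apply: rder_eq (rder_comp (f := fun w => Y w t' k b) (rderD (rder_cst w s) (rderM (rder_id s) (rder_cst h s))) (hd t' _ ct' k b)) _.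
  by move: (_ k b) => Z; rewrite mul1r mulr0 addr0 add0r mulrC.
- by move=> k s _; rewrite lexx.
- move=> k s /andP[s0 s1]; rewrite addr0 /rr ncM mulrC.
  have q : nc (((cexp (w + s%:C * h) *: diag_mx (u0 + t') + A t') *m Y (w + s%:C * h) t') k b) <=
     eta * \sum_b0 nc (x b0 s).
    rewrite mxE; apply: le_trans (nc_sum _ _ _) _; rewrite mulr_sumr; apply: ler_sum => l _.
    rewrite ncM; apply: ler_wpM2r; first exact: nc_ge0.
    rewrite mxaddE mxscaleE; apply: le_trans (ncD _ _) _; apply: lerD; last first.
      by apply: HA; apply: pd_le tt; rewrite !ge_min lexx !orbT.
    rewrite ncM nc_cexp; apply: ler_pM; rewrite ?nc_ge0 ?expR_ge0//.
      rewrite ler_expR cReD lerD2l; apply: le_trans (ler_norm _) _; apply: le_trans (Re_le_nc _) _.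
      by rewrite ncM ncR (ger0_norm s0) mulr_ile1 ?nc_ge0.
    rewrite mxE; case: eqVneq => _; rewrite ?mulr1n ?mulr0n ?nc0 ?addr_ge0 ?sumr_ge0// => *; rewrite ?nc_ge0//.
    have -> : (u0 + t') 0 k = (u0 + t) 0 k + (t' 0 k - t 0 k) by rewrite !mxE; ring.
    apply: le_trans (ncD _ _) _; apply: lerD.
      by rewrite (bigD1 k)//= lerDl sumr_ge0// => j _; exact: nc_ge0.
    by apply: ltW; apply: lt_le_trans (tt k) _; rewrite ge_min lexx.
  by apply: le_trans (ler_pM _ _ q hh) _; rewrite ?nc_ge0// mulr1.
- rewrite mulr0 !add0r /K mulr0 !add0r ler_wpM2l ?expR_ge0// -sum_cst /en; apply: ler_sum => k _.
  rewrite lerXn2r ?nnegrE ?nc_ge0// /x realC0 mul0r addr0; apply: HY.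
  by apply: pd_le tt; rewrite !ge_min lexx !orbT.
Qed.

Implicit Types (G D S N : M_n).

Lemma series_terms_bounded (u : nat -> M_n) : cvgn (series u) ->
  exists M : R, 0 <= M /\ forall l i j, nc (u l i j) <= M.
Proof.
move=> /cvgn_mcv; have E l : u l = series u l.+1 - series u l.
  by rewrite /series /= big_nat_recr//= [X in X - _]addrC addrK.
move=> h; have [K HK] := h 1 ltr01.
pose B := \sum_(l < K) \sum_i \sum_j nc (u l i j).
have B0 : 0 <= B by do 3!apply: sumr_ge0 => ? _; exact: nc_ge0.
exists (2 + B); split => [|l i j]; first by rewrite addr_ge0.
have [lK|Kl] := ltnP l K.
  apply: (@le_trans _ _ B); last by rewrite lerDr.
  rewrite /B (bigD1 (Ordinal lK))//= (bigD1 i)//= (bigD1 j)//= -!addrA lerDl !addr_ge0//.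
  - by apply: sumr_ge0 => *; exact: nc_ge0.
  - by apply: sumr_ge0 => *; apply: sumr_ge0 => *; exact: nc_ge0.
  - by do 3!apply: sumr_ge0 => * ; exact: nc_ge0.
rewrite E mxsubE; have h1 := HK l Kl i j; have h2 := HK l.+1 (leqW Kl) i j.
have := nc_triangle (series u l.+1 i j) (limn (series u) i j) (series u l i j).
rewrite ncC in h1; lra.
Qed.

(** Terms bounded at [z0] are dominated at [z] by a geometric series of ratio at most 1/2; the
    factor |z| appears because the difference with the identity has no constant term. *)
Lemma pseries_near1 (Psi : nat -> M_n) (z0 : C) : Psi 0%N = 1%:M -> z0 != 0 ->
  cvgn (series (fun l => z0 ^+ l *: Psi l)) ->
  exists M : R, 0 <= M /\ forall z, nc z <= nc z0 / 2 ->
    cvgn (series (fun l => z ^+ l *: Psi l)) ->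
    forall i j, nc ((limn (series (fun l => z ^+ l *: Psi l)) - 1%:M) i j) <= M * nc z.
Proof.
move=> P0 z00 /series_terms_bounded[M0 [M00 HM0]].
have r0 : 0 < nc z0 by rewrite nc_gt0.
exists (2 * M0 / nc z0); split => [|z zz cz i j].
  by rewrite divr_ge0 ?mulr_ge0// ltW.
pose q := nc z / nc z0.
have q0 : 0 <= q by rewrite divr_ge0 ?nc_ge0.
have q2 : q <= 2^-1 by rewrite ler_pdivrMr// mulrC.
have tb l : nc ((z ^+ l *: Psi l) i j) <= M0 * q ^+ l.
  have := HM0 l i j; rewrite !mxscaleE !ncM !ncX => h.
  rewrite /q exprMn exprVn; have a0 : 0 < nc z0 ^+ l by rewrite exprn_gt0.
  have -> : M0 * (nc z ^+ l / nc z0 ^+ l) = (nc z ^+ l / nc z0 ^+ l) * M0 by rewrite mulrC.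
  have -> : nc z ^+ l * nc (Psi l i j) = (nc z ^+ l / nc z0 ^+ l) * (nc z0 ^+ l * nc (Psi l i j)) by rewrite mulrA divfK// gt_eqF.
  by rewrite ler_wpM2l// divr_ge0 ?exprn_ge0 ?nc_ge0.
have sb k : nc (\sum_(l < k.+1) (z ^+ l *: Psi l) i j - (1%:M : M_n) i j) <= 2 * M0 * (q - q ^+ k.+1).
  elim: k => [|k IH].
    by rewrite big_ord1 expr0 scale1r P0 !subrr nc0 mulr0.
  rewrite big_ord_recr /= addrAC; apply: le_trans (ncD _ _) _.
  apply: le_trans (lerD IH (tb _)) _; rewrite (exprS q k.+1).
  have : 0 <= M0 * q ^+ k.+1 by rewrite mulr_ge0// exprn_ge0.
  move: (q ^+ k.+1) => Q; nra.
apply/ler_addgt0Pr => e e0; have [K HK] := cvgn_mcv cz e0.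
have := HK K.+1 (leqnSn K) i j; rewrite series_mxE => h1; have h2 := sb K.
have h3 : 2 * M0 * (q - q ^+ K.+1) <= 2 * M0 / nc z0 * nc z.
  have -> : 2 * M0 / nc z0 * nc z = 2 * M0 * q by rewrite /q; ring.
  by rewrite ler_wpM2l ?mulr_ge0// gerBl exprn_ge0.
rewrite mxsubE; have := nc_triangle (limn (series (fun l => z ^+ l *: Psi l)) i j) (\sum_(l < K.+1) (z ^+ l *: Psi l) i j) ((1%:M : M_n) i j).
rewrite ncC in h1; lra.
Qed.

(** The deck transformation of the covering: log z goes to log z + 2 pi i. *)
Definition per : C := 0 +i* (pi *+ 2).
Lemma cexp_per (w : C) : cexp (w + per) = cexp w.
Proof.
rewrite cexpD [cexp per]cexpE /= expR0.
by rewrite cis2pi !mulr1.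
Qed.

(** For a Levelt solution this is the single-valued factor G (I + sum_l Psi_l z^l), here available
    on the whole covering and not only near z = 0. *)
Definition leveltH Y (D S N : M_n) (w : C) : M_n := Y w *m zpow (- w) (S + N) *m zpow (- w) D.

Lemma zpowNK A w : zpow w A *m zpow (- w) A = 1%:M.
Proof. by rewrite -zpowD subrr; exact: zpow0. Qed.
Lemma zpowKN A w : zpow (- w) A *m zpow w A = 1%:M.
Proof. by rewrite -zpowD addNr; exact: zpow0. Qed.

Lemma leveltHK Y D S N w : leveltH Y D S N w *m (zpow w D *m zpow w (S + N)) = Y w.
Proof.
have G (X P P' Q Q' : M_n) : P *m P' = 1%:M -> Q *m Q' = 1%:M -> X *m P *m Q *m (Q' *m P') = X.
  move=> e1 e2; have -> : X *m P *m Q *m (Q' *m P') = X *m P *m (Q *m Q') *m P' by rewrite !mulmxA.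
  by rewrite e2 mulmx1 -mulmxA e1 mulmx1.
exact: G (zpowKN _ w) (zpowKN _ w).
Qed.

Lemma zpow_neg_der A w : mder (fun w => zpow (- w) A) w (- (A *m zpow (- w) A)).
Proof.
apply: mder_eq (mder_comp (cderN (cder_id w)) (zpow_der A (- w))) _.
by rewrite scaleN1r.
Qed.

Lemma leveltH_der u A Y D S N w : fundamental_solution u A Y ->
  exists E, mder (leveltH Y D S N) w E.
Proof.
move=> /fundP h; eexists; exact: mderM (mderM (h w).1 (zpow_neg_der _ w)) (zpow_neg_der _ w).
Qed.

Lemma leveltH_unit u A Y D S N w : fundamental_solution u A Y -> leveltH Y D S N w \in unitmx.
Proof.
move=> /fundP h; rewrite /leveltH !unitmx_mul; apply/andP; split; last exact: (zpow_unit D (- w)).1.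
by apply/andP; split; [exact: (h w).2|exact: (zpow_unit (S + N) (- w)).1].
Qed.

(** Near z = 0 the factor is [G] times a power series in z. Hence it is invariant under [per], first
    there and then everywhere by the identity theorem, and it is close to the invertible [G], which
    bounds it and its inverse. *)
Lemma leveltH_facts u A Y G D S N : fundamental_solution u A Y -> levelt_form A Y G D S N ->
  (forall w, leveltH Y D S N (w + per) = leveltH Y D S N w) /\
  exists ro M : R, forall w, cRe w <= ro -> forall i j,
    nc (leveltH Y D S N w i j) <= M /\ nc (invmx (leveltH Y D S N w) i j) <= M.
Proof.
move=> hY [[uG _] _ _ _ [_ _ [Psi [P0 [rho rho0 HP]]]]].
pose P w := limn (series (fun l => cexp w ^+ l *: Psi l)).
have zr (w : C) : cRe w < ln rho -> `|cexp w| < rho%:C by move=> h; rewrite normE ltc_R nc_cexp -[X in _ < X](lnK rho0) ltr_expR.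
have HE w : cRe w < ln rho -> leveltH Y D S N w = G *m P w.
  move=> /zr/HP[_ E]; rewrite /leveltH E -/(P w).
  have K (X P' P'' Q Q' : M_n) : P'' *m P' = 1%:M -> Q *m Q' = 1%:M -> X *m Q *m P'' *m P' *m Q' = X by move=> e1 e2; rewrite -(mulmxA (X *m Q)) e1 mulmx1 -mulmxA e2 mulmx1.
  exact: K (zpowNK _ w) (zpowNK _ w).
have PP w : P (w + per) = P w by rewrite /P cexp_per.
split => [w|].
  apply/matrixP => i j; apply/eqP; rewrite -subr_eq0; apply/eqP.
  pose c : C := (ln rho - 1)%:C.
  pose f x := leveltH Y D S N (x + per) i j - leveltH Y D S N x i j.
  have hf : holo f c (nc (w - c) + 1).
    move=> z _; have [E1 H1] := leveltH_der D S N (z + per) hY; have [E2 H2] := leveltH_der D S N z hY.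
    exists (E1 i j - E2 i j); apply: cderB (H2 i j).
    apply: cder_eq (cder_comp (f := fun x => leveltH Y D S N x i j) (cderD (cder_id z) (cder_cst per z)) (H1 i j)) _.
    by rewrite addr0 mulr1.
  have := @holo_zero_ball R f c _ 1 hf ltr01 _ (w - c); rewrite [c + _]addrC subrK; apply; last by rewrite ltrDl.
  move=> h h1; have hr : cRe (c + h) < ln rho.
    rewrite cReD /=; have := Re_le_nc h; have := ler_norm (cRe h); lra.
  have hr' : cRe (c + h + per) < ln rho by rewrite cReD [cRe per]/= addr0.
  by rewrite /f (HE _ hr) (HE _ hr') PP subrr.
pose w0 : C := (ln (rho / 2))%:C.
have rho2 : 0 < rho / 2 by rewrite divr_gt0.
have nw0 : nc (cexp w0) = rho / 2 by rewrite nc_cexp /= lnK.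
have c0 : `|cexp w0| < rho%:C by rewrite normE ltc_R nw0 half_lt.
have [M1 [M10 HM1]] := pseries_near1 P0 (cexp_neq0 w0) (HP w0 c0).1.
have [g [g0 Hg]] := mx_bound G; have [g' [g'0 Hg']] := mx_bound (invmx G).
pose K : R := 2 * n%:R * M1 + 1; have K0 : 0 < K by rewrite ltr_wpDl// !mulr_ge0.
(* Within [r1] the power series differs from the identity by at most 1 / (2 n), the threshold of
   [inv_near1]. *)
pose r1 := Num.min (rho / 4) K^-1; have r10 : 0 < r1 by rewrite lt_min invr_gt0 K0 divr_gt0.
exists (ln r1), (n%:R * g * (1 + M1 * rho) + n%:R * 2 * g') => w wr i j.
have zr1 : nc (cexp w) <= r1 by rewrite nc_cexp -[leRHS](lnK r10) ler_expR.
have [z1 z2] : nc (cexp w) <= rho / 4 /\ nc (cexp w) <= K^-1 by move: zr1; rewrite le_min => /andP.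
have zrho : cRe w < ln rho.
  apply: le_lt_trans wr _; rewrite ltr_ln ?posrE//; apply: le_lt_trans (_ : rho / 4 < _).
    by rewrite /r1 ge_min lexx.
  by rewrite ltr_pdivrMr// ltr_pMr// ltr1n.
have near1 := HM1 (cexp w) (ltac:(by rewrite nw0; lra)) (HP w (zr w zrho)).1.
have uP : P w \in unitmx.
  have := leveltH_unit D S N w hY; rewrite (HE w zrho) unitmx_mul => /andP[_]; exact.
have b1 : forall i j, nc ((P w - 1%:M) i j) <= (2 * n%:R)^-1.
  move=> i' j'; apply: le_trans (near1 i' j') _.
  have n0 : 0 < n%:R :> R by rewrite ltr0n; case: (n) i' => [[]|].
  have nn : 0 < 2 * n%:R :> R by rewrite mulr_gt0.
  rewrite -[leRHS]mulr1 ler_pdivlMl// mulrA.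
  apply: le_trans (ler_wpM2l _ z2) _; first by rewrite !mulr_ge0.
  by rewrite ler_pdivrMr// mul1r /K lerDl.
have Pb : forall i j, nc (P w i j) <= 1 + M1 * rho.
  move=> i' j'; have -> : P w i' j' = (1%:M : M_n) i' j' + (P w - 1%:M) i' j' by rewrite mxsubE addrCA subrr addr0.
  apply: le_trans (ncD _ _) (lerD (nc_mx1 _ _) _); apply: le_trans (near1 i' j') _.
  by rewrite ler_wpM2l//; apply: le_trans z1 _; rewrite ler_pdivrMr// ler_peMr// ?ltW// ltr1n.
rewrite (HE w zrho); split.
  apply: le_trans (nc_mulmx _ _ Hg Pb) _; rewrite lerDl !mulr_ge0//.
rewrite (invmx_mul uG uP).
apply: le_trans (nc_mulmx _ _ (inv_near1 uP b1) Hg') _; rewrite lerDr !mulr_ge0//.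
by rewrite addr_ge0// mulr_ge0// ltW.
Qed.

Definition omega (q : 'I_n -> 'I_n -> T -> C) v t : M_n := \matrix_(a, b) ((v 0 a - v 0 b) * q a b t).

Lemma cauchy_bound c r t v : pd c r t -> exists K : R, 0 <= K /\
  forall (f : T -> C) (M : R), ghol f c r -> (forall s, pd c r s -> nc (f s) <= M) -> nc (pder f v t) <= K * M.
Proof.
move=> ct; have [e e0 He] := pd_open ct; have K0 : 0 < vn v + 1 by rewrite ltr_wpDl ?vn_ge0.
have d0 : 0 < e / (vn v + 1) by rewrite divr_gt0.
exists (2 / (e / (vn v + 1))); split => [|f M hf hM]; first by rewrite divr_ge0// ltW.
have L (x : C) : nc x < e / (vn v + 1) -> pd c r (t + x *: v) by move=> h; exact: pd_trans (line_pd t h) He.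
have := (@ghol_cauchy R n f c r t v _ M hf d0 L (fun x xd => hM _ (L x xd))).1.
by rewrite mulrAC.
Qed.

Lemma gau_ext u (B B' : M_n) (Y : C -> M_n) : (forall j, B j j = B' j j) -> gau u B Y = gau u B' Y.
Proof. by move=> h; apply/funext => w; apply/matrixP => i j; rewrite !mxE h. Qed.

Lemma gau_unit u (B : M_n) (Y : C -> M_n) w : Y w \in unitmx -> gau u B Y w \in unitmx.
Proof.
move=> uY; rewrite -gauE !unitmx_mul uY /=; apply/andP; split.
  have -> : mexp (- (cexp w *: diag_mx u)) = zpow (- cexp w) (diag_mx u) by rewrite /zpow scaleNr.
  exact: (zpow_unit (diag_mx u) (- cexp w)).1.
exact: (zpow_unit (- diag_part B) w).1.
Qed.

Lemma gau_ghol (u0 : T) (B : M_n) (Y : T -> C -> M_n) c r w : mghol (Y^~ w) c r ->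
  mghol (fun t => gau (u0 + t) B (Y t) w) c r.
Proof.
move=> hY i j; apply: (ghol_ext (f := fun t => Y t w i j * cexp (- (cexp w * (u0 0 j + t 0 j) + w * B j j)))).
  by move=> t; rewrite [RHS]mxE [in RHS]mxE.
apply: gholM (hY i j) (ghol_cexp _); apply: gholN; apply: gholD (ghol_cst _ _ _).
by apply: gholM (ghol_cst _ _ _) _; apply: gholD (ghol_cst _ _ _) (ghol_coord _ _ _).
Qed.

Lemma gau_pder (u0 : T) (B : M_n) (Y : T -> C -> M_n) c r w t v W : mghol (Y^~ w) c r -> pd c r t ->
  mpder (Y^~ w) v t = W *m Y t w ->
  mpder (fun t => gau (u0 + t) B (Y t) w) v t =
    W *m gau (u0 + t) B (Y t) w - cexp w *: (gau (u0 + t) B (Y t) w *m diag_mx v).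
Proof.
move=> hY ct E; apply: mpderP => i j.
have hd := mpder_der v hY ct i j; rewrite E in hd.
apply: (cder_ext (f := fun x => Y (t + x *: v) w i j * cexp (- (cexp w * ((u0 + t) 0 j + x * v 0 j) + w * B j j)))).
  move=> x; have E2 : (u0 + (t + x *: v)) 0 j = (u0 + t) 0 j + x * v 0 j by rewrite !mxE addrA.
  by rewrite [RHS]mxE E2.
have cc : cder (fun x : C => - (cexp w * ((u0 + t) 0 j + x * v 0 j) + w * B j j)) 0 (- (cexp w * v 0 j)).
  apply: cder_eq (cderN (cderD (cderZ (cexp w) (cderD (cder_cst ((u0 + t) 0 j) 0) (cderM (cder_id 0) (cder_cst (v 0 j) 0)))) (cder_cst (w * B j j) 0))) _.
  ring.
apply: cder_eq (cderM hd (cder_comp cc (cder_cexp _))) _.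
rewrite mul0r addr0 scale0r addr0 mxsubE mxscaleE mul_mx_diag [X in _ - _ * X]mxE.
set e := cexp (- _).
have gE k : gau (u0 + t) B (Y t) w k j = Y t w k j * e by rewrite mxE.
have -> : (W *m gau (u0 + t) B (Y t) w) i j = (W *m Y t w) i j * e by rewrite !mxE mulr_suml; apply: eq_bigr => k _; rewrite gE mulrA.
by rewrite gE; move: ((W *m Y t w) i j) (Y t w i j) => a b; ring.
Qed.

Lemma ghol_open_gt (f : T -> C) c r t (m : R) : ghol f c r -> pd c r t -> ~ (nc (f t) <= m) ->
  exists2 d : R, 0 < d & forall s, pd t d s -> ~ (nc (f s) <= m).
Proof.
move=> hf ct /negP; rewrite -ltNge => lt.
have e0 : 0 < nc (f t) - m by rewrite subr_gt0.
have [d d0 Hd] := ghol_cont hf ct e0; exists d => // s /Hd h.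
have := nc_dist (f t) (f s); rewrite ncC => h2 h3; lra.
Qed.

Lemma strip (X : C -> C) (tau : R) : (forall w, X (w + per) = X w) -> forall w, exists w',
  [/\ X w' = X w, tau - pi <= cIm w' <= tau + pi & cRe w' = cRe w].
Proof.
move=> hp w; have p0 : 0 < pi *+ 2 :> R := pi2_gt0.
have up k (v : C) : X (v + per *+ k) = X v by elim: k => [|k IH]; rewrite ?mulr0n ?addr0// mulrSr addrA hp.
have down k (v : C) : X (v - per *+ k) = X v by rewrite -[in RHS](subrK (per *+ k) v) up.
have Rp k : cRe (per *+ k : C) = 0 by elim: k => [|k IH] //; rewrite mulrSr cReD IH /= addr0.
have Ip k : cIm (per *+ k : C) = (pi *+ 2) * k%:R by elim: k => [|k IH]; rewrite ?mulr0// mulrSr cImD IH /= -natr1 mulrDr mulr1.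
have fl (y : R) : 0 <= y -> exists k : nat, (pi *+ 2) * k%:R <= y <= (pi *+ 2) * k%:R + pi *+ 2.
  move=> y0; have y0' : 0 <= y / (pi *+ 2) by rewrite divr_ge0// ltW.
  have /andP[h1 h2] := truncn_itv y0'; exists (Num.truncn (y / (pi *+ 2))).
  have E : y = (pi *+ 2) * (y / (pi *+ 2)) by rewrite mulrC divfK// gt_eqF.
  have h3 := ler_wpM2l (ltW p0) h1; have h4 := ler_wpM2l (ltW p0) (ltW h2).
  rewrite -E in h3 h4; rewrite -natr1 mulrDr mulr1 in h4; exact/andP.
have [h|h] := leP (tau - pi) (cIm w).
  have [k /andP[h1 h2]] := fl (cIm w - (tau - pi)) (ltac:(by rewrite subr_ge0)).
  exists (w - per *+ k); rewrite down cReD cReN Rp oppr0 addr0 cImD cImN Ip; split => //.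
  by rewrite mulr2n in h1 h2 *; apply/andP; split; lra.
have [k /andP[h1 h2]] := fl (tau + pi - cIm w) (ltac:(have := pi_ge0 R; lra)).
exists (w + per *+ k); rewrite up cReD Rp addr0 cImD Ip; split => //.
by rewrite mulr2n in h1 h2 *; apply/andP; split; lra.
Qed.
End Systems.

(** * The differential equation in the deformation parameters *)

Lemma perturb {R : realType} {n : nat} (z : R[i]^o) (P H O : 'M[R[i]^o]_n) (v : 'rV[R[i]^o]_n) i j :
  (P + z *: ((1%:M + H) *m diag_mx v) - (z *: diag_mx v + O) *m (1%:M + H)) i j =
  P i j + z * H i j * (v 0 j - v 0 i) - O i j - (O *m H) i j.
Proof.
have -> : z *: ((1%:M + H) *m diag_mx v) = z *: diag_mx v + z *: (H *m diag_mx v) by rewrite mulmxDl mul1mx scalerDr.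
have -> : (z *: diag_mx v + O) *m (1%:M + H) = z *: diag_mx v + O + (z *: (diag_mx v *m H) + O *m H) by rewrite mulmxDr mulmx1 mulmxDl -scalemxAl.
rewrite !(mxaddE, mxoppE, mxscaleE) mul_mx_diag mul_diag_mx.
have -> : (\matrix_(i, j) (H i j * v 0 j)) i j = H i j * v 0 j by rewrite mxE.
have -> : (\matrix_(i, j) (v 0 i * H i j)) i j = v 0 i * H i j by rewrite mxE.
move: (P i j) (O i j) ((O *m H) i j) (diag_mx v i j) (H i j) => *; ring.
Qed.

Section Pfaffian.
Context {R : realType} {n : nat}.
Notation C := (R[i]^o)%type.
Notation T := 'rV[R[i]^o]_n.
Notation M_n := 'M[R[i]^o]_n.
Variables (u0 : T) (q : 'I_n -> 'I_n -> T -> C) (F : nat -> T -> M_n) (B : M_n) (c : T) (r : R).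
Hypothesis F0 : forall t, pd c r t -> F 0%N t = 1%:M.
Hypothesis F1 : forall t a b, pd c r t -> a != b -> F 1%N t a b = - q a b t.

(** [X] is the excess of the logarithmic derivative over the expected connection. For f = Y
    e^(-Lambda z) z^(-B) = I + F_1 / z + O(z^-2), the bound uniform in t makes the derivative of f
    of order 1 / z by Cauchy's estimate, and the terms of order 0 cancel because omega = F_1 diag v
    - diag v F_1. Hence X f, and X with it, is of order 1 / z. *)
Lemma pfaffian_decay (Y : T -> C -> M_n) (X : C -> M_n) t v (al be m : R) :
  0 < m -> pd c r t -> (forall w, mghol (Y^~ w) c r) -> (forall w, Y t w \in unitmx) ->
  (forall w, mpder (Y^~ w) v t = (X w + (cexp w *: diag_mx v + omega q v t)) *m Y t w) ->
  asym B (u0 + t) (F^~ t) (Y t) al be ->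
  (forall s w i j, pd c r s -> al <= cIm w <= be -> m <= modz w ->
     nc (cexp w * (gau (u0 + s) B (Y s) w i j - (1%:M : M_n) i j)) <= m) ->
  exists K rho : R, 0 < rho /\ forall w, al <= cIm w <= be -> rho <= modz w ->
    forall i j, nc (X w i j) <= K / modz w.
Proof.
move=> m0 ct hY uY hX has hm.
have [K1 [K10 HK1]] := cauchy_bound v ct.
have [K2 [rho2 [K20 rho20 HK2]]] := has 1%N.
have [om [om0 Hom]] := mx_bound (omega q v t).
pose Kf := K1 * m + K2 * (2 * vn v) + n%:R * om * m.
have Kf0 : 0 <= Kf by rewrite !addr_ge0 ?mulr_ge0// ?mulr_ge0 ?vn_ge0// ltW.
have mn0 : 0 < 2 * n%:R * m + m by rewrite ltr_wpDl// !mulr_ge0// ltW.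
exists (n%:R * Kf * 2), (rho2 + m + (2 * n%:R * m + m)); split; first by rewrite addr_gt0// addr_gt0.
move=> w wab rw.
set z := modz w in rw *; have z0 : 0 < z := expR_gt0 _.
have zm : m <= z by lra.
have zr : rho2 <= z by lra.
have z2 : 2 * n%:R * m <= z by lra.
pose f s := gau (u0 + s) B (Y s) w.
pose h s := f s - 1%:M.
have hb s i j : pd c r s -> nc (h s i j) <= m / z.
  move=> cs; have := hm s w i j cs wab zm; rewrite ncM nc_cexp -/z mxsubE -/(f s) => h1.
  by rewrite ler_pdivlMr// mulrC.
have hf : mghol f c r := gau_ghol u0 B (hY w).
have hh : mghol h c r := mghol_ext (fun s => erefl) (mgholB hf (mghol_cst 1%:M c r)).
have Df : mpder h v t = mpder f v t.
  have E : (fun s => h s + 1%:M) = f by apply/funext => s; rewrite /h subrK.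
  by rewrite -[in RHS]E (mpderD v hh (mghol_cst 1%:M c r) ct) mpder_cst addr0.
have dfb i j : nc (mpder f v t i j) <= K1 * (m / z) by rewrite -Df mxE; apply: HK1 => // s cs; exact: hb.
have F1b i j : nc (cexp w * h t i j - F 1%N t i j) <= K2 / z.
  have := HK2 w wab zr i j; rewrite -/z /psum !big_ord_recl big_ord0 addr0 expr0 invr1 scale1r F0// expr1 => h1.
  have -> : cexp w * h t i j - F 1%N t i j = cexp w * (f t i j - (1%:M + (cexp w)^-1 *: F 1%N t) i j).
    rewrite /h mxsubE mxaddE mxscaleE; field; exact: cexp_neq0.
  rewrite ncM nc_cexp -/z; apply: le_trans (ler_wpM2l (ltW z0) h1) _.
  apply: le_of_eq; field; by rewrite gt_eqF.
have XfE i j : (X w *m f t) i j = mpder f v t i j + (cexp w * h t i j - F 1%N t i j) * (v 0 j - v 0 i)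
    - (omega q v t *m h t) i j.
  have E : mpder f v t = _ := gau_pder u0 B (hY w) ct (hX w); rewrite -/(f t) in E.
  have -> : X w *m f t = mpder f v t + cexp w *: (f t *m diag_mx v) - (cexp w *: diag_mx v + omega q v t) *m f t by rewrite E mulmxDl subrK addrK.
  have -> : f t = 1%:M + h t by rewrite /h addrC subrK.
  have omE : omega q v t i j = F 1%N t i j * (v 0 j - v 0 i) by rewrite mxE; have [->|ij] := eqVneq i j; [rewrite !subrr mul0r mulr0|rewrite F1//; ring].
  rewrite perturb omE; move: (h t i j) => x; ring.
have vi i : nc (v 0 i) <= vn v := nc_le_vn v i.
have Xfb i j : nc ((X w *m f t) i j) <= Kf / z.
  rewrite XfE; apply: le_trans (ncB _ _) _; apply: le_trans (lerD (ncD _ _) (lexx _)) _.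
  have -> : Kf / z = K1 * (m / z) + K2 / z * (2 * vn v) + n%:R * om * (m / z) by rewrite /Kf; ring.
  apply: lerD; last by apply: nc_mulmx => // i' j'; exact: hb.
  apply: lerD; first exact: dfb.
  rewrite ncM; apply: ler_pM; rewrite ?nc_ge0//.
  by apply: le_trans (ncB _ _) _; have := vi i; have := vi j; lra.
have uf : f t \in unitmx by apply: gau_unit; exact: uY.
have fi i j : nc (invmx (f t) i j) <= 2.
  apply: inv_near1 => // i' j'; apply: le_trans (hb t i' j' ct) _.
  have n0 : 0 < n%:R :> R by rewrite ltr0n; case: (n) i' => [[]|].
  have nn : 0 < 2 * n%:R :> R by rewrite mulr_gt0.
  by rewrite -[leRHS]mulr1 ler_pdivlMl// mulrA ler_pdivrMr// mul1r.
move=> i j; have -> : X w = (X w *m f t) *m invmx (f t) by rewrite mulmxK.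
apply: le_trans (nc_mulmx _ _ Xfb fi) _.
by apply: le_of_eq; ring.
Qed.
End Pfaffian.

Section PfaffianMain.
Context {R : realType} {n : nat}.
Notation C := (R[i]^o)%type.
Notation T := 'rV[R[i]^o]_n.
Notation M_n := 'M[R[i]^o]_n.
Variables (u0 : T) (q : 'I_n -> 'I_n -> T -> C) (F : nat -> T -> M_n) (A : T -> M_n)
  (B D S N C0 St : M_n) (Y0 Y1 Y2 : T -> C -> M_n) (tau : R) (c : T) (r : R).
Hypothesis r0 : 0 < r.
Hypothesis hA : mghol A c r.
Hypothesis AB : forall t j, pd c r t -> A t j j = B j j.
Hypothesis F0 : forall t, pd c r t -> F 0%N t = 1%:M.
Hypothesis F1 : forall t a b, pd c r t -> a != b -> F 1%N t a b = - q a b t.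
Hypothesis sys0 : forall t, pd c r t -> fundamental_solution (u0 + t) (A t) (Y0 t).
Hypothesis sys1 : forall t, pd c r t -> fundamental_solution (u0 + t) (A t) (Y1 t).
Hypothesis sys2 : forall t, pd c r t -> fundamental_solution (u0 + t) (A t) (Y2 t).
Hypothesis lev : forall t, pd c r t -> exists G, levelt_form (A t) (Y0 t) G D S N.
Hypothesis hol0 : forall w, mghol (Y0^~ w) c r.
Hypothesis con1 : forall t w, pd c r t -> Y1 t w = Y0 t w *m C0.
Hypothesis con2 : forall t w, pd c r t -> Y2 t w = Y1 t w *m St.
Hypothesis asy1 : forall t, pd c r t -> asym (A t) (u0 + t) (F^~ t) (Y1 t) (tau - pi) tau.
Hypothesis asy2 : forall t, pd c r t -> asym (A t) (u0 + t) (F^~ t) (Y2 t) tau (tau + pi).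

Lemma hol1 w : mghol (Y1^~ w) c r.
Proof.
apply: (mghol_near (X := fun t => Y0 t w *m C0)) => [t ct|]; first by rewrite con1.
exact: mgholM (hol0 w) (mghol_cst _ _ _).
Qed.
Lemma hol2 w : mghol (Y2^~ w) c r.
Proof.
apply: (mghol_near (X := fun t => Y1 t w *m St)) => [t ct|]; first by rewrite con2.
exact: mgholM (hol1 w) (mghol_cst _ _ _).
Qed.
Let H t w := leveltH (Y0 t) D S N w.
Lemma holH w : mghol (H^~ w) c r.
Proof.
by apply: mgholM (mghol_cst _ _ _); apply: mgholM (hol0 w) (mghol_cst _ _ _).
Qed.

(* index of the quantities bounded uniformly in t by Baire's theorem *)
Let cond (m : nat) (k : nat) (w : C) : Prop := match k with
  | 0%N => tau - pi <= cIm w <= tau /\ m%:R <= modz w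
  | 1%N => tau <= cIm w <= tau + pi /\ m%:R <= modz w
  | _ => modz w * m%:R <= 1 end.
Let phi (k : nat) (w : C) (i j : 'I_n) (t : T) : C := match k with
  | 0%N => cexp w * (gau (u0 + t) B (Y1 t) w i j - (1%:M : M_n) i j)
  | 1%N => cexp w * (gau (u0 + t) B (Y2 t) w i j - (1%:M : M_n) i j)
  | _ => H t w i j end.

Lemma phi_ghol k w i j : ghol (phi k w i j) c r.
Proof.
case: k => [|[|k]] /=; last exact: holH.
  by apply: gholM (ghol_cst _ _ _) _; apply: gholB (ghol_cst _ _ _); exact: gau_ghol (hol1 w) i j.
by apply: gholM (ghol_cst _ _ _) _; apply: gholB (ghol_cst _ _ _); exact: gau_ghol (hol2 w) i j.
Qed.

Lemma asym_first (Y : T -> C -> M_n) t al be : pd c r t -> asym (A t) (u0 + t) (F^~ t) (Y t) al be ->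
  exists K rho : R, forall w, al <= cIm w <= be -> rho <= modz w -> forall i j,
  nc (cexp w * (gau (u0 + t) B (Y t) w i j - (1%:M : M_n) i j)) <= K.
Proof.
move=> ct /(_ 0%N)[K [rho [_ _ h]]]; exists K, rho => w wab rw i j.
have := h w wab rw i j; rewrite (gau_ext _ _ (fun j => AB j ct)).
rewrite /psum big_ord1 expr0 invr1 scale1r F0// expr1 => h1.
by rewrite ncM nc_cexp mulrC -ler_pdivlMr ?expR_gt0.
Qed.

(** Each t has its own constants in the asymptotics of [Y1] and [Y2] and in the bound of the Levelt
    factor near z = 0. For fixed [m] the conditions are closed in t, as [phi] is continuous in t, so
    some polydisc satisfies them with a single [m]. *)
Lemma pfaffian_baire : exists c' (r' : R) (m : nat), [/\ 0 < r', forall t, pd c' r' t -> pd c r t &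
  forall t, pd c' r' t -> forall k w i j, cond m k w -> nc (phi k w i j t) <= m%:R].
Proof.
have [t ct|m t ct nP|m [t [d [d0 sub HP]]]] := @baire R n c r
   (fun m t => forall k w i j, cond m k w -> nc (phi k w i j t) <= m%:R) r0.
- have [K1 [rho1 H1]] := asym_first ct (asy1 ct).
  have [K2 [rho2 H2]] := asym_first ct (asy2 ct).
  have [G HG] := lev ct; have [_ [ro [M H3]]] := leveltH_facts (sys0 ct) HG.
  (* One integer has to serve as threshold and as bound in all the conditions, hence the sum of all
     constants. *)
  pose s := `|K1| + `|rho1| + (`|K2| + `|rho2|) + (`|M| + expR (- ro)).
  have s_ge : [/\ K1 <= s, rho1 <= s & [/\ K2 <= s, rho2 <= s, M <= s & expR (- ro) <= s]].
    have := ler_norm K1; have := ler_norm K2; have := ler_norm M; have := ler_norm rho1; have := ler_norm rho2.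
    have := normr_ge0 K1; have := normr_ge0 K2; have := normr_ge0 M; have := normr_ge0 rho1; have := normr_ge0 rho2.
    have := expR_ge0 (- ro); rewrite /s; move: (expR _) => E; do 11!move=> ?; split; [lra|lra|split; lra].
  have sm : s <= (Num.truncn s).+1%:R by exact: ltW (truncnS_gt s).
  case: s_ge => a1 a2 [a3 a4 a5 a6].
  exists (Num.truncn s).+1 => -[|[|k]] w i j /=.
  + by case=> wi wm; apply: le_trans (le_trans a1 sm); apply: H1 => //; exact: le_trans (le_trans a2 sm) wm.
  + by case=> wi wm; apply: le_trans (le_trans a3 sm); apply: H2 => //; exact: le_trans (le_trans a4 sm) wm.
  + move=> wm; apply: le_trans (le_trans a5 sm); apply: (H3 w _ i j).1.
    rewrite -ler_expR; have : modz w * expR (- ro) <= 1.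
      by apply: le_trans wm; rewrite ler_wpM2l ?expR_ge0//; exact: le_trans a6 sm.
    by rewrite expRN -ler_pdivlMr ?invr_gt0 ?expR_gt0// invrK mul1r.
- have [k [w [i [j [cm nk]]]]] : exists k w i j, cond m k w /\ ~ nc (phi k w i j t) <= m%:R.
    apply: contrapT => h; apply: nP => k w i j cm; apply: contrapT => h2.
    by apply: h; exists k, w, i, j.
  have [d d0 Hd] := ghol_open_gt (phi_ghol k w i j) ct nk.
  exists d; first exact: d0.
  by move=> s ts h; apply: (Hd s ts); apply: h.
by exists t, d, m.
Qed.

(** Liouville's theorem is applied in log z: [X] is invariant under [per], so bounds on one strip of
    height 2 pi suffice. The closed half-planes of [Y1] and [Y2] make up such a strip near infinity,
    and the Levelt factor bounds [X] near z = 0. A bounded [X] is constant, and being of order 1 / z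
    it is 0. *)
Theorem pfaffian : exists c' (r' : R), [/\ 0 < r', forall t, pd c' r' t -> pd c r t &
  forall t v w, pd c' r' t -> mpder (Y1^~ w) v t = (cexp w *: diag_mx v + omega q v t) *m Y1 t w].
Proof.
have [c' [r' [m [r'0 sub HP]]]] := pfaffian_baire.
exists c', r'; split => // t v w0 ct'; have ct := sub t ct'.
have sH X : mghol X c r -> mghol X c' r'  by move=> hX i j; case: (hX i j) => h1 h2; split => [s v'|s] /sub; [exact: h1|exact: h2].
have [X XD] : exists X : C -> M_n, forall w, X w =
    mpder (Y1^~ w) v t *m invmx (Y1 t w) - (cexp w *: diag_mx v + omega q v t) by eexists.
have uY1 w : Y1 t w \in unitmx by have /fundP/(_ w)[] := sys1 ct.
have uY2 w : Y2 t w \in unitmx by have /fundP/(_ w)[] := sys2 ct.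
have E1 w : mpder (Y1^~ w) v t = (X w + (cexp w *: diag_mx v + omega q v t)) *m Y1 t w by rewrite XD subrK mulmxKV.
suff X0 : X w0 = 0 by rewrite E1 X0 add0r.
have E2 w : mpder (Y2^~ w) v t = (X w + (cexp w *: diag_mx v + omega q v t)) *m Y2 t w.
  rewrite (mpder_near v (X := fun t => Y1 t w *m St) (c := c) (r := r)) => //; last 2 first.
  - by move=> s cs; rewrite con2.
  - exact: mgholM (hol1 w) (mghol_cst _ _ _).
  by rewrite (mpderMr St v (hol1 w) ct) E1 con2// mulmxA.
pose Zr w := zpow w D *m zpow w (S + N) *m C0.
have YH s w : pd c r s -> Y1 s w = H s w *m Zr w.
  move=> cs; have E3 : H s w *m (zpow w D *m zpow w (S + N)) = Y0 s w := leveltHK (Y0 s) D S N w.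
  exact: (etrans (con1 w cs) (etrans (congr1 (mulmx^~ C0) (esym E3)) (esym (mulmxA _ _ _)))).
(* The right factor [Zr w] does not depend on t, so [Y1] has the same logarithmic derivative as the
   single-valued factor [H]; periodicity and the bound near z = 0 come from here. *)
have XH w : X w = mpder (H^~ w) v t *m invmx (H t w) - (cexp w *: diag_mx v + omega q v t).
  have dY : mpder (Y1^~ w) v t = mpder (H^~ w) v t *m Zr w.
    exact: (etrans (mpder_near v (fun s cs => esym (YH s w cs)) (mgholM (holH w) (mghol_cst (Zr w) c r)) ct)
      (mpderMr (Zr w) v (holH w) ct)).
  have YHt := YH t w ct.
  have uHZ : H t w *m Zr w \in unitmx by rewrite -YHt; exact: uY1.
  have G (P K Z : M_n) : K *m Z \in unitmx -> P *m Z *m invmx (K *m Z) = P *m invmx K.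
    by rewrite unitmx_mul => /andP[uK uZ]; rewrite invmx_mul// mulmxA mulmxK.
  have XE : mpder (Y1^~ w) v t *m invmx (Y1 t w) = mpder (H^~ w) v t *m invmx (H t w) by rewrite dY YHt; exact: G uHZ.
  by rewrite XD XE.
have [G HG] := lev ct.
have [Hper [ro [Mi HMi]]] := leveltH_facts (sys0 ct) HG.
have Xper w : X (w + per) = X w.
  have e1 : H t (w + per) = H t w := Hper w.
  have e2 : mpder (H^~ (w + per)) v t = mpder (H^~ w) v t.
    apply: (mpder_near (X := H^~ w)) (holH w) ct => s cs.
    by have [G' HG'] := lev cs; have [hp _] := leveltH_facts (sys0 cs) HG'; apply: esym; exact: (hp w).
  have gen w1 : H t w1 = H t w -> mpder (H^~ w1) v t = mpder (H^~ w) v t -> cexp w1 = cexp w -> X w1 = X w by move=> h1 h2 h3; rewrite (XH w1) h1 h2 h3 -XH.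
  exact: gen e1 e2 (cexp_per w).
have hX w i j : exists d, cder (fun w => X w i j) w d.
  have jY : mjhol (fun w t => Y1 t w) c r.
    apply: (system_mjhol (u0 := u0) hA hol1) => s w' cs; by have /fundP/(_ w')[] := sys1 cs.
  have dP : mder (fun w => mpder (Y1^~ w) v t) w _ :=
    (mjhol_dw (D := fun w t => (cexp w *: diag_mx (u0 + t) + A t) *m Y1 t w) jY
      (fun w' s cs => (proj1 ((fundP _ _ _).1 (sys1 cs) w'))) w).2 t v ct.
  have /choice[I HI] : forall ij : 'I_n * 'I_n, exists d, cder (fun w => invmx (Y1 t w) ij.1 ij.2) w d.
    move=> ij; apply: mder_invmx => // i' j'; eexists; exact: ((fundP _ _ _).1 (sys1 ct) w).1.
  have dI : mder (fun w => invmx (Y1 t w)) w (\matrix_(i, j) I (i, j)) by move=> i' j'; rewrite mxE; exact: HI (i', j').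
  have dE : mder (fun w => cexp w *: diag_mx v + omega q v t) w (cexp w *: diag_mx v + cexp w *: 0 + 0).
    exact: mderD (mderZ (cder_cexp w) (mder_cst (diag_mx v) w)) (mder_cst _ w).
  rewrite (funext XD); eexists; exact: (mderD (mderM dP dI) (mderN dE)) i j.
have m0 : 0 < (m%:R + 1 : R) by rewrite ltr_wpDl.
have sub1 s w i j : pd c' r' s -> tau - pi <= cIm w <= tau -> m%:R + 1 <= modz w ->
    nc (cexp w * (gau (u0 + s) B (Y1 s) w i j - (1%:M : M_n) i j)) <= m%:R + 1.
  move=> cs wi wm; have := HP s cs 0%N w i j; rewrite /= => h; apply: le_trans (h _) _; last by rewrite lerDl.
  by split => //; apply: le_trans wm; rewrite lerDl.
have sub2 s w i j : pd c' r' s -> tau <= cIm w <= tau + pi -> m%:R + 1 <= modz w ->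
    nc (cexp w * (gau (u0 + s) B (Y2 s) w i j - (1%:M : M_n) i j)) <= m%:R + 1.
  move=> cs wi wm; have := HP s cs 1%N w i j; rewrite /= => h; apply: le_trans (h _) _; last by rewrite lerDl.
  by split => //; apply: le_trans wm; rewrite lerDl.
have BA s : pd c r s -> forall j, A s j j = B j j by move=> cs j; exact: AB.
have as1 : asym B (u0 + t) (F^~ t) (Y1 t) (tau - pi) tau by move=> k; have := asy1 ct k; rewrite (gau_ext _ _ (BA t ct)).
have as2 : asym B (u0 + t) (F^~ t) (Y2 t) tau (tau + pi) by move=> k; have := asy2 ct k; rewrite (gau_ext _ _ (BA t ct)).
have F0' s : pd c' r' s -> F 0%N s = 1%:M by move=> /sub; exact: F0.
have F1' s a b : pd c' r' s -> a != b -> F 1%N s a b = - q a b s by move=> /sub; exact: F1.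
have [K1 [rho1 [rho10 D1]]] := pfaffian_decay F0' F1' m0 ct' (fun w => sH _ (hol1 w)) uY1 E1 as1 sub1.
have [K2 [rho2 [rho20 D2]]] := pfaffian_decay F0' F1' m0 ct' (fun w => sH _ (hol2 w)) uY2 E2 as2 sub2.
pose K := Num.max K1 K2; pose rho := Num.max rho1 rho2.
have DK w : tau - pi <= cIm w <= tau + pi -> rho <= modz w -> forall i j,
    nc (X w i j) <= K / modz w.
  move=> /andP[w1 w2]; rewrite ge_max => /andP[p1 p2] i j.
  have [h|/ltW h] := leP (cIm w) tau.
    apply: le_trans (D1 w _ p1 i j) _; first by rewrite w1.
    by rewrite ler_wpM2r ?invr_ge0 ?expR_ge0// le_max lexx.
  apply: le_trans (D2 w _ p2 i j) _; first by rewrite h.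
  by rewrite ler_wpM2r ?invr_ge0 ?expR_ge0// le_max lexx orbT.
have [Kc [Kc0 HKc]] := cauchy_bound v ct'.
have [om [om0 Hom]] := mx_bound (omega q v t).
pose lo := Num.min ro (- ln (m%:R + 1)).
have DL w : cRe w <= lo -> forall i j, nc (X w i j) <= n%:R * (Kc * m%:R) * Mi + (expR lo * vn v + om).
  move=> wl i j; have [wl1 wl2] : cRe w <= ro /\ cRe w <= - ln (m%:R + 1).
    by move: wl; rewrite le_min => /andP.
  rewrite XH mxsubE; apply: le_trans (ncB _ _) _; apply: lerD.
    apply: nc_mulmx => i' j'; last exact: (HMi w wl1 i' j').2.
    rewrite mxE; apply: HKc => [|s cs]; first exact: (sH _ (holH w)).
    have := HP s cs 2%N w i' j'; rewrite /=; apply.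
    apply: (@le_trans _ _ (expR (- ln (m%:R + 1)) * (m%:R + 1))).
      by apply: ler_pM; rewrite ?expR_ge0 ?ler_expR// lerDl.
    by rewrite expRN lnK// mulVf// gt_eqF.
  rewrite mxaddE mxscaleE; apply: le_trans (ncD _ _) (lerD _ (Hom i j)).
  rewrite ncM nc_cexp; apply: ler_pM; rewrite ?nc_ge0 ?expR_ge0 ?ler_expR//.
  rewrite mxE; case: eqVneq => _; rewrite ?mulr1n ?mulr0n ?nc0 ?vn_ge0//; exact: nc_le_vn.
have rho0 : 0 < rho by rewrite lt_max rho10.
(* Three ranges of [cRe w]: the Levelt factor below [lo], the asymptotics above [ln rho], a compact
   rectangle between. *)
have Xb i j : exists M : R, forall w, nc (X w i j) <= M.
  have [M [M0 HM]] := @rect_bounded R (fun w => X w i j) lo (ln rho) (tau - pi) (tau + pi)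
    (fun z => cder_cont (projT2 (cid (hX z i j)))).
  exists (M + `|K / rho| + `|n%:R * (Kc * m%:R) * Mi + (expR lo * vn v + om)|) => w.
  have [w' [<- wi _]] := @strip R (fun w => X w i j) tau (fun w => congr1 (fun Z : M_n => Z i j) (Xper w)) w.
  have n1 := normr_ge0 (K / rho); set Q := n%:R * _ * _ + _; have n2 := normr_ge0 Q.
  have [h1|/ltW h1] := leP (cRe w') lo.
    have := DL w' h1 i j; rewrite -/Q; have := ler_norm Q; lra.
  have [h2|/ltW h2] := leP (cRe w') (ln rho).
    have := HM w' (ltac:(by rewrite h1)) wi; lra.
  have h3 : rho <= modz w' by rewrite -[leLHS](lnK rho0) ler_expR.
  have h4 : `|K / modz w'| <= `|K / rho|.
    rewrite !normrM ler_wpM2l// !normfV (gtr0_norm (expR_gt0 _)) (gtr0_norm rho0).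
    by rewrite lef_pV2 ?posrE ?expR_gt0.
  have := DK w' wi h3 i j; have := ler_norm (K / modz w'); lra.
apply/matrixP => i j; rewrite mxE; have [M HM] := Xb i j.
have lio w : X w i j = X 0 i j := @liouville R (fun w => X w i j) M (fun z => hX z i j) HM w.
rewrite lio; apply/eqP; rewrite -nc_eq0 eq_le nc_ge0 andbT; apply/ler_addgt0Pr => e e0; rewrite add0r.
pose E := rho + `|K| / e + 1.
have Ke : 0 <= `|K| / e by rewrite divr_ge0// ltW.
have Ep : 0 < E by rewrite ltr_wpDl// addr_ge0// ltW.
pose w : C := (ln E +i* tau).
have Ew : modz w = E by rewrite /w /= lnK.
rewrite -(lio w); apply: le_trans (DK w _ _ i j) _.
- by rewrite /w /= lerBlDr !lerDl pi_ge0.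
- by rewrite Ew /E -addrA lerDl addr_ge0.
rewrite Ew ler_pdivrMr//; apply: le_trans (ler_norm K) _.
have -> : e * E = e * (rho + 1) + `|K| by rewrite /E; field; rewrite gt_eqF.
by rewrite lerDr mulr_ge0 ?(ltW e0)// addr_ge0// ltW.
Qed.
End PfaffianMain.

(** * Time-one maps of linear equations *)

Section Solution.
Context {R : realType} {n : nat}.
Notation C := (R[i]^o)%type.
Notation M_n := 'M[R[i]^o]_n.
Implicit Types (M X Y : R -> M_n).

Lemma mrdM X Y s (D E : M_n) : mrd X s D -> mrd Y s E ->
  mrd (fun s => X s *m Y s) s (D *m Y s + X s *m E).
Proof.
move=> hX hY i j; rewrite !mxE -big_split /=.
apply: rder_ext (rder_sum (d := fun l => D i l * Y s l j + X s i l * E l j) _ _) => [x|l].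
  by rewrite mxE.
exact: rderM.
Qed.

Lemma mrd0_cst X a b : a <= b -> (forall s, a <= s <= b -> mrd X s 0) -> X b = X a.
Proof.
move=> ab h; apply/matrixP => i j; apply: (rder0_cst (f := fun s => X s i j) _ ab) => s sab.
by have := h s sab i j; rewrite mxE.
Qed.

Lemma mrd_eq X s (D E : M_n) : mrd X s D -> D = E -> mrd X s E.
Proof. by move=> h <-. Qed.

Definition regular M (B : R) := (forall s i j, rcont (fun s => M s i j) s) /\
  forall s i j, nc (M s i j) <= B.

Lemma ode_indep M B B' x : regular M B -> regular M B' -> ode M B x = ode M B' x.
Proof.
move=> [h1 h2] [h1' h2']; apply/matrixP => i j; apply: nc_eps_eq => e e0; have e2 : 0 < e / 2 by rewrite divr_gt0.
have [N1 H1] := tail_small (is_cvg_series_exp_coeff (n%:R * B * `|x|)) e2.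
have [N2 H2] := tail_small (is_cvg_series_exp_coeff (n%:R * B' * `|x|)) e2.
pose N := maxn N1 N2.
have a1 := le_trans (odeP h1 h2 x i j N) (le_trans (ler_norm _) (ltW (H1 N (leq_maxl _ _)))).
have a2 := le_trans (odeP h1' h2' x i j N) (le_trans (ler_norm _) (ltW (H2 N (leq_maxr _ _)))).
have := nc_triangle (ode M B x i j) (\sum_(l < N) pic M l x i j) (ode M B' x i j).
rewrite ncC in a1; lra.
Qed.

(** The value at time 1. The constant enters [ode] only through its tail estimate, and by
    [ode_indep] every admissible one gives the same matrix. *)
Definition sol M : M_n := ode M (xget 0 [set B | regular M B]) 1.

Lemma solE M B : regular M B -> sol M = ode M B 1.
Proof.
move=> h; apply: (ode_indep _ _ h); rewrite /regular.
by case: xgetP => [B' _ //|/(_ B)].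
Qed.

(* the transpose of the adjoint solution is the inverse *)
Lemma sol_transport M B X : regular M B ->
  (forall s, 0 <= s <= 1 -> mrd X s (M s *m X s)) ->
  sol M \in unitmx /\ X 1 = sol M *m X 0.
Proof.
move=> hM hX; have [h1 h2] := hM; rewrite (solE hM).
pose M' s : M_n := - (M s)^T.
have hM' : regular M' B.
  split => s i j; last by rewrite !mxE ncN.
  apply: (rcont_ext (f := fun s => -1 * M s j i)) => [y|]; first by rewrite !mxE mulN1r.
  by apply: rcontM; [exact: rcont_cst|exact: h1].
pose W s : M_n := (ode M' B s)^T.
have dW s : mrd W s (- (W s *m M s)).
  move=> i j; have := ode_rd hM'.1 hM'.2 s j i.
  have -> : (M' s *m ode M' B s) j i = (- (W s *m M s)) i j.
    rewrite /M' mulNmx !mxE; congr (- _); apply: eq_bigr => k _; by rewrite !mxE mulrC.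
  by apply: rder_ext => y; rewrite /W [RHS]mxE.
have W0 : W 0 = 1%:M by rewrite /W (ode0 hM'.1 hM'.2) trmx1.
have G (P Q K : M_n) : - (P *m K) *m Q + P *m (K *m Q) = 0 by rewrite mulNmx mulmxA addNr.
have inv s : W s *m ode M B s = 1%:M.
  have d0 y : mrd (fun y => W y *m ode M B y) y 0.
    exact: mrd_eq (mrdM (dW y) (ode_rd h1 h2 y)) (G _ _ _).
  have base : W 0 *m ode M B 0 = 1%:M by rewrite W0 (ode0 h1 h2) mulmx1.
  have [s0|/ltW s0] := leP 0 s.
    by rewrite (mrd0_cst (X := fun y => W y *m ode M B y) s0 (fun y _ => d0 y)).
  by rewrite -(mrd0_cst (X := fun y => W y *m ode M B y) s0 (fun y _ => d0 y)).
have [uW uO] := mulmx1_unit (inv 1); split => //.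
have c1 : W 1 *m X 1 = X 0.
  rewrite -[RHS]mul1mx -W0; apply: (mrd0_cst (X := fun y => W y *m X y) ler01) => s s01.
  exact: mrd_eq (mrdM (dW s) (hX s s01)) (G _ _ _).
by rewrite -c1 mulmxA (mulmx1C (inv 1)) mul1mx.
Qed.

Lemma sol_bound M B i j : regular M B -> nc (sol M i j) <= expR (n%:R * B).
Proof.
by move=> h; rewrite (solE h); have := ode_bound h.1 h.2 1 i j; rewrite normr1 mulr1.
Qed.

Lemma sol_holo (M : R -> C -> M_n) (B r : R) c i j : 0 < r ->
  (forall y, nc (y - c) < r -> regular (M^~ y) B) ->
  (forall s i j, holo (fun y => M s y i j) c r) -> holo (fun y => sol (M^~ y) i j) c r.
Proof.
move=> r0 hM hh; apply: (holo_near (f := fun y => ode (M^~ y) B 1 i j)) => [y yr|].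
  by rewrite (solE (hM y yr)).
by apply: (ode_holo _ _ _ r0) => // y yr; [exact: (hM y yr).1|exact: (hM y yr).2].
Qed.
End Solution.

(** * Parallel transport of the connection z diag v + omega *)

Section Extension.
Context {R : realType} {n : nat}.
Notation C := (R[i]^o)%type.
Notation T := 'rV[R[i]^o]_n.
Notation M_n := 'M[R[i]^o]_n.
Implicit Types (t v : T).
Variables (q : 'I_n -> 'I_n -> T -> C) (c : T) (e1 : R) (ts : T).
Hypothesis hq : forall a b, ghol (q a b) c e1.
Hypothesis cts : pd c e1 ts.

Definition conn (z : C) v t : M_n := z *: diag_mx v + omega q v t.

Lemma connE z v t i j : conn z v t i j = (z * v 0 i) *+ (i == j) + (v 0 i - v 0 j) * q i j t.
Proof. by rewrite mxaddE mxscaleE !mxE mulrnAr. Qed.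

(** The clamp extends the segment from [ts] to [t] to all times without leaving it, since [ode]
    takes coefficients that are continuous and bounded on the whole line. *)
Definition path t (s : R) : T := ts + (clamp 0 1 s)%:C *: (t - ts).
Lemma path_in t s : pd c e1 t -> pd c e1 (path t s).
Proof. by move=> ct; apply: pd_convex => //; exact: clamp_in ler01. Qed.

Definition Mseg z t (s : R) : M_n := conn z (t - ts) (path t s).

Lemma rcont_clamp s : rcont (fun s : R => (clamp 0 1 s)%:C) s.
Proof.
move=> e e0; exists e => // h he; rewrite -realCB ncR; exact: le_lt_trans (clamp_lip 0 1 s h) he.
Qed.

Lemma rcont_qpath a b t s : pd c e1 t -> rcont (fun s => q a b (path t s)) s.
Proof.
move=> ct; apply: (rcont_comp (f := fun x => q a b (ts + x *: (t - ts))) (g := fun s => (clamp 0 1 s)%:C)).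
  exact: rcont_clamp.
exact: cder_cont (ghol_pder_line (hq a b) (path_in s ct)).
Qed.

Lemma Mseg_cont z t s i j : pd c e1 t -> rcont (fun s => Mseg z t s i j) s.
Proof.
move=> ct; apply: (rcont_ext (f := fun s => (z * (t - ts) 0 i) *+ (i == j) +
  ((t - ts) 0 i - (t - ts) 0 j) * q i j (path t s))) => [x|]; first by rewrite connE.
by apply: rcontD (rcont_cst _ _) _; apply: rcontM (rcont_cst _ _) _; exact: rcont_qpath.
Qed.

Lemma Mseg_bound z t : pd c e1 t -> exists d B : R, 0 < d /\ forall z' t', nc (z' - z) < d -> pd t d t' ->
  pd c e1 t' /\ regular (Mseg z' t') B.
Proof.
move=> ct; have [||d [M [d0 HM]]] := @fin_uniform R ('I_n * 'I_n)%type (fun ij d M =>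
   forall (s : R) t', 0 <= s <= 1 -> pd (ts + s%:C *: (t - ts)) d t' -> nc (q ij.1 ij.2 t') <= M).
- move=> ij d M d' M' dd MM H s t' s01 ht; apply: le_trans MM; apply: (H s) => //; exact: pd_le ht.
- move=> ij; have [d [M [d0 H]]] := segment_locbd (hq ij.1 ij.2) (fun s s01 => pd_convex cts ct s01).
  by exists d, M; split => // s t' s01 ht; exact: (H s t' s01 ht).2.
have [e e0 He] := pd_open ct.
pose m := Num.min 1 (Num.min d e).
have m0 : 0 < m by rewrite !lt_min ltr01 d0.
pose V := vn (t - ts) + 1.
exists m, ((nc z + 1) * V + (2 * V) * `|M|); split => // z' t' zz tt.
have ct' : pd c e1 t' by apply: pd_trans (pd_le _ tt) He; rewrite !ge_min lexx !orbT.
have vb i : nc ((t' - ts) 0 i) <= V.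
  have -> : (t' - ts) 0 i = (t - ts) 0 i + (t' 0 i - t 0 i) by rewrite !mxE; ring.
  apply: le_trans (ncD _ _) _; apply: lerD; first exact: nc_le_vn.
  by apply: ltW; apply: lt_le_trans (tt i) _; rewrite ge_min lexx.
have V0 : 0 <= V by rewrite addr_ge0// vn_ge0.
split => //; split => [s i j|s i j]; first exact: Mseg_cont.
rewrite connE; apply: le_trans (ncD _ _) _; apply: lerD.
  case: (i == j); last by rewrite mulr0n nc0 mulr_ge0// addr_ge0 ?nc_ge0.
  rewrite mulr1n ncM; apply: ler_pM; rewrite ?nc_ge0//.
  have : nc (z' - z) <= 1 by apply: ltW; apply: lt_le_trans zz _; rewrite ge_min lexx.
  have := nc_dist z' z; lra.
rewrite ncM; apply: ler_pM; rewrite ?nc_ge0//.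
  by apply: le_trans (ncB _ _) _; have := vb i; have := vb j; lra.
apply: le_trans (ler_norm M); apply: (HM (i, j) (clamp 0 1 s) _ (clamp_in s ler01)) => k.
have -> : path t' s 0 k - (ts + (clamp 0 1 s)%:C *: (t - ts)) 0 k = (clamp 0 1 s)%:C * (t' 0 k - t 0 k) by rewrite !mxE; ring.
rewrite ncM ncR ger0_norm; last by case/andP: (clamp_in s ler01).
apply: le_lt_trans (_ : nc (t' 0 k - t 0 k) < _).
  by rewrite ler_piMl ?nc_ge0//; case/andP: (clamp_in s ler01).
by apply: lt_le_trans (tt k) _; rewrite !ge_min lexx !orbT.
Qed.

(** Parallel transport from [ts] to [t] along the segment, at the fixed value [z]. *)
Definition U (z : C) t : M_n := sol (Mseg z t).

(** Moving z and t along one common complex line treats holomorphy in t ([z' = 0]) and in z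
    ([v = 0]) at once. *)
Lemma U_line z z' t v i j : pd c e1 t -> exists d, cder (fun y => U (z + y * z') (t + y *: v) i j) 0 d.
Proof.
move=> ct; have [d [B [d0 H]]] := Mseg_bound z ct.
have K0 : 0 < vn v + 1 by rewrite ltr_wpDl ?vn_ge0.
have L0 : 0 < nc z' + 1 by rewrite ltr_wpDl ?nc_ge0.
pose r := Num.min (d / (vn v + 1)) (d / (nc z' + 1)).
have r0 : 0 < r by rewrite lt_min !divr_gt0.
have in1 (y : C) : nc (y - 0) < r -> pd t d (t + y *: v) by rewrite subr0 lt_min => /andP[h _]; exact: line_pd.
have in2 (y : C) : nc (y - 0) < r -> nc (z + y * z' - z) < d.
  rewrite subr0 lt_min => /andP[_]; rewrite ltr_pdivlMr// => h.
  rewrite addrAC subrr add0r ncM; apply: le_lt_trans h; by rewrite ler_wpM2l ?nc_ge0// lerDl.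
suff hol : holo (fun y => U (z + y * z') (t + y *: v) i j) 0 r by apply: hol; rewrite subrr nc0.
apply: (@sol_holo R n (fun s y => Mseg (z + y * z') (t + y *: v) s) B r 0 i j r0).
- by move=> y yr; exact: (H _ _ (in2 y yr) (in1 y yr)).2.
- move=> s a b; pose f (y : C) := q a b (path t s + y *: ((clamp 0 1 s)%:C *: v)).
  have pE (y : C) : path (t + y *: v) s = path t s + y *: ((clamp 0 1 s)%:C *: v) by apply/rowP => k; rewrite !mxE; ring.
  have hf : holo f 0 r by apply: (ghol_holo (hq a b)) => y yr; rewrite -pE; apply: path_in; exact: (H _ _ (in2 y yr) (in1 y yr)).1.
  move=> y yr; have [D HD] := hf y yr.
  have c1 k : exists D, cder (fun y : C => (t + y *: v - ts) 0 k) y D.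
    exists (v 0 k); apply: (cder_ext (f := fun y => (t 0 k - ts 0 k) + y * v 0 k)) => [x|].
      by rewrite !mxE; ring.
    by apply: cder_eq (cderD (cder_cst _ y) (cderM (cder_id y) (cder_cst (v 0 k) y))) _; ring.
  have [Da HDa] := c1 a; have [Db HDb] := c1 b.
  have c2 : cder (fun y => z + y * z') y (0 + (1 * z' + y * 0)).
    exact: cderD (cder_cst z y) (cderM (cder_id y) (cder_cst z' y)).
  eexists; apply: (cder_ext (f := fun y => (a == b)%:R * ((z + y * z') * (t + y *: v - ts) 0 a) +
      ((t + y *: v - ts) 0 a - (t + y *: v - ts) 0 b) * f y)) => [x|].
    by rewrite connE /f pE mulr_natl.
  exact: cderD (cderM (cder_cst _ y) (cderM c2 HDa)) (cderM (cderB HDa HDb) HD).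
Qed.

Lemma U_mghol z : mghol (U z) c e1.
Proof.
move=> i j; split => [t v ct|t ct].
  have [d Hd] := U_line z 0 v i j ct; exists d; apply: cder_ext Hd => y; by rewrite mulr0 addr0.
have [d [B [d0 H]]] := Mseg_bound z ct; exists d, (expR (n%:R * B)); split => // s ts'.
by apply: sol_bound; apply: (H z s _ ts').2; rewrite subrr nc0.
Qed.

Lemma U_cder z t i j : pd c e1 t -> exists d, cder (fun z => U z t i j) z d.
Proof.
move=> ct; have [d Hd] := U_line z 1 0 i j ct; exists d.
apply: (cder_ext (f := fun x => U (z + (x - z) * 1) (t + (x - z) *: 0) i j)) => [x|].
  by rewrite mulr1 addrC subrK scaler0 addr0.
apply: cder_eq (cder_comp (f := fun y => U (z + y * 1) (t + y *: 0) i j) (cderB (cder_id z) (cder_cst z z)) _) _.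
  by rewrite subrr; exact: Hd.
by rewrite subr0 mulr1.
Qed.

Lemma U_joint z t : pd c e1 t -> exists d M : R, 0 < d /\ forall z' t', nc (z' - z) < d -> pd t d t' ->
  forall i j, nc (U z' t' i j) <= M.
Proof.
move=> ct; have [d [B [d0 H]]] := Mseg_bound z ct; exists d, (expR (n%:R * B)); split => // z' t' zz tt i j.
by apply: sol_bound; exact: (H z' t' zz tt).2.
Qed.

Lemma U_transport z (X : T -> M_n) t c' r' : pd c e1 t -> mghol X c' r' ->
  (forall s : R, 0 <= s <= 1 -> pd c' r' (ts + s%:C *: (t - ts))) ->
  (forall s : R, 0 <= s <= 1 -> mpder X (t - ts) (ts + s%:C *: (t - ts)) =
    conn z (t - ts) (ts + s%:C *: (t - ts)) *m X (ts + s%:C *: (t - ts))) ->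
  X t = U z t *m X ts.
Proof.
move=> ct hX hs hd; have [d [B [d0 H]]] := Mseg_bound z ct.
have reg : regular (Mseg z t) B by apply: (H z t _ (pd_center t d0)).2; rewrite subrr nc0.
have [|_] := sol_transport (X := fun s => X (ts + s%:C *: (t - ts))) reg.
  move=> s s01; rewrite /Mseg /path clamp_id// -hd// => i j.
  have := rder_comp (rder_id s) (mpder_line (x := s%:C) hX (hs s s01) i j).
  by rewrite mulr1.
by rewrite realC1 scale1r addrC subrK realC0 scale0r addr0.
Qed.

Lemma U_unit z t : pd c e1 t -> U z t \in unitmx.
Proof.
move=> ct; have [d [B [d0 H]]] := Mseg_bound z ct.
have reg : regular (Mseg z t) B by apply: (H z t _ (pd_center t d0)).2; rewrite subrr nc0.
apply: (sol_transport (X := fun=> 0) reg _).1 => s _ i j; rewrite mulmx0.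
by have -> : (0 : M_n) i j = 0 :> C by [rewrite mxE|]; exact: rder_cst.
Qed.
End Extension.

(** * Continuation of the solutions to the whole polydisc *)

Section Continuation.
Context {R : realType} {n : nat}.
Notation C := (R[i]^o)%type.
Notation T := 'rV[R[i]^o]_n.
Notation M_n := 'M[R[i]^o]_n.
Implicit Types (t v : T).

(** The zero curvature condition at z = 1: the mixed derivatives of Y agree, diag v commutes with
    Lambda, and [Lambda, omega] = [diag v, A] removes the mixed terms, which leaves dA =
    [omega, A]. *)
Lemma flow_algebra (E L om A D Y : M_n) : Y \in unitmx -> E *m L = L *m E ->
  L *m om - om *m L = E *m A - A *m E ->
  E *m Y + (E + om) *m ((L + A) *m Y) = (E + D) *m Y + (L + A) *m ((E + om) *m Y) ->
  D = om *m A - A *m om.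
Proof.
move=> uY EL Lom; rewrite !mulmxA -!mulmxDl => H.
have {}H : E + (E + om) *m (L + A) = E + D + (L + A) *m (E + om) by rewrite -[LHS](mulmxK uY) H mulmxK.
apply/matrixP => i j; have := congr1 (fun M : M_n => M i j) H; have := congr1 (fun M : M_n => M i j) Lom.
have := congr1 (fun M : M_n => M i j) EL; rewrite !mulmxDl !mulmxDr; clear.
move: (E *m L) (L *m E) (L *m om) (om *m L) (E *m A) (A *m E) (om *m A) (A *m om) => a b c d e f g h.
rewrite !mxaddE !mxoppE => h1 h2 h3.
have -> : D i j = (E i j + D i j + (b i j + f i j + (c i j + h i j))) - E i j - b i j - f i j - c i j - h i j by ring.
have -> : E i j + D i j + (b i j + f i j + (c i j + h i j)) = E i j + (a i j + e i j + (d i j + g i j)) by rewrite h3; ring.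
rewrite h1; have -> : c i j = e i j - f i j + d i j by rewrite -h2; ring.
by ring.
Qed.

Variables (u0 : T) (q : 'I_n -> 'I_n -> T -> C) (A : T -> M_n) (e1 : R) (ts : T) (rs : R).
Hypothesis hq : forall a b, ghol (q a b) 0 e1.
Hypothesis hA : mghol A 0 e1.
Hypothesis Aq : forall t a b, pd 0 e1 t -> a != b ->
  A t a b = ((u0 + t) 0 a - (u0 + t) 0 b) * q a b t.
Hypothesis rs0 : 0 < rs.
Hypothesis sub : forall t, pd ts rs t -> pd 0 e1 t.

Lemma cts : pd 0 e1 ts. Proof. exact: sub (pd_center _ rs0). Qed.

Lemma mghol_ball (X : T -> M_n) : mghol X 0 e1 -> mghol X ts rs.
Proof.
move=> hX i j; split => [t v ct|t ct]; first exact: (hX i j).1 t v (sub ct).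
exact: (hX i j).2 t (sub ct).
Qed.

Lemma omega_ghol v : mghol (omega q v) 0 e1.
Proof.
move=> a b; apply: ghol_ext (gholM (ghol_cst (v 0 a - v 0 b) 0 e1) (hq a b)) => t.
by rewrite mxE.
Qed.

Lemma diag_mxD (u v : T) : diag_mx (u + v) = diag_mx u + diag_mx v :> M_n.
Proof. by apply/matrixP => i j; rewrite !mxE mulrnDl. Qed.

Lemma diag_mxZ (x : C) v : diag_mx (x *: v) = x *: diag_mx v :> M_n.
Proof. by apply/matrixP => i j; rewrite !mxE mulrnAr. Qed.

Lemma diag_mx_comm (u v : T) : diag_mx u *m diag_mx v = diag_mx v *m diag_mx u :> M_n.
Proof.
apply/matrixP => i j; rewrite !mul_diag_mx !mxE.
by case: (eqVneq i j) => [->|_]; rewrite ?mulr1n ?mulr0n ?mulr0// mulrC.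
Qed.

Lemma omegaE v t a b : omega q v t a b = (v 0 a - v 0 b) * q a b t.
Proof. by rewrite mxE. Qed.

(** Both entries are (v_a - v_b) (u_a - u_b) q_ab: omega is a solution of [Lambda, omega] =
    [diag v, A] that is holomorphic across the coalescence locus. *)
Lemma omega_comm t v : pd 0 e1 t ->
  diag_mx (u0 + t) *m omega q v t - omega q v t *m diag_mx (u0 + t) =
  diag_mx v *m A t - A t *m diag_mx v.
Proof.
move=> ct; apply/matrixP => a b; apply: (etrans (diag_commE _ _ _ _)); apply/esym; apply: (etrans (diag_commE _ _ _ _)).
rewrite omegaE; have [->|ab] := eqVneq a b; first by rewrite !subrr !mul0r.
rewrite (Aq ct ab); move: (v 0 a) (v 0 b) (q a b t) ((u0 + t) 0 a) ((u0 + t) 0 b) => x y z x' y'; ring.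
Qed.

Lemma mghol_diag : mghol (fun t => diag_mx (u0 + t)) 0 e1.
Proof.
move=> i j; apply: (ghol_ext (f := fun t : T => (i == j)%:R * (u0 0 i + t 0 i))) => [t|].
  by rewrite !mxE mulr_natl.
exact: gholM (ghol_cst _ _ _) (gholD (ghol_cst _ _ _) (ghol_coord i _ _)).
Qed.

Lemma mpder_diag t v : mpder (fun t => diag_mx (u0 + t)) v t = diag_mx v.
Proof.
apply: mpderP.
apply: (mder_ext (X := fun x => diag_mx (u0 + t) + x *: diag_mx v)) => [x|].
  by rewrite addrA [in RHS]diag_mxD diag_mxZ.
apply: mder_eq (mderD (mder_cst _ 0) (mderZ (cder_id 0) (mder_cst _ 0))) _.
by rewrite scale1r scaler0 addr0 add0r.
Qed.

Lemma mghol_sys (z : C) : mghol (fun t => z *: diag_mx (u0 + t) + A t) 0 e1.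
Proof. exact: mgholD (mgholZ (ghol_cst z 0 e1) mghol_diag) hA. Qed.

Lemma mpderZc (z : C) (X : T -> M_n) c r t v : mghol X c r -> pd c r t ->
  mpder (fun t => z *: X t) v t = z *: mpder X v t.
Proof.
move=> hX ct; apply: mpderP.
apply: mder_eq (mderZ (cder_cst z 0) (mpder_der v hX ct)) _.
by rewrite scale0r add0r.
Qed.

Lemma mpder_sys (z : C) t v : pd 0 e1 t ->
  mpder (fun t => z *: diag_mx (u0 + t) + A t) v t = z *: diag_mx v + mpder A v t.
Proof.
move=> ct; rewrite (mpderD v (mgholZ (ghol_cst z 0 e1) mghol_diag) hA ct).
by congr (_ + _); rewrite -(mpder_diag t v); exact: mpderZc mghol_diag ct.
Qed.

Definition pfaff (Y : T -> C -> M_n) c r := forall t v w, pd c r t ->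
  mpder (Y^~ w) v t = conn q (cexp w) v t *m Y t w.

Section Ball.
Variable Y : T -> C -> M_n.
Hypothesis hY : forall w, mghol (Y^~ w) ts rs.
Hypothesis sys : forall t, pd ts rs t -> fundamental_solution (u0 + t) (A t) (Y t).
Hypothesis pf : pfaff Y ts rs.

Let sysD t w : pd ts rs t -> mder (Y t) w ((cexp w *: diag_mx (u0 + t) + A t) *m Y t w).
Proof. by move=> ct; have [] := (fundP _ _ _).1 (sys ct) w. Qed.

(** The derivatives in t and in log z are exchanged at w = 0, that is z = 1, where [flow_algebra]
    isolates the derivative of [A]. *)
Lemma flow_ball t v : pd ts rs t -> mpder A v t = omega q v t *m A t - A t *m omega q v t.
Proof.
move=> ct; have ct' := sub ct.
have hX : mjhol (fun w t => Y t w) ts rs by apply: (system_mjhol (mghol_ball hA) hY) => s w; exact: sysD.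
have [_ H] := mjhol_dw hX (fun w s cs => sysD w cs) 0.
have {}H := H t v ct; rewrite cexp0 in H.
have H1 : mder (fun w => mpder (fun t => Y t w) v t) 0 ((diag_mx v) *m Y t 0 +
   (diag_mx v + omega q v t) *m ((diag_mx (u0 + t) + A t) *m Y t 0)).
  apply: (mder_ext (X := fun w => conn q (cexp w) v t *m Y t w)) => [w|]; first by rewrite pf.
  apply: mder_eq (mderM (mderD (mderZ (cder_cexp 0) (mder_cst (diag_mx v) 0)) (mder_cst (omega q v t) 0)) (sysD 0 ct)) _.
  by rewrite /conn cexp0 !scale1r !addr0.
have {H}H1 := mder_unique H1 H; move: H1.
rewrite (mpderM v (mghol_ball (mghol_sys 1)) (hY 0) ct) (mpder_sys 1 v ct') (pf v 0 ct) /conn cexp0 !scale1r.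
apply: flow_algebra; first by case: ((fundP _ _ _).1 (sys ct) 0).
  exact: diag_mx_comm.
exact: omega_comm.
Qed.

Lemma flow t v : pd 0 e1 t -> mpder A v t = omega q v t *m A t - A t *m omega q v t.
Proof.
apply: (mghol_eq (X := mpder A v) (Y := fun t => omega q v t *m A t - A t *m omega q v t) _ _ cts rs0).
- exact: mpder_mghol.
- exact: mgholB (mgholM (omega_ghol v) hA) (mgholM hA (omega_ghol v)).
- by move=> s; exact: flow_ball.
Qed.

(** The solution continued by parallel transport from the base point. Transport acts on the left and
    commutes with constant right factors, so Stokes and connection matrices are preserved. *)
Definition ext t w : M_n := U q ts (cexp w) t *m Y ts w.

Lemma ext_ball t w : pd ts rs t -> Y t w = ext t w.
Proof.
have seg s : pd ts rs t -> 0 <= s <= 1 -> pd ts rs (ts + s%:C *: (t - ts)) by move=> ct s01; apply: pd_convex => //; exact: pd_center.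
move=> ct; apply: (U_transport hq cts (sub ct) (hY w)) => s s01; first exact: seg.
by apply: pf; exact: seg.
Qed.

Lemma ext_mghol w : mghol (ext^~ w) 0 e1.
Proof. exact: (mgholM (U_mghol hq cts (cexp w)) (mghol_cst (Y ts w) _ _)). Qed.

Lemma ext_pfaff : pfaff ext 0 e1.
Proof.
move=> t v w; apply: (mghol_eq (X := mpder (ext^~ w) v) (Y := fun t => conn q (cexp w) v t *m ext t w) _ _ cts rs0).
- exact: mpder_mghol (ext_mghol w).
- by apply: mgholM (ext_mghol w); apply: mgholD (omega_ghol v); exact: mghol_cst.
- move=> s cs; rewrite -(ext_ball w cs) -(pf v w cs).
  by apply: mpder_near cs; [move=> x /(ext_ball w)|exact: hY].
Qed.

Lemma ext_mder t w : pd 0 e1 t -> exists D, mder (ext t) w D.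
Proof.
move=> ct; have /choice[D HD] : forall ij : 'I_n * 'I_n, exists d, cder (fun z => U q ts z t ij.1 ij.2) (cexp w) d.
  move=> ij; exact (U_cder hq cts (cexp w) ij.1 ij.2 ct).
have H1 : mder (fun w => U q ts (cexp w) t) w (cexp w *: \matrix_(i, j) D (i, j)).
  apply: (mder_comp (X := fun z => U q ts z t) (cder_cexp w)) => i j; rewrite mxE; exact: (HD (i, j)).
eexists; apply: mderM H1 _; exact: sysD (pd_center _ rs0).
Qed.

Lemma ext_mjhol : mjhol (fun w t => ext t w) 0 e1.
Proof.
move=> i j; split => [w|t w ct|w t ct]; first exact: ext_mghol.
  by have [D HD] := ext_mder w ct; exists (D i j).
have [d [M [d0 H]]] := U_joint hq cts (cexp w) ct.
have [b [b0 Hb]] := mx_bound (Y ts w).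
have cc : ccont cexp w by exact: cder_cont (cder_cexp w).
have [d1 d10 Hd1] := cc d d0.
have cY : forall k, exists2 r : R, 0 < r & forall h : C, nc h < r -> nc (Y ts (w + h) k j) <= b + 1.
  move=> k; have [r r0 Hr] := cder_cont (sysD w (pd_center _ rs0) k j) ltr01.
  exists r => // h /Hr; have := nc_dist (Y ts (w + h) k j) (Y ts w k j); have := Hb k j; lra.
have [||d2 [_ [d20 Hd2]]] := @fin_uniform R 'I_n (fun k d (M : R) => forall h : C, nc h < d -> nc (Y ts (w + h) k j) <= b + 1).
- by move=> k e M1 e' M2 ee _ Hk h hh; apply: Hk; exact: lt_le_trans ee.
- by move=> k; have [r r0 Hr] := cY k; exists r, 0; split.
exists (Num.min d (Num.min d1 d2)), (n%:R * (`|M| * (b + 1))); split; first by rewrite !lt_min d0 d10.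
move=> w' t' ww tt; rewrite -sum_cst /ext mxE; apply: le_trans (nc_sum _ _ _) _; apply: ler_sum => k _.
rewrite ncM; apply: ler_pM; rewrite ?nc_ge0//.
  apply: le_trans (ler_norm M); apply: H.
    have := Hd1 (w' - w); rewrite [w + _]addrC subrK; apply; by apply: lt_le_trans ww _; rewrite !ge_min lexx !orbT.
  by apply: pd_le tt; rewrite ge_min lexx.
have := Hd2 k (w' - w); rewrite [w + _]addrC subrK; apply; by apply: lt_le_trans ww _; rewrite !ge_min lexx !orbT.
Qed.

(** The derivative in w is itself holomorphic in t by [mjhol_dw], so the equation, valid in the
    small polydisc, extends by the identity theorem. *)
Lemma ext_fund t : pd 0 e1 t -> fundamental_solution (u0 + t) (A t) (ext t).
Proof.
move=> ct; apply/fundP => w; split; last first.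
  rewrite unitmx_mul (U_unit hq cts _ ct)/=.
  by have [] := (fundP _ _ _).1 (sys (pd_center _ rs0)) w.
pose D w t := xget 0 [set D | mder (ext t) w D].
have HD w' t' : pd 0 e1 t' -> mder (ext t') w' (D w' t') by move=> /(ext_mder w')[D0 HD0]; rewrite /D; case: xgetP => [D1 _ //|/(_ D0)].
have [hD _] := mjhol_dw ext_mjhol HD w.
suff <- : D w t = (cexp w *: diag_mx (u0 + t) + A t) *m ext t w by exact: HD.
apply: (mghol_eq (X := D w) (Y := fun t => (cexp w *: diag_mx (u0 + t) + A t) *m ext t w) hD _ cts rs0) => //.
  exact: mgholM (mghol_sys _) (ext_mghol w).
move=> s cs; apply: mder_unique (HD w s (sub cs)) _; rewrite -ext_ball//.
by apply: mder_ext (sysD w cs) => x; exact: ext_ball.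
Qed.
End Ball.
End Continuation.

(** The points of [V] near which [X] and [Y] agree form an open set whose complement in [V] is open
    too, by the identity theorem on polydiscs. *)
Lemma identity_connected {R : realType} {n : nat} (V : set 'rV[R[i]^o]_n)
    (X Y : 'rV[R[i]^o]_n -> 'M[R[i]^o]_n) ts rs :
  open V -> connected V -> V ts -> 0 < rs ->
  (forall t, V t -> exists2 r : R, 0 < r & mghol X t r /\ mghol Y t r) ->
  (forall t, pd ts rs t -> X t = Y t) -> forall t, V t -> X t = Y t.
Proof.
move=> oV cV Vts rs0 hXY XYts.
pose O := [set t | exists2 d : R, 0 < d & forall s, pd t d s -> X s = Y s].
have oO : open O.
  rewrite openE => t [d d0 Hd]; apply/nbhs_pd; have d2 : 0 < d / 2 by rewrite divr_gt0.
  exists (d / 2) => // s st; exists (d / 2) => // x xs; apply: Hd; apply: pd_trans xs _ => i.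
  by have := st i; lra.
have oVO : open (V `&` ~` O).
  rewrite openE => t [Vt nOt]; apply/nbhs_pd.
  have [r r0 [hX hY]] := hXY t Vt; have [r' r'0 Hr'] := open_pd oV Vt.
  exists (Num.min r r'); first by rewrite lt_min r0.
  move=> s st; split; first by apply: Hr'; apply: pd_le st; rewrite ge_min lexx orbT.
  move=> [d d0 Hd]; apply: nOt; exists r => // x xt.
  apply: (mghol_eq hX hY (_ : pd t r s) d0) => //; by apply: pd_le st; rewrite ge_min lexx.
have E : V `&` O = V.
  apply: cV.
  - by exists ts; split => //; exists rs.
  - by exists O.
  - exists (~` (V `&` ~` O)); first by rewrite closedC.
    by apply/seteqP; split => t [Vt]; [move=> Ot; split => // -[_]|move=> h; split => //; apply: contrapT => nO; apply: h].
move=> t Vt; have [_ [d d0 Hd]] : (V `&` O) t by rewrite E.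
exact: Hd (pd_center _ d0).
Qed.

(** * Continuation of the formal solution *)

Section FormalExtension.
Context {R : realType} {n : nat}.
Notation C := (R[i]^o)%type.
Notation T := 'rV[R[i]^o]_n.
Notation M_n := 'M[R[i]^o]_n.
Implicit Types (t v : T).
Variables (u0 : T) (q : 'I_n -> 'I_n -> T -> C) (A : T -> M_n) (e1 : R) (ts : T) (rs : R).
Hypothesis hq : forall a b, ghol (q a b) 0 e1.
Hypothesis hA : mghol A 0 e1.
Hypothesis Aq : forall t a b, pd 0 e1 t -> a != b ->
  A t a b = ((u0 + t) 0 a - (u0 + t) 0 b) * q a b t.
Hypothesis fl : forall t v, pd 0 e1 t -> mpder A v t = omega q v t *m A t - A t *m omega q v t.

Lemma mulmx_eq (X Y : M_n) i j : (X *m Y) i j = \sum_k X i k * Y k j.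
Proof. by rewrite mxE. Qed.

(** The diagonal of omega A - A omega vanishes: both products contribute the same terms (v_j - v_k)
    (u_k - u_j) q_jk q_kj. *)
Lemma diag_const t j : pd 0 e1 t -> A t j j = A 0 j j.
Proof.
move=> ct; have e0 : 0 < e1 by exact: le_lt_trans (nc_ge0 _) (ct j).
have c0 : pd 0 e1 (0 : T) by exact: pd_center.
have d0 s v : pd 0 e1 s -> mpder A v s j j = 0.
  move=> cs; rewrite fl// mxsubE !mulmx_eq; apply/eqP; rewrite subr_eq0; apply/eqP.
  apply: eq_bigr => k _; have [->|kj] := eqVneq k j; first by rewrite !omegaE !subrr mul0r mulr0 mul0r.
  rewrite !omegaE (Aq cs kj) (Aq cs (_ : j != k)); last by rewrite eq_sym.
  move: (v 0 j) (v 0 k) (q j k s) (q k j s) ((u0 + s) 0 j) ((u0 + s) 0 k) => x y z w x' y'; ring.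
have cst (s : R) : 0 <= s <= 1 -> rder (fun s : R => A (0 + s%:C *: t) j j) s 0.
  move=> s01; have cs : pd 0 e1 (0 + s%:C *: t) by rewrite -[t]subr0; exact: pd_convex.
  by apply: rder_eq (rder_comp (rder_id s) (mpder_line (v := t) hA cs j j)) _; rewrite d0// mul0r.
have := rder0_cst cst ler01; by rewrite realC1 realC0 scale1r scale0r !add0r.
Qed.

Lemma diag_part_const t : pd 0 e1 t -> diag_part (A t) = diag_part (A 0).
Proof. by move=> ct; apply/matrixP => i j; rewrite !mxE diag_const. Qed.

Definition unitv (a : 'I_n) : T := \row_c (c == a)%:R.
Definition offd (X : T -> M_n) t a b := (mpder X (unitv a) t - omega q (unitv a) t *m X t) a b.
(* off the diagonal, the flow in the direction [e_a] determines the next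
   coefficient without dividing by [u_a - u_b] *)
Fixpoint fext (k : nat) t : M_n := if k is k'.+1 then
   \matrix_(a, b) (if a == b then - (k%:R)^-1 * \sum_(c | c != a) A t a c * offd (fext k') t c a
                   else offd (fext k') t a b)
  else 1%:M.

Lemma offd_ghol (X : T -> M_n) a b : mghol X 0 e1 -> ghol (fun t => offd X t a b) 0 e1.
Proof. by move=> hX; exact: mgholB (mpder_mghol _ hX) (mgholM (omega_ghol hq _) hX) a b. Qed.

Lemma fextS k t a b : fext k.+1 t a b = if a == b then - (k.+1%:R)^-1 * \sum_(c | c != a) A t a c * offd (fext k) t c a
                   else offd (fext k) t a b.
Proof. by rewrite mxE. Qed.

Lemma fext_mghol k : mghol (fext k) 0 e1.
Proof.
elim: k => [|k IH] a b; first exact: mghol_cst.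
apply: ghol_ext (fun t => esym (fextS k t a b)) _; case: (a == b); last exact: offd_ghol.
apply: gholM (ghol_cst _ _ _) _.
apply: (ghol_ext (f := fun t => \sum_c (if c != a then A t a c * offd (fext k) t c a else 0))) => [t|].
  by rewrite -big_mkcond.
apply: ghol_sum => c; case: (c != a); last exact: ghol_cst.
exact: gholM (hA a c) (offd_ghol c a IH).
Qed.

Hypothesis rs0 : 0 < rs.
Hypothesis sub : forall t, pd ts rs t -> pd 0 e1 t.
Variables (F : nat -> T -> M_n) (m : R).
Hypothesis hF : forall t, pd ts rs t -> formal_solution (u0 + t) (A t) (F^~ t).
Hypothesis m0 : 0 < m.
Hypothesis dist : forall t a b, pd ts rs t -> a != b -> m <= nc ((u0 + t) 0 a - (u0 + t) 0 b).

Lemma F_zero t : pd ts rs t -> F 0%N t = 1%:M.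
Proof. by move=> /hF/formal_solutionP[]. Qed.

Lemma F_rec k t : pd ts rs t -> diag_mx (u0 + t) *m F k.+1 t - F k.+1 t *m diag_mx (u0 + t) =
  F k t *m diag_part (A t) - A t *m F k t - F k t *+ k.
Proof. by move=> /hF/formal_solutionP[_]; apply. Qed.

Lemma distinct t a b : pd ts rs t -> a != b -> (u0 + t) 0 a - (u0 + t) 0 b != 0.
Proof. by move=> ct ab; rewrite -nc_gt0; exact: lt_le_trans (dist ct ab). Qed.

Lemma rec_entry (L : T) (F1 F0 B : M_n) A' k a b :
  diag_mx L *m F1 - F1 *m diag_mx L = F0 *m diag_part B - A' *m F0 - F0 *+ k ->
  (L 0 a - L 0 b) * F1 a b = F0 a b * B b b - (A' *m F0) a b - k%:R * F0 a b.
Proof. by move=> H; rewrite -diag_commE H !mxsubE mxmulnE diag_part_mulr. Qed.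

Lemma F_off k t a b : pd ts rs t -> a != b -> F k.+1 t a b =
  ((u0 + t) 0 a - (u0 + t) 0 b)^-1 * (F k t a b * A t b b - (A t *m F k t) a b - k%:R * F k t a b).
Proof.
move=> ct ab; rewrite -(rec_entry a b (F_rec k ct)) mulrA mulVf ?mul1r//; exact: distinct.
Qed.

Lemma F_diag k t a : pd ts rs t -> F k.+1 t a a = - (k.+1%:R)^-1 * \sum_(c | c != a) A t a c * F k.+1 t c a.
Proof.
move=> ct; have := rec_entry a a (F_rec k.+1 ct).
rewrite subrr mul0r mulmx_eq (bigD1 a)//=; move: (\sum_(i < n | i != a) _) => S H.
have k0 : (k.+1%:R : C) != 0 by rewrite pnatr_eq0.
have {}H : k.+1%:R * F k.+1 t a a = - S by rewrite -[LHS]addr0 H; ring.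
by rewrite mulNr -mulrN -H mulrA mulVf ?mul1r.
Qed.

Lemma F_mghol k : mghol (F k) ts rs.
Proof.
elim: k => [|k IH].
  by apply: (mghol_near (X := fun=> 1%:M)) => [t /F_zero//|]; exact: mghol_cst.
have off a b : a != b -> ghol (fun t => F k.+1 t a b) ts rs.
  move=> ab; apply: ghol_near (fun t ct => esym (F_off k ct ab)) _.
  have hA' := mghol_ball sub hA.
  apply: gholM; last first.
    apply: gholB; last exact: gholM (ghol_cst _ _ _) (IH a b).
    by apply: gholB; [exact: gholM (IH a b) (hA' b b)|exact: mgholM hA' IH a b].
  apply: ghol_inv m0 _ => [|t ct]; last exact: dist.
  apply: (ghol_ext (f := fun t : T => (u0 0 a + t 0 a) - (u0 0 b + t 0 b))) => [t|]; first by rewrite !mxE.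
  by apply: gholB; apply: gholD (ghol_cst _ _ _) (ghol_coord _ _ _).
move=> a b; have [<-|/off//] := eqVneq a b.
apply: ghol_near (fun t ct => esym (F_diag k a ct)) _.
apply: gholM (ghol_cst _ _ _) _.
apply: (ghol_ext (f := fun t => \sum_c (if c != a then A t a c * F k.+1 t c a else 0))) => [t|].
  by rewrite -big_mkcond.
apply: ghol_sum => c; have [->|ca] := eqVneq c a; first exact: ghol_cst.
exact: gholM (mghol_ball sub hA a c) (off c a ca).
Qed.

Lemma F_one t a b : pd ts rs t -> a != b -> F 1%N t a b = - q a b t.
Proof.
move=> ct ab; rewrite F_off// F_zero// mulmx1 (Aq (sub ct) ab) mul0r subr0.
have -> : (1%:M : M_n) a b = 0 by rewrite mxE (negPf ab).
by rewrite mul0r sub0r mulrN mulrA mulVf ?mul1r//; exact: distinct.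
Qed.

Lemma comm_mpder (X : T -> M_n) t v : mghol X ts rs -> pd ts rs t ->
  mpder (fun t => diag_mx (u0 + t) *m X t - X t *m diag_mx (u0 + t)) v t =
  diag_mx v *m X t - X t *m diag_mx v + (diag_mx (u0 + t) *m mpder X v t - mpder X v t *m diag_mx (u0 + t)).
Proof.
move=> hX ct; have hd := mghol_ball sub (mghol_diag u0 e1).
apply: mpderP; have dL := mpder_der v hd ct; have dX := mpder_der v hX ct; rewrite mpder_diag in dL.
apply: mder_eq (mderD (mderM dL dX) (mderN (mderM dX dL))) _.
have E0 : t + (0 : C) *: v = t by rewrite scale0r addr0.
rewrite !E0; have G (a b c d : M_n) : a + b - (c + d) = a - d + (b - c).
  by rewrite opprD [- c - d]addrC addrACA.
exact: G.
Qed.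

(** The defect [H] of this flow satisfies the homogeneous recursion, and [H 0 = 0] because omega =
    F_1 diag v - diag v F_1. In this polydisc the u_a are distinct, so the only divisors are the
    integers -(k + 1) on the diagonal. *)
Lemma F_flow k t v : pd ts rs t -> mpder (F k) v t =
  omega q v t *m F k t + (diag_mx v *m F k.+1 t - F k.+1 t *m diag_mx v).
Proof.
move=> ct; have ct' := sub ct.
pose H k := mpder (F k) v t - omega q v t *m F k t - (diag_mx v *m F k.+1 t - F k.+1 t *m diag_mx v).
suff : H k = 0 by move=> H0; rewrite -[LHS](subrK (omega q v t *m F k t)) -[X in X + _](subrK (diag_mx v *m F k.+1 t - F k.+1 t *m diag_mx v)) -/(H k) H0 add0r addrC.
apply: (@formal_zero _ _ (u0 + t) (A t) H) k => [a b ab uab|a b k uab||k].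
- by have := distinct ct ab; rewrite uab subrr eqxx.
- have [->|ab] := eqVneq a b; last first.
    by have := distinct ct ab; rewrite uab subrr eqxx.
  by rewrite subrr eq_sym pnatr_eq0.
- rewrite /H.
  have -> : mpder (F 0) v t = 0 by rewrite (mpder_near v (X := fun=> 1%:M) _ (mghol_cst _ ts rs) ct) ?mpder_cst// => s /F_zero.
  rewrite F_zero// mulmx1 sub0r; apply/matrixP => a b.
  have Z : (0 : M_n) a b = 0 by rewrite mxE.
  rewrite mxsubE mxoppE diag_commE omegaE Z; have [->|ab] := eqVneq a b; first by rewrite subrr !mul0r subr0 oppr0.
  by rewrite F_one// mulrN opprK addNr.
apply: (formal_flow (A := A t) (F_rec k ct) (F_rec k.+1 ct)).
- apply: (etrans (esym (comm_mpder v (F_mghol k.+1) ct))).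
  rewrite -(fl v ct').
  have hA' := mghol_ball sub hA; have hF' := F_mghol k.
  rewrite (mpder_near v (X := fun t => F k t *m diag_part (A 0) - A t *m F k t - F k t *+ k) _ _ ct); last 2 first.
  + by move=> s cs; rewrite (F_rec k cs) (diag_part_const (sub cs)).
  + apply: mgholB; first exact: mgholB (mgholM hF' (mghol_cst _ _ _)) (mgholM hA' hF').
    apply: (mghol_ext (X := fun t => (k%:R : C) *: F k t)) => [s|]; first by rewrite scaler_nat.
    exact: mgholZ (ghol_cst _ _ _) hF'.
  apply: mpderP; have dF := mpder_der v hF' ct; have dA := mpder_der v hA' ct.
  have dk : mder (fun x => F k (t + x *: v) *+ k) 0 (mpder (F k) v t *+ k).
    apply: (mder_ext (X := fun x => (k%:R : C) *: F k (t + x *: v))) => [s|]; first by rewrite scaler_nat.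
    apply: mder_eq (mderZ (cder_cst (k%:R : C) 0) dF) _; by rewrite scale0r add0r scaler_nat.
  apply: mder_eq (mderD (mderD (mderM dF (mder_cst (diag_part (A 0)) 0)) (mderN (mderM dA dF))) (mderN dk)) _.
  rewrite !at0 mulmx0 addr0 (diag_part_const ct') opprD.
  by rewrite !addrA.
- exact (omega_comm Aq v ct').
- exact: diag_mx_comm.
- exact: diag_mx_comm.
Qed.

Lemma unitv_off a b (X : M_n) : a != b -> (diag_mx (unitv a) *m X - X *m diag_mx (unitv a)) a b = X a b.
Proof.
by move=> ab; rewrite diag_commE !mxE eqxx eq_sym (negPf ab) subr0 mul1r.
Qed.

Lemma fext_ball k t : pd ts rs t -> fext k t = F k t.
Proof.
elim: k t => [|k IH] t ct; first by rewrite F_zero.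
have off a b : a != b -> offd (fext k) t a b = F k.+1 t a b.
  move=> ab; rewrite /offd (mpder_near _ (X := F k) _ (F_mghol k) ct) ?IH//; last by move=> s /IH.
  by rewrite F_flow// addrAC subrr add0r unitv_off.
apply/matrixP => a b; rewrite fextS; case: eqVneq => [->|ab]; last exact: off.
by rewrite F_diag//; congr (_ * _); apply: eq_bigr => c cb; rewrite off.
Qed.

Let cts : pd 0 e1 ts. Proof. exact: sub (pd_center _ rs0). Qed.

Lemma fext_rec t : pd 0 e1 t -> formal_rec (u0 + t) (A t) (diag_part (A t)) (fext^~ t).
Proof.
move=> ct k; rewrite diag_part_const//.
have hX := fext_mghol k; have hX' := fext_mghol k.+1; have hd := mghol_diag u0 e1.
apply: (mghol_eq (X := fun t => diag_mx (u0 + t) *m fext k.+1 t - fext k.+1 t *m diag_mx (u0 + t))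
  (Y := fun t => fext k t *m diag_part (A 0) - A t *m fext k t - fext k t *+ k) _ _ cts rs0) ct.
- exact: mgholB (mgholM hd hX') (mgholM hX' hd).
- apply: mgholB; first exact: mgholB (mgholM hX (mghol_cst _ _ _)) (mgholM hA hX).
  apply: (mghol_ext (X := fun t => (k%:R : C) *: fext k t)) => [s|]; first by rewrite scaler_nat.
  exact: mgholZ (ghol_cst _ _ _) hX.
by move=> s cs; rewrite (fext_ball k cs) (fext_ball k.+1 cs) (F_rec k cs) (diag_part_const (sub cs)).
Qed.

Lemma fext_formal t : pd 0 e1 t -> formal_solution (u0 + t) (A t) (fext^~ t).
Proof. by move=> ct; apply/formal_solutionP; split => //; exact: fext_rec. Qed.

Lemma fext_flow k t v : pd 0 e1 t -> mpder (fext k) v t =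
  omega q v t *m fext k t + (diag_mx v *m fext k.+1 t - fext k.+1 t *m diag_mx v).
Proof.
have hX := fext_mghol k; have hX' := fext_mghol k.+1.
apply: (mghol_eq (X := mpder (fext k) v) (Y := fun t => omega q v t *m fext k t + (diag_mx v *m fext k.+1 t - fext k.+1 t *m diag_mx v)) _ _ cts rs0).
- exact: mpder_mghol.
- by apply: mgholD (mgholM (omega_ghol hq v) hX) _; apply: mgholB; apply: mgholM => //; exact: mghol_cst.
move=> s cs; rewrite !fext_ball// -F_flow//.
by apply: mpder_near cs; [move=> x /fext_ball->|exact: F_mghol].
Qed.
End FormalExtension.

(** * The residual of the truncated expansion *)

Lemma telescope (K : fieldType) (z e : K) (O F : nat -> K) N : z != 0 -> e * F 0%N = 0 ->
  \sum_(k < N.+1) z ^- k * (O k + e * F k.+1) =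
  \sum_(k < N.+1) z ^- k * O k + z * (e * \sum_(k < N.+1) z ^- k * F k) + z ^- N * (e * F N.+1).
Proof.
move=> z0 eF; pose S (f : nat -> K) m := \sum_(k < m.+1) z ^- k * f k.
have SS f m : S f m.+1 = S f m + z ^- m.+1 * f m.+1 by rewrite /S big_ord_recr.
rewrite -[LHS]/(S (fun k => O k + e * F k.+1) N) -[X in X + _ + _]/(S O N) -[X in z * (e * X)]/(S F N).
elim: N => [|N IH]; first by rewrite /S !big_ord1 !expr0 invr1 !mul1r eF mulr0 addr0.
rewrite !SS IH exprS invfM; move: (S O N) (S F N) (z ^- N) => S1 S2 y.
by field.
Qed.

Section Residual.
Context {R : realType} {n : nat}.
Notation C := (R[i]^o)%type.
Notation T := 'rV[R[i]^o]_n.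
Notation M_n := 'M[R[i]^o]_n.
Implicit Types (t v : T).
Variables (u0 : T) (q : 'I_n -> 'I_n -> T -> C) (A : T -> M_n) (e1 : R)
  (F : nat -> T -> M_n) (Y : T -> C -> M_n).
Hypothesis hq : forall a b, ghol (q a b) 0 e1.
Hypothesis hA : mghol A 0 e1.
Hypothesis diagA : forall t j, pd 0 e1 t -> A t j j = A 0 j j.
Hypothesis F0 : forall t, F 0%N t = 1%:M.
Hypothesis hF : forall k, mghol (F k) 0 e1.
Hypothesis Frec : forall t, pd 0 e1 t -> formal_rec (u0 + t) (A t) (diag_part (A t)) (F^~ t).
Hypothesis Fflow : forall k t v, pd 0 e1 t -> mpder (F k) v t =
  omega q v t *m F k t + (diag_mx v *m F k.+1 t - F k.+1 t *m diag_mx v).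
Hypothesis hY : forall w, mghol (Y^~ w) 0 e1.
Hypothesis sys : forall t, pd 0 e1 t -> fundamental_solution (u0 + t) (A t) (Y t).
Hypothesis pf : pfaff q Y 0 e1.

Definition res N t w : M_n := gau (u0 + t) (A 0) (Y t) w - psum (F^~ t) N w.

Lemma cexp_powV (w : C) k : cexp (- k%:R * w) = cexp w ^- k.
Proof.
elim: k => [|m IH]; first by rewrite oppr0 mul0r cexp0 expr0 invr1.
rewrite exprS invfM -IH -cexpN -cexpD; congr cexp; rewrite -natr1; ring.
Qed.

Lemma psumE (G : nat -> M_n) N w i j : psum G N w i j = \sum_(k < N.+1) cexp w ^- k * G k i j.
Proof. by rewrite /psum summxE; apply: eq_bigr => k _; rewrite mxscaleE. Qed.

Lemma psum_mul (G : nat -> M_n) N w (P : M_n) i j :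
  (P *m psum G N w) i j = \sum_(k < N.+1) cexp w ^- k * (P *m G k) i j.
Proof.
by rewrite /psum mulmx_sumr summxE; apply: eq_bigr => k _; rewrite -scalemxAr mxscaleE.
Qed.

Lemma psum_mghol N w : mghol (fun t => psum (F^~ t) N w) 0 e1.
Proof.
move=> i j; apply: ghol_ext (fun t => esym (psumE (F^~ t) N w i j)) _.
by apply: ghol_sum => k; apply: gholM (ghol_cst _ _ _) _; exact: hF.
Qed.

Lemma res_mghol N w : mghol (res N ^~ w) 0 e1.
Proof. exact: mgholB (gau_ghol u0 (A 0) (hY w)) (psum_mghol N w). Qed.

Lemma psum_flow N w v t i j : pd 0 e1 t -> mpder (fun t => psum (F^~ t) N w) v t i j =
  (omega q v t *m psum (F^~ t) N w) i j + cexp w * ((v 0 i - v 0 j) * psum (F^~ t) N w i j)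
  + cexp w ^- N * ((v 0 i - v 0 j) * F N.+1 t i j).
Proof.
move=> ct; rewrite psum_mul psumE; have e0 : (v 0 i - v 0 j) * F 0%N t i j = 0.
  rewrite F0 mxE; have [->|_] := eqVneq i j; first by rewrite subrr mul0r.
  by rewrite mulr0n mulr0.
apply: etrans (telescope (F := fun k => F k t i j) (fun k => (omega q v t *m F k t) i j) N (cexp_neq0 w) e0).
rewrite /mpder mxE; apply: pderP.
apply: (cder_ext (fun x => esym (psumE (F^~ (t + x *: v)) N w i j))).
apply: cder_sum => k; apply: cderZ; apply: cder_eq (mpder_der v (hF k) ct i j) _.
by rewrite (Fflow k v ct) mxaddE diag_commE.
Qed.

(** The truncated sum solves the equation of the full solution up to the one term that the index
    shift leaves over, of order z^-N ([telescope]). The residual thus satisfies an inhomogeneous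
    equation with the diagonal rates z (v_i - v_j). *)
Lemma res_flow N w v t i j : pd 0 e1 t -> mpder (res N ^~ w) v t i j =
  cexp w * (v 0 i - v 0 j) * res N t w i j + (omega q v t *m res N t w) i j
  - cexp w ^- N * ((v 0 i - v 0 j) * F N.+1 t i j).
Proof.
move=> ct; have hg := gau_ghol u0 (A 0) (hY w).
have E : mpder (res N ^~ w) v t = mpder (fun t => gau (u0 + t) (A 0) (Y t) w) v t - mpder (fun t => psum (F^~ t) N w) v t by apply: mpderP; apply: mderD (mpder_der v hg ct) (mderN (mpder_der v (psum_mghol N w) ct)).
rewrite E mxsubE psum_flow// (gau_pder u0 (A 0) (hY w) ct (pf v w ct)).
rewrite /res /conn; move: (gau _ _ _ _) (psum _ _ _) (F N.+1 t) (omega q v t) (cexp w) => g S F' om z.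
rewrite mulmxDl -scalemxAl mulmxBr [in LHS]mxsubE [in LHS]mxaddE !mxsubE !mxscaleE.
have Edd : (diag_mx v *m g) i j = v 0 i * g i j by rewrite mul_diag_mx mxE.
have Ede : (g *m diag_mx v) i j = g i j * v 0 j by rewrite mul_mx_diag mxE.
rewrite Edd Ede; move: ((om *m g) i j) ((om *m S) i j) (g i j) (S i j) (F' i j) (v 0 i) (v 0 j) (z ^- N) => a b c d e f h k.
ring.
Qed.

Lemma psum_dw N w t i j : pd 0 e1 t -> cder (fun w => psum (F^~ t) N w i j) w
  ((A t *m psum (F^~ t) N w) i j - psum (F^~ t) N w i j * A 0 j j
   + cexp w * (((u0 + t) 0 i - (u0 + t) 0 j) * psum (F^~ t) N w i j)
   + cexp w ^- N * (((u0 + t) 0 i - (u0 + t) 0 j) * F N.+1 t i j)).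
Proof.
move=> ct; apply: (cder_ext (fun w => esym (psumE (F^~ t) N w i j))).
have E : (A t *m psum (F^~ t) N w) i j - psum (F^~ t) N w i j * A 0 j j =
  \sum_(k < N.+1) cexp w ^- k * ((A t *m F k t) i j - F k t i j * A 0 j j).
  rewrite psum_mul psumE mulr_suml -sumrB; apply: eq_bigr => k _.
  by rewrite mulrBr mulrA.
have e0 : ((u0 + t) 0 i - (u0 + t) 0 j) * F 0%N t i j = 0.
  rewrite F0 [X in _ * X]mxE; have [->|_] := eqVneq i j; first by rewrite subrr mul0r.
  by rewrite mulr0n mulr0.
rewrite E psumE -(telescope (F := fun k => F k t i j) (fun k => (A t *m F k t) i j - F k t i j * A 0 j j) N (cexp_neq0 w) e0).
apply: cder_sum => k; rewrite (rec_entry i j (Frec ct k)).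
have -> : cexp w ^- k * ((A t *m F k t) i j - F k t i j * A 0 j j +
   (F k t i j * A t j j - (A t *m F k t) i j - k%:R * F k t i j)) = - k%:R * cexp w ^- k * F k t i j.
  rewrite diagA//; move: ((A t *m F k t) i j) (F k t i j) (A 0 j j) (cexp w ^- k) => a b c d; ring.
apply: (cder_ext (f := fun w => cexp (- k%:R * w) * F k t i j)) => [x|].
  by rewrite cexp_powV.
apply: cder_eq (cderM (cder_comp (cderM (cder_cst _ w) (cder_id w)) (cder_cexp _)) (cder_cst _ w)) _.
rewrite cexp_powV; ring.
Qed.

(** As in [res_flow], now in log z and with the rates z (u_i - u_j); the constancy of the diagonal
    of [A] lets [A 0] stand for it. *)
Lemma res_dw N w t i j : pd 0 e1 t -> cder (fun w => res N t w i j) w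
  (cexp w * ((u0 + t) 0 i - (u0 + t) 0 j) * res N t w i j + ((A t *m res N t w) i j - res N t w i j * A 0 j j)
  - cexp w ^- N * (((u0 + t) 0 i - (u0 + t) 0 j) * F N.+1 t i j)).
Proof.
move=> ct; have [dY _] := (fundP _ _ _).1 (sys ct) w.
have hg := gau_der (A 0) dY.
apply: (cder_ext (f := fun w => gau (u0 + t) (A 0) (Y t) w i j - psum (F^~ t) N w i j)) => [x|]; first by rewrite mxsubE.
apply: cder_eq (cderB (hg i j) (psum_dw N w i j ct)) _.
rewrite /res; move: (gau (u0 + t) (A 0) (Y t) w) (psum (F^~ t) N w) (F N.+1 t) (cexp w) (u0 + t) => g S F' z u.
rewrite mulmxBr [in LHS]mxsubE [in LHS]mxaddE [in LHS]mxscaleE diag_commE diag_part_mulr !mxsubE.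
move: ((A t *m g) i j) ((A t *m S) i j) (g i j) (S i j) (F' i j) (u 0 i) (u 0 j) (z ^- N) (A 0 j j) => a b c d e f h k l.
ring.
Qed.
End Residual.

(** * Logarithms along a line in the z-plane *)

Section LogPath.
Context {R : realType}.
Notation C := (R[i]^o)%type.

Lemma sin_min (a b : R) : 0 < a -> a <= b -> b < pi -> exists2 m : R, 0 < m & forall x, a <= x <= b -> m <= sin x.
Proof.
move=> a0 ab bp; have [|c cab Hc] := @EVT_min R sin a b ab.
  by apply: continuous_subspaceT => x; exact: continuous_sin.
exists (sin c) => [|x xab]; last by apply: Hc; rewrite in_itv.
move: cab; rewrite in_itv/= => /andP[ac cb].
by apply: sin_gt0_pi; rewrite (lt_le_trans a0 ac) (le_lt_trans cb bp).
Qed.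

Variables (Y gam sg : R).
Hypothesis Y0 : 0 < Y.
Hypothesis sg2 : sg = 1 \/ sg = -1.

(* the branch of [ln (e^(i gam) (x - i sg Y))] with argument between [gam - sg pi] and [gam] *)
Definition lpath (x : R) : C := (ln (Y ^+ 2 + x ^+ 2) / 2) +i* (gam + sg * (atan (x / Y) - pi / 2)).

Let Q0 x : 0 < Y ^+ 2 + x ^+ 2.
Proof. by rewrite ltr_pwDl ?sqr_ge0// exprn_gt0. Qed.

Let zl (x : R) : C := x%:C - (0 +i* (sg * Y)).

Lemma zl_sqr x : zl x * (x +i* (sg * Y)) = (Y ^+ 2 + x ^+ 2)%:C.
Proof.
have s2 : sg * sg = 1 by case: sg2 => ->; rewrite ?mulr1// mulrNN mulr1.
apply: ceqP; rewrite ?cReM ?cImM /zl ?cReD ?cImD ?cReN ?cImN /=; last by ring.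
have -> : (x - 0) * x - (0 - sg * Y) * (sg * Y) = x ^+ 2 + (sg * sg) * Y ^+ 2 by ring.
by rewrite s2 mul1r addrC.
Qed.

Lemma zl_neq0 x : zl x != 0.
Proof.
apply/eqP => E; have := zl_sqr x; rewrite E mul0r => /(congr1 (@cRe R)) /= H.
by have := Q0 x; rewrite -H ltxx.
Qed.

Lemma lpath_der x : rder lpath x (zl x)^-1.
Proof.
have -> : (zl x)^-1 = (x / (Y ^+ 2 + x ^+ 2)) +i* (sg * Y / (Y ^+ 2 + x ^+ 2)).
  have /eqP := zl_sqr x; have z0 := zl_neq0 x.
  have Q' : ((Y ^+ 2 + x ^+ 2)%:C : C) != 0 by rewrite -nc_gt0 ncR normr_gt0 gt_eqF.
  move=> /eqP E; apply: (mulfI z0); rewrite mulfV//.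
  have -> : (x / (Y ^+ 2 + x ^+ 2)) +i* (sg * Y / (Y ^+ 2 + x ^+ 2)) = ((x +i* (sg * Y)) * ((Y ^+ 2 + x ^+ 2)%:C)^-1 : C) by rewrite -realCV; apply: ceqP; rewrite ?cReM ?cImM /=; ring.
  by rewrite mulrA E mulfV.
apply: rderP => /=.
  have d1 : dr (fun x => Y ^+ 2 + x ^+ 2) x (2 * x).
    apply: (dr_ext (f := fun x => Y ^+ 2 + x * x)) => [y|]; first by rewrite expr2.
    by apply: dr_eq (drD (dr_cst _ x) (drM (dr_id x) (dr_id x))) _; ring.
  have d2 : dr (@ln R) (Y ^+ 2 + x ^+ 2) (Y ^+ 2 + x ^+ 2)^-1 by apply/drP; exact: is_derive1_ln.
  apply: (dr_ext (f := fun x => 2^-1 * ln (Y ^+ 2 + x ^+ 2))) => [y|]; first by rewrite mulrC.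
  apply: dr_eq (drZ 2^-1 (dr_comp d1 d2)) _; have := Q0 x => /gt_eqF/negbT; move: (Y ^+ 2 + _) => y y0.
  by field.
have d1 : dr (fun x => x / Y) x Y^-1.
  apply: (dr_ext (f := fun x => Y^-1 * x)) => [y|]; first by rewrite mulrC.
  by apply: dr_eq (drZ Y^-1 (dr_id x)) _; rewrite mulr1.
have d2 : dr (@atan R) (x / Y) (1 + (x / Y) ^+ 2)^-1 by apply/drP; exact: is_derive1_atan.
apply: dr_eq (drD (dr_cst gam x) (drZ sg (drB (dr_comp d1 d2) (dr_cst (pi / 2) x)))) _.
have yn : Y != 0 by rewrite gt_eqF.
have -> : (1 + (x / Y) ^+ 2)^-1 = Y ^+ 2 / (Y ^+ 2 + x ^+ 2).
  have -> : 1 + (x / Y) ^+ 2 = (Y ^+ 2 + x ^+ 2) / Y ^+ 2 by field.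
  by rewrite invf_div.
have /gt_eqF/negbT := Q0 x; move: (Y ^+ 2 + x ^+ 2) => Q q0.
by field; rewrite q0 yn.
Qed.

(** The product of exp(- lpath) with the line has derivative 0; the constant is found at x = 0, the
    point of the line nearest to the origin. *)
Lemma cexp_lpath x : cexp (lpath x) = cis gam * zl x.
Proof.
pose k (x : R) := cexp (- lpath x) * zl x.
have dk y : rder k y 0.
  apply: rder_eq (rderM (rder_comp (rderN (lpath_der y)) (cder_cexp _)) (rderB (rder_id y) (rder_cst (0 +i* (sg * Y)) y))) _.
  by rewrite subr0 mulr1 mulrN mulNr -mulrA mulVf ?mulr1 ?addNr//; exact: zl_neq0.
have kc : k x = k 0.
  have [x0|/ltW x0] := leP 0 x; first by rewrite (rder0_cst (fun y _ => dk y) x0).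
  by rewrite (rder0_cst (fun y _ => dk y) x0).
have k0 : k 0 = cis (- gam).
  have r0 : cRe (- lpath 0) = - ln Y by rewrite cReN /lpath /= expr0n/= addr0 lnXn// mulr2n; field.
  have i0 : cIm (- lpath 0) = - gam + sg * (pi / 2) by rewrite cImN /lpath /= mul0r atan0 sub0r; ring.
  rewrite /k cexpE r0 i0 expRN lnK ?posrE// cisD.
  have -> : cis (sg * (pi / 2)) = 0 +i* sg :> C.
    case: sg2 => ->; rewrite /cis ?mulN1r ?mul1r ?cosN ?sinN cos_pihalf sin_pihalf//.
  have -> : zl 0 = - (0 +i* (sg * Y)) by rewrite /zl realC0 sub0r.
  have E : (0 +i* sg : C) * - (0 +i* (sg * Y)) = Y%:C.
    apply: ceqP; rewrite ?cReM ?cImM ?cReN ?cImN /=; last by ring.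
    by case: sg2 => ->; ring.
  have G (a b c d : C) : b * d = c -> a * c = 1 -> forall e, a * (e * b) * d = e by move=> <- h e; rewrite -[RHS]mul1r -h; ring.
  by apply: G E _ _; rewrite -realCM mulVf ?gt_eqF// realC1.
have e0 := cexp_neq0 (lpath x).
have -> : zl x = cexp (lpath x) * k x by rewrite /k cexpN mulrA mulfV// mul1r.
by rewrite kc k0 mulrCA -cisD subrr cis0 mulr1.
Qed.

Lemma lpath_rder x : rder lpath x (cis gam / cexp (lpath x)).
Proof.
apply: rder_eq (lpath_der x) _.
by rewrite cexp_lpath invfM mulrA mulfV ?mul1r// cis_neq0.
Qed.

Lemma nc_lpath x : modz (lpath x) ^+ 2 = Y ^+ 2 + x ^+ 2.
Proof.
rewrite -nc_cexp cexp_lpath ncM nc_cis mul1r ncE /zl cReD cImD cReN cImN /= subr0 sub0r sqrrN addrC.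
by case: sg2 => ->; rewrite ?mul1r// mulN1r sqrrN.
Qed.

Lemma lpath_ge x : Y <= modz (lpath x).
Proof.
by rewrite -(@ler_pXn2r _ 2)// ?nnegrE ?expR_ge0 ?(ltW Y0)// nc_lpath lerDl sqr_ge0.
Qed.

Lemma tanBpihalf (D : R) : sin D != 0 -> tan (pi / 2 - D) = cos D / sin D.
Proof. by move=> s0; rewrite /tan sinB cosB sin_pihalf cos_pihalf !mul1r !mul0r subr0 add0r. Qed.

Lemma atan_cot (D : R) : 0 < D < pi -> atan (cos D / sin D) = pi / 2 - D.
Proof.
move=> /[dup] D0 /andP[D1 D2]; rewrite -tanBpihalf ?gt_eqF ?sin_gt0_pi// tanK// in_itv/=; apply/andP; split; lra.
Qed.

(** [p] is the angle between the point of modulus [rho] and the direction e^(i gam) of the line,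
    whose distance from the origin is [rho * sin p]. *)
Lemma lpath_point (p rho : R) : 0 < p < pi -> 0 < rho -> rho * sin p = Y ->
  lpath (rho * cos p) = ln rho +i* (gam - sg * p).
Proof.
move=> p0 r0 E; have s0 := sin_gt0_pi p0; rewrite /lpath; congr (_ +i* _).
  have -> : Y ^+ 2 + (rho * cos p) ^+ 2 = rho ^+ 2 by rewrite -E !exprMn -mulrDr [sin p ^+ 2 + _]addrC cos2Dsin2 mulr1.
  by rewrite lnXn// mulr2n; field.
have -> : rho * cos p / Y = cos p / sin p by rewrite -E; field; rewrite !gt_eqF.
by rewrite atan_cot//; ring.
Qed.

(** From the point at angle [D] on, the argument runs from gam - sg D towards gam and never passes
    it, as the line escapes in the direction e^(i gam). *)
Lemma lpath_arg (D x : R) : 0 < D < pi -> Y * (cos D / sin D) <= x -> exists2 p : R, 0 <= p <= D &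
  cIm (lpath x) = gam - sg * D + sg * p.
Proof.
move=> D0 hx; exists (D + (atan (x / Y) - pi / 2)); last by rewrite /lpath /=; ring.
have := atan_ltpi2 (x / Y).
have : atan (cos D / sin D) <= atan (x / Y) by apply: le_atan; rewrite ler_pdivlMr// mulrC.
by rewrite atan_cot// => a b; apply/andP; split; lra.
Qed.
End LogPath.

(** * Propagation of the residual in t, along arcs and along lines *)

Lemma powV_le {R : realType} (a b : R) N : 0 < a -> a <= b -> b ^- N <= a ^- N.
Proof.
move=> a0 ab; have b0 := lt_le_trans a0 ab.
rewrite lef_pV2 ?posrE ?exprn_gt0//; apply: lerXn2r => //; rewrite nnegrE; exact: ltW.
Qed.

(** Takes the square root of an energy estimate: [e] is the exponential loss, [M] the initial bound
    and [p * d] the forcing. *)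
Lemma sqr_estimate {R : realType} (x e E c M d p : R) : 0 <= x -> 0 <= e -> 0 <= E -> 0 <= c -> 0 <= M ->
  0 <= d -> 0 <= p -> x ^+ 2 <= e ^+ 2 * E * (c * M ^+ 2 + c * (p * d) ^+ 2) ->
  x <= (E * c + 1) * (1 + d) * (M + p) * e.
Proof.
move=> x0 e0 E0 c0 M0 d0 p0 H.
have Ec := mulr_ge0 E0 c0.
rewrite -(@ler_pXn2r _ 2)// ?nnegrE ?mulr_ge0 ?addr_ge0//.
apply: le_trans H _.
have h1 : M ^+ 2 + (p * d) ^+ 2 <= ((1 + d) * (M + p)) ^+ 2.
  have := mulr_ge0 M0 p0; have := mulr_ge0 d0 (sqr_ge0 M); have := mulr_ge0 d0 (sqr_ge0 p).
  have := mulr_ge0 d0 (mulr_ge0 M0 p0); have := mulr_ge0 (sqr_ge0 d) (mulr_ge0 M0 p0).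
  have := sqr_ge0 (d * M); rewrite !expr2; nra.
have h2 : E * c <= (E * c + 1) ^+ 2 by rewrite expr2; nra.
have -> : e ^+ 2 * E * (c * M ^+ 2 + c * (p * d) ^+ 2) = (E * c) * (M ^+ 2 + (p * d) ^+ 2) * e ^+ 2 by ring.
rewrite [in leRHS]exprMn ler_wpM2r ?sqr_ge0//.
by apply: le_trans (ler_pM Ec _ h2 h1) _; rewrite ?addr_ge0 ?sqr_ge0// !exprMn !mulrA.
Qed.

Lemma rate_gap {R : realType} (a b e : R) : e <= b - a -> 0 < b - a -> 2 * a < 2 * b - e.
Proof. lra. Qed.

Section Propagation.
Context {R : realType} {n : nat}.
Notation C := (R[i]^o)%type.
Notation T := 'rV[R[i]^o]_n.
Notation M_n := 'M[R[i]^o]_n.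
Implicit Types (t v : T).
Variables (u0 : T) (q : 'I_n -> 'I_n -> T -> C) (A : T -> M_n) (e1 : R)
  (F : nat -> T -> M_n) (rs : nat -> T -> C -> M_n).
Hypothesis hq : forall a b, ghol (q a b) 0 e1.
Hypothesis hF : forall k, mghol (F k) 0 e1.
Hypothesis rm : forall N w, mghol (rs N ^~ w) 0 e1.
Hypothesis rfl : forall N w v t i j, pd 0 e1 t -> mpder (rs N ^~ w) v t i j =
  cexp w * (v 0 i - v 0 j) * rs N t w i j + (omega q v t *m rs N t w) i j
  - cexp w ^- N * ((v 0 i - v 0 j) * F N.+1 t i j).
Hypothesis rdw : forall N w t i j, pd 0 e1 t -> cder (fun w => rs N t w i j) w
  (cexp w * ((u0 + t) 0 i - (u0 + t) 0 j) * rs N t w i j + ((A t *m rs N t w) i j - rs N t w i j * A 0 j j)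
  - cexp w ^- N * (((u0 + t) 0 i - (u0 + t) 0 j) * F N.+1 t i j)).

Lemma mul_bound (P X : M_n) (M : R) a j : (forall i k, nc (P i k) <= M) ->
  nc ((P *m X) a j) <= M * \sum_b nc (X b j).
Proof.
move=> H; rewrite mulmx_eq mulr_sumr; apply: le_trans (nc_sum _ _ _) _; apply: ler_sum => b _.
by rewrite ncM ler_wpM2r ?nc_ge0.
Qed.

Lemma seg_bound (X : T -> M_n) t v : mghol X 0 e1 ->
  (forall s : R, 0 <= s <= 1 -> pd 0 e1 (t + s%:C *: v)) ->
  exists M : R, 0 <= M /\ forall s : R, 0 <= s <= 1 -> forall i j, nc (X (t + s%:C *: v) i j) <= M.
Proof.
move=> hX hs.
have [||d [M [d0 H]]] := @fin_uniform R ('I_n * 'I_n)%type (fun ij d M =>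
   forall s : R, 0 <= s <= 1 -> nc (X (t + s%:C *: v) ij.1 ij.2) <= M).
- by move=> ij d M d' M' dd MM H s s01; exact: le_trans (H s s01) MM.
- move=> ij; have [d [M [d0 H]]] := segment_locbd (hX ij.1 ij.2) hs.
  by exists d, M; split => // s s01; exact: (H s _ s01 (pd_center _ d0)).2.
by exists `|M|; split => // s s01 i j; exact: le_trans (H (i, j) s s01) (ler_norm _).
Qed.

Lemma nc_vdiff v i j : nc (v 0 i - v 0 j) <= 2 * vn v.
Proof. by apply: le_trans (ncB _ _) _; have := nc_le_vn v i; have := nc_le_vn v j; lra. Qed.

Lemma nc_cexpX (w : C) N : nc (cexp w ^- N) = modz w ^- N.
Proof. by rewrite ncV ncX nc_cexp. Qed.

(** At fixed z the energy estimate on the segment loses the factor [expR kappa], where [kappa]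
    bounds Re(z (v_a - v_b)); the forcing is of order z^-N, the order wanted for the residual. *)
Lemma tpath t v N : (forall s : R, 0 <= s <= 1 -> pd 0 e1 (t + s%:C *: v)) ->
  exists K : R, 0 <= K /\ forall (w : C) (kappa M : R), 0 <= kappa -> 0 <= M ->
    (forall a b, cRe (cexp w * (v 0 a - v 0 b)) <= kappa) ->
    (forall i j, nc (rs N t w i j) <= M) ->
    forall i j, nc (rs N (t + v) w i j) <= K * (M + modz w ^- N) * expR kappa.
Proof.
move=> hs; have [eta [eta0 Heta]] := seg_bound (omega_ghol hq v) hs.
have [MF [MF0 HMF]] := seg_bound (hF N.+1) hs.
pose d0 := 2 * vn v * MF; have d00 : 0 <= d0 by rewrite !mulr_ge0 ?vn_ge0.
pose E := expR (2 * n%:R * eta + 1); have E0 : 0 <= E by exact: expR_ge0.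
exists ((E * n%:R + 1) * (1 + d0)); split => [|w kappa M k0 M0 hk hM i j].
  by apply: mulr_ge0; apply: addr_ge0 => //; exact: mulr_ge0.
have p0 : 0 <= modz w ^- N := powV_ge0 N _.
move: p0; set p := modz w ^- N => p0.
pose x a (s : R) : C := rs N (t + s%:C *: v) w a j.
have delta0 : 0 <= p * d0 by rewrite mulr_ge0.
have := @growth R n x (fun a _ => cexp w * (v 0 a - v 0 j))
  (fun a s => (omega q v (t + s%:C *: v) *m rs N (t + s%:C *: v) w) a j
     - cexp w ^- N * ((v 0 a - v 0 j) * F N.+1 (t + s%:C *: v) a j)) kappa eta (p * d0) 1 ler01 k0 eta0 delta0.
move=> HH; refine (_ (HH _ _ _)); last 3 first.
- move=> a s s01; apply: rder_eq (rder_comp (rder_id s) (mpder_line (x := s%:C) (rm N w) (hs s s01) a j)) _.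
  by rewrite mulr1 (rfl N w v a j (hs s s01)) addrA.
- by move=> a s _; exact: hk.
- move=> a s s01; apply: le_trans (ncB _ _) _; apply: lerD; first exact: mul_bound (Heta s s01).
  rewrite ncM nc_cexpX -/p ler_wpM2l// ncM; apply: ler_pM; rewrite ?nc_ge0 ?nc_vdiff//; exact: HMF.
move=> H; apply: sqr_estimate => //; rewrite ?nc_ge0 ?expR_ge0//.
have h1 : nc (rs N (t + v) w i j) ^+ 2 <= en xpredT x 1 by have := nc2_le_en x 1 i; rewrite /x realC1 scale1r.
have h2 : en xpredT x 0 <= n%:R * M ^+ 2.
  rewrite -sum_cst; apply: ler_sum => a _; rewrite /x realC0 scale0r addr0.
  by rewrite ler_pXn2r ?nnegrE ?nc_ge0.
have h3 : 0 <= n%:R * (p * d0) ^+ 2 by rewrite mulr_ge0 ?exprn_ge0.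
have e2 : expR kappa ^+ 2 * E = expR ((2 * kappa + 2 * n%:R * eta + 1) * 1) by rewrite /E expr2 -!expRD; congr expR; ring.
rewrite e2; apply: le_trans h1 _; apply: le_trans (_ : en xpredT x 1 <= en xpredT x 1 + n%:R * (p * d0) ^+ 2) _.
  by rewrite lerDl.
by apply: le_trans H _; rewrite ler_wpM2l ?expR_ge0// lerD2r.
Qed.

(** At fixed t, rotating z by [phi] costs an exponential of rate proportional to [phi]. This crude
    bound provides the a priori growth that [line] asks for. *)
Lemma arc t N : pd 0 e1 t -> exists K : R, 0 <= K /\
  forall (w : C) (sg phi M : R), sg = 1 \/ sg = -1 -> 0 <= phi <= 1 -> 0 <= M ->
    (forall i j, nc (rs N t w i j) <= M) -> forall i j,
    nc (rs N t (w + (0 +i* (sg * phi))) i j) <=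
      K * (M + modz w ^- N) * expR (2 * vn (u0 + t) * modz w * phi).
Proof.
move=> ct; have [MA [MA0 HMA]] := mx_bound (A t); have [MB [MB0 HMB]] := mx_bound (A 0).
have [MF [MF0 HMF]] := mx_bound (F N.+1 t).
pose L := 2 * vn (u0 + t); have L0 : 0 <= L by rewrite mulr_ge0 ?vn_ge0.
pose d0 := L * MF; have d00 : 0 <= d0 by rewrite mulr_ge0.
pose eta := MA + MB; have eta0 : 0 <= eta by rewrite addr_ge0.
pose E := expR (2 * n%:R * eta + 1); have E0 : 0 <= E by exact: expR_ge0.
exists ((E * n%:R + 1) * (1 + d0)); split => [|w sg phi M sg2 /andP[phi0 phi1] M0 hM i j].
  by apply: mulr_ge0; apply: addr_ge0 => //; exact: mulr_ge0.
have p0 : 0 <= modz w ^- N := powV_ge0 N _.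
move: p0; set p := modz w ^- N => p0; set rho := modz w; rewrite -/L.
have rho0 : 0 <= rho by exact: expR_ge0.
have delta0 : 0 <= p * d0 by rewrite mulr_ge0.
pose g (s : R) : C := w + s%:C * (0 +i* sg).
have gR s : cRe (g s) = cRe w by rewrite /g cReD cReM /=; ring.
have nsg : nc (0 +i* sg : C) = 1 by apply/eqP; rewrite -(@eqrXn2 _ 2)// ?nc_ge0// ncE /= expr0n/= add0r; case: sg2 => ->; rewrite ?sqrrN expr1n.
pose x a (s : R) : C := rs N t (g s) a j.
have k0 : 0 <= rho * L by rewrite mulr_ge0.
have := @growth R n x (fun a s => (0 +i* sg) * (cexp (g s) * ((u0 + t) 0 a - (u0 + t) 0 j)))
  (fun a s => (0 +i* sg) * ((A t *m rs N t (g s)) a j - rs N t (g s) a j * A 0 j j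
     - cexp (g s) ^- N * (((u0 + t) 0 a - (u0 + t) 0 j) * F N.+1 t a j))) (rho * L) eta (p * d0) phi phi0 k0 eta0 delta0.
move=> HH; refine (_ (HH _ _ _)); last 3 first.
- move=> a s s01; have dg : rder g s (0 + (1 * (0 +i* sg) + s%:C * 0)).
    exact: rderD (rder_cst w s) (rderM (rder_id s) (rder_cst _ s)).
  apply: rder_eq (rder_comp dg (rdw N (g s) a j ct)) _; rewrite /x.
  move: ((A t *m rs N t (g s)) a j) (rs N t (g s) a j) (A 0 j j) (F N.+1 t a j) ((u0 + t) 0 a) ((u0 + t) 0 j) (cexp (g s) ^- N) (cexp (g s)).
  move: (0 +i* sg : C) => I a1 a2 a3 a4 a5 a6 a7 a8; ring.
- move=> a s s01; apply: le_trans (ler_norm _) _; apply: le_trans (Re_le_nc _) _.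
  by rewrite ncM nsg mul1r ncM nc_cexp gR ler_wpM2l ?nc_vdiff.
- move=> a s s01; rewrite ncM nsg mul1r; apply: le_trans (ncB _ _) _; apply: lerD.
    apply: le_trans (ncB _ _) _; rewrite /eta mulrDl; apply: lerD; first exact: mul_bound.
    rewrite ncM mulrC; apply: ler_pM; rewrite ?nc_ge0 ?HMB//.
    by rewrite (bigD1 a)//= lerDl sumr_ge0// => b _; exact: nc_ge0.
  rewrite ncM nc_cexpX gR -/p ler_wpM2l// ncM; apply: ler_pM; rewrite ?nc_ge0 ?nc_vdiff//; exact: HMF.
move=> H; apply: sqr_estimate => //; rewrite ?nc_ge0 ?expR_ge0//.
have h1 : nc (rs N t (w + (0 +i* (sg * phi))) i j) ^+ 2 <= en xpredT x phi.
  have := nc2_le_en x phi i; rewrite /x /g.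
  by have -> : phi%:C * (0 +i* sg) = 0 +i* (sg * phi) :> C by apply: ceqP; rewrite ?cReM ?cImM /=; ring.
have h2 : en xpredT x 0 <= n%:R * M ^+ 2.
  rewrite -sum_cst; apply: ler_sum => a _; rewrite /x /g realC0 mul0r addr0.
  by rewrite ler_pXn2r ?nnegrE ?nc_ge0.
have h3 : 0 <= n%:R * (p * d0) ^+ 2 by rewrite mulr_ge0 ?exprn_ge0.
have e2 : expR ((2 * (rho * L) + 2 * n%:R * eta + 1) * phi) <= expR (L * rho * phi) ^+ 2 * E.
  rewrite /E expr2 -!expRD ler_expR.
  have h : 0 <= 2 * n%:R * eta + 1 by rewrite addr_ge0 ?mulr_ge0.
  have := ler_wpM2l h phi1; rewrite mulr1; lra.
apply: le_trans h1 _; apply: le_trans (_ : en xpredT x phi <= en xpredT x phi + n%:R * (p * d0) ^+ 2) _.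
  by rewrite lerDl.
by apply: le_trans H _; apply: ler_pM => //; rewrite ?expR_ge0 ?addr_ge0 ?en_ge0 ?lerD2r.
Qed.

(* Along the line [z0 + s e^(i gam)] the components of the residual decouple into
   those with rate at least [mu] and those with rate at most 0; the a priori growth,
   of rate less than [mu], excludes the former. *)
Lemma line t (th D sg Phi kap c be mu : R) N : pd 0 e1 t -> 0 < D < pi -> 0 <= Phi -> Phi < D ->
  sg = 1 \/ sg = -1 -> 0 <= kap -> 0 <= c -> kap + c * `|sin (th + sg * D - be)| < mu ->
  (forall a b, mu <= cRe (cis (th + sg * D) * ((u0 + t) 0 a - (u0 + t) 0 b)) \/
     cRe (cis (th + sg * D) * ((u0 + t) 0 a - (u0 + t) 0 b)) <= 0) ->
  (exists K rho : R, [/\ 0 <= K, 0 < rho & forall w, cIm w = th ->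
     rho <= modz w -> forall i j, nc (rs N t w i j) <= K * modz w ^- N]) ->
  (exists K rho : R, [/\ 0 <= K, 0 < rho & forall w (phi : R), 0 <= phi <= D -> cIm w = th + sg * phi ->
     rho <= modz w -> forall i j, nc (rs N t w i j) <=
       K * expR (kap * modz w + c * `|cIm (cexp w * cis (- be))|)]) ->
  exists K rho : R, [/\ 0 <= K, 0 < rho & forall w (phi : R), 0 <= phi <= Phi -> cIm w = th + sg * phi ->
     rho <= modz w -> forall i j, nc (rs N t w i j) <= K * modz w ^- N].
Proof.
move=> ct D0 P0 PD sg2 k0 c0; move gamE : (th + sg * D) => gam hmu hu [K1 [r1 [K10 r10 H1]]] [K2 [r2 [K20 r20 H2]]].
have sD := sin_gt0_pi D0; case/andP: (D0) => D1 D2.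
(* The points to be reached make an angle between [D - Phi] and [D] with the line; the lower bound
   of the sine keeps the line at a distance comparable to |z| from the origin. *)
have [||//|m m0 Hm] := @sin_min R (D - Phi) D; [by rewrite subr_gt0|by rewrite lerBlDr lerDl|].
have mD : m <= sin D by apply: Hm; rewrite lexx lerBlDr lerDl P0.
have [MA [MA0 HMA]] := mx_bound (A t); have [MB [MB0 HMB]] := mx_bound (A 0).
have [MF [MF0 HMF]] := mx_bound (F N.+1 t).
pose L := 2 * vn (u0 + t); have L0 : 0 <= L by rewrite mulr_ge0 ?vn_ge0.
pose d0 := L * MF; have d00 : 0 <= d0 by rewrite mulr_ge0.
pose eta0 := MA + MB + 1; have eta00 : 0 <= MA + MB by rewrite addr_ge0.
have eta01 : 1 <= eta0 by rewrite lerDr.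
have eta02 : 0 <= eta0 by rewrite (le_trans ler01).
pose mu1 := kap + c * `|sin (gam - be)|; have mu10 : 0 <= mu1 by rewrite addr_ge0// mulr_ge0.
pose g := mu - mu1; have g0 : 0 < g by rewrite subr_gt0.
have n0 : 0 <= (2 * n + 1)%:R :> R by [].
pose E := 2 * expR (2 * (2 * n + 1)%:R * (eta0 / m ^+ 2)); have E0 : 0 <= E by rewrite mulr_ge0 ?expR_ge0.
(* Beyond [rg] the lower order terms, of size [eta0] over the distance, fit into the gap [g] between
   [mu] and the a priori rate [mu1]. *)
pose rg := r1 + r2 + (2 * n + 1)%:R * eta0 / g.
have h3 : 0 <= (2 * n + 1)%:R * eta0 / g by rewrite divr_ge0 ?mulr_ge0// ltW.
have r12 : r1 <= rg /\ r2 <= rg by split; apply: le_trans (_ : r1 + r2 <= _); rewrite ?lerDl ?lerDr// ltW.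
have rg0 : 0 < rg by rewrite ltr_pwDl// addr_gt0.
exists ((E * n%:R + 1) * (1 + d0) * (K1 + 1) * m ^- N), (rg / m); split; first 2 last.
- move=> w phi /andP[phi0 phiP] wphi wr i j; set rho := modz w in wr *.
  have rho0 : 0 < rho by exact: expR_gt0.
  (* The line of direction [gam] through [w] has distance [Y] from the origin, meets the ray [th] at
     modulus [z0n] and reaches [w] after the length [s1], by the law of sines. *)
  pose p := D - phi; have pD : D - Phi <= p <= D by rewrite /p lerD2l lerN2 phiP lerBlDr lerDl.
  have p0 : 0 < p < pi by case/andP: pD => a b; rewrite (le_lt_trans b D2) andbT subr_gt0 (le_lt_trans phiP PD).
  pose Y := rho * sin p; have mY : m * rho <= Y by rewrite mulrC ler_wpM2l ?Hm// ltW.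
  have Y0 : 0 < Y by rewrite mulr_gt0// sin_gt0_pi.
  have rgY : rg <= Y by apply: le_trans mY; rewrite mulrC -ler_pdivrMr.
  pose z0n := Y / sin D; have z0Y : Y <= z0n by rewrite ler_pdivlMr// ler_piMr ?(ltW Y0)// sin_le1.
  have z0n0 : 0 < z0n by exact: lt_le_trans z0Y.
  pose x0 := z0n * cos D; pose s1 := rho * sin phi / sin D.
  have sphi : 0 <= sin phi by apply: sin_ge0_pi; rewrite phi0 ltW//; exact: le_lt_trans (le_trans phiP (ltW PD)) D2.
  have s10 : 0 <= s1 by rewrite divr_ge0 ?mulr_ge0// ltW.
  have xs : x0 + s1 = rho * cos p.
    rewrite /x0 /s1 /z0n /Y; have -> : sin phi = sin (D - p) by congr sin; rewrite /p; ring.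
    by rewrite sinB; move: sD; move: (sin D) (cos D) (sin p) (cos p) => a b d e /gt_eqF/negbT a0; field.
  pose lp := lpath Y gam sg.
  have end1 : lp (x0 + s1) = w.
    rewrite /lp xs (lpath_point _ _ p0 rho0)//; apply: ceqP; rewrite /= ?expRK//.
    by rewrite wphi -gamE /p; ring.
  have end0 : lp x0 = ln z0n +i* th.
    rewrite /lp (lpath_point _ _ D0 z0n0); last by rewrite divfK// gt_eqF.
    by congr (_ +i* _); rewrite -gamE; ring.
  pose x a (s : R) : C := rs N t (lp (x0 + s)) a j.
  pose z s := cexp (lp (x0 + s)); have zY s : Y <= nc (z s) by rewrite nc_cexp; exact: lpath_ge.
  have zn0 s : z s != 0 by exact: cexp_neq0.
  have zE s : z s = z 0 + s%:C * cis gam by rewrite /z /lp !cexp_lpath// addr0 realCD; ring.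
  have nz0 : nc (z 0) = z0n by rewrite nc_cexp addr0 end0 /= lnK.
  pose eta := eta0 / Y; have e0 : 0 <= eta by rewrite divr_ge0// ltW.
  pose kk := d0 * Y ^- N; have kk0 : 0 <= kk by rewrite mulr_ge0 ?invr_ge0 ?exprn_ge0 ?(ltW Y0).
  have ng : (2 * n + 1)%:R * eta <= g.
    rewrite /eta mulrA ler_pdivrMr// [g * Y]mulrC -ler_pdivrMr//; apply: le_trans rgY.
    by rewrite lerDr addr_ge0// ltW.
  have := @dichotomy R n x (fun a s => cis gam / z s * ((A t *m rs N t (lp (x0 + s))) a j - rs N t (lp (x0 + s)) a j * A 0 j j
     - z s ^- N * (((u0 + t) 0 a - (u0 + t) 0 j) * F N.+1 t a j))) (fun a => cis gam * ((u0 + t) 0 a - (u0 + t) 0 j))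
     (fun a => mu <= cRe (cis gam * ((u0 + t) 0 a - (u0 + t) 0 j))) mu1 mu eta kk
     (n%:R * (K2 * expR ((kap + c) * z0n)) ^+ 2) e0 kk0.
  move=> HH; refine (_ (HH _ _ _ _ _ _ s1 s10)); last 6 first.
  + move=> a s s0; have ds : dr (fun s => x0 + s) s (0 + 1) by exact: drD (dr_cst x0 s) (dr_id s).
    have dl := rder_compr ds (lpath_rder gam Y0 sg2 (x0 + s)).
    apply: rder_eq (rder_comp dl (rdw N (lp (x0 + s)) a j ct)) _; rewrite add0r realC1 mulr1 /x.
    have G (y P X b Z u cg : C) : y != 0 -> (y * u * X + (P - X * b) - Z) * (cg / y) = cg * u * X + cg / y * (P - X * b - Z) by move=> y0; field.
    exact: G (zn0 s).
  + by move=> a; case: ifPn => // na; case: (hu a j) => // h; rewrite h in na.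
  + move=> a s s0; rewrite ncM ncM nc_cis mul1r ncV.
    have b1 : nc ((A t *m rs N t (lp (x0 + s))) a j - rs N t (lp (x0 + s)) a j * A 0 j j) <= (MA + MB) * \sum_b nc (x b s).
      apply: le_trans (ncB _ _) _; rewrite mulrDl; apply: lerD; first exact: mul_bound.
      rewrite ncM mulrC; apply: ler_pM; rewrite ?nc_ge0 ?HMB//.
      by rewrite (bigD1 a)//= lerDl sumr_ge0// => b _; exact: nc_ge0.
    have b2 : nc (z s ^- N * (((u0 + t) 0 a - (u0 + t) 0 j) * F N.+1 t a j)) <= kk.
      rewrite ncM ncV ncX /kk mulrC; apply: ler_pM; rewrite ?nc_ge0 ?invr_ge0 ?exprn_ge0 ?nc_ge0//.
        by rewrite ncM; apply: ler_pM; rewrite ?nc_ge0 ?nc_vdiff.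
      exact: powV_le.
    have S0 : 0 <= \sum_b nc (x b s) by apply: sumr_ge0 => b _; exact: nc_ge0.
    have b3 : (nc (z s))^-1 <= Y^-1 by rewrite lef_pV2 ?posrE// (lt_le_trans Y0).
    rewrite /eta mulrAC mulrC; apply: ler_pM; rewrite ?invr_ge0 ?nc_ge0//.
    apply: le_trans (ncB _ _) _; apply: le_trans (lerD b1 b2) _.
    rewrite mulrDr /eta0; apply: lerD; first by rewrite ler_wpM2r// lerDl.
    by rewrite ler_peMl.
  (* A priori growth along the line: |z| increases by at most [s] and |Im(z e^(-i be))| by at most
     [s * |sin (gam - be)|], which makes the rate [mu1]. *)
  + move=> s s0; rewrite -mulrA -sum_cst; apply: ler_sum => b _.
    have -> : expR (2 * mu1 * s) = expR (mu1 * s) ^+ 2 by rewrite expr2 -expRD; congr expR; ring.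
    rewrite -exprMn ler_pXn2r ?nnegrE ?nc_ge0 ?mulr_ge0 ?expR_ge0//.
    have xle : Y * (cos D / sin D) <= x0 + s by rewrite /x0 /z0n -mulrA [_^-1 * _]mulrC lerDl.
    have [q0 q0D qE] := lpath_arg gam sg Y0 D0 xle.
    have imE : cIm (lp (x0 + s)) = th + sg * q0 by rewrite qE -gamE; ring.
    have rE : r2 <= modz (lp (x0 + s)).
      rewrite -nc_cexp; apply: le_trans (zY s); apply: le_trans rgY.
      by case: r12.
    apply: le_trans (H2 _ q0 q0D imE rE b j) _; rewrite -[leRHS]mulrA; apply: ler_wpM2l => //; rewrite -expRD ler_expR -nc_cexp -/(z s).
    have zs : nc (z s) <= z0n + s by rewrite zE; apply: le_trans (ncD _ _) _; rewrite nz0 lerD2l ncM nc_cis mulr1 ncR ger0_norm.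
    have Is : `|cIm (z s * cis (- be))| <= z0n + s * `|sin (gam - be)|.
      rewrite zE mulrDl cImD -mulrA -cisD; apply: le_trans (ler_normD _ _) _; apply: lerD.
        by apply: le_trans (Im_le_nc _) _; rewrite ncM nc_cis mulr1 nz0.
      by rewrite cImM /= mul0r addr0 normrM (ger0_norm s0).
    have := lerD (ler_wpM2l k0 zs) (ler_wpM2l c0 Is); rewrite /mu1.
    move/le_trans; apply; apply: le_of_eq; ring.
  + by apply: le_trans ng _; rewrite /g lerBlDr lerDl.
  + exact: rate_gap ng g0.
  (* The length [s1] is at most of order |z| and [eta] of order 1 / |z|, so the dichotomy costs only
     the bounded factor [E]. *)
  move=> H; have s1m : eta * s1 <= eta0 / m ^+ 2.
    have sb : s1 <= rho / m.
      apply: ler_pM; rewrite ?mulr_ge0 ?invr_ge0 ?(ltW rho0) ?(ltW sD)//; last by rewrite lef_pV2 ?posrE.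
      by rewrite ler_piMr ?sin_le1// ltW.
    have yb : eta <= eta0 / (m * rho) by apply: ler_wpM2l => //; rewrite lef_pV2 ?posrE//; exact: mulr_gt0.
    apply: le_trans (ler_pM e0 s10 yb sb) _; apply: le_of_eq.
    by field; rewrite !gt_eqF.
  have Yp : Y ^- N <= (m * rho) ^- N by apply: powV_le => //; rewrite mulr_gt0.
  have p0' : 0 <= (m * rho) ^- N by rewrite invr_ge0 exprn_ge0// mulr_ge0// ltW.
  have h1 : nc (rs N t w i j) ^+ 2 <= en xpredT x s1 by have := nc2_le_en x s1 i; rewrite /x end1.
  have h2 : en xpredT x 0 <= n%:R * (K1 * (m * rho) ^- N) ^+ 2.
    rewrite -sum_cst; apply: ler_sum => a _; rewrite /x addr0 end0.
    rewrite ler_pXn2r ?nnegrE ?nc_ge0 ?mulr_ge0//; apply: le_trans (H1 _ _ _ a j) _ => //=; rewrite lnK ?posrE//.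
      by apply: le_trans z0Y; apply: le_trans rgY; case: r12.
    rewrite ler_wpM2l//; apply: le_trans Yp; exact: powV_le.
  have n1 : 1 <= n%:R :> R by rewrite ler1n; exact: leq_ltn_trans (leq0n i) (ltn_ord i).
  have h4 : kk ^+ 2 <= n%:R * ((m * rho) ^- N * d0) ^+ 2.
    apply: le_trans (_ : kk ^+ 2 <= ((m * rho) ^- N * d0) ^+ 2) _; last by rewrite ler_peMl ?sqr_ge0.
    apply: lerXn2r; rewrite ?nnegrE//; first exact: mulr_ge0.
    rewrite /kk [leRHS]mulrC; exact: ler_wpM2l.
  have h5 : 2 * expR (2 * (2 * n + 1)%:R * eta * s1) <= E by rewrite /E ler_wpM2l// ler_expR -[leLHS]mulrA ler_wpM2l// mulr_ge0.
  have K1p : 0 <= K1 * (m * rho) ^- N by rewrite mulr_ge0.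
  have := @sqr_estimate R (nc (rs N t w i j)) 1 E n%:R (K1 * (m * rho) ^- N) d0 ((m * rho) ^- N) (nc_ge0 _) ler01 E0 (ler0n _ _) K1p d00 p0'.
  rewrite expr1n mul1r mulr1 => /(_ _)/le_trans; apply.
    apply: le_trans h1 _; apply: le_trans H _; apply: ler_pM => //; rewrite ?mulr_ge0 ?expR_ge0 ?addr_ge0 ?en_ge0 ?sqr_ge0//.
    exact: lerD.
  apply: le_of_eq; rewrite exprMn invfM.
  move: (m ^- N) (rho ^- N) => a b; ring.
- apply: mulr_ge0; last by rewrite invr_ge0 exprn_ge0// ltW.
  by apply: mulr_ge0; [apply: mulr_ge0; apply: addr_ge0 => //; exact: mulr_ge0|exact: addr_ge0].
- exact: divr_gt0.
Qed.
End Propagation.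

(** * Small rotations of a ray *)

Lemma step_size {R : realType} (L m : R) : 0 <= L -> 0 < m -> exists D : R, [/\ 0 < D, D <= 1 / 2 & 3 * (L * D) < m].
Proof.
move=> L0 m0; have p0 : 0 < 3 * (L + 1) by rewrite mulr_gt0// ltr_wpDl.
have D0 : 0 < Num.min (1 / 2) (m / (3 * (L + 1))) by rewrite lt_min !divr_gt0.
exists (Num.min (1 / 2) (m / (3 * (L + 1)))); split => //; first by rewrite ge_min lexx.
have : Num.min (1 / 2) (m / (3 * (L + 1))) * (3 * (L + 1)) <= m by rewrite -ler_pdivlMr// ge_min lexx orbT.
move: D0; move: (Num.min _ _) => D; nra.
Qed.

Lemma half_bound {R : realType} (p D : R) : 2 <= p -> D <= 1 / 2 -> p / 2 < p - D.
Proof. lra. Qed.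

Lemma half_turn {R : realType} (al p phi sg x : R) : sg = 1 \/ sg = -1 -> 0 <= phi -> phi <= p / 2 ->
  x = al + p / 2 + sg * phi -> al <= x <= al + p.
Proof. by move=> [] -> h1 h2 ->; apply/andP; split; lra. Qed.

Lemma bound_product {R : realType} (K' K p E e f : R) : 0 <= K' -> 0 <= K -> 0 <= p -> 1 <= E -> 0 <= e -> e <= f ->
  K' * (K * p * E + p) * e <= K' * (K + 1) * p * (E * f).
Proof.
move=> K'0 K0 p0 E1 e0 ef; have E0 : 0 <= E by exact: le_trans E1.
have -> : K' * (K + 1) * p * (E * f) = K' * (K * p * E + p * E) * f by ring.
apply: ler_pM => //; first by rewrite mulr_ge0// addr_ge0 ?mulr_ge0.
by apply: ler_wpM2l => //; rewrite lerD2l ler_peMr.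
Qed.

Lemma step_gap {R : realType} (m d : R) : 0 <= d -> 3 * d < m -> d < m - d.
Proof. lra. Qed.

Lemma rotate_gap {R : realType} (X Y d e m : R) : `|Y - X| <= d -> d <= e -> m <= `|X| -> m - e <= `|Y|.
Proof. by move=> h1 h2 h3; have := lerB_dist X Y; rewrite distrC; lra. Qed.

Section Rotation.
Context {R : realType}.
Notation C := (R[i]^o)%type.

Lemma cis_lip (e : R) : nc (cis e - 1) <= `|e|.
Proof.
have H (x : R) : 0 <= x -> nc (cis x - 1) <= x.
  move=> x0; have := @rder_bound R cis (fun s => 'i * cis s) 1 0 x (fun s _ => rder_cis s) _ x0.
  rewrite cis0 subr0 mul1r; apply => s _; rewrite ncM nc_cis mulr1 nc_i//.
have [e0|/ltW e0] := leP 0 e; first by rewrite ger0_norm// H.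
rewrite ler0_norm// -[e]opprK cisN.
have -> : (cis (- e))^-1 - 1 = - (cis (- e))^-1 * (cis (- e) - 1) by rewrite mulrBr mulr1 mulNr mulVf ?cis_neq0//; ring.
by rewrite ncM ncN ncV nc_cis invr1 mul1r opprK H// oppr_ge0.
Qed.

Lemma rotate (b e : R) (x : C) :
  `|cRe (cis (b + e) * x) - cRe (cis b * x)| <= `|e| * nc x.
Proof.
have -> : cRe (cis (b + e) * x) - cRe (cis b * x) = cRe (cis b * x * (cis e - 1)) by rewrite -cReN -cReD cisD; congr cRe; ring.
apply: le_trans (Re_le_nc _) _; rewrite !ncM nc_cis mul1r mulrC ler_wpM2r ?nc_ge0//.
exact: cis_lip.
Qed.

Lemma sin_le_abs (e : R) : `|sin e| <= `|e|.
Proof.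
have -> : sin e = cIm (cis e - 1) by rewrite cImD cImN /= subr0.
exact: le_trans (Im_le_nc _) (cis_lip e).
Qed.

Lemma cexp_cis (w : C) (b : R) : cexp w * cis (- b) = (modz w)%:C * cis (cIm w - b).
Proof. by rewrite cexpE -mulrA -cisD. Qed.

Lemma Re_real_mul (a : R) (x : C) : cRe (a%:C * x) = a * cRe x.
Proof. by rewrite cReM /= mul0r subr0. Qed.
Lemma Im_real_mul (a : R) (x : C) : cIm (a%:C * x) = a * cIm x.
Proof. by rewrite cImM /= mul0r addr0. Qed.

Lemma cisDpi (b : R) (x : C) : cRe (cis (b + pi) * x) = - cRe (cis b * x).
Proof. by rewrite cisD cispi mulrN1 mulNr cReN. Qed.

Lemma Re_cis_min (lo hi : R) (x : C) : lo <= hi -> (forall th, lo <= th <= hi -> cRe (cis th * x) != 0) ->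
  exists2 m : R, 0 < m & forall th, lo <= th <= hi -> m <= `|cRe (cis th * x)|.
Proof.
move=> lh h; pose f th := cRe (cis th * x) ^+ 2.
have [|c clh Hc] := @EVT_min R f lo hi lh.
  apply: continuous_subspaceT => y.
  have d := rder_Re (rderM (rder_cis y) (rder_cst x y)).
  apply: (dr_cont (d := _)); exact: dr_ext (fun y => esym (expr2 _)) (drM d d).
rewrite in_itv/= in clh; exists `|cRe (cis c * x)|; first by rewrite normr_gt0 h.
move=> th hth; rewrite -(@ler_pXn2r _ 2)// ?nnegrE// !real_normK ?num_real//.
by apply: Hc; rewrite in_itv.
Qed.
End Rotation.

(** * Sectors on which the residual has the right order *)

Section Asymptotics.
Context {R : realType} {n : nat}.
Notation C := (R[i]^o)%type.
Notation T := 'rV[R[i]^o]_n.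
Notation M_n := 'M[R[i]^o]_n.
Implicit Types (t v : T).
Variables (u0 : T) (q : 'I_n -> 'I_n -> T -> C) (A : T -> M_n) (e1 : R)
  (F : nat -> T -> M_n) (rs : nat -> T -> C -> M_n).
Hypothesis hq : forall a b, ghol (q a b) 0 e1.
Hypothesis hF : forall k, mghol (F k) 0 e1.
Hypothesis rm : forall N w, mghol (rs N ^~ w) 0 e1.
Hypothesis rfl : forall N w v t i j, pd 0 e1 t -> mpder (rs N ^~ w) v t i j =
  cexp w * (v 0 i - v 0 j) * rs N t w i j + (omega q v t *m rs N t w) i j
  - cexp w ^- N * ((v 0 i - v 0 j) * F N.+1 t i j).
Hypothesis rdw : forall N w t i j, pd 0 e1 t -> cder (fun w => rs N t w i j) w
  (cexp w * ((u0 + t) 0 i - (u0 + t) 0 j) * rs N t w i j + ((A t *m rs N t w) i j - rs N t w i j * A 0 j j)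
  - cexp w ^- N * (((u0 + t) 0 i - (u0 + t) 0 j) * F N.+1 t i j)).

(** The residual is of order z^-N on the closed sector swept from the ray [th] through the angle
    [x], counterclockwise for [sg = 1] and clockwise for [sg = -1]. *)
Definition wray N t (th sg x : R) := exists K rho : R, [/\ 0 <= K, 0 < rho & forall w (phi : R),
  0 <= phi <= x -> cIm w = th + sg * phi -> rho <= modz w -> forall i j,
  nc (rs N t w i j) <= K * modz w ^- N].

Lemma wray_sub N t (th sg x y : R) : y <= x -> wray N t th sg x -> wray N t th sg y.
Proof.
move=> yx [K [r [K0 r0 H]]]; exists K, r; split => // w phi /andP[p0 py]; apply: H.
by rewrite p0 (le_trans py).
Qed.

Lemma wray_cat N t (th sg x y : R) : wray N t th sg x -> wray N t (th + sg * x) sg y -> wray N t th sg (x + y).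
Proof.
move=> [K [r [K0 r0 H]]] [K' [r' [K'0 r'0 H']]]; exists (K + K'), (r + r'); split; rewrite ?addr_ge0 ?addr_gt0//.
move=> w phi /andP[p0 py] wphi rw i j.
have e0 : 0 <= modz w ^- N := powV_ge0 N _.
have [px|xp] := leP phi x.
  apply: le_trans (H w phi _ wphi _ i j) _; rewrite ?p0//; first by apply: le_trans rw; rewrite lerDl ltW.
  by rewrite ler_wpM2r// lerDl.
apply: le_trans (H' w (phi - x) _ _ _ i j) _; first by rewrite subr_ge0 ltW//= lerBlDr addrC.
- by rewrite wphi; ring.
- by apply: le_trans rw; rewrite lerDr ltW.
by rewrite ler_wpM2r// lerDr.
Qed.

(** In the sector of opening [D] the bound of [arc] has rate [2 * vn u0 * D], below the gap [m] on
    the far side: [line] applies and secures half of the sector. *)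
Lemma ray_step N (th sg D m : R) : 0 < e1 -> sg = 1 \/ sg = -1 -> 0 < D -> D <= 1 ->
  2 * vn u0 * D < m -> (forall a b, u0 0 a != u0 0 b -> m <= `|cRe (cis (th + sg * D) * (u0 0 a - u0 0 b))|) ->
  wray N 0 th sg 0 -> wray N 0 th sg (D / 2).
Proof.
move=> e0 sg2 D0 D1 Lm hm H1; have c0 : pd 0 e1 (0 : T) by exact: pd_center.
have Dpi : D < pi by apply: le_lt_trans D1 _; apply: lt_le_trans (pi_ge2 R); rewrite ltr1n.
have L0 : 0 <= 2 * vn u0 * D by rewrite !mulr_ge0 ?vn_ge0// ltW.
apply: (@line _ _ u0 A e1 F rs rdw 0 th D sg (D / 2) (2 * vn u0 * D) 0 0 m N c0) => //.
- by rewrite D0.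
- by rewrite divr_ge0// ltW.
- by rewrite ltr_pdivrMr// mulr_natr mulr2n ltrDl.
- by rewrite mul0r addr0.
- move=> a b; rewrite addr0; have [->|ab] := eqVneq (u0 0 a) (u0 0 b).
    by right; rewrite subrr mulr0.
  have := hm a b ab; have [x0|x0] := leP 0 (cRe (cis (th + sg * D) * (u0 0 a - u0 0 b))).
    by rewrite ger0_norm// => ?; left.
  by right; exact: ltW.
- case: H1 => K [r [K0 r0 H]]; exists K, r; split => // w wth; apply: (H w 0); rewrite ?lexx//.
  by rewrite mulr0 addr0.
case: H1 => K [r [K0 r0 H]]; have [K' [K'0 H']] := arc rdw N c0.
exists (K' * (K + 1)), (r + 1); split; rewrite ?mulr_ge0 ?addr_ge0 ?addr_gt0// => w phi /andP[p0 pD] wphi rw i j.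
have rho1 : 1 <= modz w by apply: le_trans rw; rewrite lerDr ltW.
have e1' : modz w ^- N <= 1 by have := powV_le N ltr01 rho1; rewrite expr1n invr1.
have e0' : 0 <= modz w ^- N := powV_ge0 N _.
pose w0 : C := cRe w +i* th.
have -> : w = w0 + (0 +i* (sg * phi)) by apply: ceqP; rewrite ?cReD ?cImD /= ?addr0.
have M0 : 0 <= K * modz w ^- N by rewrite mulr_ge0.
have hM i' j' : nc (rs N 0 w0 i' j') <= K * modz w ^- N.
  apply: (H w0 0); rewrite ?lexx ?mulr0 ?addr0//=; apply: le_trans rw; by rewrite lerDl.
apply: le_trans (H' w0 sg phi _ sg2 _ M0 hM i j) _; first by rewrite p0 (le_trans pD).
rewrite /= addr0; apply: ler_pM; rewrite ?expR_ge0 ?mulr_ge0 ?addr_ge0//.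
  by rewrite ler_wpM2l// lerD// ler_piMr.
rewrite ler_expR mul0r addr0 addr0 -[leLHS]mulrA -[leRHS]mulrA ler_wpM2l ?mulr_ge0 ?vn_ge0//.
by rewrite [leLHS]mulrC ler_wpM2r ?expR_ge0.
Qed.

(** On a closed sector without Stokes rays, compactness bounds |Re(e^(i th) (u_a - u_b))| below;
    hence [ray_step] works with one [D] throughout and finitely many steps suffice. *)
Lemma ray_extend N (th sg x : R) : 0 < e1 -> sg = 1 \/ sg = -1 -> 0 <= x ->
  (forall a b (phi : R), u0 0 a != u0 0 b -> 0 <= phi <= x -> cRe (cis (th + sg * phi) * (u0 0 a - u0 0 b)) != 0) ->
  wray N 0 th sg 0 -> wray N 0 th sg x.
Proof.
move=> e0 sg2 x0 h H0.
have [||m [_ [m0 Hm]]] := @fin_uniform R ('I_n * 'I_n)%type (fun ab d M => u0 0 ab.1 != u0 0 ab.2 ->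
   forall phi, 0 <= phi <= x -> d <= `|cRe (cis (th + sg * phi) * (u0 0 ab.1 - u0 0 ab.2))|).
- by move=> ab d M d' M' dd _ H uab phi px; exact: le_trans dd (H uab phi px).
- move=> [a b] /=; have [->|ab] := eqVneq (u0 0 a) (u0 0 b); first by exists 1, 0.
  have [||m m0 Hm] := @Re_cis_min R (Num.min th (th + sg * x)) (Num.max th (th + sg * x)) (u0 0 a - u0 0 b).
  + by rewrite ge_min le_max lexx.
  + move=> y; case: sg2 h => -> h hy; have := h a b _ ab.
      move/(_ (y - th)); rewrite mul1r [th + _]addrC subrK; apply; move: hy; rewrite mul1r min_l ?max_r ?lerDl// => /andP[]; lra.
    move/(_ (th - y)); have -> : th + -1 * (th - y) = y by ring.
    apply; move: hy; rewrite mulN1r min_r ?max_l ?gerBl// => /andP[]; lra.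
  exists m, 0; split => // _ phi /andP[p0 px]; apply: Hm.
  have l1 : phi - x <= 0 by rewrite subr_le0.
  rewrite ge_min le_max; case: sg2 => ->; rewrite ?mul1r ?mulN1r; apply/andP; split; apply/orP.
  - by left; rewrite lerDl.
  - by right; rewrite lerD2l.
  - by right; rewrite lerD2l lerN2.
  by left; rewrite gerBl.
pose L := 2 * vn u0; have L0 : 0 <= L by rewrite mulr_ge0 ?vn_ge0.
have [D [D0 D12 LD]] := step_size L0 m0; have D1 : D <= 1 by lra.
have step phi : 0 <= phi <= x -> wray N 0 (th + sg * phi) sg 0 -> wray N 0 (th + sg * phi) sg (D / 2).
  move=> px; apply: (@ray_step _ _ _ _ (m - L * D)) => //.
    by apply: step_gap LD; rewrite mulr_ge0// ltW.
  move=> a b ab; apply: (rotate_gap (rotate (th + sg * phi) (sg * D) (u0 0 a - u0 0 b)) _ (Hm (a, b) ab phi px)).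
  have -> : `|sg * D| = D by rewrite normrM (gtr0_norm D0); case: sg2 => ->; rewrite ?normrN normr1 mul1r.
  by rewrite mulrC; apply: ler_wpM2r; [exact: ltW|exact: nc_vdiff].
suff H k y : 0 <= y <= x -> y <= k%:R * (D / 2) -> wray N 0 th sg y.
  have [k Hk] : exists k : nat, x <= k%:R * (D / 2).
    exists (Num.bound (x / (D / 2))); rewrite -ler_pdivrMr ?divr_gt0//; apply: ltW.
    by apply: archi_boundP; rewrite divr_ge0// divr_ge0// ltW.
  by apply: (H k); rewrite ?x0 ?lexx.
elim: k y => [|k IH] y /andP[y0 yx] yk.
  by apply: wray_sub H0; rewrite mul0r in yk.
have [yD|Dy] := leP y (D / 2).
  apply: wray_sub yD _; have := step 0; rewrite mulr0 addr0; apply => //; by rewrite lexx.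
have yE : y = (y - D / 2) + D / 2 by ring.
have y'0 : 0 <= y - D / 2 <= x.
  have : 0 < D / 2 by rewrite divr_gt0.
  by move: Dy yx; move: (D / 2) => d; lra.
have W : wray N 0 th sg (y - D / 2) by apply: IH y'0 _; rewrite lerBlDr; apply: le_trans yk _; rewrite -natr1 mulrDl mul1r.
rewrite yE; apply: (wray_cat W); apply: (step _ y'0).
case/andP: y'0 => y'0 _; case: W => K [r [K0 r0 HW]]; exists K, r; split => // w phi /andP[p0 p1] wphi; apply: (HW w (y - D / 2)).
  by rewrite y'0 lexx.
by rewrite wphi (_ : phi = 0) ?mulr0 ?addr0//; apply/eqP; rewrite eq_le p0 p1.
Qed.

(** * Passage from the cell to t = 0 *)

Section FromCell.
Variables (al eps0 : R) (ts : T).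
Hypothesis eps00 : 0 <= eps0.
Hypothesis eps01 : eps0 < e1.
Hypothesis tse : forall i, nc (ts 0 i) <= eps0.
Hypothesis tsd : forall a b, a != b -> cRe (cis al * ((u0 + ts) 0 a - (u0 + ts) 0 b)) != 0.
Hypothesis gap : forall a b, u0 0 a != u0 0 b -> 2 * eps0 < `|cRe (cis al * (u0 0 a - u0 0 b))|.
Hypothesis W0 : forall N, wray N ts al 1 pi.

(* The point of the polydisc on the line joining [ts] to the real span of [e^(-i al)]
   along which the exponentials do not grow on the ray [al]. *)
Let vs : T := \row_i (- 'i * cis (- al) * (cIm (cis al * ts 0 i))%:C).
Let tp : T := ts + vs.

Let vsE i : cis al * vs 0 i = - 'i * (cIm (cis al * ts 0 i))%:C.
Proof.
have G (x y b c : C) : x * y = 1 -> x * (- b * y * c) = - b * c by move=> h; rewrite -[RHS]mul1r -h; ring.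
by rewrite mxE; apply: G; rewrite -cisD subrr cis0.
Qed.

Let cis_inv (x : C) : x = cis (- al) * (cis al * x).
Proof. by rewrite mulrA -cisD addNr cis0 mul1r. Qed.

Let tpE i : cis al * tp 0 i = (cRe (cis al * ts 0 i))%:C.
Proof.
have -> : tp 0 i = ts 0 i + vs 0 i by rewrite [LHS]mxE.
rewrite mulrDr vsE; move: (cis al * ts 0 i) => x.
by apply: ceqP; rewrite ?cReD ?cImD ?cReM ?cImM ?cReN ?cImN /=; ring.
Qed.

Let tp_le i : nc (tp 0 i) <= eps0.
Proof.
rewrite [tp 0 i]cis_inv tpE ncM nc_cis mul1r ncR; apply: le_trans (Re_le_nc _) _.
by rewrite ncM nc_cis mul1r.
Qed.

Let path_vs (s : R) : 0 <= s <= 1 -> pd 0 e1 (ts + s%:C *: vs).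
Proof.
move=> s01 i; have -> : (ts + s%:C *: vs) 0 i - (0 : T) 0 i = (1 - s)%:C * ts 0 i + s%:C * tp 0 i.
  rewrite /tp !mxE realCB realC1; ring.
case/andP: s01 => s0 s1; apply: le_lt_trans (ncD _ _) _; rewrite !ncM !ncR.
rewrite (ger0_norm s0) ger0_norm ?subr_ge0//; apply: le_lt_trans eps01.
have := ler_wpM2l s0 (tp_le i); have h : 0 <= 1 - s by rewrite subr_ge0.
have := ler_wpM2l h (tse i); move: (s * _) ((1 - s) * _) => a b; lra.
Qed.

Let path_tp (s : R) : 0 <= s <= 1 -> pd 0 e1 (tp + s%:C *: (- tp)).
Proof.
move=> s01 i; have -> : (tp + s%:C *: - tp) 0 i - (0 : T) 0 i = (1 - s)%:C * tp 0 i.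
  by rewrite !mxE realCB realC1; ring.
case/andP: s01 => s0 s1; rewrite ncM ncR ger0_norm ?subr_ge0//; apply: le_lt_trans eps01.
by apply: le_trans (tp_le i); rewrite ler_piMl ?nc_ge0// gerBl.
Qed.

(** For displacements along -i e^(-i al) and along e^(-i al) the exponents involve only the
    imaginary, respectively the real, part of z e^(-i al). *)
Lemma growth_real (w : C) (x y : R) : `|x| <= eps0 -> `|y| <= eps0 ->
  cRe (cexp w * (- 'i * cis (- al) * x%:C) - cexp w * (- 'i * cis (- al) * y%:C)) <=
  2 * eps0 * `|cIm (cexp w * cis (- al))| /\
  cRe (cexp w * (cis (- al) * x%:C) - cexp w * (cis (- al) * y%:C)) <=
  2 * eps0 * `|cRe (cexp w * cis (- al))|.
Proof.
move=> x0 y0; move zE : (cexp w * cis (- al)) => z.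
have d : `|x - y| <= 2 * eps0 by apply: le_trans (ler_normB _ _) _; lra.
have -> : cexp w * (- 'i * cis (- al) * x%:C) - cexp w * (- 'i * cis (- al) * y%:C) = (x - y)%:C * (- 'i * z) by rewrite -zE realCB; ring.
have -> : cexp w * (cis (- al) * x%:C) - cexp w * (cis (- al) * y%:C) = (x - y)%:C * z by rewrite -zE realCB; ring.
rewrite !Re_real_mul; have -> : cRe (- 'i * z) = cIm z by rewrite mulNr cReN cReM /=; ring.
by split; apply: le_trans (ler_norm _) _; rewrite normrM ler_wpM2r.
Qed.

(** The leg from [ts] to [tp] runs along -i e^(-i al), so it costs nothing on the rays al and al +
    pi. *)
Lemma growth_at_tp N : exists K rho : R, [/\ 0 <= K, 1 <= rho & forall w, al <= cIm w <= al + pi ->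
  rho <= modz w -> forall i j, nc (rs N tp w i j) <=
    K * modz w ^- N * expR (2 * eps0 * `|cIm (cexp w * cis (- al))|)].
Proof.
have [K [K0 HK]] := tpath hq hF rm rfl N path_vs; have [K1 [r [K10 r0 H1]]] := W0 N.
exists (K * (K1 + 1)), (r + 1); split; first by rewrite mulr_ge0// addr_ge0.
  by rewrite lerDr ltW.
move=> w /andP[w1 w2] rw i j.
have p0 : 0 <= modz w ^- N := powV_ge0 N _.
have -> : K * (K1 + 1) * modz w ^- N = K * (K1 * modz w ^- N + modz w ^- N) by ring.
apply: HK; first by rewrite mulr_ge0// mulr_ge0.
- by rewrite mulr_ge0.
- move=> a b; rewrite mulrBr !mxE; apply: (growth_real w _ _).1.
    by apply: le_trans (Im_le_nc _) _; rewrite ncM nc_cis mul1r.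
  by apply: le_trans (Im_le_nc _) _; rewrite ncM nc_cis mul1r.
move=> a b; apply: (H1 w (cIm w - al)); first by rewrite subr_ge0 w1 lerBlDr addrC.
  by rewrite mul1r addrC subrK.
by apply: le_trans rw; rewrite lerDl.
Qed.

Let cpt : pd 0 e1 tp.
Proof. by have := path_tp (s := 0); rewrite realC0 scale0r addr0; apply; rewrite lexx ler01. Qed.

Lemma pi1 : 1 < pi :> R. Proof. by apply: lt_le_trans (pi_ge2 R); rewrite ltr1n. Qed.

(** The loss of the first leg is removed by [line], from the ray al in a direction just short of al
    + pi, where the a priori rate is [2 * eps0 * sin D]. The gap is inherited from [ts], as the move
    to [tp] preserves the real parts of e^(i al) u_a. *)
Lemma wray_tp N : wray N tp al 1 (pi / 2).
Proof.
have [||m [_ [m0 Hm]]] := @fin_uniform R ('I_n * 'I_n)%type (fun ab d M => ab.1 != ab.2 ->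
   d <= `|cRe (cis al * ((u0 + ts) 0 ab.1 - (u0 + ts) 0 ab.2))|).
- by move=> ab d M d' M' dd _ H uab; exact: le_trans dd (H uab).
- move=> [a b] /=; have [->|ab] := eqVneq a b; first by exists 1, 0.
  by exists `|cRe (cis al * ((u0 + ts) 0 a - (u0 + ts) 0 b))|, 0; split => //; rewrite normr_gt0 tsd.
pose L := 2 * vn (u0 + tp) + 2 * eps0; have L0 : 0 <= L by rewrite addr_ge0 ?mulr_ge0 ?vn_ge0.
have [D [D0 D12 LD]] := step_size L0 m0; have D1 : D <= 1 by lra.
have [K [r [K0 r1 H]]] := growth_at_tp N.
have r0 : 0 < r by exact: lt_le_trans r1.
have Dp : pi - D < pi by rewrite gtrBl.
have pD : pi / 2 < pi - D by exact: half_bound (pi_ge2 R) D12.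
apply: (@line _ _ u0 A e1 F rs rdw tp al (pi - D) 1 (pi / 2) 0 (2 * eps0) al (m - L * D) N cpt).
- by rewrite Dp andbT subr_gt0; apply: le_lt_trans D1 pi1.
- by rewrite divr_ge0// pi_ge0.
- exact: pD.
- by left.
- by [].
- by rewrite mulr_ge0.
- rewrite add0r mul1r; have -> : al + (pi - D) - al = pi - D by ring.
  have -> : sin (pi - D) = sin D by rewrite sinB sinpi cospi mul0r mulN1r opprK add0r.
  apply: le_lt_trans (_ : L * D < _); last by apply: step_gap LD; rewrite mulr_ge0// ltW.
  apply: ler_pM; rewrite ?mulr_ge0//; first by rewrite lerDr mulr_ge0 ?vn_ge0.
  by apply: le_trans (sin_le_abs D) _; rewrite gtr0_norm.
- move=> a b; have [->|ab] := eqVneq a b; first by right; rewrite subrr mulr0.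
  have E : cRe (cis al * ((u0 + tp) 0 a - (u0 + tp) 0 b)) = cRe (cis al * ((u0 + ts) 0 a - (u0 + ts) 0 b)).
    have G c : (u0 + tp) 0 c = u0 0 c + tp 0 c by rewrite [LHS]mxE.
    have G' c : (u0 + ts) 0 c = u0 0 c + ts 0 c by rewrite [LHS]mxE.
    by rewrite !G !G' !mulrBr !mulrDr !tpE !cReD !cReN !cReD.
  have h1 : m <= `|cRe (cis (al + pi) * ((u0 + tp) 0 a - (u0 + tp) 0 b))| by rewrite cisDpi normrN E; exact: (Hm (a, b) ab).
  have h2 := rotate (al + pi) (- D) ((u0 + tp) 0 a - (u0 + tp) 0 b).
  have h3 : `|- D| * nc ((u0 + tp) 0 a - (u0 + tp) 0 b) <= L * D.
    rewrite normrN (gtr0_norm D0) mulrC; apply: ler_wpM2r; first exact: ltW.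
    by apply: le_trans (nc_vdiff _ _ _) _; rewrite lerDl mulr_ge0.
  have := rotate_gap h2 h3 h1; have -> : al + pi - D = al + 1 * (pi - D) by ring.
  have [x0|x0] := leP 0 (cRe (cis (al + 1 * (pi - D)) * ((u0 + tp) 0 a - (u0 + tp) 0 b))).
    by rewrite ger0_norm// => ?; left.
  by right; exact: ltW.
- exists K, r; split => // w wal rw i j; apply: le_trans (H w _ rw i j) _; first by rewrite wal lexx lerDl pi_ge0.
  by rewrite cexp_cis wal subrr cis0 mulr1 /= normr0 mulr0 expR0 mulr1.
exists K, r; split => // w phi /andP[p0 pQ] wphi rw i j.
have rho1 : 1 <= modz w by exact: le_trans rw.
have e1' : modz w ^- N <= 1 by have := powV_le N ltr01 rho1; rewrite expr1n invr1.
apply: le_trans (H w _ rw i j) _.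
  by rewrite wphi mul1r lerDl p0 lerD2l (le_trans pQ)// ltW.
rewrite mul0r add0r ler_wpM2r ?expR_ge0//; by rewrite ler_piMr.
Qed.

(** The leg from [tp] to 0 runs along e^(-i al). The loss of the first leg is kept as a factor,
    because the bound is wanted on the whole closed half-plane. *)
Lemma growth_at_0 N : exists K rho : R, [/\ 0 <= K, 1 <= rho & forall w, al <= cIm w <= al + pi ->
  rho <= modz w -> forall i j, nc (rs N 0 w i j) <=
    K * modz w ^- N * expR (2 * eps0 * `|cIm (cexp w * cis (- al))| +
       2 * eps0 * `|cRe (cexp w * cis (- al))|)].
Proof.
have [K [K0 HK]] := tpath hq hF rm rfl N path_tp; have [K1 [r [K10 r0 H1]]] := growth_at_tp N.
exists (K * (K1 + 1)), r; split => //; first by rewrite mulr_ge0// addr_ge0.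
move=> w wI rw i j.
have p0 : 0 <= modz w ^- N := powV_ge0 N _.
rewrite expRD; have e1' : 1 <= expR (2 * eps0 * `|cIm (cexp w * cis (- al))|).
  by rewrite -expR0 ler_expR mulr_ge0// mulr_ge0.
move: (H1 w wI rw) e1'; set p := modz w ^- N in p0 *.
move: (expR (2 * eps0 * `|cIm _|)) => E H E1.
have k0 : 0 <= 2 * eps0 * `|cRe (cexp w * cis (- al))| by rewrite mulr_ge0// mulr_ge0.
have M0 : 0 <= K1 * p * E by rewrite !mulr_ge0// (le_trans ler01).
have -> : rs N 0 w i j = rs N (tp + (- tp)) w i j by rewrite subrr.
apply: le_trans (HK w (2 * eps0 * `|cRe (cexp w * cis (- al))|) (K1 * p * E) k0 M0 _ H i j) _.
  move=> a b; rewrite mulrBr.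
  have G c : (- tp) 0 c = cis (- al) * (- cRe (cis al * ts 0 c))%:C by rewrite realCN mulrN -tpE -cis_inv mxE.
  rewrite !G; apply: (growth_real w _ _).2; rewrite normrN.
    by apply: le_trans (Re_le_nc _) _; rewrite ncM nc_cis mul1r.
  by apply: le_trans (Re_le_nc _) _; rewrite ncM nc_cis mul1r.
exact: (bound_product K0 K10 p0 E1 (expR_ge0 _) (lexx _)).
Qed.

(** On the middle ray Re(z e^(-i al)) = 0, so the second leg is free, and [wray_tp] has already
    removed the loss of the first. *)
Lemma wray_mid N (sg : R) : wray N 0 (al + pi / 2) sg 0.
Proof.
have [K [K0 HK]] := tpath hq hF rm rfl N path_tp; have [K1 [r [K10 r0 H1]]] := wray_tp N.
exists (K * (K1 + 1)), r; split => //; first by rewrite mulr_ge0// addr_ge0.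
move=> w phi /andP[p0 p1] wphi rw i j.
have {}wphi : cIm w = al + pi / 2 by rewrite wphi (_ : phi = 0) ?mulr0 ?addr0//; apply/eqP; rewrite eq_le p0 p1.
have q0 : 0 <= modz w ^- N := powV_ge0 N _.
have M0 : 0 <= K1 * modz w ^- N by rewrite mulr_ge0.
have -> : rs N 0 w i j = rs N (tp + (- tp)) w i j by rewrite subrr.
have Rz : cRe (cexp w * cis (- al)) = 0 by rewrite cexp_cis wphi addrAC subrr add0r Re_real_mul /= cos_pihalf mulr0.
apply: le_trans (HK w 0 _ (lexx _) M0 _ _ i j) _.
- move=> a b; rewrite mulrBr.
  have G c : (- tp) 0 c = cis (- al) * (- cRe (cis al * ts 0 c))%:C by rewrite realCN mulrN -tpE -cis_inv mxE.
  have := (@growth_real w (- cRe (cis al * ts 0 a)) (- cRe (cis al * ts 0 b)) _ _).2.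
  rewrite !G Rz normr0 mulr0; apply; rewrite normrN.
    by apply: le_trans (Re_le_nc _) _; rewrite ncM nc_cis mul1r.
  by apply: le_trans (Re_le_nc _) _; rewrite ncM nc_cis mul1r.
- move=> a b; apply: (H1 w (pi / 2)) => //; first by rewrite lexx divr_ge0// pi_ge0.
  by rewrite mul1r.
by rewrite expR0 mulr1; apply: le_of_eq; ring.
Qed.

(** [line] starts on the middle ray and aims at a direction [D] beyond either boundary ray. There
    the a priori rate is close to [2 * eps0], which lies below the rates |Re(e^(i al) (u_a - u_b))|
    of the distinct eigenvalues at 0: the smallness of the radius is decisive here. *)
Lemma wray_beyond : exists2 eps : R, 0 < eps & forall N sg, sg = 1 \/ sg = -1 ->
  wray N 0 (al + pi / 2) sg (pi / 2 + eps).
Proof.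
have e0 : 0 < e1 by exact: le_lt_trans eps01.
have c0 : pd 0 e1 (0 : T) by exact: pd_center.
have [||d [_ [d0 Hd]]] := @fin_uniform R ('I_n * 'I_n)%type (fun ab d M => u0 0 ab.1 != u0 0 ab.2 ->
   2 * eps0 + d <= `|cRe (cis al * (u0 0 ab.1 - u0 0 ab.2))|).
- by move=> ab d M d' M' dd _ H uab; apply: le_trans (H uab); rewrite lerD2l.
- move=> [a b] /=; have [->|ab] := eqVneq (u0 0 a) (u0 0 b); first by exists 1, 0.
  exists (`|cRe (cis al * (u0 0 a - u0 0 b))| - 2 * eps0), 0; split; first by rewrite subr_gt0 gap.
  by rewrite addrC subrK.
pose L := 2 * vn u0 + 2 * eps0; have L0 : 0 <= L by rewrite addr_ge0 ?mulr_ge0 ?vn_ge0.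
have [D [D0 D12 LD]] := step_size L0 d0; have D1 : D <= 1 by lra.
have LD0 : 0 <= L * D by rewrite mulr_ge0// ltW.
exists (D / 2) => [|N sg sg2]; first by rewrite divr_gt0.
have pp : 0 <= pi / 2 :> R by rewrite divr_ge0// pi_ge0.
have base : al + pi / 2 + sg * (pi / 2 + D) = (al + pi / 2 + sg * (pi / 2)) + sg * D by ring.
have nsg : `|sg * D| = D by rewrite normrM (gtr0_norm D0); case: sg2 => ->; rewrite ?normrN normr1 mul1r.
have vD : 2 * vn u0 * D <= L * D by apply: ler_wpM2r; [exact: ltW|rewrite /L lerDl mulr_ge0].
have [K [r [K0 r1 H]]] := growth_at_0 N; have [K' [K'0 H']] := arc rdw N c0.
have r0 : 0 < r by exact: lt_le_trans r1.
apply: (@line _ _ u0 A e1 F rs rdw 0 (al + pi / 2) (pi / 2 + D) sg (pi / 2 + D / 2) (2 * eps0 + 2 * vn u0 * D) (2 * eps0) al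
  (2 * eps0 + d - L * D) N c0) => //.
- by rewrite ltr_wpDl//= -ltrBrDr (half_bound (pi_ge2 R) D12).
- by rewrite addr_ge0// divr_ge0// ltW.
- by rewrite ltrD2l ltr_pdivrMr// mulr_natr mulr2n ltrDl.
- by rewrite addr_ge0// ?mulr_ge0 ?vn_ge0// ltW.
- by rewrite mulr_ge0.
- have s1 : `|sin (al + pi / 2 + sg * (pi / 2 + D) - al)| <= D.
    have -> : al + pi / 2 + sg * (pi / 2 + D) - al = pi / 2 + sg * (pi / 2) + sg * D by ring.
    have s0 : sin (pi / 2 + sg * (pi / 2)) = 0 :> R.
      case: sg2 => ->; first by rewrite mul1r -splitr sinpi.
      by rewrite mulN1r subrr sin0.
    rewrite sinD s0 mul0r add0r normrM; apply: le_trans (_ : `|sin (sg * D)| <= _).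
      by rewrite ler_piMl// cos_max.
    by apply: le_trans (sin_le_abs _) _; rewrite nsg.
  have s2 : 2 * eps0 * `|sin (al + pi / 2 + sg * (pi / 2 + D) - al)| <= 2 * eps0 * D by rewrite ler_wpM2l// mulr_ge0.
  apply: le_lt_trans (_ : 2 * eps0 + L * D < _); last by rewrite -[ltRHS]addrA ltrD2l step_gap.
  by rewrite /L [(_ + _) * D]mulrDl addrA lerD2l.
- move=> a b; rewrite addr0; have [->|ab] := eqVneq (u0 0 a) (u0 0 b); first by right; rewrite subrr mulr0.
  have h1 : 2 * eps0 + d <= `|cRe (cis (al + pi / 2 + sg * (pi / 2)) * (u0 0 a - u0 0 b))|.
    apply: le_trans (Hd (a, b) ab) _; case: sg2 => ->; last by rewrite mulN1r addrK.
    by rewrite mul1r -addrA -splitr cisDpi normrN.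
  have h2 := rotate (al + pi / 2 + sg * (pi / 2)) (sg * D) (u0 0 a - u0 0 b).
  have h3 : `|sg * D| * nc (u0 0 a - u0 0 b) <= L * D.
    rewrite nsg mulrC; apply: ler_wpM2r; first exact: ltW.
    by apply: le_trans (nc_vdiff _ _ _) _; rewrite lerDl mulr_ge0.
  have := rotate_gap h2 h3 h1; rewrite -base.
  have [x0|x0] := leP 0 (cRe (cis (al + pi / 2 + sg * (pi / 2 + D)) * (u0 0 a - u0 0 b))).
    by rewrite ger0_norm// => ?; left.
  by right; exact: ltW.
- have [K2 [r2 [K20 r20 H2]]] := wray_mid N sg; exists K2, r2; split => // w wal; apply: (H2 w 0); rewrite ?lexx//.
  by rewrite mulr0 addr0.
exists (K + K' * (K + 1)), r; split => //; first by rewrite addr_ge0// mulr_ge0// addr_ge0.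
move=> w phi /andP[p0 pD] wphi rw i j.
have rho1 : 1 <= modz w by exact: le_trans rw.
have e1' : modz w ^- N <= 1 by have := powV_le N ltr01 rho1; rewrite expr1n invr1.
have e0' : 0 <= modz w ^- N := powV_ge0 N _.
have KK : 0 <= K' * (K + 1) by rewrite mulr_ge0// addr_ge0.
have Rle (w' : C) : `|cRe (cexp w' * cis (- al))| <= modz w' by apply: le_trans (Re_le_nc _) _; rewrite ncM nc_cis mulr1 nc_cexp.
(* Inside the half-plane the a priori growth is [growth_at_0]; past it, [arc] continues from the
   point [w0] of the boundary ray. *)
have [pp2|pp2] := leP phi (pi / 2).
  apply: le_trans (H w _ rw i j) _; first exact: half_turn sg2 p0 pp2 wphi.
  apply: ler_pM; rewrite ?expR_ge0 ?mulr_ge0//.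
    by apply: le_trans (_ : K <= _); rewrite ?ler_piMr// lerDl.
  rewrite ler_expR addrC lerD2r [leRHS](mulrDl (2 * eps0)); apply: le_trans (_ : 2 * eps0 * modz w <= _).
    by rewrite ler_wpM2l// mulr_ge0.
  by rewrite lerDl !mulr_ge0 ?vn_ge0 ?expR_ge0// ltW.
pose w0 : C := cRe w +i* (al + pi / 2 + sg * (pi / 2)).
have -> : rs N 0 w i j = rs N 0 (w0 + (0 +i* (sg * (phi - pi / 2)))) i j.
  congr (rs N 0 _ i j); apply: ceqP; rewrite ?cReD ?cImD /= ?addr0// wphi; ring.
have w0I : al <= cIm w0 <= al + pi.
  rewrite /w0 /=; case: sg2 => ->; first by rewrite mul1r -addrA -splitr lexx lerDl pi_ge0.
  by rewrite mulN1r addrK lexx lerDl pi_ge0.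
have Iz : cIm (cexp w0 * cis (- al)) = 0.
  rewrite cexp_cis Im_real_mul /=; have -> : al + pi / 2 + sg * (pi / 2) - al = pi / 2 + sg * (pi / 2) by ring.
  case: sg2 => ->; first by rewrite mul1r -splitr sinpi mulr0.
  by rewrite mulN1r subrr sin0 mulr0.
pose E := expR (2 * eps0 * modz w).
have E1 : 1 <= E by rewrite -expR0 ler_expR mulr_ge0 ?expR_ge0// mulr_ge0.
have M0 : 0 <= K * E by rewrite mulr_ge0// (le_trans ler01).
apply: le_trans (H' w0 sg (phi - pi / 2) (K * E) sg2 _ M0 _ i j) _.
- by rewrite subr_ge0 ltW//= lerBlDr; apply: le_trans pD _; rewrite addrC lerD2r.
- move=> a b; apply: le_trans (H w0 w0I rw a b) _; rewrite Iz normr0 mulr0 add0r.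
  apply: ler_pM; rewrite ?expR_ge0//; first exact: mulr_ge0.
    by rewrite ler_piMr.
  by rewrite /E ler_expR; apply: ler_wpM2l; [exact: mulr_ge0|exact: Rle].
rewrite /= addr0; apply: le_trans (_ : K' * (K + 1) * expR ((2 * eps0 + 2 * vn u0 * D) * modz w) <= _); last first.
  apply: ler_pM; rewrite ?expR_ge0//; first by rewrite lerDr.
  by rewrite ler_expR lerDl mulr_ge0// mulr_ge0.
have -> : expR ((2 * eps0 + 2 * vn u0 * D) * modz w) = E * expR (2 * vn u0 * D * modz w) by rewrite /E -expRD; congr expR; ring.
have F1 : expR (2 * vn u0 * modz w * (phi - pi / 2)) <= expR (2 * vn u0 * D * modz w).
  rewrite ler_expR [leRHS]mulrAC; apply: ler_wpM2l; first by rewrite !mulr_ge0 ?vn_ge0 ?expR_ge0.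
  by rewrite lerBlDr; apply: le_trans pD _; rewrite addrC.
have h0 : 0 <= K * E + modz w ^- N by rewrite addr_ge0.
have := bound_product K'0 K0 ler01 E1 (expR_ge0 _) F1; rewrite !mulr1; apply: le_trans.
by apply: ler_wpM2r; [exact: expR_ge0|apply: ler_wpM2l => //; rewrite lerD2l].
Qed.

(** The closed half-plane is covered by [wray_beyond]; outside it no Stokes ray occurs up to [a] and
    [b], so [ray_extend] goes on from both boundary rays. *)
Lemma residual_sector N (a b : R) : a <= b ->
  (forall c d (th : R), u0 0 c != u0 0 d -> (a <= th <= al) || (al + pi <= th <= b) ->
     cRe (cis th * (u0 0 c - u0 0 d)) != 0) ->
  exists K rho : R, [/\ 0 <= K, 0 < rho & forall w, a <= cIm w <= b -> rho <= modz w ->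
    forall i j, nc (rs N 0 w i j) <= K * modz w ^- N].
Proof.
move=> ab h; have e0 : 0 < e1 by exact: le_lt_trans eps01.
have [eps eps0' Heps] := wray_beyond.
have pp : 0 <= pi / 2 :> R by rewrite divr_ge0// pi_ge0.
have H sg x : sg = 1 \/ sg = -1 -> (forall c d (phi : R), u0 0 c != u0 0 d -> 0 <= phi <= x ->
    cRe (cis (al + pi / 2 + sg * (pi / 2) + sg * phi) * (u0 0 c - u0 0 d)) != 0) ->
    wray N 0 (al + pi / 2) sg (pi / 2 + x).
  move=> sg2 hx; have W1 : wray N 0 (al + pi / 2) sg (pi / 2).
    by apply: wray_sub (Heps N sg sg2); rewrite lerDl ltW.
  have [x0|/ltW x0] := leP 0 x; last by apply: wray_sub W1; rewrite gerDl.
  apply: wray_cat (W1) _; apply: (ray_extend e0 sg2 x0 hx).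
  case: W1 => K [r [K0 r0 HW]]; exists K, r; split => // w phi /andP[p0 p1] wphi; apply: (HW w (pi / 2)).
    by rewrite pp lexx.
  by rewrite wphi (_ : phi = 0) ?mulr0 ?addr0//; apply/eqP; rewrite eq_le p0 p1.
have [||K1 [r1 [K10 r10 H1]]] := H 1 (b - (al + pi)); first by left.
  move=> c d phi cd /andP[p0 p1]; apply: h => //; apply/orP; right.
  have -> : al + pi / 2 + 1 * (pi / 2) + 1 * phi = al + pi + phi by field.
  by rewrite lerDl p0 addrC -lerBrDr.
have [||K2 [r2 [K20 r20 H2]]] := H (-1) (al - a); first by right.
  move=> c d phi cd /andP[p0 p1]; apply: h => //; apply/orP; left.
  have -> : al + pi / 2 + -1 * (pi / 2) + -1 * phi = al - phi by ring.
  by rewrite gerBl p0 andbT lerBrDr addrC -lerBrDr.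
exists (K1 + K2), (r1 + r2); split; rewrite ?addr_ge0 ?addr_gt0// => w /andP[wa wb] rw i j.
have p0 : 0 <= modz w ^- N := powV_ge0 N _.
have [le|/ltW le] := leP (al + pi / 2) (cIm w).
  apply: le_trans (H1 w (cIm w - (al + pi / 2)) _ _ _ i j) _.
  - rewrite subr_ge0 le/=; have -> : pi / 2 + (b - (al + pi)) = b - (al + pi / 2) by field.
    by rewrite lerD2r.
  - by rewrite mul1r addrC subrK.
  - by apply: le_trans rw; rewrite lerDl ltW.
  by rewrite ler_wpM2r// lerDl.
apply: le_trans (H2 w (al + pi / 2 - cIm w) _ _ _ i j) _.
- rewrite subr_ge0 le/=; have -> : pi / 2 + (al - a) = al + pi / 2 - a by ring.
  by rewrite lerD2l lerN2.
- by ring.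
- by apply: le_trans rw; rewrite lerDr ltW.
by rewrite ler_wpM2r// lerDr.
Qed.
End FromCell.
End Asymptotics.

(** * Sectors, the gap, and the quotients A_ab / (u_a - u_b) *)

Section Quotients.
Context {R : realType} {n : nat}.
Notation C := (R[i]^o)%type.
Notation T := 'rV[R[i]^o]_n.
Implicit Types (u : T) (tau th : R).

Lemma cexp_imag th : cexp (0 +i* th) = cis th :> C.
Proof. by rewrite cexpE /= expR0 realC1 mul1r. Qed.

Lemma Re_ray (w x : C) : cRe (x * cexp w) = modz w * cRe (cis (cIm w) * x).
Proof. by rewrite cexpE mulrCA Re_real_mul mulrC [x * _]mulrC mulrC. Qed.

Lemma stokes_argE u th : stokes_arg u th <->
  exists a b, u 0 a != u 0 b /\ cRe (cis th * (u 0 a - u 0 b)) = 0.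
Proof.
split=> -[a [b [ab H]]]; exists a, b; split => //.
  have := H (0 +i* th) erefl; have := Re_ray (0 +i* th) (u 0 a - u 0 b).
  by rewrite /= expR0 mul1r => <-.
move=> w wth; have := Re_ray w (u 0 a - u 0 b); rewrite wth H mulr0; exact.
Qed.

Lemma admissibleE u tau : admissible_direction u tau -> forall a b, u 0 a != u 0 b ->
  cRe (cis tau * (u 0 a - u 0 b)) != 0.
Proof.
move=> H a b ab; have := H a b ab (0 +i* tau) erefl; have := Re_ray (0 +i* tau) (u 0 a - u 0 b).
by rewrite /= expR0 mul1r => <-.
Qed.

(** Argument of the lower boundary of the half-plane Pi_r; the upper boundary is at angle pi from
    it. *)
Definition ray tau (r : nat) : R := tau + (r%:R - 2) * pi.

Lemma ray_pi tau r : ray tau r + pi = tau + (r%:R - 1) * pi.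
Proof. by rewrite /ray; ring. Qed.

Lemma ray_abs tau r (x : C) : (1 <= r <= 3)%N ->
  `|cRe (cis (ray tau r) * x)| = `|cRe (cis tau * x)|.
Proof.
case: r => [|[|[|[|]]]]// _; rewrite /ray.
- have -> : tau + (1%:R - 2) * pi = tau - pi by ring.
  by rewrite -[in RHS](subrK pi tau) cisDpi normrN.
- by rewrite subrr mul0r addr0.
- have -> : tau + (3%:R - 2) * pi = tau + pi by ring.
  by rewrite cisDpi normrN.
Qed.

(** Both boundary rays have argument [tau] modulo pi, where Stokes rays are excluded by symmetry; so
    the sector contains the closed half-plane. *)
Lemma halfplane_sector u tau r w : (1 <= r <= 3)%N -> ~ stokes_arg u tau ->
  ray tau r <= cIm w <= ray tau r + pi -> sector u tau r w.
Proof.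
move=> r13 ns /andP[w1 w2] th sth.
have nth x : x = ray tau r \/ x = ray tau r + pi -> th <> x.
  move=> xE thx; apply: ns; case/stokes_argE: sth => a [b [ab H]]; apply/stokes_argE.
  exists a, b; split => //; apply/eqP; rewrite -normr_eq0 -(ray_abs tau _ r13) normr_eq0; apply/eqP.
  rewrite thx in H; case: xE H => -> //; rewrite cisDpi => /eqP; by rewrite oppr_eq0 => /eqP.
split => h.
  apply: le_lt_trans w2 _; rewrite lt_def ray_pi h andbT.
  by apply/eqP; rewrite -ray_pi; apply: nth; right.
apply: lt_le_trans w1; rewrite lt_def [_ <= _]h andbT eq_sym; apply/eqP; apply: nth; by left.
Qed.

Lemma sector_interval u tau r (a b : R) : a <= b -> [set w : R[i] | a <= cIm w <= b] `<=` sector u tau r ->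
  forall c d th, u 0 c != u 0 d -> (a <= th <= ray tau r) || (ray tau r + pi <= th <= b) ->
  cRe (cis th * (u 0 c - u 0 d)) != 0.
Proof.
move=> ab sub c d th cd hth; apply/eqP => H.
have sth : stokes_arg u th by apply/stokes_argE; exists c, d.
case/orP: hth => /andP[h1 h2].
  have sa : sector u tau r (0 +i* a) by apply: sub; rewrite /= lexx.
  by have [_ /(_ h2)] := sa th sth; rewrite /= ltNge h1.
have sb : sector u tau r (0 +i* b) by apply: sub; rewrite /= lexx ab.
by rewrite ray_pi in h1; have [/(_ h1) + _] := sb th sth; rewrite /= ltNge h2.
Qed.

(** [gap] is half the distance from lambda_j - lambda_k to the line i rho e^(-i tau), and this
    distance is |Re(e^(i tau) (lambda_k - lambda_j))|, attained at the rho used below. *)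
Lemma gap_lt (s : nat) (lam : 'I_s -> R[i]) tau j k (eps : R) : eps < gap lam tau j k ->
  2 * eps < `|cRe (cis tau * (lam k - lam j))|.
Proof.
have G (x y : R) : x < 2^-1 * y -> 2 * x < y by lra.
move=> /G/lt_le_trans; apply.
have <- : cRe `|lam k - lam j + (0 +i* - cIm (cis tau * (lam k - lam j))) * cexp (0 +i* (- tau))| =
   `|cRe (cis tau * (lam k - lam j))|.
  rewrite normE /=; rewrite cexp_imag.
  have -> : lam k - lam j + (0 +i* - cIm (cis tau * (lam k - lam j))) * cis (- tau) =
     cis (- tau) * (cis tau * (lam k - lam j) + (0 +i* - cIm (cis tau * (lam k - lam j)))).
    have G2 (x y c ci : C) : ci * c = 1 -> x + y * ci = ci * (c * x + y) by move=> h; rewrite -[x in LHS]mul1r -h; ring.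
    by apply: G2; rewrite -cisD addNr cis0.
  rewrite ncM nc_cis mul1r; move: (cis tau * _) => x.
  have -> : x + (0 +i* - cIm x) = (cRe x)%:C by apply: ceqP; rewrite ?cReD ?cImD /= ?addr0 ?subrr.
  by rewrite ncR.
apply: ge_inf; last by exists (- cIm (cis tau * (lam k - lam j))).
by exists 0 => _ [rho _ <-]; rewrite normE; exact: nc_ge0.
Qed.
Notation M_n := 'M[R[i]^o]_n.

Implicit Types (t : T).

Lemma vanishing_at (u0 : T) (eps : R) (A : T -> M_n) a b t : vanishing_condition u0 eps A -> a != b ->
  polydisc eps t -> (u0 + t) 0 a = (u0 + t) 0 b -> A t a b = 0.
Proof.
move=> H ab ct tab; have coal : coalescence_locus u0 eps t by split => //; exists a, b.
have /eqO_exP[k k0 Hk] := H a b ab t coal tab.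
by have := nbhs_singleton Hk ct; rewrite tab subrr normr0 mulr0 normr_le0 => /eqP.
Qed.

Lemma coord_eq (u0 t : T) a b : u0 0 a = u0 0 b -> (u0 + t) 0 a = (u0 + t) 0 b <-> t 0 a = t 0 b.
Proof.
by rewrite !mxE => ->; split => [/addrI|->].
Qed.

(** On the complex line through 0 and [t] the two coordinates agree, and near 0 the line lies in the
    closed polydisc; the identity theorem carries the zero to [t]. *)
Lemma vanishing_beyond (eps e1 : R) (A : T -> M_n) a b t : 0 < eps -> eps < e1 ->
  mghol A 0 e1 -> (forall s, polydisc eps s -> s 0 a = s 0 b -> A s a b = 0) ->
  pd 0 e1 t -> t 0 a = t 0 b -> A t a b = 0.
Proof.
move=> e0 ee hA H ct tab; have [d d0 Hd] := pd_open ct.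
have v0 : 0 < vn t + 1 by rewrite ltr_wpDl ?vn_ge0.
pose f (x : C) := A (0 + x *: t) a b.
have -> : A t a b = f (0 + 1) by rewrite /f !add0r scale1r.
apply: (@holo_zero_segment R f (d / (vn t + 1))); first exact: divr_gt0.
  move=> x x01; rewrite mulr1 add0r; apply: (ghol_holo (hA a b)) => y hy.
  have -> : 0 + y *: t = (0 + x%:C *: t) + (y - x%:C) *: t by rewrite !add0r -scalerDl addrC subrK.
  apply: (pd_trans (t := 0 + x%:C *: t) (d := d)); first exact: line_pd.
  move=> i; case/andP: x01 => x0 x1.
  apply: le_trans (Hd i); rewrite lerD2r !mxE !add0r !subr0 ncM ncR ger0_norm// ler_piMl ?nc_ge0//.
exists (eps / (vn t + 1)); first exact: divr_gt0.
move=> h hh; rewrite add0r /f add0r; apply: H; last by rewrite !mxE tab.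
apply/polydiscP; first exact: ltW.
move=> i; rewrite mxE ncM; move: hh; rewrite ltr_pdivlMr// => hh; apply: ltW; apply: le_lt_trans hh.
by rewrite ler_wpM2l ?nc_ge0//; apply: le_trans (nc_le_vn t i) _; rewrite lerDl.
Qed.

(** Pairs with equal eigenvalues at 0 are treated by [hadamard]; for the others u_a - u_b is bounded
    away from 0 on the polydisc. *)
Lemma quotient_exists (u0 : T) (e1 d0 : R) (A : T -> M_n) : 0 < d0 -> 0 < e1 -> mghol A 0 e1 ->
  (forall a b, u0 0 a != u0 0 b -> 2 * e1 + d0 <= nc (u0 0 a - u0 0 b)) ->
  (forall a b t, a != b -> u0 0 a = u0 0 b -> pd 0 e1 t -> t 0 a = t 0 b -> A t a b = 0) ->
  exists q : 'I_n -> 'I_n -> T -> C, (forall a b, ghol (q a b) 0 e1) /\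
    forall t a b, pd 0 e1 t -> a != b -> A t a b = ((u0 + t) 0 a - (u0 + t) 0 b) * q a b t.
Proof.
move=> d00 e0 hA gap van.
have /choice[q Hq] : forall ab : 'I_n * 'I_n, exists f : T -> C, ghol f 0 e1 /\ (ab.1 != ab.2 -> forall t, pd 0 e1 t ->
    A t ab.1 ab.2 = ((u0 + t) 0 ab.1 - (u0 + t) 0 ab.2) * f t).
  move=> [a b] /=; have [->|ab] := eqVneq a b; first by exists (fun=> 0); split => //; exact: ghol_cst.
  have [uab|uab] := eqVneq (u0 0 a) (u0 0 b).
    have [|t ct tab|f [hf Hf]] := hadamard (hA a b) ab; rewrite ?mxE//; first exact: van.
    exists f; split => // _ t ct; rewrite (Hf t ct); congr (_ * _).
    by rewrite !mxE uab; ring.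
  have lowb t : pd 0 e1 t -> d0 <= nc ((u0 + t) 0 a - (u0 + t) 0 b).
    move=> ct; have -> : (u0 + t) 0 a - (u0 + t) 0 b = (u0 0 a - u0 0 b) - (t 0 b - t 0 a) by rewrite !mxE; ring.
    have := nc_dist (u0 0 a - u0 0 b) (t 0 b - t 0 a); have := ncB (t 0 b) (t 0 a).
    have := ct a; have := ct b; rewrite !mxE !subr0; have := gap a b uab; lra.
  exists (fun t => ((u0 + t) 0 a - (u0 + t) 0 b)^-1 * A t a b); split; last first.
    move=> _ t ct; rewrite mulrA mulfV ?mul1r// -nc_gt0; exact: lt_le_trans (lowb t ct).
  apply: gholM (hA a b); apply: (ghol_inv _ d00) => //.
  apply: (ghol_ext (f := fun t : T => (u0 0 a + t 0 a) - (u0 0 b + t 0 b))) => [t|]; first by rewrite !mxE.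
  by apply: gholB; apply: gholD (ghol_cst _ _ _) (ghol_coord _ _ _).
exists (fun a b => q (a, b)); split => [a b|t a b ct ab]; first exact: (Hq (a, b)).1.
exact: ((Hq (a, b)).2 ab t ct).
Qed.
End Quotients.

(** * Uniqueness of canonical solutions *)

Lemma exponent_le {R : realType} (N : nat) (b x y : R) : - b * x <= N%:R * x -> - (N.+1%:R * x) + (y - x * b) <= y - x.
Proof. rewrite -natr1; lra. Qed.

Section CanonicalUniqueness.
Context {R : realType} {n : nat}.
Notation C := (R[i]^o)%type.
Notation M_n := 'M[R[i]^o]_n.

Lemma decay_zero (c K x0 : R) : 0 <= c -> (forall x, x0 <= x -> c <= K * expR (- x)) -> c = 0.
Proof.
move=> c0 H; apply/eqP; rewrite eq_le c0 andbT leNgt; apply/negP => c1.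
pose x := Num.max x0 (Num.max 0 (K / c)).
have hx : K / c <= x by rewrite !le_max lexx !orbT.
have x00 : 0 <= x by rewrite !le_max lexx orbT.
have := H x; rewrite le_max lexx => /(_ isT); rewrite expRN ler_pdivlMr ?expR_gt0// => h.
have := expR_ge1Dx x; rewrite ler_pdivrMr// in hx; have := ler_wpM2l c0 (expR_ge1Dx x); rewrite mulrDr mulr1; lra.
Qed.

(** A closed half-plane suffices: for every pair (k, j) one of its boundary rays has Re(z (u_k -
    u_j)) >= 0. There the entry (k, j) of the connecting matrix is multiplied by at least a fixed
    power of |z|, up to a constant, so asymptotics of high order force it to 0; coinciding u_k and
    u_j are covered too. *)
Lemma canonical_unique (u : 'rV[R[i]^o]_n) (A : M_n) (F : nat -> M_n) (Y Y' : C -> M_n) (al : R) :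
  fundamental_solution u A Y -> fundamental_solution u A Y' -> F 0%N = 1%:M ->
  asym A u F Y al (al + pi) -> asym A u F Y' al (al + pi) -> forall w, Y' w = Y w.
Proof.
move=> fY fY' F0 aY aY'; have YC := fund_const fY fY'; move: YC; move: (invmx _ *m _) => Cm YC.
suff E1 : Cm = 1%:M by move=> w; rewrite YC E1 mulmx1.
pose ex w j : C := cexp w * u 0 j + w * A j j.
pose Q w : M_n := \matrix_(k, j) (Cm k j * cexp (ex w k - ex w j)).
have PQ w : gau u A Y' w = gau u A Y w *m Q w.
  apply/matrixP => i j; rewrite mxE YC mulmx_eq mulmx_eq mulr_suml; apply: eq_bigr => k _.
  rewrite !mxE -/(ex w k) -/(ex w j).
  have -> : cexp (- ex w j) = cexp (- ex w k) * cexp (ex w k - ex w j) by rewrite -cexpD addrA addNr add0r.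
  move: (Y w i k) (Cm k j) (cexp (- ex w k)) (cexp (ex w k - ex w j)) => a b c d; ring.
have near N : exists K x0 : R, forall w, al <= cIm w <= al + pi -> x0 <= cRe w ->
    forall k j, nc ((Q w - 1%:M) k j) <= K * modz w ^- N.+1.
  have [K1 [r1 [K10 r10 H1]]] := aY N; have [K2 [r2 [K20 r20 H2]]] := aY' N.
  have [K3 [r3 [K30 r30 H3]]] := aY 0%N.
  exists (n%:R * (2 * (K1 + K2))), (r1 + r2 + r3 + 2 * n%:R * K3) => w wI wr k j.
  set rho := modz w.
  have rr : r1 + r2 + r3 + 2 * n%:R * K3 <= rho by apply: le_trans wr _; apply: le_trans (expR_ge1Dx _); rewrite lerDr.
  have nK : 0 <= 2 * n%:R * K3 by rewrite mulr_ge0 ?mulr_ge0.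
  have [rr1 rr2 rr3 rr4] : [/\ r1 <= rho, r2 <= rho, r3 <= rho & 2 * n%:R * K3 <= rho] by move: rr nK; move: (2 * n%:R * K3) => y; split; lra.
  have n0 : 0 < n%:R :> R by rewrite ltr0n; exact: leq_ltn_trans (leq0n k) (ltn_ord k).
  have uP : gau u A Y w \in unitmx by apply: gau_unit; case: ((fundP _ _ _).1 fY w).
  have Pn a b : nc ((gau u A Y w - 1%:M) a b) <= (2 * n%:R)^-1.
    have := H3 w wI rr3 a b; rewrite psumE big_ord1 expr0 invr1 mul1r F0 mxsubE expr1 => /le_trans; apply.
    rewrite ler_pdivrMr ?expR_gt0// -(@ler_pM2l _ (2 * n%:R)) ?mulr_gt0// mulrA mulfV ?mul1r// gt_eqF// mulr_gt0//.
  have inv2 := inv_near1 uP Pn.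
  have -> : Q w - 1%:M = invmx (gau u A Y w) *m (gau u A Y' w - gau u A Y w) by rewrite PQ mulmxBr mulKmx// mulVmx.
  rewrite mulmx_eq; apply: le_trans (nc_sum _ _ _) _.
  have -> : n%:R * (2 * (K1 + K2)) / rho ^+ N.+1 = \sum_(i < n) (2 * ((K1 + K2) / rho ^+ N.+1)) by rewrite sum_cst; ring.
  apply: ler_sum => a _; rewrite ncM; apply: ler_pM; rewrite ?nc_ge0 ?inv2// mxsubE.
  apply: le_trans (nc_triangle _ (psum F N w a j) _) _; rewrite mulrDl addrC; apply: lerD.
    by rewrite ncC; exact: H1.
  exact: H2.
have Q1 w k j : (Q w - 1%:M) k j = Cm k j * cexp (ex w k - ex w j) - (k == j)%:R by rewrite mxsubE !mxE.
apply/matrixP => k j; rewrite mxE; apply/eqP; rewrite -subr_eq0 -nc_eq0; apply/eqP.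
have [kj|kj] := eqVneq k j.
  have [K [x0 H]] := near 0%N; apply: (@decay_zero _ K x0); first exact: nc_ge0.
  move=> x xx; have := H (x +i* al) _ _ k j; rewrite Q1 kj eqxx subrr cexp0 mulr1 expr1 /= expRN.
  by apply => //; rewrite lexx lerDl pi_ge0.
rewrite subr0; pose b := cRe (A k k - A j j); pose b' := cIm (A k k - A j j).
have [th thI th0] : exists2 th, al <= th <= al + pi & 0 <= cRe (cis th * (u 0 k - u 0 j)).
  have [h|/ltW h] := leP 0 (cRe (cis al * (u 0 k - u 0 j))).
    by exists al; rewrite ?lexx ?lerDl ?pi_ge0.
  by exists (al + pi); rewrite ?lexx ?lerDl ?pi_ge0// cisDpi oppr_ge0.
(* [N] outweighs the power |z|^b coming from z^(A_kk - A_jj) and leaves a factor 1 / |z| for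
   [decay_zero]. *)
pose N := Num.bound `|b|; have Nb : `|b| < N%:R := archi_boundP (normr_ge0 b).
have [K [x0 H]] := near N.
have K0 : 0 <= `|K| by [].
apply: (@decay_zero _ (`|K| * expR (th * b')) (Num.max x0 0)); first exact: nc_ge0.
move=> x; rewrite ge_max => /andP[xx x00].
have := H (x +i* th) thI xx k j; rewrite Q1 (negPf kj) subr0 ncM nc_cexp /=.
have -> : cRe (ex (x +i* th) k - ex (x +i* th) j) = expR x * cRe (cis th * (u 0 k - u 0 j)) + (x * b - th * b').
  rewrite /b /b' -Re_real_mul; have -> : x * cRe (A k k - A j j) - th * cIm (A k k - A j j) = cRe ((x +i* th : C) * (A k k - A j j)) by rewrite cReM.
  rewrite -cReD /ex cexpE /=; congr cRe; move: (expR x)%:C (cis th) => e f; ring.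
move=> h; have h1 : nc (Cm k j) * expR (x * b - th * b') <= `|K| * expR x ^- N.+1.
  apply: le_trans (_ : _ <= K * expR x ^- N.+1) _; last by rewrite ler_wpM2r ?ler_norm// invr_ge0 exprn_ge0// expR_ge0.
  apply: le_trans h; rewrite ler_wpM2l ?nc_ge0// ler_expR lerDr mulr_ge0// expR_ge0.
have h2 : nc (Cm k j) <= `|K| * (expR x ^- N.+1 * expR (th * b' - x * b)).
  rewrite mulrA -ler_pdivrMr ?expR_gt0// -expRN opprB; exact: h1.
apply: le_trans h2 _; rewrite -mulrA ler_wpM2l//.
have -> : expR x ^- N.+1 = expR (- (N.+1%:R * x)) by rewrite expRN -expRM_natl.
rewrite -!expRD ler_expR; have xN : - b * x <= N%:R * x.
  by apply: ler_wpM2r => //; apply: le_trans (ltW Nb); rewrite -normrN ler_norm.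
exact: exponent_le.
Qed.

Lemma cexp_surj (z : C) : z != 0 -> exists w, cexp w = z.
Proof.
rewrite -nc_gt0 => z0; pose c := cRe z / nc z; pose s := cIm z / nc z.
have zn : nc z != 0 by rewrite gt_eqF.
have cs : c ^+ 2 + s ^+ 2 = 1 by rewrite /c /s !expr_div_n -mulrDl -ncE mulfV// expf_neq0.
have c1 : -1 <= c <= 1 by rewrite -ler_norml -(@ler_pXn2r _ 2)// ?nnegrE// real_normK ?num_real// expr1n -cs lerDl sqr_ge0.
have sq : Num.sqrt (1 - c ^+ 2) = `|s| by rewrite -cs addrAC subrr add0r sqrtr_sqr.
have H : z = (nc z)%:C * (c +i* s) by apply: ceqP; rewrite ?cReM ?cImM /= ?mul0r ?subr0 ?addr0 /c /s mulrC divfK.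
have [s0|s0] := leP 0 s.
  exists (ln (nc z) +i* acos c); rewrite [RHS]H cexpE /= lnK ?posrE// /cis acosK ?in_itv//= sin_acos// sq ger0_norm//.
exists (ln (nc z) +i* - acos c); rewrite [RHS]H cexpE /= lnK ?posrE// /cis cosN sinN acosK ?in_itv//= sin_acos// sq ltr0_norm// opprK//.
Qed.
End CanonicalUniqueness.

(** * Transport of Levelt solutions *)

Lemma remainder_le {R : realType} (M d q : R) k N : 0 <= d -> 0 <= q < 1 -> (N <= k)%N ->
  M * q ^+ k * d <= `|M| * d * q ^+ N.
Proof.
move=> d0 /andP[q0 q1] Nk; rewrite mulrAC.
apply: le_trans (_ : `|M| * d * q ^+ k <= _).
  by apply: ler_wpM2r; [exact: exprn_ge0|apply: ler_wpM2r => //; exact: ler_norm].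
by apply: ler_wpM2l; [exact: mulr_ge0|apply: ler_wiXn2l => //; exact: ltW].
Qed.

Section Assembly.
Context {R : realType} {n : nat}.
Notation C := (R[i]^o)%type.
Notation M_n := 'M[R[i]^o]_n.

Lemma pseries_holo (Psi : nat -> M_n) (rho : R) : 0 < rho ->
  (forall z : C, nc z < rho -> cvgn (series (fun l => z ^+ l *: Psi l))) ->
  forall i j, holo (fun z => limn (series (fun l => z ^+ l *: Psi l)) i j) 0 (rho / 4).
Proof.
move=> r0 H i j; pose z0 : C := (rho / 2)%:C.
have nz0 : nc z0 = rho / 2 by rewrite ncR ger0_norm// divr_ge0// ltW.
have cv0 : cvgn (series (fun l => z0 ^+ l *: Psi l)) by apply: H; rewrite nz0 half_lt.
have [M [M0 HM]] := series_terms_bounded cv0.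
have tb l z : nc z < rho / 4 -> nc ((z ^+ l *: Psi l) i j) <= M * (1 / 2) ^+ l.
  move=> hz; have := HM l i j; rewrite !mxscaleE !ncM !ncX nz0 => h.
  have : nc z ^+ l <= (rho / 2) ^+ l * (1 / 2) ^+ l by rewrite -exprMn; apply: lerXn2r; rewrite ?nnegrE ?nc_ge0 ?mulr_ge0 ?divr_ge0 ?ltW//; lra.
  move=> h2; apply: le_trans (ler_wpM2r (nc_ge0 _) h2) _.
  by rewrite mulrAC; apply: ler_wpM2r; [rewrite exprn_ge0|exact: h].
apply: (@unif_holo R (fun k z => \sum_(l < k) (z ^+ l *: Psi l) i j)).
  move=> k z _; eexists; apply: cder_sum => l.
  apply: (cder_ext (f := fun z => z ^+ l * Psi l i j)) => [x|]; first by rewrite mxscaleE.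
  exact: (cderM (cderX z l) (cder_cst _ z)).
have part k m z : nc z < rho / 4 -> nc (\sum_(l < k + m) (z ^+ l *: Psi l) i j - \sum_(l < k) (z ^+ l *: Psi l) i j)
    <= M * (2 * ((1 / 2) ^+ k - (1 / 2) ^+ (k + m))).
  move=> hz; elim: m => [|m IH]; first by rewrite addn0 !subrr nc0 !mulr0.
  rewrite addnS big_ord_recr/= addrAC; apply: le_trans (ncD _ _) _; apply: le_trans (lerD IH (tb _ _ hz)) _.
  by apply: le_of_eq; rewrite exprS; move: ((1 / 2) ^+ (k + m)) => y; field.
have lim k z : nc z < rho / 4 -> nc (\sum_(l < k) (z ^+ l *: Psi l) i j - limn (series (fun l => z ^+ l *: Psi l)) i j)
    <= 2 * M * (1 / 2) ^+ k.
  move=> hz; apply/ler_addgt0Pr => e e0; have zr : nc z < rho by apply: lt_le_trans hz _; lra.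
  have [N HN] := cvgn_mcv (H z zr) e0; have := HN (k + N)%N (leq_addl _ _) i j; rewrite series_mxE => h1.
  have h2 := part k N z hz; rewrite ncC in h2.
  apply: le_trans (nc_triangle _ (\sum_(l < k + N) (z ^+ l *: Psi l) i j) _) _; apply: lerD h1.
  apply: le_trans h2 _; have p0 : 0 <= (1 / 2 : R) ^+ (k + N) by rewrite exprn_ge0.
  have -> : 2 * M * (1 / 2) ^+ k = M * (2 * (1 / 2) ^+ k) by ring.
  by apply: ler_wpM2l => //; apply: ler_wpM2l => //; rewrite gerBl.
move=> e e0; have [|||K HK] := @small_pow R (1 / 2) (2 * M) e; rewrite ?mulr_ge0//.
  by apply/andP; split; lra.
exists K => k Kk z; rewrite subr0 => hz; apply: le_trans (lim k z hz) _; apply: le_trans (ltW HK).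
by apply: ler_wpM2l; [rewrite mulr_ge0|apply: ler_wiXn2l => //; lra].
Qed.
Notation T := 'rV[R[i]^o]_n.

Implicit Types (t v : T).

Section Flow.
Variables (q : 'I_n -> 'I_n -> T -> C) (A : T -> M_n) (e1 : R) (ts : T).
Hypothesis hq : forall a b, ghol (q a b) 0 e1.
Hypothesis hA : mghol A 0 e1.
Hypothesis cts : pd 0 e1 ts.
Hypothesis fl : forall t v, pd 0 e1 t -> mpder A v t = omega q v t *m A t - A t *m omega q v t.

Lemma conn0 v t : conn q 0 v t = omega q v t.
Proof. by rewrite /conn scale0r add0r. Qed.

(** At z = 0 the connection is omega alone; by dA = [omega, A] the product of [A] with the transport
    is again parallel, with initial value [A ts]. *)
Lemma U_flow t : pd 0 e1 t -> A t *m U q ts 0 t = U q ts 0 t *m A ts.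
Proof.
move=> ct; have [d [B [d0 H]]] := Mseg_bound hq cts 0 ct.
have reg : regular (Mseg q ts 0 t) B by apply: (H 0 t _ (pd_center t d0)).2; rewrite subrr nc0.
pose O := ode (Mseg q ts 0 t) B.
have [|_] := sol_transport (X := fun s => A (ts + s%:C *: (t - ts)) *m O s) reg.
  move=> s s01; have cs : pd 0 e1 (ts + s%:C *: (t - ts)) by exact: pd_convex.
  have dO := ode_rd reg.1 reg.2 s.
  have dA : mrd (fun s => A (ts + s%:C *: (t - ts))) s (mpder A (t - ts) (ts + s%:C *: (t - ts))) by move=> i j; have := rder_comp (rder_id s) (mpder_line (x := s%:C) hA cs i j); rewrite mulr1.
  apply: mrd_eq (mrdM dA dO) _; rewrite fl// /Mseg /path clamp_id// conn0.
  by rewrite mulmxBl mulmxA -/O -!mulmxA subrK.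
rewrite realC1 scale1r addrC subrK realC0 scale0r addr0 /O (ode0 reg.1 reg.2) mulmx1 => <-.
by rewrite /U (solE reg).
Qed.
End Flow.

(** An invertible left factor entire in z changes only the power series P: (X(0) G)^-1 X(z) G P(z)
    is holomorphic near 0 with value I there, and its Taylor coefficients are the new Psi_l. The
    relation between [A'] and [A] gives both the same Jordan form. *)
Lemma levelt_transport (A A' G D S N : M_n) (Y : C -> M_n) (X : C -> M_n) :
  levelt_form A Y G D S N -> (forall z, X z \in unitmx) -> (forall z i j, exists d, cder (fun z => X z i j) z d) ->
  A' *m X 0 = X 0 *m A ->
  levelt_form A' (fun w => X (cexp w) *m Y w) (X 0 *m G) D S N.
Proof.
move=> [[uG GA] jor dD jS [nil blk [Psi [P0 [rho rho0 HPsi]]]]] uX hX AX.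
(* z = 0 is not of the form [cexp w], so convergence there is checked apart. *)
have lim0 : mcv (series (fun l => (0 : C) ^+ l *: Psi l)) 1%:M.
  move=> e e0; exists 1%N => -[|k]// _ i j; rewrite series_mxE big_ord_recl/= expr0 scale1r P0 big1 ?addr0 ?subrr ?nc0 ?ltW//.
  by move=> l _; rewrite expr0n/= scale0r mxE.
have cP (z : C) : nc z < rho -> cvgn (series (fun l => z ^+ l *: Psi l)).
  have [->|z0] := eqVneq z 0; first by move=> _; exact: (mcv_lim lim0).1.
  by have [w <-] := cexp_surj z0 => wr; apply: (HPsi w _).1; rewrite normE ltcR.
have hP := pseries_holo rho0 cP.
have G0 (a b : M_n) : a \in unitmx -> b \in unitmx -> invmx (a *m b) *m a *m b = 1%:M by move=> ua ub; rewrite -mulmxA mulVmx// unitmx_mul ua.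
pose H z : M_n := invmx (X 0 *m G) *m X z *m G *m limn (series (fun l => z ^+ l *: Psi l)).
have uXG : X 0 *m G \in unitmx by rewrite unitmx_mul uX.
have hH i j : holo (fun z => H z i j) 0 (rho / 4).
  move=> z hz; have /choice[d Hd] : forall ij : 'I_n * 'I_n, exists d, cder (fun z => X z ij.1 ij.2) z d by move=> ij; exact: hX.
  have /choice[e He] : forall ij : 'I_n * 'I_n, exists d, cder (fun z => limn (series (fun l => z ^+ l *: Psi l)) ij.1 ij.2) z d by move=> ij; exact: hP.
  have dX : mder X z (\matrix_(i, j) d (i, j)) by move=> a b; rewrite mxE; exact: (Hd (a, b)).
  have dP : mder (fun z => limn (series (fun l => z ^+ l *: Psi l))) z (\matrix_(i, j) e (i, j)) by move=> a b; rewrite mxE; exact: (He (a, b)).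
  eexists; exact: (mderM (mderM (mderM (mder_cst (invmx (X 0 *m G)) z) dX) (mder_cst G z)) dP i j).
have r0 : 0 < rho / 8 by rewrite divr_gt0.
have r1 : rho / 8 < rho / 4 by lra.
have /choice[M HM] : forall ij : 'I_n * 'I_n, exists M, taylor_at (fun z => H z ij.1 ij.2) 0 (rho / 8) M.
  move=> ij; have [M HM] := holo_circle_bound (hH ij.1 ij.2) r0 r1; exists M.
  exact: taylor (hH ij.1 ij.2) r0 r1 HM.
split => //.
  split => //.
  have G1 (gi xi a' x g a : M_n) : a' *m x = x *m a -> xi *m x = 1%:M -> gi *m xi *m a' *m (x *m g) = gi *m a *m g by move=> h1 h2; rewrite -!mulmxA (mulmxA a') h1 -!mulmxA (mulmxA xi) h2 mul1mx.
  by rewrite invmx_mul// -GA; apply: G1 AX _; rewrite mulVmx.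
split => //; exists (fun l => \matrix_(i, j) tc (fun z => H z i j) 0 (rho / 8) l); split.
  apply/matrixP => i j; rewrite mxE (taylor_tc0 r0 (HM (i, j)))/= /H (mcv_lim lim0).2 mulmx1.
  by rewrite G0.
exists (rho / 8) => // w; rewrite normE ltcR => wr.
have key : mcv (series (fun l => (cexp w : C) ^+ l *: \matrix_(i, j) tc (fun z => H z i j) 0 (rho / 8) l)) (H (cexp w)).
  have q01 : 0 <= nc (cexp w) / (rho / 8) < 1 by rewrite divr_ge0 ?nc_ge0 ?ltW//= ltr_pdivrMr// mul1r.
  move=> e e0; have /choice[Nf HN] : forall ij : 'I_n * 'I_n, exists K,
      `|M ij| * (rho / 8 / (rho / 8 - nc (cexp w))) * (nc (cexp w) / (rho / 8)) ^+ K < e.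
    by move=> ij; apply: small_pow => //; rewrite mulr_ge0// divr_ge0 ?ltW// subr_gt0.
  exists (\max_ij Nf ij) => k Nk i j; rewrite series_mxE ncC.
  have := HM (i, j) (cexp w) wr k; rewrite add0r/=.
  have -> : \sum_(m < k) tc (fun z => H z i j) 0 (rho / 8) m * cexp w ^+ m =
    \sum_(l < k) (cexp w ^+ l *: (\matrix_(i, j) tc (fun z => H z i j) 0 (rho / 8) l : M_n)) i j.
    by apply: eq_bigr => l _; rewrite mxscaleE mxE mulrC.
  move=> /le_trans; apply; apply: le_trans (ltW (HN (i, j))).
  have d0 : 0 <= rho / 8 / (rho / 8 - nc (cexp w)) by rewrite divr_ge0 ?ltW// subr_gt0.
  apply: remainder_le => //; apply: leq_trans Nk; exact: (leq_bigmax (i, j)).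
have [c1 c2] := mcv_lim key; split => //; rewrite c2 /H.
have wr' : `|cexp w| < rho%:C by rewrite normE ltcR; apply: lt_trans wr _; lra.
have [_ ->] := HPsi w wr'.
have G2 (x b bi g l d e : M_n) : b *m bi = 1%:M -> x *m (g *m l *m d *m e) = b *m (bi *m x *m g *m l) *m d *m e by move=> h; rewrite !mulmxA h mul1mx.
by apply: G2; exact: mulmxV.
Qed.

(** * Holomorphic data on a slightly larger polydisc *)

Lemma spectral_gap (s : nat) (u0 : T) (lam : 'I_s -> R[i]) blk tau (eps0 : R) :
  coalescent_spectrum u0 lam blk -> (forall j k : 'I_s, j != k -> eps0 < gap lam tau j k) ->
  forall a b, u0 0 a != u0 0 b -> 2 * eps0 < `|cRe (cis tau * (u0 0 a - u0 0 b))|.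
Proof.
move=> [_ _ _ _ uE] hg a b; rewrite !uE => ab; apply: gap_lt; apply: hg.
by apply: contraNneq ab => ->.
Qed.

(** [A1] is given on the closed polydisc; derivatives are taken on a larger open one, of radius [e1]
    so close to [eps0] that eigenvalues distinct at 0 stay apart on it. *)
Lemma analytic_data (u0 : T) (tau eps0 : R) (A1 : T -> M_n) : 0 < eps0 ->
  (forall a b, u0 0 a != u0 0 b -> 2 * eps0 < `|cRe (cis tau * (u0 0 a - u0 0 b))|) ->
  holomorphic_on A1 (polydisc eps0) -> vanishing_condition u0 eps0 A1 ->
  exists (A : T -> M_n) (e1 : R) (q : 'I_n -> 'I_n -> T -> C),
  [/\ eps0 < e1, mghol A 0 e1, forall t, polydisc eps0 t -> A t = A1 t, forall a b, ghol (q a b) 0 e1 &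
    forall t a b, pd 0 e1 t -> a != b -> A t a b = ((u0 + t) 0 a - (u0 + t) 0 b) * q a b t].
Proof.
move=> e0 hg hol van.
have [A [d [d0 hA AA]]] := holomorphic_on_polydisc (ltW e0) hol.
have [||d' [_ [d'0 Hd]]] := @fin_uniform R ('I_n * 'I_n)%type (fun ab d M => u0 0 ab.1 != u0 0 ab.2 ->
   2 * eps0 + d <= `|cRe (cis tau * (u0 0 ab.1 - u0 0 ab.2))|).
- by move=> ab x M x' M' dd _ H uab; apply: le_trans (H uab); rewrite lerD2l.
- move=> [a b] /=; have [->|ab] := eqVneq (u0 0 a) (u0 0 b); first by exists 1, 0.
  exists (`|cRe (cis tau * (u0 0 a - u0 0 b))| - 2 * eps0), 0; split; first by rewrite subr_gt0 hg.
  by rewrite addrC subrK.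
(* [x <= d' / 4] gives [2 * (eps0 + x) + d' / 2 <= 2 * eps0 + d'], the separation that
   [quotient_exists] asks for. *)
pose x := Num.min d (d' / 4); have x0 : 0 < x by rewrite lt_min d0 divr_gt0.
have xd : x <= d by rewrite ge_min lexx.
have xd' : x <= d' / 4 by rewrite ge_min lexx orbT.
have ee : eps0 < eps0 + x by rewrite ltrDl.
have hA' : mghol A 0 (eps0 + x) by apply: mghol_sub hA _ => i; rewrite subrr nc0 add0r lerD2l.
have [|||||q [hq Aq]] := @quotient_exists R n u0 (eps0 + x) (d' / 2) A.
- exact: divr_gt0.
- exact: addr_gt0.
- exact: hA'.
- move=> a b uab; apply: le_trans (_ : 2 * eps0 + d' <= _); first by move: xd'; clear; lra.
  apply: le_trans (Hd (a, b) uab) _; apply: le_trans (Re_le_nc _) _; by rewrite ncM nc_cis mul1r.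
- move=> a b t ab uab ct tab; apply: (vanishing_beyond e0 ee hA' _ ct tab) => s cs sab.
  by rewrite AA//; apply: (vanishing_at van ab cs); apply/coord_eq.
by exists A, (eps0 + x), q.
Qed.

Lemma gau_congr u (B B' : M_n) (Y Y' : C -> M_n) w i j :
  Y w = Y' w -> B j j = B' j j -> gau u B Y w i j = gau u B' Y' w i j.
Proof. by move=> e1 e2; rewrite !mxE e1 e2. Qed.

Lemma fund_mulr u (A : M_n) (Y : C -> M_n) (K : M_n) :
  fundamental_solution u A Y -> K \in unitmx -> fundamental_solution u A (fun w => Y w *m K).
Proof.
move=> /fundP hY uK; apply/fundP => w; have [d1 u1] := hY w; split; last by rewrite unitmx_mul u1.
by apply: mder_eq (mderM d1 (mder_cst K w)) _; rewrite mulmx0 addr0 mulmxA.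
Qed.

(** Propagation bounds the residual of order N by z^-N only; including one more term and discarding
    it afterwards restores the order that the asymptotic expansion demands. *)
Lemma psum_tail (g : C) (Fn : nat -> M_n) l (w : C) i j (K B : R) :
  nc (Fn l.+1 i j) <= B -> nc (g - psum Fn l.+1 w i j) <= K / modz w ^+ l.+1 ->
  nc (g - psum Fn l w i j) <= (K + B) / modz w ^+ l.+1.
Proof.
move=> hB; rewrite !psumE big_ord_recr /= => h.
have G (s y : C) : g - s = (g - (s + y)) + y by ring.
rewrite (G _ (cexp w ^- l.+1 * Fn l.+1 i j)); apply: le_trans (ncD _ _) _; rewrite mulrDl; apply: lerD h _.
by rewrite ncM nc_cexpX mulrC; apply: ler_wpM2r; [rewrite invr_ge0 exprn_ge0// expR_ge0|].
Qed.

Lemma cell_facts (u0 : T) (eps0 tau : R) (V : set T) : admissible_domain u0 eps0 tau V ->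
  forall t, closure V t -> (forall a b, a != b -> (u0 + t) 0 a != (u0 + t) 0 b) /\ ~ stokes_arg (u0 + t) tau.
Proof.
move=> [_ _ _ _ [W [t0 Dt0 WE] cW]] t /cW; rewrite WE => /connected_component_sub[pt nt]; split.
  by move=> a b ab; apply/eqP => E; apply: nt; left; split => //; exists a, b.
by move=> st; apply: nt; right.
Qed.

(** * The isomonodromic solutions and their values at t = 0 *)

Variables (u0 : T) (A1 A : T -> M_n) (V : set T) (F : nat -> T -> M_n) (Y : nat -> T -> C -> M_n) (St : nat -> M_n)
  (tau eps0 e1 : R) (q : 'I_n -> 'I_n -> T -> C) (Y0 : T -> C -> M_n) (D S N C0 : M_n).
Hypothesis eps00 : 0 < eps0.
Hypothesis eps01 : eps0 < e1.
Hypothesis hA : mghol A 0 e1.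
Hypothesis AA : forall t, polydisc eps0 t -> A t = A1 t.
Hypothesis hq : forall a b, ghol (q a b) 0 e1.
Hypothesis Aq : forall t a b, pd 0 e1 t -> a != b -> A t a b = ((u0 + t) 0 a - (u0 + t) 0 b) * q a b t.
Hypothesis gapE : forall a b, u0 0 a != u0 0 b -> 2 * eps0 < `|cRe (cis tau * (u0 0 a - u0 0 b))|.
Hypothesis oV : open V.
Hypothesis cV : connected V.
Hypothesis V0 : V !=set0.
Hypothesis Vp : V `<=` polydisc eps0.
Hypothesis Vd : forall t, closure V t -> forall a b, a != b -> (u0 + t) 0 a != (u0 + t) 0 b.
Hypothesis Vs : forall t, closure V t -> ~ stokes_arg (u0 + t) tau.
Hypothesis fF : forall t, V t -> formal_solution (u0 + t) (A1 t) (F^~ t).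
Hypothesis can : forall r t, (1 <= r <= 3)%N -> V t ->
  canonical_solution (u0 + t) (A1 t) (F ^~ t) (sector_on u0 tau r V) (Y r t).
Hypothesis stk : forall r t, (1 <= r <= 2)%N -> V t -> connected_by (Y r t) (Y r.+1 t) (St r).
Hypothesis diagV : forall t t', V t -> V t' -> diag_part (A1 t) = diag_part (A1 t').
Hypothesis lev : levelt_family u0 A1 V Y0 D S N.
Hypothesis con : forall t, V t -> connected_by (Y0 t) (Y 1%N t) C0.

Lemma polydisc_pd t : polydisc eps0 t -> pd 0 e1 t.
Proof. by move=> /(polydiscP _ (ltW eps00)) H i; rewrite mxE subr0; exact: le_lt_trans (H i) eps01. Qed.

Lemma V_pd t : V t -> pd 0 e1 t. Proof. by move=> /Vp/polydisc_pd. Qed.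

Lemma AV t : V t -> A t = A1 t. Proof. by move=> /Vp/AA. Qed.

(** Holomorphy in t is given for the Levelt solution and passes to the canonical solutions through
    the constant matrices [C0] and [St]. *)
Lemma Y_mghol r c rs w : (1 <= r <= 3)%N -> (forall t, pd c rs t -> V t) -> mghol (Y r ^~ w) c rs.
Proof.
move=> r13 sub; have [G [_ hY0 _]] := lev.
have h0 : mghol (Y0^~ w) c rs by exact: holomorphic_on_open oV (hY0 w) sub.
have step r' : (1 <= r' <= 2)%N -> mghol (Y r' ^~ w) c rs -> mghol (Y r'.+1 ^~ w) c rs.
  move=> r'12 h; apply: (mghol_near (X := fun t => Y r' t w *m St r')) => [t ct|].
    by rewrite (stk r'12 (sub t ct)).
  exact: mgholM h (mghol_cst _ _ _).
have h1 : mghol (Y 1%N ^~ w) c rs.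
  apply: (mghol_near (X := fun t => Y0 t w *m C0)) => [t ct|]; first by rewrite (con (sub t ct)).
  exact: mgholM h0 (mghol_cst _ _ _).
case: r r13 => [|[|[|[|r]]]] r13; first by [].
- exact h1.
- exact (step 1%N isT h1).
- exact (step 2%N isT (step 1%N isT h1)).
by [].
Qed.

Lemma Y_asym r t : (1 <= r <= 3)%N -> V t ->
  asym (A1 t) (u0 + t) (F^~ t) (Y r t) (ray tau r) (ray tau r + pi).
Proof.
move=> r13 Vt; apply: ((asymptotic_toP _ _ _ _ _).1 (can r13 Vt).2); first by rewrite lerDl pi_ge0.
by move=> w wI s cs; apply: halfplane_sector wI => //; exact: Vs.
Qed.

(** In a small polydisc of [V] the u_a are uniformly separated; [pfaffian] treats the first
    canonical solution, and constant right factors carry the equation to the other two. *)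
Lemma pfaffian_ball : exists ts rs m, [/\ 0 < rs, forall t, pd ts rs t -> V t, 0 < m,
   forall t a b, pd ts rs t -> a != b -> m <= nc ((u0 + t) 0 a - (u0 + t) 0 b) &
   forall r, (1 <= r <= 3)%N -> pfaff q (Y r) ts rs].
Proof.
have [t1 Vt1] := V0; have [r1 r10 Hr1] := open_pd oV Vt1.
have [||m [_ [m0 Hm]]] := @fin_uniform R ('I_n * 'I_n)%type (fun ab d M => ab.1 != ab.2 ->
   d <= nc ((u0 + t1) 0 ab.1 - (u0 + t1) 0 ab.2)).
- by move=> ab d M d' M' dd _ H uab; exact: le_trans dd (H uab).
- move=> [a b] /=; have [->|ab] := eqVneq a b; first by exists 1, 0.
  exists (nc ((u0 + t1) 0 a - (u0 + t1) 0 b)), 0; split => //; rewrite nc_gt0 subr_eq0.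
  by apply: Vd ab; exact: subset_closure.
pose rb := Num.min r1 (m / 4); have rb0 : 0 < rb by rewrite lt_min r10 divr_gt0.
have subV t : pd t1 rb t -> V t by move=> ct; apply: Hr1; apply: pd_le ct; rewrite ge_min lexx.
have dist t a b : pd t1 rb t -> a != b -> m / 2 <= nc ((u0 + t) 0 a - (u0 + t) 0 b).
  move=> ct ab; have := Hm (a, b) ab => /= h.
  have -> : (u0 + t) 0 a - (u0 + t) 0 b = ((u0 + t1) 0 a - (u0 + t1) 0 b) - ((t 0 b - t1 0 b) - (t 0 a - t1 0 a)) by rewrite !mxE; ring.
  have := nc_dist ((u0 + t1) 0 a - (u0 + t1) 0 b) ((t 0 b - t1 0 b) - (t 0 a - t1 0 a)).
  have := ncB (t 0 b - t1 0 b) (t 0 a - t1 0 a); have := ct a; have := ct b.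
  have : rb <= m / 4 by rewrite ge_min lexx orbT.
  move: h; lra.
have m2 : 0 < m / 2 by rewrite divr_gt0.
have subp t : pd t1 rb t -> pd 0 e1 t by move=> /subV/V_pd.
have fF' t : pd t1 rb t -> formal_solution (u0 + t) (A t) (F^~ t) by move=> ct; rewrite (AV (subV t ct)); exact (fF (subV t ct)).
have [G [_ _ levG]] := lev.
have sys r t : (1 <= r <= 3)%N -> pd t1 rb t -> fundamental_solution (u0 + t) (A t) (Y r t) by move=> r13 ct; rewrite (AV (subV t ct)); case: (can r13 (subV t ct)).
have [|||||||||||||ts [rs [rs0 sub pf]]] := @pfaffian R n u0 q F A (A1 t1) D S N C0 (St 1%N) Y0 (Y 1%N) (Y 2%N) tau t1 rb rb0.
- exact (mghol_ball subp hA).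
- move=> t j ct; rewrite (AV (subV t ct)); have := diagV (subV t ct) Vt1 => /matrixP/(_ j j).
  by rewrite !mxE eqxx !mulr1n.
- by move=> t /fF'/formal_solutionP[].
- by move=> t a b ct ab; exact (F_one Aq subp fF' m2 dist ct ab).
- by move=> t ct; rewrite (AV (subV t ct)); exact: (levG t (subV t ct)).1.
- by move=> t; exact: sys.
- by move=> t; exact: sys.
- by move=> t ct; rewrite (AV (subV t ct)); exists (G t); exact: (levG t (subV t ct)).2.
- by move=> w; have [_ [_ hY0 _]] := lev; exact (holomorphic_on_open oV (hY0 w) subV).
- by move=> t w ct; exact (con (subV t ct) w).
- by move=> t w ct; exact: (@stk 1%N t isT (subV t ct) w).
- move=> t ct; rewrite (AV (subV t ct)); have := @Y_asym 1%N t isT (subV t ct).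
  by have -> : ray tau 1%N = tau - pi by [rewrite /ray; ring]; rewrite subrK.
- move=> t ct; rewrite (AV (subV t ct)); have := @Y_asym 2%N t isT (subV t ct).
  by have -> : ray tau 2%N = tau by rewrite /ray subrr mul0r addr0.
exists ts, rs, (m / 2); split => //.
- by move=> t /sub/subV.
- by move=> t a b /sub; exact: dist.
have h1 : pfaff q (Y 1%N) ts rs by [].
have subV' t : pd ts rs t -> V t by move=> /sub/subV.
have step r : (1 <= r <= 2)%N -> pfaff q (Y r) ts rs -> pfaff q (Y r.+1) ts rs.
  move=> r12 h t v w ct; have r13 : (1 <= r <= 3)%N by case/andP: r12 => -> /leqW.
  have hY := Y_mghol w r13 subV'.
  rewrite (stk r12 (subV' t ct)) mulmxA -(h t v w ct) -(mpderMr (St r) v hY ct).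
  apply: mpder_near ct; last exact: mgholM hY (mghol_cst _ _ _).
  by move=> s cs; rewrite (stk r12 (subV' s cs)).
move=> [|[|[|[|r]]]] r13; first by [].
- exact h1.
- exact (step 1%N isT h1).
- exact (step 2%N isT (step 1%N isT h1)).
by [].
Qed.

Section Extended.
Variables (ts : T) (rs m : R).
Hypothesis rs0 : 0 < rs.
Hypothesis subV : forall t, pd ts rs t -> V t.
Hypothesis m0 : 0 < m.
Hypothesis dist : forall t a b, pd ts rs t -> a != b -> m <= nc ((u0 + t) 0 a - (u0 + t) 0 b).
Hypothesis pf : forall r, (1 <= r <= 3)%N -> pfaff q (Y r) ts rs.

Notation Yx r := (ext q ts (Y r)).
Notation Fx := (fext q A).

Let sub t : pd ts rs t -> pd 0 e1 t. Proof. by move=> /subV/V_pd. Qed.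
Let Vts : V ts. Proof. exact (subV (pd_center _ rs0)). Qed.
Let cts : pd 0 e1 ts. Proof. exact: V_pd. Qed.
Let e10 : 0 < e1. Proof. exact: lt_trans eps01. Qed.
Let c0 : pd 0 e1 (0 : T). Proof. exact: pd_center. Qed.
Let p0 : polydisc eps0 (0 : T). Proof. by apply/(polydiscP _ (ltW eps00)) => i; rewrite mxE nc0 ltW. Qed.
Let hY r (r13 : (1 <= r <= 3)%N) w : mghol (Y r ^~ w) ts rs. Proof. exact (Y_mghol w r13 subV). Qed.
Let sysY r t : (1 <= r <= 3)%N -> pd ts rs t -> fundamental_solution (u0 + t) (A t) (Y r t).
Proof. by move=> r13 ct; rewrite (AV (subV ct)); case: (can r13 (subV ct)). Qed.
Let fF' t : pd ts rs t -> formal_solution (u0 + t) (A t) (F^~ t).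
Proof. by move=> ct; rewrite (AV (subV ct)); exact (fF (subV ct)). Qed.

Lemma flowA t v : pd 0 e1 t -> mpder A v t = omega q v t *m A t - A t *m omega q v t.
Proof. exact (@flow _ _ u0 q A e1 ts rs hq hA Aq rs0 sub (Y 1%N) (@hY 1%N isT) (fun t => @sysY 1%N t isT) (@pf 1%N isT) t v). Qed.

Lemma Yx_fund r t : (1 <= r <= 3)%N -> pd 0 e1 t -> fundamental_solution (u0 + t) (A t) (Yx r t).
Proof. by move=> r13; exact (ext_fund hq hA rs0 sub (hY r13) (fun t => @sysY r t r13) (pf r13) (t := t)). Qed.

Lemma Yx_mghol r w : mghol (Yx r ^~ w) 0 e1.
Proof. exact (ext_mghol hq rs0 sub (Y r) w). Qed.

Lemma Yx_V r t w : (1 <= r <= 3)%N -> V t -> Yx r t w = Y r t w.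
Proof.
move=> r13; apply: (identity_connected (X := Yx r ^~ w) (Y := Y r ^~ w) oV cV Vts rs0) => [s Vs'|s cs].
  have [r0 r00 Hr0] := open_pd oV Vs'; exists r0 => //; split; last exact (Y_mghol w r13 Hr0).
  by apply: mghol_ball (Yx_mghol r w) => x /Hr0/V_pd.
by rewrite -(ext_ball hq rs0 sub (hY r13) (pf r13) w cs).
Qed.

Lemma Yx_St r t w : (1 <= r <= 2)%N -> Yx r.+1 t w = Yx r t w *m St r.
Proof. by move=> r12; rewrite /ext (stk r12 Vts) mulmxA. Qed.

Lemma Fx_mghol k : mghol (Fx k) 0 e1.
Proof. exact (fext_mghol hq hA k). Qed.

Lemma Fx_formal t : pd 0 e1 t -> formal_solution (u0 + t) (A t) (Fx ^~ t).
Proof. exact (fext_formal hq hA Aq flowA rs0 sub fF' m0 dist (t := t)). Qed.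

Lemma Fx_distinct k t : polydisc eps0 t -> (forall a b, a != b -> (u0 + t) 0 a != (u0 + t) 0 b) ->
  formal_solution (u0 + t) (A1 t) (F^~ t) -> Fx k t = F k t.
Proof.
move=> pt dt ft; have h1 := Fx_formal (polydisc_pd pt); rewrite (AA pt) in h1.
apply: (formal_unique _ _ h1 ft) => [a b ab /eqP|a b l uab]; first by rewrite (negPf (dt a b ab)).
have [->|ab] := eqVneq a b; first by rewrite subrr eq_sym pnatr_eq0.
by have := dt a b ab; rewrite uab eqxx.
Qed.

Lemma asym_zero r : (1 <= r <= 3)%N -> asymptotic_to u0 (A1 0) (Fx ^~ 0) (sector u0 tau r) (Yx r 0).
Proof.
move=> r13; apply/asymptotic_toP => a b ab sb l.
have diag t j : pd 0 e1 t -> A t j j = A 0 j j by move=> ct; exact (diag_const hA Aq flowA j ct).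
have Frec t : pd 0 e1 t -> formal_rec (u0 + t) (A t) (diag_part (A t)) (Fx ^~ t) by move=> /Fx_formal/formal_solutionP[].
have Ffl := fext_flow hq hA Aq flowA rs0 sub fF' m0 dist.
have pfx := ext_pfaff hq rs0 sub (hY r13) (pf r13).
have sysx t : pd 0 e1 t -> fundamental_solution (u0 + t) (A t) (Yx r t) by exact: Yx_fund.
(* One order is given away: the asymptotics at [ts] bound the residual by z^-(N' + 1), the
   propagation works with z^-N'. *)
have W N' : wray (res u0 A Fx (Yx r)) N' ts (ray tau r) 1 pi.
  have [K [rho [K0 rho0 H]]] := Y_asym r13 Vts N'.
  exists K, (rho + 1); split => // [|w phi /andP[ph0 ph1] wphi rw i j]; first by rewrite addr_gt0.
  have rw1 : 1 <= modz w by apply: le_trans rw; rewrite lerDr ltW.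
  have rw2 : rho <= modz w by apply: le_trans rw; rewrite lerDl.
  have wI : ray tau r <= cIm w <= ray tau r + pi by rewrite wphi mul1r lerDl ph0 lerD2l.
  have E : res u0 A Fx (Yx r) N' ts w i j = gau (u0 + ts) (A1 ts) (Y r ts) w i j - psum (F^~ ts) N' w i j.
    rewrite mxsubE !psumE; congr (_ - _).
      by apply: gau_congr; [exact: Yx_V|rewrite -(AV Vts) (diag ts j cts)].
    apply: eq_bigr => k _; rewrite Fx_distinct//; first exact: Vp.
      by move=> x y; apply: Vd; exact: subset_closure.
    exact: fF.
  rewrite E; apply: le_trans (H w wI rw2 i j) _; apply: ler_wpM2l => //.
  rewrite lef_pV2 ?posrE ?exprn_gt0 ?expR_gt0//; exact: ler_weXn2l.
have gap' x y : u0 0 x != u0 0 y -> 2 * eps0 < `|cRe (cis (ray tau r) * (u0 0 x - u0 0 y))| by move=> xy; rewrite ray_abs//; exact: gapE.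
have tsn i : nc (ts 0 i) <= eps0 by have /(polydiscP _ (ltW eps00)) := Vp Vts; apply.
have tsd x y : x != y -> cRe (cis (ray tau r) * ((u0 + ts) 0 x - (u0 + ts) 0 y)) != 0.
  move=> xy; rewrite -normr_eq0 ray_abs// normr_eq0; apply/eqP => E.
  have cl : closure V ts by exact: subset_closure.
  by apply: (Vs cl); apply/stokes_argE; exists x, y; split => //; exact (Vd cl xy).
have rm l' w : mghol ((res u0 A Fx (Yx r) l') ^~ w) 0 e1 by exact (res_mghol u0 A Fx_mghol (Yx_mghol r) l' w).
have F0 t : Fx 0%N t = 1%:M by [].
have rfl := res_flow u0 A F0 Fx_mghol Ffl (Yx_mghol r) pfx.
have rdw := res_dw diag F0 Frec sysx.
have [K [rho [K0 rho0 H]]] := residual_sector hq Fx_mghol rm rfl rdw (ltW eps00) eps01 tsn tsd gap' W l.+1 ab (sector_interval ab sb).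
have [MF [MF0 HMF]] := mx_bound (Fx l.+1 0).
exists (K + MF), rho; split => //; first by rewrite addr_ge0.
move=> w wI rw i j; have := H w wI rw i j.
rewrite /res mxsubE addr0 (AA p0); apply: psum_tail; exact: HMF.
Qed.

Lemma U_inv_unit z t : pd 0 e1 t -> U q ts z t \in unitmx.
Proof. exact (U_unit hq cts z (t := t)). Qed.

(** The given solution is the first canonical solution at 0 times a constant matrix [CC], and the
    family keeps this right factor. By construction of the continuation it equals U(z, t) U(z, 0)^-1
    times the given solution, a left factor entire in z, so [levelt_transport] applies; the
    connection matrix is the inverse of [CC]. *)
Lemma levelt_zero (Yo0 : C -> M_n) G Do So No : fundamental_solution u0 (A1 0) Yo0 -> levelt_form (A1 0) Yo0 G Do So No ->
  exists (YY : T -> C -> M_n) (CC : M_n), [/\ levelt_family u0 A1 (polydisc eps0) YY Do So No,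
    forall w, YY 0 w = Yo0 w & forall t, polydisc eps0 t -> connected_by (YY t) (Yx 1%N t) CC].
Proof.
move=> fo lo; have f0 : fundamental_solution u0 (A1 0) (Yx 1%N 0).
  by have := @Yx_fund 1%N 0 isT c0; rewrite addr0 (AA p0).
have E0 := fund_const f0 fo; move: E0; set CC := invmx (Yx 1%N 0 0) *m Yo0 0 => E0.
have uCC : CC \in unitmx.
  rewrite unitmx_mul unitmx_inv; have [_ ->] := (fundP _ _ _).1 f0 0.
  by have [_ ->] := (fundP _ _ _).1 fo 0.
exists (fun t w => Yx 1%N t w *m CC), (invmx CC); split => [|w|t ct w]; last 2 first.
- by rewrite E0.
- by rewrite mulmxK.
exists (fun t => U q ts 0 t *m invmx (U q ts 0 0) *m G); split => [|w|t ct].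
- apply: (mghol_holomorphic_on (ltW eps00) eps01).
  exact: (mgholM (mgholM (U_mghol hq cts 0) (mghol_cst (invmx (U q ts 0 0)) _ _)) (mghol_cst G _ _)).
- apply: (mghol_holomorphic_on (ltW eps00) eps01).
  exact: (mgholM (Yx_mghol 1%N w) (mghol_cst CC _ _)).
have pt := polydisc_pd ct; split.
  have Ff := @Yx_fund 1%N t isT pt; rewrite (AA ct) in Ff; exact: fund_mulr.
pose X z : M_n := U q ts z t *m invmx (U q ts z 0).
have -> : (fun w => Yx 1%N t w *m CC) = fun w => X (cexp w) *m Yo0 w.
  apply/funext => w.
  have K (a b c d : M_n) : b \in unitmx -> a *m c *m d = a *m invmx b *m (b *m c *m d) by move=> ub; rewrite !mulmxA mulmxKV.
  by rewrite E0 /X /ext; exact (K _ _ _ _ (U_inv_unit (cexp w) c0)).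
have := levelt_transport (A' := A1 t) (X := X) lo; apply.
- have K (a b : M_n) : a \in unitmx -> b \in unitmx -> a *m invmx b \in unitmx by move=> ua ub; rewrite unitmx_mul ua unitmx_inv.
  by move=> z; exact (K _ _ (U_inv_unit z pt) (U_inv_unit z c0)).
- move=> z i j; have hX k l := U_cder hq cts z k l pt.
  have hX0 := mder_invmx (fun z => U_inv_unit z c0) (fun k l => U_cder hq cts z k l c0).
  pose D1 := \matrix_(k, l) projT1 (cid (hX k l)) : M_n; pose D2 := \matrix_(k, l) projT1 (cid (hX0 k l)) : M_n.
  have h1 : mder (fun z => U q ts z t) z D1 by move=> k l; rewrite mxE; exact: (projT2 (cid (hX k l))).
  have h2 : mder (fun z => invmx (U q ts z 0)) z D2 by move=> k l; rewrite mxE; exact: (projT2 (cid (hX0 k l))).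
  exact: ex_intro (mderM h1 h2 i j).
- have Ut := U_flow hq hA cts flowA pt; have U0 := U_flow hq hA cts flowA c0.
  have K (a b c d d' : M_n) : b \in unitmx -> d' *m a = a *m c -> d *m b = b *m c ->
      d' *m (a *m invmx b) = a *m invmx b *m d.
    by move=> ub e' e; rewrite mulmxA e' -[in RHS](mulmxK ub d) e !mulmxA mulmxKV.
  by rewrite -(AA ct) -(AA p0); exact (K _ _ _ _ _ (U_inv_unit 0 c0) Ut U0).
Qed.
End Extended.
End Assembly.

Lemma connected_by_unique {R : realType} {n : nat} (Y Y' : R[i]^o -> 'M[R[i]^o]_n) (K K' : 'M[R[i]^o]_n) :
  Y 0 \in unitmx -> connected_by Y Y' K -> connected_by Y Y' K' <-> K = K'.
Proof.
move=> uY h; split => [h'|<-//]; have := h' 0; rewrite (h 0) => /(congr1 (mulmx (invmx (Y 0)))).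
by rewrite !mulKmx.
Qed.

Theorem corollary1p1 (R : realType) (n s : nat) (u0 : 'rV[R[i]^o]_n)
    (lam : 'I_s -> R[i]) (blk : 'I_n -> 'I_s) (tau eps0 : R)
    (A1 : 'rV[R[i]^o]_n -> 'M[R[i]^o]_n) (V : set 'rV[R[i]^o]_n)
    (F : nat -> 'rV[R[i]^o]_n -> 'M[R[i]^o]_n)
    (Y : nat -> 'rV[R[i]^o]_n -> R[i]^o -> 'M[R[i]^o]_n)
    (St : nat -> 'M[R[i]^o]_n) :
  coalescent_spectrum u0 lam blk ->
  admissible_direction u0 tau ->
  0 < eps0 ->
  (forall j k : 'I_s, j != k -> eps0 < gap lam tau j k) ->
  coalescence_locus u0 eps0 0 ->
  holomorphic_on A1 (polydisc eps0) ->
  (forall t, polydisc eps0 t -> ~ coalescence_locus u0 eps0 t ->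
     formal_solution (u0 + t) (A1 t) (F ^~ t)) ->
  (forall r t, (1 <= r <= 3)%N -> V t ->
     canonical_solution (u0 + t) (A1 t) (F ^~ t) (sector_on u0 tau r V)
       (Y r t)) ->
  isomonodromic u0 eps0 tau A1 V Y St ->
  vanishing_condition u0 eps0 A1 ->
  nonresonant_diagonal (A1 0) ->
  exists (Fx : nat -> 'rV[R[i]^o]_n -> 'M[R[i]^o]_n)
         (Yx : nat -> 'rV[R[i]^o]_n -> R[i]^o -> 'M[R[i]^o]_n),
    (* the extensions of F_k and Y_r to the polydisc *)
    [/\ forall k, holomorphic_on (Fx k) (polydisc eps0),
        forall k t, polydisc eps0 t -> ~ coalescence_locus u0 eps0 t ->
          Fx k t = F k t,
        forall r w, (1 <= r <= 3)%N ->
          holomorphic_on (Yx r ^~ w) (polydisc eps0)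
      & forall r t w, (1 <= r <= 3)%N -> V t -> Yx r t w = Y r t w] /\
    exists (Fo : nat -> 'M[R[i]^o]_n) (Yo : nat -> R[i]^o -> 'M[R[i]^o]_n),
      [/\ (* the unique formal solution at t = 0 *)
          unique (formal_solution u0 (A1 0)) Fo /\
            (forall k, (1 <= k)%N -> Fo k = Fx k 0),
          (* the canonical solutions at t = 0 *)
          forall r, (1 <= r <= 3)%N ->
            unique (canonical_solution u0 (A1 0) Fo (sector u0 tau r)) (Yo r) /\
            (forall w, Yx r 0 w = Yo r w),
          (* the Stokes matrices *)
          forall r, (1 <= r <= 2)%N ->
            forall So, connected_by (Yo r) (Yo r.+1) So <-> St r = So
        & (* the solutions in Levelt form and the central connection matrix *)
          forall (Yo0 : R[i]^o -> 'M[R[i]^o]_n) (G D S N : 'M[R[i]^o]_n),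
            fundamental_solution u0 (A1 0) Yo0 ->
            levelt_form (A1 0) Yo0 G D S N ->
            exists (Y0 : 'rV[R[i]^o]_n -> R[i]^o -> 'M[R[i]^o]_n)
                   (C0 : 'M[R[i]^o]_n),
              [/\ levelt_family u0 A1 (polydisc eps0) Y0 D S N,
                  forall w, Y0 0 w = Yo0 w,
                  forall t, polydisc eps0 t ->
                    connected_by (Y0 t) (Yx 1%N t) C0
                & forall Co, connected_by Yo0 (Yo 1%N) Co <-> C0 = Co]].
Proof.
move=> spec adm eps00 gaps _ hol fs can [dom stk diagV _ [Y0 [D [S [N [C0 [lev con]]]]]]] van nres.
have gapE := spectral_gap spec gaps.
have [A [e1 [q [eps01 hA AA hq Aq]]]] := analytic_data eps00 gapE hol van.
have Vd t : closure V t -> forall a b, a != b -> (u0 + t) 0 a != (u0 + t) 0 b by move=> /(cell_facts dom)[].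
have Vs t : closure V t -> ~ stokes_arg (u0 + t) tau by move=> /(cell_facts dom)[].
have [oV cV V0 Vp _] := dom.
have fF t : V t -> formal_solution (u0 + t) (A1 t) (F ^~ t).
  move=> Vt; apply: fs; first exact: Vp.
  move=> [_ [a [b [ab E]]]]; have := Vd t (subset_closure Vt) a b ab; by rewrite E eqxx.
have [ts [rs [m [rs0 subV m0 dist pf]]]] :=
  pfaffian_ball eps00 eps01 hA AA Aq oV V0 Vp Vd Vs fF can stk diagV lev con.
pose Fx := fext q A; pose Yx r := ext q ts (Y r).
have p0 : polydisc eps0 (0 : 'rV[R[i]^o]_n) by apply/(polydiscP _ (ltW eps00)) => i; rewrite mxE nc0 ltW.
have c0 : pd 0 e1 (0 : 'rV[R[i]^o]_n) by apply: pd_center; exact: lt_trans eps01.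
have hFx k : mghol (Fx k) 0 e1 by exact (Fx_mghol hA hq k).
have hYx r w : mghol (Yx r ^~ w) 0 e1 by exact (Yx_mghol Y eps00 eps01 hq Vp rs0 subV r w).
have F0 : formal_solution u0 (A1 0) (Fx ^~ 0).
  have := Fx_formal eps00 eps01 hA AA hq Aq oV Vp fF can stk lev con rs0 subV m0 dist pf c0.
  by rewrite addr0 (AA 0 p0).
have Y0f r : (1 <= r <= 3)%N -> fundamental_solution u0 (A1 0) (Yx r 0).
  move=> r13; have := Yx_fund eps00 eps01 hA AA hq oV Vp can stk lev con rs0 subV pf r13 c0.
  by rewrite addr0 (AA 0 p0).
have Yas r : (1 <= r <= 3)%N -> asymptotic_to u0 (A1 0) (Fx ^~ 0) (sector u0 tau r) (Yx r 0).
  move=> r13.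
  exact (asym_zero eps00 eps01 hA AA hq Aq gapE oV cV Vp Vd Vs fF can stk lev con rs0 subV m0 dist pf r13).
have u0Y r : (1 <= r <= 3)%N -> Yx r 0 0 \in unitmx by move=> r13; case: ((fundP _ _ _).1 (Y0f r r13) 0).
exists Fx, Yx; split.
  split => [k|k t pt nt|r w r13|r t w r13 Vt].
  - exact: mghol_holomorphic_on (ltW eps00) eps01 (hFx k).
  - apply: (Fx_distinct eps00 eps01 hA AA hq Aq oV Vp fF can stk lev con rs0 subV m0 dist pf k pt _ (fs t pt nt)).
    by move=> a b ab; apply/eqP => E; apply: nt; split => //; exists a, b.
  - exact: mghol_holomorphic_on (ltW eps00) eps01 (hYx r w).
  exact (Yx_V eps00 eps01 hq oV cV Vp stk lev con rs0 subV pf w r13 Vt).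
exists (Fx ^~ 0), (fun r => Yx r 0); split.
- split => //; split=> [|G hG]; first exact: F0.
  (* At t = 0 uniqueness rests on the vanishing of [A1] between equal eigenvalues and on the absence
     of positive integer differences on its diagonal. *)
  apply/funext => k; apply: (formal_unique _ _ F0 hG) => [a b ab uab|a b l _].
    by have := @vanishing_at _ _ u0 eps0 A1 a b 0 van ab p0; rewrite addr0; apply.
  exact (nres b a l.+1 isT).
- move=> r r13; split=> //; split=> [|Z [fZ aZ]]; first by split; [exact: Y0f|exact: Yas].
  (* Uniqueness is tested on the closed half-plane, which lies in the sector at t = 0 because [tau]
     is admissible for [u0]. *)
  have half Z' : asymptotic_to u0 (A1 0) (Fx ^~ 0) (sector u0 tau r) Z' ->
      asym (A1 0) u0 (Fx ^~ 0) Z' (ray tau r) (ray tau r + pi).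
    move=> /asymptotic_toP; apply; first by rewrite lerDl pi_ge0.
    move=> w; apply: halfplane_sector r13 _ => /stokes_argE[a [b [ab E]]].
    by have := admissibleE adm ab; rewrite E eqxx.
  apply/funext => w; apply/esym.
  exact: (canonical_unique (Y0f r r13) fZ F0.1 (half _ (Yas r r13)) (half _ aZ)).
- move=> r r12 So; apply: connected_by_unique; first by apply: u0Y; case/andP: r12 => -> /leqW.
  move=> w; exact (Yx_St q stk rs0 subV 0 w r12).
move=> Yo0 G Do So No fo lo.
have [YY [CC [h1 h2 h3]]] := levelt_zero eps00 eps01 hA AA hq Aq oV Vp can stk lev con rs0 subV pf fo lo.
exists YY, CC; split => // Co; apply: connected_by_unique.
  by case: ((fundP _ _ _).1 fo 0).
by move=> w; rewrite -h2; exact: h3.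
Qed.
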